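(* Let $0<|q|<1$ and $a,b,c,d,e,f,g\in\mathbb C^\ast$ such that $|q^2a^3|<|bcdefg|$, $|qa|<|fg|$, and none of the denominator factors vanish. Then $${}_8\Psi_8\left(a;b,c,d,e,f,g;q,\tfrac{q^2a^3}{bcdefg}\right)$$ $$=\frac{(qa,\frac qa,\frac ba,\frac{ce}{a},\frac{de}{a},\frac{qa}{cd},\frac{qa}{ce},\frac{qa}{de},\frac{qa}{ef},\frac{qa}{eg},\frac{qa}{fg},\frac{bce}{a},\frac{bde}{a},\frac{q^2a^2}{bcdef},\frac{q^2a^2}{bcdeg};q)_\infty}{(\frac qb,\frac qc,\frac qd,\frac qf,\frac qg,\frac{qa}{c},\frac{qa}{d},\frac{qa}{e},\frac{qa}{f},\frac{qa}{g},\frac{bc}{a},\frac{bd}{a},\frac{qa}{cde},\frac{bcde^2}{qa^2},\frac{q^2a^3}{bcde^2fg};q)_\infty}\;{}_4\psi_4\left(\begin{matrix}e,\frac{bcde^2}{qa^2},\frac{bcdef}{qa^2},\frac{bcdeg}{qa^2}\\ \frac{bce}{a},\frac{bde}{a},\frac{cde}{a},\frac{bcde^2fg}{qa^3}\end{matrix};q,q\right)$$ $$-\frac{(q,c,d,e,qa,\frac qa,\frac ba,\frac{qb}{c},\frac{qb}{d},\frac{qb}{e},\frac{qa}{bf},\frac{qa}{bg},\frac{qa}{fg},\frac{q^2a^2}{cdef},\frac{q^2a^2}{cdeg};q)_\infty\,\vartheta(\frac{qa^2}{bcde};q)}{(\frac qb,\frac qf,\frac qg,\frac{qa}{c},\frac{qa}{d},\frac{qa}{e},\frac{qa}{f},\frac{qa}{g},\frac{bc}{a},\frac{bd}{a},\frac{be}{a},\frac{q^2ab}{cde},\frac{q^2a^3}{bcdefg};q)_\infty\,\vartheta(\frac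 ab,\frac{cde}{a};q)}\;{}_8W_7\left(\tfrac{qab}{cde};\tfrac{qa}{cd},\tfrac{qa}{ce},\tfrac{qa}{de},\tfrac{bf}{a},\tfrac{bg}{a};q,\tfrac{qa}{fg}\right)$$ $$+\frac{(q,qa,\frac qa,\frac ba,\frac{qe}{f},\frac{qe}{g},\frac{qa}{cd},\frac{qa}{ce},\frac{qa}{de},\frac{qa}{ef},\frac{qa}{eg},\frac{bcde}{a^2},\frac{q^2a^3}{bcdefg};q)_\infty\,\vartheta(\frac{bce}{a},\frac{bde}{a};q)}{(\frac qb,\frac qc,\frac qd,\frac qe,\frac qf,\frac qg,\frac{qa}{c},\frac{qa}{d},\frac{qa}{e},\frac{qa}{f},\frac{qa}{g},\frac{bc}{a},\frac{bd}{a},\frac{be}{a},\frac{q^2a^3}{bcdefg};q)_\infty\,\vartheta(\frac{qa^2}{bcde^2};q)}\;{}_4\phi_3\left(\begin{matrix}\frac{be}{a},\frac{ce}{a},\frac{de}{a},\frac{qa}{fg}\\ \frac{qe}{f},\frac{qe}{g},\frac{bcde}{a^2}\end{matrix};q,q\right)$$ $$+\frac{(q,e,qa,\frac qa,\frac ba,\frac{ce}{a},\frac{de}{a},\frac{qa}{cd},\frac{qa}{ce},\frac{qa}{de},\frac{q^2a^2}{befg},\frac{q^2a^2}{cefg},\frac{q^2a^2}{defg};q)_\infty\,\vartheta(\frac{bcdef}{qa^2},\frac{bcdeg}{qa^2};q)}{(\frac qb,\frac qc,\frac qd,\frac qf,\frac qg,\frac{qa}{c},\frac{qa}{d},\frac{qa}{e},\frac{qa}{f},\frac{qa}{g},\frac{bc}{a},\frac{bd}{a},\frac{q^2a^3}{bcdefg};q)_\infty\,\vartheta(\frac{cde}{a},\frac{bcde^2fg}{q^2a^3};q)}\;{}_4\phi_3\left(\begin{matrix}\frac{qa}{ef},\frac{qa}{eg},\frac{qa}{fg},\frac{q^2a^3}{bcdefg}\\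 \frac{q^2a^2}{befg},\frac{q^2a^2}{cefg},\frac{q^2a^2}{defg}\end{matrix};q,q\right).$$
   Context: $\mathbb C^\ast=\mathbb C\setminus\{0\}$. $(x;q)_\infty=\prod_{n\ge0}(1-xq^n)$, $(x;q)_k=(x;q)_\infty/(xq^k;q)_\infty$ for $k\in\mathbb Z$, $(x_1,\dots,x_m;q)_k=\prod_i(x_i;q)_k$ for $k\in\mathbb Z\cup\{\infty\}$; $\vartheta(z;q)=(z,q/z;q)_\infty$, $\vartheta(z_1,\dots,z_m;q)=\prod_i\vartheta(z_i;q)$. ${}_4\phi_3\left(\begin{matrix}a_1,\dots,a_4\\ b_1,b_2,b_3\end{matrix};q,z\right)=\sum_{k\ge0}\frac{(a_1,\dots,a_4;q)_k}{(q,b_1,b_2,b_3;q)_k}z^k$; ${}_4\psi_4\left(\begin{matrix}a_1,\dots,a_4\\ b_1,\dots,b_4\end{matrix};q,z\right)=\sum_{k\in\mathbb Z}\frac{(a_1,\dots,a_4;q)_k}{(b_1,\dots,b_4;q)_k}z^k$; $${}_8W_7(a;a_4,\dots,a_8;q,z)=\sum_{k=0}^\infty\frac{1-aq^{2k}}{1-a}\,\frac{(a;q)_k}{(q;q)_k}\prod_{j=4}^8\frac{(a_j;q)_k}{(qa/a_j;q)_k}\,z^k,$$ $${}_8\Psi_8(a;a_3,\dots,a_8;q,z)=\sum_{k=-\infty}^\infty\frac{1-aq^{2k}}{1-a}\prod_{j=3}^8\frac{(a_j;q)_k}{(qa/a_j;q)_k}\,z^k .$$ *)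

(* Defs.v *)
From mathcomp Require Import all_boot all_order all_algebra.
From mathcomp Require Import complex.
From mathcomp Require Import all_classical all_reals all_analysis.

Set Implicit Arguments.
Unset Strict Implicit.
Unset Printing Implicit Defensive.

Import Order.TTheory GRing.Theory Num.Theory.
Import numFieldNormedType.Exports.

Local Open Scope classical_set_scope.
Local Open Scope ring_scope.

(* The definitions are over an arbitrary numFieldType, whose metric topology
   is the one provided by numFieldNormedType; they are meant for K = R[i]. *)
Section QSeries.
Context {K : numFieldType}.
Implicit Types (q x z a : K) (xs : seq K) (k : int).

Definition qpoch_inf q x : K :=
  \big[*%R/1]_(0 <= i <oo) (1 - x * q ^+ i).

(* (x; q)_k for k in Z.  The quotient (x; q)_oo / (x q^k; q)_oo is written in
   its reduced form, so that it keeps its usual value when both infinite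
   products vanish (e.g. x = q^-m with k > 0); see qpoch_quotient below.
   At a pole of (x; q)_{-n} (x = q^i with 1 <= i <= n) the value is 0, hence
   1 / (x; q)_{-n} = 0, which is the usual value of that reciprocal. *)
Definition qpoch q x k : K :=
  match k with
  | Posz n => \prod_(0 <= i < n) (1 - x * q ^+ i)
  | Negz n => (\prod_(1 <= i < n.+2) (1 - x * q ^- i))^-1
  end.

Definition qpochs_inf q xs : K := \prod_(x <- xs) qpoch_inf q x.
Definition qpochs q xs k : K := \prod_(x <- xs) qpoch q x k.

Definition theta q z : K := qpochs_inf q [:: z; q / z].
Definition thetas q xs : K := \prod_(z <- xs) theta q z.

Definition bilateral_sum (F : int -> K) : K :=
  limn (series (fun n => F n%:Z)) + limn (series (fun n => F (- n.+1%:Z))).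

Definition phi r (aa : r.+1.-tuple K) (bb : r.-tuple K) q z : K :=
  limn (series (fun n : nat =>
    qpochs q aa n%:Z / qpochs q (q :: bb) n%:Z * z ^+ n)).

Definition psi r (aa bb : r.-tuple K) q z : K :=
  bilateral_sum (fun k => qpochs q aa k / qpochs q bb k * z ^ k).

Definition W87 a (aa : 5.-tuple K) q z : K :=
  limn (series (fun n : nat =>
    (1 - a * q ^+ (2 * n)) / (1 - a) * (qpoch q a n%:Z / qpoch q q n%:Z) *
    (\prod_(x <- aa) (qpoch q x n%:Z / qpoch q (q * a / x) n%:Z)) * z ^+ n)).

Definition Psi88 a (aa : 6.-tuple K) q z : K :=
  bilateral_sum (fun k =>
    (1 - a * q ^ (2 * k)) / (1 - a) *
    (\prod_(x <- aa) (qpoch q x k / qpoch q (q * a / x) k)) * z ^ k).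

(* "No denominator factor vanishes" in the terms of a series: lower parameters
   bb contribute the denominators (b; q)_n, n >= 0, and in a bilateral series
   the upper parameters aa contribute, through
   (a; q)_{-n} = 1 / ((1 - a q^-1) ... (1 - a q^-n)),
   the factors 1 - a q^-n, n >= 1. *)
Definition lower_ok q xs : Prop :=
  forall n : nat, qpochs q xs n%:Z != 0.
Definition upper_ok q xs : Prop :=
  forall n : nat, (0 < n)%N -> \prod_(x <- xs) (1 - x * q ^- n) != 0.

Definition phi_ok r (bb : r.-tuple K) q : Prop := lower_ok q (q :: bb).

Definition psi_ok r (aa bb : r.-tuple K) q : Prop :=
  upper_ok q aa /\ lower_ok q bb.

Definition W87_ok a (aa : 5.-tuple K) q : Prop :=
  1 - a != 0 /\ lower_ok q (q :: [seq q * a / x | x <- aa]).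

Definition Psi88_ok a (aa : 6.-tuple K) q : Prop :=
  [/\ 1 - a != 0, upper_ok q aa & lower_ok q [seq q * a / x | x <- aa]].

Lemma qpoch_inf_shift q x n :
  cvgn (fun m => \prod_(0 <= i < m) (1 - x * q ^+ n * q ^+ i)) ->
  qpoch_inf q x = qpoch q x n%:Z * qpoch_inf q (x * q ^+ n).
Proof.
move=> cv; apply: (@cvg_lim _ _ _ _ eventually_filter) => //.
rewrite -(cvg_shiftn n) /=.
have -> : (fun m => \prod_(0 <= i < m + n) (1 - x * q ^+ i)) =
   (fun m => qpoch q x n%:Z * \prod_(0 <= i < m) (1 - x * q ^+ n * q ^+ i)).
  apply/funext => m; rewrite (@big_cat_nat _ _ _ n 0) ?leq_addl //=.
  congr (_ * _); rewrite -{1}(add0n n) big_addn addnK.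
  by apply: eq_bigr => i _; rewrite addnC exprD mulrA.
exact: cvgMr.
Qed.

Lemma qpoch_quotient q x k : q != 0 ->
  (forall y, cvgn (fun m => \prod_(0 <= i < m) (1 - y * q ^+ i))) ->
  qpoch_inf q (x * q ^ k) != 0 ->
  qpoch q x k = qpoch_inf q x / qpoch_inf q (x * q ^ k).
Proof.
move=> q0 cv; case: k => n nz.
  by rewrite [qpoch_inf q x](@qpoch_inf_shift _ _ n) // mulfK.
move: nz; rewrite NegzE -exprnN => nz.
have := @qpoch_inf_shift q (x * q ^- n.+1) n.+1 (cv _).
rewrite mulfVK ?expf_neq0 //= => E.
rewrite E in nz *; move: nz; rewrite mulf_eq0 negb_or => /andP[nz1 nz2].
rewrite invfM mulrCA divff // mulr1; congr (_^-1).
rewrite [LHS]big_nat_rev /= big_add1 /=.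
rewrite !big_mkord; apply: eq_bigr => i _.
rewrite -mulrA; congr (1 - _ * _).
have -> : q ^- n.+1 = q ^- (n.+1 - i) * q ^- i.
  by rewrite -invfM -exprD subnK // ltnW.
by rewrite add1n !subSS -mulrA mulVf ?expf_neq0 // mulr1.
Qed.

End QSeries.

(* Main.v *)
(** Partial fractions, obtained from Lagrange interpolation on finite pieces of geometric progressions of ratio q
    followed by dominated convergence, give two relations between residue sums: one expresses the 8-Psi-8 by two
    very-well-poised 8-phi-7 (with b and e as distinguished parameters), the other is a five-term relation between
    the 4-psi-4 and four balanced 4-phi-3. The nonterminating Watson transformation, a consequence of the 6-phi-5
    sum and of the nonterminating q-Saalschuetz sum by interchange of summations, splits the two 8-phi-7, and also the
    8W7 of the theorem, into pairs of these same four 4-phi-3. Eliminating the series that do not occur in the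
    theorem is linear algebra whose coefficients agree by Weierstrass' three-term relation for theta functions.

    The residue computations need certain monomials in the parameters not to be powers of q. The general case
    follows by continuity: the parameters are scaled by powers of a number slightly above 1, which moves all these
    monomials away from the powers of q. *)
Require Import Defs.
From mathcomp Require Import all_boot all_order all_algebra.
From mathcomp Require Import complex.
From mathcomp Require Import all_classical all_reals all_analysis.
From mathcomp Require Import ring lra zify.
Set Implicit Arguments.
Unset Strict Implicit.
Unset Printing Implicit Defensive.
Import Order.TTheory GRing.Theory Num.Theory.
Import numFieldNormedType.Exports.
Local Open Scope classical_set_scope.
Local Open Scope ring_scope.

(** * A real-valued modulus *)

(** The four 4-phi-3 are the hinge. The 8-phi-7 at b is a combination of [u4b] and [u4z], the one at
    e a combination of [u4e] and [u4p]; the 8W7 of the theorem has the same auxiliary parameter [Bb]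
    in Watson's transformation as the 8-phi-7 at b, and is a multiple of the same combination. Since
    only [u4e] and [u4z] survive, the disappearance of [u4p] forces the coefficient of the 4-psi-4,
    that of [u4b] forces the coefficient of the 8W7, and the last two coefficients must then agree
    with the stated ones: there the theta relations enter. For this to be linear algebra, (x; q)_k
    is replaced by P x / P (x q^k), so that the constants are infinite products which merge into
    thetas. This form fails when an upper parameter is a nonpositive power of q, hence the final
    limit is taken on series in finite symbols. All convergence is geometric: a bound M r^n, uniform
    in the parameter, serves the interchange of sums, the passage from interpolation to residues,
    and the continuity in the parameters. Completeness is needed only for such series. *)

(* The norm of [R[i]] takes its values in [R[i]] itself; [cmod] is the modulus with values in [R]. *)
Class modulus (R : realType) (K : numFieldType) := Modulus {
  cmod : K -> R;
  cmod_ge0 : forall x, 0 <= cmod x;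
  cmod_eq0 : forall x, (cmod x == 0) = (x == 0);
  cmodM : forall x y, cmod (x * y) = cmod x * cmod y;
  ler_cmodD : forall x y, cmod (x + y) <= cmod x + cmod y;
  cvg_cmodP : forall (T : Type) (F : set_system T) (FF : Filter F) (f : T -> K) (l : K),
    f @ F --> l <-> (fun t => cmod (f t - l)) @ F --> (0 : R);
  cmod_complete : forall (u : nat -> K) (M r : R), 0 <= M -> 0 <= r < 1 ->
    (forall n, cmod (u n) <= M * r ^+ n) -> cvgn (series u) }.

Section ModulusTheory.
Context {R : realType} {K : numFieldType} {KR : modulus R K}.
Implicit Types (x y z : K).

Lemma cmod0 : cmod (0 : K) = 0 :> R.
Proof. by apply/eqP; rewrite cmod_eq0. Qed.

Lemma cmod1 : cmod (1 : K) = 1 :> R.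
Proof.
have h : cmod (1 : K) != 0 :> R by rewrite cmod_eq0 oner_neq0.
by apply: (mulfI h); rewrite -cmodM !mulr1.
Qed.

Lemma cmod_gt0 x : (0 < cmod x) = (x != 0).
Proof. by rewrite lt_neqAle cmod_ge0 andbT eq_sym cmod_eq0. Qed.

Lemma cmodN x : cmod (- x) = cmod x.
Proof.
have h : cmod (-1 : K) = 1 :> R.
  apply/eqP; rewrite -(@eqrXn2 _ 2) ?ler01 ?cmod_ge0 // expr2 -cmodM.
  by rewrite mulrNN mulr1 cmod1 expr1n.
by rewrite -mulN1r cmodM h mul1r.
Qed.

Lemma cmodC x y : cmod (x - y) = cmod (y - x).
Proof. by rewrite -cmodN opprB. Qed.

Lemma cmodV x : cmod x^-1 = (cmod x)^-1.
Proof.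
have [->|x0] := eqVneq x 0; first by rewrite invr0 cmod0 invr0.
have h : cmod x != 0 by rewrite cmod_eq0.
by apply: (mulfI h); rewrite -cmodM !divff // cmod1.
Qed.

Lemma cmodX x n : cmod (x ^+ n) = cmod x ^+ n.
Proof. by elim: n => [|n IH]; rewrite ?expr0 ?cmod1 // !exprS cmodM IH. Qed.

Lemma cmod_prod I (s : seq I) (Q : pred I) (F : I -> K) :
  cmod (\prod_(i <- s | Q i) F i) = \prod_(i <- s | Q i) cmod (F i).
Proof. exact: (big_morph cmod cmodM cmod1). Qed.

Lemma ler_cmodB x y : cmod (x - y) <= cmod x + cmod y.
Proof. by rewrite -(cmodN y) ler_cmodD. Qed.

Lemma ler_cmod_sum I (s : seq I) (Q : pred I) (F : I -> K) :
  cmod (\sum_(i <- s | Q i) F i) <= \sum_(i <- s | Q i) cmod (F i).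
Proof.
elim/big_rec2: _ => [|i a b _ h]; first by rewrite cmod0.
by apply: le_trans (ler_cmodD _ _) _; rewrite lerD2l.
Qed.

Lemma ler_dist_cmod x y : `|cmod x - cmod y| <= cmod (x - y).
Proof.
rewrite ler_norml; apply/andP; split.
  by rewrite lerNl opprB lerBlDr cmodC -{1}(subrK x y) ler_cmodD.
by rewrite lerBlDr -{1}(subrK y x) ler_cmodD.
Qed.

Lemma cvg_cmod {T} {F : set_system T} {FF : Filter F} (f : T -> K) (l : K) :
  f @ F --> l -> (fun t => cmod (f t)) @ F --> cmod l.
Proof.
move=> /cvg_cmodP fl; apply/cvgrPdist_lt => e e0.
have /cvgr0Pnorm_lt/(_ _ e0) := fl.
apply: filterS => t; rewrite ger0_norm ?cmod_ge0 //.
by apply: le_lt_trans; rewrite cmodC ler_dist_cmod.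
Qed.

End ModulusTheory.

Section GeometricBound.
Context {R : realType} {K : numFieldType} {KR : modulus R K}.
Implicit Types (u v : nat -> K) (M r : R).

Lemma geometric_ge0 M r n : 0 <= M -> 0 <= r -> 0 <= M * r ^+ n :> R.
Proof. by move=> ? ?; rewrite mulr_ge0 // exprn_ge0. Qed.

Lemma sum_geometric_le r n m : 0 <= r < 1 ->
  \sum_(n <= i < m) r ^+ i <= r ^+ n / (1 - r) :> R.
Proof.
move=> /andP[r0 r1].
have h1r : 0 < 1 - r by rewrite subr_gt0.
have [nm|mn] := leqP n m; last first.
  by rewrite big_geq ?(ltnW mn) // divr_ge0 ?exprn_ge0 // ltW.
rewrite ler_pdivlMr // -(subnK nm); elim: (m - n)%N => [|k IH].
  by rewrite add0n big_geq // mul0r exprn_ge0.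
suff -> : (\sum_(n <= i < k.+1 + n) r ^+ i) * (1 - r) = r ^+ n - r ^+ (k.+1 + n).
  by rewrite gerBl exprn_ge0.
elim: k.+1 => [|j IHj]; first by rewrite add0n big_geq // mul0r subrr.
rewrite addSn big_nat_recr ?leq_addl //= mulrDl IHj exprS.
by rewrite mulrBr mulr1 [r ^+ _ * r]mulrC addrA subrK.
Qed.

Lemma series_tail_le u M r N : 0 <= M -> 0 <= r < 1 ->
  (forall n, cmod (u n) <= M * r ^+ n) ->
  cmod (limn (series u) - series u N) <= M * r ^+ N / (1 - r).
Proof.
move=> M0 r01 h; have cu := cmod_complete M0 r01 h.
have cl : (fun n => cmod (series u n - series u N)) @ \oo
   --> cmod (limn (series u) - series u N).
  by apply: cvg_cmod; apply: cvgB; [exact: cu | exact: cvg_cst].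
rewrite -(cvg_lim _ cl) //; apply: limr_le; first exact: cvgP cl.
near=> n; rewrite sub_series ifT; last by near: n; exists N.
apply: le_trans (ler_cmod_sum _ _ _) _.
apply: le_trans (ler_sum _ (fun i _ => h i)) _.
by rewrite -mulr_sumr -mulrA ler_wpM2l // sum_geometric_le.
Unshelve. all: by end_near. Qed.

End GeometricBound.

(** * The modulus of complex numbers *)

Section ComplexModulus.
Context {R : realType}.
Local Notation C := (complex_complex__canonical__Num_NumField R).
Implicit Types (x y z : R[i]) (r s : R).

Definition Cmod z : R := complex.Re `|z|.

Lemma normr_Cmod z : `|z| = ((Cmod z)%:C)%C.
Proof. by rewrite /Cmod normc_def. Qed.

Lemma CmodE z : Cmod z = Num.sqrt (complex.Re z ^+ 2 + complex.Im z ^+ 2).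
Proof. by rewrite /Cmod normc_def. Qed.

Lemma Cmod_ge0 z : 0 <= Cmod z.
Proof. by rewrite -ler0c -normr_Cmod normr_ge0. Qed.

Lemma CmodM x y : Cmod (x * y) = Cmod x * Cmod y.
Proof. by apply: complexI; rewrite rmorphM /= -!normr_Cmod normrM. Qed.

Lemma Cmod1 : Cmod 1 = 1.
Proof. by apply: complexI; rewrite -normr_Cmod normr1. Qed.

Lemma Cmod0 : Cmod 0 = 0.
Proof. by apply: complexI; rewrite -normr_Cmod normr0. Qed.

Lemma Cmod_eq0 x : (Cmod x == 0) = (x == 0).
Proof. by rewrite -(inj_eq (@complexI R)) -normr_Cmod normr_eq0. Qed.

Lemma Cmod_gt0 x : (0 < Cmod x) = (x != 0).
Proof. by rewrite lt_neqAle Cmod_ge0 andbT eq_sym Cmod_eq0. Qed.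

Lemma CmodN x : Cmod (- x) = Cmod x.
Proof. by rewrite /Cmod normrN. Qed.

Lemma CmodC x y : Cmod (x - y) = Cmod (y - x).
Proof. by rewrite -CmodN opprB. Qed.

Lemma CmodV x : Cmod x^-1 = (Cmod x)^-1.
Proof. by apply: complexI; rewrite fmorphV -!normr_Cmod normfV. Qed.

Lemma ler_CmodD x y : Cmod (x + y) <= Cmod x + Cmod y.
Proof. by rewrite -lecR rmorphD /= -!normr_Cmod ler_normD. Qed.

Lemma ler_Re_Cmod z : `|complex.Re z| <= Cmod z.
Proof. by rewrite CmodE -sqrtr_sqr ler_wsqrtr // lerDl sqr_ge0. Qed.

Lemma ler_Im_Cmod z : `|complex.Im z| <= Cmod z.
Proof. by rewrite CmodE -sqrtr_sqr ler_wsqrtr // lerDr sqr_ge0. Qed.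

Lemma Cmod_le_ReIm z : Cmod z <= `|complex.Re z| + `|complex.Im z|.
Proof.
rewrite CmodE -[leRHS]ger0_norm ?addr_ge0 // -sqrtr_sqr ler_wsqrtr //.
rewrite sqrrD !real_normK ?num_real // lerD2r lerDl mulrn_wge0 // mulr_ge0.
Qed.

Lemma Cmod_normr_lt x y : (`|x| < `|y|) = (Cmod x < Cmod y).
Proof. by rewrite !normr_Cmod ltcR. Qed.

Lemma cvg_CmodP {T} {F : set_system T} {FF : Filter F} (f : T -> C) (l : C) :
  f @ F --> l <-> (fun t => Cmod (f t - l)) @ F --> (0 : R).
Proof.
split=> [fl|fl].
  apply/cvgr0Pnorm_lt => e e0.
  have /cvgrPdist_lt/(_ (e%:C)%C) := fl; rewrite ltcR => /(_ e0).
  apply: filterS => t; rewrite normr_Cmod ltcR CmodC ger0_norm //.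
  exact: Cmod_ge0.
apply/cvgrPdist_lt => e e0.
(* The radii of balls in [R[i]] are positive elements of [R[i]]; positivity forces the imaginary
   part to vanish, so that the radius is the real number [complex.Re e]. *)
have e0R : 0 < complex.Re e by move: e0; rewrite ltcE => /andP[].
have eE : e = ((complex.Re e)%:C)%C by rewrite RRe_real // gtr0_real.
have /cvgr0Pnorm_lt/(_ _ e0R) := fl.
apply: filterS => t; rewrite ger0_norm ?Cmod_ge0 // => h.
by rewrite normr_Cmod eE ltcR CmodC.
Qed.

Lemma cvg_ReIm {T} {F : set_system T} {FF : Filter F} (f : T -> C) r s :
  (fun t => complex.Re (f t)) @ F --> r -> (fun t => complex.Im (f t)) @ F --> s ->
  f @ F --> (Complex r s : C).
Proof.
move=> fr fs; apply/cvg_CmodP.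
have h : (fun t => `|complex.Re (f t) - r| + `|complex.Im (f t) - s|) @ F
         --> (0 : R).
  rewrite -[X in _ --> X](addr0 (0 : R)); apply: cvgD.
    by apply/norm_cvg0P; rewrite -(subrr r); apply: cvgB => //; exact: cvg_cst.
  by apply/norm_cvg0P; rewrite -(subrr s); apply: cvgB => //; exact: cvg_cst.
apply: (squeeze_cvgr _ _ h); last exact: cvg_cst.
apply: nearW => t; rewrite Cmod_ge0 /=.
apply: le_trans (Cmod_le_ReIm _) _.
by case: (f t) => u v /=.
Qed.

End ComplexModulus.

Section ComplexComplete.
Context {R : realType}.
Local Notation C := (complex_complex__canonical__Num_NumField R).
Implicit Types (u v : nat -> C) (M r : R).

Lemma is_cvg_series_real (u : nat -> R) M r : 0 <= M -> 0 <= r < 1 ->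
  (forall n, `|u n| <= M * r ^+ n) -> cvgn (series u).
Proof.
move=> M0 r01 h; apply: normed_cvg.
apply: (@series_le_cvg _ _ (geometric M r)) => [n|n|n|].
- exact: normr_ge0.
- by rewrite /geometric /= geometric_ge0 //; case/andP: r01.
- exact: h.
- by apply: is_cvg_geometric_series; rewrite ger0_norm; case/andP: r01.
Qed.

Lemma Cmod_complete u M r : 0 <= M -> 0 <= r < 1 ->
  (forall n, Cmod (u n) <= M * r ^+ n) -> cvgn (series u).
Proof.
move=> M0 r01 h.
have cr : cvgn (series (fun n => complex.Re (u n))).
  by apply: (@is_cvg_series_real _ M r M0 r01) => n; exact: le_trans (ler_Re_Cmod _) (h n).
have ci : cvgn (series (fun n => complex.Im (u n))).
  by apply: (@is_cvg_series_real _ M r M0 r01) => n; exact: le_trans (ler_Im_Cmod _) (h n).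
have sRe : (fun n => complex.Re (series u n)) = series (fun n => complex.Re (u n)).
  apply/funext => n; apply: (big_morph (fun z : R[i] => complex.Re z)) => //.
  by case=> [? ?] [? ?].
have sIm : (fun n => complex.Im (series u n)) = series (fun n => complex.Im (u n)).
  apply/funext => n; apply: (big_morph (fun z : R[i] => complex.Im z)) => //.
  by case=> [? ?] [? ?].
by apply: cvgP; apply: cvg_ReIm; rewrite ?sRe ?sIm; [exact: cr | exact: ci].
Qed.

#[global] Instance complex_modulus : modulus R C :=
  Modulus (@Cmod_ge0 R) (@Cmod_eq0 R) (@CmodM R) (@ler_CmodD R)
    (fun T F FF f l => @cvg_CmodP R T F FF f l) (@Cmod_complete).

End ComplexComplete.

(** * Dominated convergence of series *)

Section DominatedConvergence.
Context {R : realType} {K : numFieldType} {KR : modulus R K}.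
Implicit Types (u v : nat -> K) (M r : R).

Definition nsum u : K := limn (series u).

Lemma nsum_lim (s : nat -> K) l u : s @ \oo --> l ->
  (forall n, \sum_(0 <= k < n) u k = s n) -> nsum u = l.
Proof.
move=> sl us; rewrite /nsum (_ : series u = s) ?(cvg_lim _ sl) //.
exact/funext.
Qed.

(** The only mode of summability in use: an explicit geometric majorant is stable under the
    operations below, and [cmod_complete] turns it into convergence. *)
Definition geo_bounded u :=
  exists M r, [/\ 0 <= M, 0 <= r < 1 & forall n, cmod (u n) <= M * r ^+ n].

Lemma is_cvg_geo_bounded u : geo_bounded u -> cvgn (series u).
Proof. by case=> M [r [M0 r01 h]]; exact: cmod_complete M0 r01 h. Qed.

Lemma nsumD u v : geo_bounded u -> geo_bounded v ->
  nsum (fun n => u n + v n) = nsum u + nsum v.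
Proof.
move=> /is_cvg_geo_bounded cu /is_cvg_geo_bounded cv.
by rewrite /nsum -lim_seriesD.
Qed.

Lemma nsumZ c u : geo_bounded u -> nsum (fun n => c * u n) = c * nsum u.
Proof.
move=> /is_cvg_geo_bounded cu.
apply: (@nsum_lim (fun n => c * series u n)); last by move=> n; rewrite mulr_sumr.
by apply: (@cvgM _ _ _ _ (fun=> c) (series u)); [exact: cvg_cst | exact: cu].
Qed.

Lemma nsumB u v : geo_bounded u -> geo_bounded v ->
  nsum (fun n => u n - v n) = nsum u - nsum v.
Proof.
move=> /is_cvg_geo_bounded cu /is_cvg_geo_bounded cv.
by rewrite /nsum -lim_seriesB.
Qed.

Lemma eq_nsum u v : u =1 v -> nsum u = nsum v.
Proof. by move=> /funext ->. Qed.

Lemma eq_geo_bounded u v : u =1 v -> geo_bounded u -> geo_bounded v.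
Proof. by move=> /funext ->. Qed.

Lemma geo_boundedZ c u : geo_bounded u -> geo_bounded (fun n => c * u n).
Proof.
case=> M [r [M0 r01 h]]; exists (cmod c * M), r; split => //.
  by rewrite mulr_ge0 // cmod_ge0.
by move=> n; rewrite cmodM -mulrA ler_wpM2l ?cmod_ge0.
Qed.

Lemma geo_boundedD u v : geo_bounded u -> geo_bounded v ->
  geo_bounded (fun n => u n + v n).
Proof.
case=> M [r [M0 r01 h]] [M' [r' [M0' r01' h']]].
have /andP[r0 r1] := r01; have /andP[r0' r1'] := r01'.
exists (M + M'), (Num.max r r'); split=> [||n].
- exact: addr_ge0.
- by rewrite le_max r0 /= gt_max r1.
apply: le_trans (ler_cmodD _ _) _; rewrite mulrDl; apply: lerD.
  apply: le_trans (h n) _; rewrite ler_wpM2l // lerXn2r ?nnegrE //.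
    by rewrite le_max r0.
  by rewrite le_max lexx.
apply: le_trans (h' n) _; rewrite ler_wpM2l // lerXn2r ?nnegrE //.
  by rewrite le_max r0.
by rewrite le_max lexx orbT.
Qed.

Lemma geo_boundedS u : geo_bounded u -> geo_bounded (fun n => u n.+1).
Proof.
case=> M [r [M0 r01 h]]; have /andP[r0 r1] := r01.
exists M, r; split=> // n; apply: le_trans (h _) _; rewrite ler_wpM2l //.
by rewrite exprS ler_piMl ?exprn_ge0 // ltW.
Qed.

Lemma nsum_recl u : geo_bounded u -> nsum u = u 0%N + nsum (fun n => u n.+1).
Proof.
move=> gu; rewrite {1}/nsum; set v := fun n => u n.+1.
have h : (fun n => u 0%N + series v n) @ \oo --> u 0%N + nsum v.
  apply: (@cvgD _ _ _ _ _ (fun=> u 0%N) (series v)); first exact: cvg_cst.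
  exact: (is_cvg_geo_bounded (geo_boundedS gu)).
apply: (@cvg_lim _ _ _ _ eventually_filter) => //.
rewrite -(cvg_shiftn 1); apply: cvg_trans h.
apply: near_eq_cvg; apply: nearW => n.
by rewrite /mk_sequence addn1 /series /= big_nat_recl.
Qed.

Lemma nsum_fin u N : (forall n, (N <= n)%N -> u n = 0) ->
  nsum u = \sum_(0 <= n < N) u n.
Proof.
move=> h; apply: (@cvg_lim _ _ _ _ eventually_filter) => //.
apply: cvg_near_cst; exists N => // n /= Nn.
rewrite /series /= (@big_cat_nat _ _ _ N) //= [X in _ + X]big_nat.
by rewrite [X in _ + X]big1 ?addr0 // => i /andP[Ni _]; exact: h.
Qed.

Lemma nsum_telescope (V : nat -> K) (l : K) : V @ \oo --> l ->
  nsum (fun n => V n - V n.+1) = V 0%N - l.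
Proof.
move=> Vl; apply: (@nsum_lim (fun n => V 0%N - V n)).
  by apply: (@cvgB _ _ _ _ _ (fun=> V 0%N) V); [exact: cvg_cst | exact: Vl].
by move=> n; rewrite -[RHS]opprB -telescope_sumr // -sumrN; apply: eq_bigr => i _; rewrite opprB.
Qed.

(** Termwise convergence together with a majorant that is eventually uniform in the parameter. The
    ratio r is part of the data so that majorants multiply; r = 1 means uniformly bounded, which is
    the case of all q-Pochhammer factors, and the decay comes from a single power. *)
Definition dom_cvg {T} (F : set_system T) (u : T -> nat -> K) v r :=
  (forall k, (fun t => u t k) @ F --> v k) /\
  exists2 M, 0 <= M & \forall t \near F, forall k, cmod (u t k) <= M * r ^+ k.

Section Filtered.
Context {T : Type} {F : set_system T} {FF : ProperFilter F}.
Implicit Types (U V : T -> nat -> K).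

Lemma dom_cvg_bound U v r : dom_cvg F U v r ->
  exists2 M, 0 <= M & forall k, cmod (v k) <= M * r ^+ k.
Proof.
case=> cv [M M0 h]; exists M => // k.
rewrite -(cvg_lim _ (cvg_cmod (cv k))) //; apply: limr_le.
  exact: cvgP (cvg_cmod (cv k)).
by apply: filterS h.
Qed.

Lemma dom_cvg_geo_bounded U v r : 0 <= r < 1 -> dom_cvg F U v r -> geo_bounded v.
Proof. by move=> r01 /dom_cvg_bound [M M0 h]; exists M, r. Qed.

Lemma dom_cvgM U v r U' v' r' : dom_cvg F U v r -> dom_cvg F U' v' r' ->
  dom_cvg F (fun t k => U t k * U' t k) (fun k => v k * v' k) (r * r').
Proof.
case=> cv [M M0 h] [cv' [M' M0' h']]; split=> [k|]; first exact: cvgM.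
exists (M * M'); first exact: mulr_ge0.
near=> t => k; rewrite cmodM exprMn mulrACA ler_pM ?cmod_ge0 //.
  by move: k; near: t.
by move: k; near: t.
Unshelve. all: by end_near. Qed.

Lemma dom_cvg_const v r M : 0 <= M -> (forall k, cmod (v k) <= M * r ^+ k) ->
  dom_cvg F (fun _ => v) v r.
Proof.
by move=> M0 h; split=> [k|]; [exact: cvg_cst | exists M => //; apply: nearW].
Qed.

Lemma cvg_cstD (c : K) (f : T -> K) (l : K) : f @ F --> l ->
  (fun t => c + f t) @ F --> c + l.
Proof. by move=> fl; apply: (@cvgD _ _ _ _ _ (fun=> c) f); [exact: cvg_cst | exact: fl]. Qed.

Lemma cvg_cstM (c : K) (f : T -> K) (l : K) : f @ F --> l ->
  (fun t => c * f t) @ F --> c * l.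
Proof. by move=> fl; apply: (@cvgM _ _ _ _ (fun=> c) f); [exact: cvg_cst | exact: fl]. Qed.

Lemma near_cmod_lt (f : T -> K) (l : K) e : f @ F --> l -> cmod l < e ->
  \forall t \near F, cmod (f t) < e.
Proof.
move=> fl le; have h0 : (fun t => cmod (f t)) @ F --> cmod l by exact: cvg_cmod.
 move/cvgrPdist_lt: h0 => /(_ (e - cmod l)).
rewrite subr_gt0 => /(_ le); apply: filterS => t.
by rewrite ltr_norml => /andP[h _]; lra.
Qed.

Lemma near_cmod_gt (f : T -> K) (l : K) e : f @ F --> l -> e < cmod l ->
  \forall t \near F, e < cmod (f t).
Proof.
move=> fl le; have h0 : (fun t => cmod (f t)) @ F --> cmod l by exact: cvg_cmod.
 move/cvgrPdist_lt: h0 => /(_ (cmod l - e)).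
rewrite subr_gt0 => /(_ le); apply: filterS => t.
by rewrite ltr_norml => /andP[_ h]; lra.
Qed.

Lemma dom_cvg_scalar (c : T -> K) (c0 : K) : c @ F --> c0 ->
  dom_cvg F (fun t _ => c t) (fun=> c0) 1.
Proof.
move=> cc0; split=> // ; exists (cmod c0 + 1); first by rewrite addr_ge0 ?cmod_ge0.
have h : cmod c0 < cmod c0 + 1 by rewrite ltrDl.
by apply: filterS (near_cmod_lt cc0 h) => t /ltW h' k; rewrite expr1n mulr1.
Qed.

Lemma cvg_exprn (c : T -> K) (c0 : K) n : c @ F --> c0 ->
  (fun t => c t ^+ n) @ F --> c0 ^+ n.
Proof.
move=> h; elim: n => [|n IH]; first exact: cvg_cst.
have -> : (fun t => c t ^+ n.+1) = (fun t => c t * c t ^+ n).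
  by apply/funext => t; rewrite exprS.
by rewrite exprS; apply: cvgM.
Qed.

Lemma dom_cvg_pow (c : T -> K) (c0 : K) r : c @ F --> c0 -> cmod c0 < r ->
  dom_cvg F (fun t k => c t ^+ k) (fun k => c0 ^+ k) r.
Proof.
move=> cc0 c0r; split=> [k|]; first exact: cvg_exprn.
exists 1 => //; apply: filterS (near_cmod_lt cc0 c0r) => t /ltW hr k.
rewrite mul1r cmodX.
by rewrite lerXn2r ?nnegrE ?cmod_ge0 // (le_trans _ hr) // cmod_ge0.
Qed.

Lemma eq_dom_cvg U v r U' v' r' :
  (forall t k, U t k = U' t k) -> v =1 v' -> r = r' ->
  dom_cvg F U v r -> dom_cvg F U' v' r'.
Proof.
move=> h /funext <- <-; suff -> : U = U' by [].
by apply/funext => t; apply/funext.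
Qed.

(** Tannery's theorem: beyond a rank N the tails of both series are small uniformly in the
    parameter, by the geometric majorant, and the finitely many remaining terms converge one by
    one. *)
Theorem dom_cvg_nsum U v r : 0 <= r < 1 -> dom_cvg F U v r ->
  (fun t => nsum (U t)) @ F --> nsum v.
Proof.
move=> r01 cUv; have [M' M'0 hv] := dom_cvg_bound cUv.
case: cUv => cv [M M0 h]; have /andP[r0 r1] := r01.
have r1' : 0 < 1 - r by rewrite subr_gt0.
apply/cvg_cmodP/cvgr0Pnorm_lt => e e0.
have [N hN] : exists N, (M + M') * r ^+ N / (1 - r) < e / 2.
  have /cvgr0Pnorm_lt : (fun n => (M + M') / (1 - r) * r ^+ n) @ \oo --> (0 : R).
    by apply: cvg_geometric; rewrite ger0_norm.
  move=> /(_ (e / 2)); rewrite divr_gt0 // => /(_ isT) [N _ hN].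
  exists N; apply: le_lt_trans (hN N (leqnn N)).
  by rewrite mulrAC ler_norm.
have cfin : (fun t => \sum_(0 <= k < N) cmod (U t k - v k)) @ F --> (0 : R).
  elim: N {hN} => [|N IH].
    by under eq_fun do rewrite big_geq //; exact: cvg_cst.
  under eq_fun do rewrite big_nat_recr //=.
  have h1 : (fun t => cmod (U t N - v N)) @ F --> (0 : R).
    by move: (cv N) => /cvg_cmodP h1; exact: h1.
  by have := cvgD IH h1; rewrite addr0; exact.
have /cvgr0Pnorm_lt/(_ (e / 2)) := cfin; rewrite divr_gt0 // => /(_ isT) hfin.
near=> t.
have ht : forall k, cmod (U t k) <= M * r ^+ k by near: t.
have hf : `|\sum_(0 <= k < N) cmod (U t k - v k)| < e / 2 by near: t.
rewrite ger0_norm ?cmod_ge0 //.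
have -> : nsum (U t) - nsum v = (nsum (U t) - series (U t) N) +
   (series (U t) N - series v N) - (nsum v - series v N) by ring.
apply: le_lt_trans (ler_cmodB _ _) _.
have t1 := series_tail_le N M0 r01 ht.
have t2 := series_tail_le N M'0 r01 hv.
have t3 : cmod (series (U t) N - series v N) < e / 2.
  apply: le_lt_trans hf; rewrite ger0_norm; last first.
    by apply: sumr_ge0 => i _; exact: cmod_ge0.
  by rewrite /series /= -sumrB ler_cmod_sum.
have t4 : cmod (nsum (U t) - series (U t) N + (series (U t) N - series v N)) <=
  cmod (nsum (U t) - series (U t) N) + cmod (series (U t) N - series v N).
  exact: ler_cmodD.
move: t1 t2 t4; rewrite -/(nsum (U t)) -/(nsum v); move: hN; rewrite !mulrDl.
by lra.
Unshelve. all: by end_near. Qed.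

Lemma dom_cvgD U v U' v' r : dom_cvg F U v r -> dom_cvg F U' v' r ->
  dom_cvg F (fun t k => U t k + U' t k) (fun k => v k + v' k) r.
Proof.
case=> cv [M M0 h] [cv' [M' M0' h']]; split=> [k|].
  by apply: cvgD; [exact: cv | exact: cv'].
exists (M + M'); first exact: addr_ge0.
move: h h'; apply: filterS2 => t h h' k; apply: le_trans (ler_cmodD _ _) _.
by rewrite mulrDl lerD.
Qed.

Lemma dom_cvg_cst (c : K) : dom_cvg F (fun _ _ => c) (fun=> c) 1.
Proof. by apply: dom_cvg_scalar; exact: cvg_cst. Qed.

Lemma dom_cvgMr U v r U' v' : dom_cvg F U v r -> dom_cvg F U' v' 1 ->
  dom_cvg F (fun t k => U t k * U' t k) (fun k => v k * v' k) r.
Proof. by move=> h h'; rewrite -[r]mulr1; apply: dom_cvgM. Qed.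

Lemma dom_cvgMl U v U' v' r : dom_cvg F U v 1 -> dom_cvg F U' v' r ->
  dom_cvg F (fun t k => U t k * U' t k) (fun k => v k * v' k) r.
Proof. by move=> h h'; rewrite -[r]mul1r; apply: dom_cvgM. Qed.

Lemma dom_cvgVM U v U' v' : dom_cvg F (fun t k => (U t k)^-1) (fun k => (v k)^-1) 1 ->
  dom_cvg F (fun t k => (U' t k)^-1) (fun k => (v' k)^-1) 1 ->
  dom_cvg F (fun t k => (U t k * U' t k)^-1) (fun k => (v k * v' k)^-1) 1.
Proof.
move=> h h'; have := dom_cvgMr h h'.
by apply: eq_dom_cvg => // [t k|k]; rewrite invfM.
Qed.

End Filtered.

Lemma nsum_ltn u N : nsum (fun k => ((k < N)%N)%:R * u k) = \sum_(0 <= k < N) u k.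
Proof.
rewrite (@nsum_fin _ N) => [|n]; last by rewrite leqNgt; case: ltnP => //; rewrite mul0r.
by apply: eq_big_nat => i /andP[_ ->]; rewrite mul1r.
Qed.

(* Interchange of two summations is the dominated convergence of the partial
   sums over the first index. *)
Lemma exchange_nsum (f : nat -> nat -> K) M r s :
  0 <= M -> 0 <= r < 1 -> 0 <= s < 1 ->
  (forall k n, cmod (f k n) <= M * r ^+ k * s ^+ n) ->
  nsum (fun k => nsum (f k)) = nsum (fun n => nsum (f^~ n)).
Proof.
move=> M0 r01 s01 h; have /andP[r0 r1] := r01; have /andP[s0 s1] := s01.
have gf k : geo_bounded (f k).
  by exists (M * r ^+ k), s; split=> //; rewrite geometric_ge0.
have gf' n : geo_bounded (f^~ n).
  exists (M * s ^+ n), r; split=> //; first by rewrite geometric_ge0.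
  by move=> k; rewrite mulrAC.
have gfin N : geo_bounded (fun n => \sum_(0 <= k < N) f k n).
  elim: N => [|N IH].
    exists 0, s; split=> // n; rewrite big_geq // cmod0 mul0r //.
  apply: (@eq_geo_bounded (fun n => \sum_(0 <= k < N) f k n + f N n)).
    by move=> n; rewrite big_nat_recr.
  exact: geo_boundedD.
have fin N : \sum_(0 <= k < N) nsum (f k) = nsum (fun n => \sum_(0 <= k < N) f k n).
  elim: N => [|N IH].
    rewrite big_geq // (@nsum_fin _ 0) ?big_geq // => n _.
    by rewrite big_geq.
  rewrite big_nat_recr //= IH -nsumD //.
  by apply: eq_nsum => n; rewrite big_nat_recr.
apply: nsum_lim fin; apply: (dom_cvg_nsum s01); split=> [n|]; first exact: is_cvg_geo_bounded (gf' n).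
exists (M / (1 - r)); first by rewrite divr_ge0 // subr_ge0 ltW.
apply: nearW => N n; apply: le_trans (ler_cmod_sum _ _ _) _.
apply: le_trans (ler_sum _ (fun k _ => h k n)) _.
rewrite -mulr_suml -mulr_sumr ler_wpM2r ?exprn_ge0 // ler_wpM2l //.
by apply: le_trans (sum_geometric_le _ _ r01) _; rewrite expr0 mul1r.
Qed.

End DominatedConvergence.

(** * q-Pochhammer symbols *)

Class nome {R : realType} {K : numFieldType} {KR : modulus R K} (q : K) : Prop :=
  nomeP : 0 < cmod q < 1.

Definition qpoch_fin {K : numFieldType} (q x : K) n : K := \prod_(0 <= i < n) (1 - x * q ^+ i).

Section QPochhammer.
Context {R : realType} {K : numFieldType} {KR : modulus R K}.
Local Notation cmod := (@cmod R K KR).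
Context {q : K} {hq : nome q}.
Implicit Types (x y z : K).

Lemma nome_neq0 : q != 0.
Proof. by rewrite -cmod_gt0; case/andP: hq. Qed.

Lemma nome_lt1 : cmod q < 1.
Proof. by case/andP: hq. Qed.

Let q0 := nome_neq0.
Let q1 := nome_lt1.

Local Notation P := (qpoch_inf q).
Local Notation qp := (qpoch_fin q).

Lemma qp0 x : qp x 0 = 1.
Proof. by rewrite /qp big_geq. Qed.

Lemma qpS x n : qp x n.+1 = qp x n * (1 - x * q ^+ n).
Proof. by rewrite /qp big_nat_recr. Qed.

Lemma qpD x m n : qp x (m + n) = qp x m * qp (x * q ^+ m) n.
Proof.
elim: n => [|n IH]; first by rewrite addn0 qp0 mulr1.
by rewrite addnS !qpS IH mulrA exprD !mulrA.
Qed.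

Lemma qpSl x n : qp x n.+1 = (1 - x) * qp (x * q) n.
Proof. by rewrite -add1n qpD qpS qp0 expr0 expr1 mul1r mulr1. Qed.

(** The finite symbol telescopes, which makes the infinite product a series: its convergence and its
    continuity in x then come from the theorems on series. *)
Lemma qp_sum x n : qp x n = 1 + \sum_(0 <= k < n) (- x * q ^+ k * qp x k).
Proof.
elim: n => [|n IH]; first by rewrite qp0 big_geq // addr0.
rewrite big_nat_recr //= addrA -IH qpS; ring.
Qed.

Let rho : R := cmod q.
Let rho01 : 0 <= rho < 1. Proof. by rewrite cmod_ge0 q1. Qed.
Let rho1 : 0 < 1 - rho. Proof. by rewrite subr_gt0. Qed.

Lemma cmod_qX k : cmod (q ^+ k) <= 1.
Proof. by rewrite cmodX exprn_ile1 ?cmod_ge0 // ltW. Qed.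

(** Each factor has modulus at most 1 + B |q|^i <= exp (B |q|^i); the bound is uniform in n and in
    the disc of radius B. *)
Lemma qp_le B x n : cmod x <= B -> cmod (qp x n) <= expR (B / (1 - rho)).
Proof.
move=> xB; have B0 : 0 <= B := le_trans (cmod_ge0 _) xB.
apply: (@le_trans _ _ (expR (B * \sum_(0 <= i < n) rho ^+ i))).
  rewrite mulr_sumr expR_sum cmod_prod; apply: ler_prod => i _.
  rewrite cmod_ge0 /=; apply: le_trans (expR_ge1Dx _).
  apply: le_trans (ler_cmodB _ _) _; rewrite cmod1 lerD2l cmodM cmodX.
  by rewrite ler_wpM2r ?exprn_ge0 ?cmod_ge0.
rewrite ler_expR ler_wpM2l //.
by apply: le_trans (sum_geometric_le _ _ rho01) _; rewrite expr0 mul1r.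
Qed.

Lemma geo_bounded_qp x : geo_bounded (fun k => - x * q ^+ k * qp x k).
Proof.
exists (cmod x * expR (cmod x / (1 - rho))), rho; split=> //.
  by rewrite mulr_ge0 ?cmod_ge0 ?expR_ge0.
move=> n; rewrite !cmodM cmodN cmodX mulrAC ler_wpM2r ?exprn_ge0 ?cmod_ge0 //.
by rewrite ler_wpM2l ?cmod_ge0 // qp_le.
Qed.

Lemma cvg_qp x : qp x @ \oo --> P x.
Proof.
suff : cvgn (qp x) by [].
rewrite (_ : qp x = fun n => 1 + series (fun k => - x * q ^+ k * qp x k) n); last first.
  by apply/funext => n; rewrite qp_sum.
apply: cvgP; apply: cvg_cstD.
exact: (is_cvg_geo_bounded (geo_bounded_qp x)).
Qed.

Lemma qpoch_inf_sum x : P x = 1 + nsum (fun k => - x * q ^+ k * qp x k).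
Proof.
have h : (fun n => 1 + series (fun k => - x * q ^+ k * qp x k) n) @ \oo -->
    1 + nsum (fun k => - x * q ^+ k * qp x k).
  by apply: cvg_cstD; exact: (is_cvg_geo_bounded (geo_bounded_qp x)).
rewrite -(cvg_lim _ h) //; congr (lim (_ @ \oo)).
by apply/funext => n; rewrite -[LHS]/(qp x n) qp_sum.
Qed.

Lemma qpoch_inf_qp x n : P x = qp x n * P (x * q ^+ n).
Proof. by apply: qpoch_inf_shift; apply: cvgP; exact: cvg_qp. Qed.

Lemma qpoch_inf1 x : P x = (1 - x) * P (q * x).
Proof. by rewrite (qpoch_inf_qp x 1) qpS qp0 expr0 expr1 mul1r mulr1 (mulrC x). Qed.

Lemma qpoch_inf_at1 : P 1 = 0.
Proof. by rewrite qpoch_inf1 subrr mul0r. Qed.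

Lemma qpoch_inf_at0 : P 0 = 1.
Proof.
rewrite qpoch_inf_sum (@nsum_fin _ _ 0) ?big_geq ?addr0 // => n _.
by rewrite oppr0 !mul0r.
Qed.

Lemma qpoch_inf_factor_neq0 x n : P x != 0 -> 1 - x * q ^+ n != 0.
Proof. by rewrite (qpoch_inf_qp x n.+1) qpS !mulf_eq0 !negb_or => /andP[/andP[]]. Qed.

Lemma qp_neq0 x n : (forall k, 1 - x * q ^+ k != 0) -> qp x n != 0.
Proof.
move=> h; elim: n => [|n IH]; first by rewrite qp0 oner_neq0.
by rewrite qpS mulf_neq0.
Qed.

Lemma qpoch_inf_qp_neq0 x n : P x != 0 -> qp x n != 0.
Proof. by move=> h; apply: qp_neq0 => k; exact: qpoch_inf_factor_neq0. Qed.

(** Weierstrass' product inequality. It keeps the tail of a q-Pochhammer symbol away from 0. *)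
Lemma prod_ge1B (t : nat -> K) n : (forall i, cmod (t i) <= 1) ->
  1 - \sum_(0 <= i < n) cmod (t i) <= cmod (\prod_(0 <= i < n) (1 - t i)).
Proof.
move=> t1; rewrite cmod_prod.
apply: (@le_trans _ _ (\prod_(0 <= i < n) (1 - cmod (t i)))); last first.
  apply: ler_prod => i _; rewrite subr_ge0 t1 /=.
  by rewrite lerBlDr -{1}cmod1 -{1}(subrK (t i) 1) ler_cmodD.
elim: n => [|n IH]; first by rewrite !big_geq // subr0.
rewrite !big_nat_recr //=.
have h : 0 <= \prod_(0 <= i < n) (1 - cmod (t i)) <= 1.
  elim: n {IH} => [|n /andP[h0 h1]]; first by rewrite big_geq // ler01 lexx.
  rewrite big_nat_recr //= mulr_ge0 ?subr_ge0 ?t1 //=.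
  by rewrite mulr_ile1 ?subr_ge0 ?t1 // lerBlDr lerDl cmod_ge0.
have : 0 <= cmod (t n) := cmod_ge0 _; have := t1 n; move: h IH => /andP[].
set p := \prod_(0 <= i < n) _; set s := \sum_(0 <= i < n) _; nra.
Qed.

Section Filtered.
Context {T : Type} {F : set_system T} {FF : ProperFilter F}.
Implicit Types a b : T -> K.

Lemma cvg_qp_param a (a0 : K) n : a @ F --> a0 -> (fun t => qp (a t) n) @ F --> qp a0 n.
Proof.
move=> aa0; elim: n => [|n IH].
  rewrite qp0 (_ : (fun t => _) = fun=> 1); first exact: cvg_cst.
  by apply/funext => t; rewrite qp0.
rewrite qpS (_ : (fun t => _) = fun t => qp (a t) n * (1 - a t * q ^+ n)); last first.
  by apply/funext => t; rewrite qpS.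
apply: cvgM; first exact: IH.
apply: cvgB; first exact: cvg_cst.
by apply: cvgM; [exact: aa0 | exact: cvg_cst].
Qed.

Lemma dom_cvg_qp a (a0 : K) : a @ F --> a0 ->
  dom_cvg F (fun t k => qp (a t) k) (qp a0) 1.
Proof.
move=> aa0; split=> [k|]; first exact: cvg_qp_param.
exists (expR ((cmod a0 + 1) / (1 - rho))); first exact: expR_ge0.
have h : cmod a0 < cmod a0 + 1 by rewrite ltrDl.
apply: filterS (near_cmod_lt aa0 h) => t /ltW h' k.
by rewrite expr1n mulr1 qp_le.
Qed.

Lemma cvg_qpoch_inf a (a0 : K) : a @ F --> a0 -> (fun t => P (a t)) @ F --> P a0.
Proof.
move=> aa0; rewrite qpoch_inf_sum.
rewrite (_ : (fun t => _) = fun t => 1 + nsum (fun k => - a t * q ^+ k * qp (a t) k)).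
  apply: cvg_cstD; apply: (dom_cvg_nsum rho01).
  apply: (eq_dom_cvg (U := fun t k => - a t * q ^+ k * qp (a t) k) (r := 1 * rho * 1)).
  - by [].
  - by move=> k.
  - by rewrite mul1r mulr1.
  apply: dom_cvgM; last exact: dom_cvg_qp.
  apply: dom_cvgM; first by apply: dom_cvg_scalar; apply: cvgN.
  by apply: (dom_cvg_const (M := 1)) => // k; rewrite cmodX mul1r.
by apply/funext => t; rewrite qpoch_inf_sum.
Qed.

(** Uniform in n and in the parameter near [b0]. The first N factors form a polynomial in the
    parameter that does not vanish at [b0]; N is so large that the moduli of the later b q^i add up
    to at most 1/2, whence their factors have a product of modulus at least 1/2. *)
Lemma qp_lower_bound b (b0 : K) : b @ F --> b0 ->
  (forall n, 1 - b0 * q ^+ n != 0) ->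
  exists2 c : R, 0 < c & \forall t \near F, forall n, c <= cmod (qp (b t) n).
Proof.
move=> bb0 hb; pose B := cmod b0 + 1.
have B0 : 0 < B by rewrite ltr_wpDl ?cmod_ge0.
have [N hN] : exists N, B / (1 - rho) * rho ^+ N <= 2^-1.
  have h : (fun n => B / (1 - rho) * rho ^+ n) @ \oo --> (0 : R).
    by apply: cvg_geometric; rewrite ger0_norm ?cmod_ge0.
  move/cvgr0Pnorm_lt: h => /(_ 2^-1); rewrite invr_gt0 => /(_ (ltr0Sn _ _)) [N _ hN].
  by exists N; apply/ltW; apply: le_lt_trans (hN N (leqnn N)); exact: ler_norm.
have tail t m : cmod (b t) <= B -> 2^-1 <= cmod (qp (b t * q ^+ N) m).
  move=> tB; have hi i : cmod (b t * q ^+ N * q ^+ i) <= B * rho ^+ N * rho ^+ i.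
    rewrite !cmodM !cmodX ler_wpM2r ?exprn_ge0 ?cmod_ge0 //.
    by rewrite ler_wpM2r ?exprn_ge0 ?cmod_ge0.
  have s_le : \sum_(0 <= i < m) cmod (b t * q ^+ N * q ^+ i) <= 2^-1.
    apply: le_trans (ler_sum _ (fun i _ => hi i)) _; rewrite -mulr_sumr.
    apply: le_trans (_ : B * rho ^+ N * (1 / (1 - rho)) <= _); last first.
      by move: hN; rewrite mul1r mulrAC.
    rewrite ler_wpM2l ?mulr_ge0 ?exprn_ge0 ?cmod_ge0 ?(ltW B0) //.
    by apply: le_trans (sum_geometric_le _ _ rho01) _; rewrite expr0.
  apply: le_trans (prod_ge1B _ _) => [|i].
    by move: s_le; set s := \sum_(0 <= i < m) _; lra.
  apply: le_trans (hi i) _; apply: le_trans (_ : B * rho ^+ N <= _).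
    by rewrite ler_piMr ?mulr_ge0 ?exprn_ge0 ?cmod_ge0 ?(ltW B0) // exprn_ile1 ?cmod_ge0 // ltW.
  apply: le_trans (_ : 2^-1 <= 1); last by rewrite invf_le1 // ler1n.
  apply: le_trans hN; rewrite mulrAC ler_pMr ?mulr_gt0 ?exprn_gt0 ?cmod_gt0 //.
  by rewrite invf_ge1 ?gerBl ?cmod_ge0.
pose c0 := cmod (qp b0 N) / 2; pose L := expR (B / (1 - rho)).
have c00 : 0 < c0 by rewrite divr_gt0 // cmod_gt0 qp_neq0.
have L0 : 0 < L by exact: expR_gt0.
exists (Num.min (c0 / L) (c0 / 2)); first by rewrite lt_min; apply/andP; split; apply: divr_gt0; rewrite ?ltr0n.
have hc0 : c0 < cmod (qp b0 N) by rewrite /c0; move: c00; rewrite /c0; lra.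
have hB : cmod b0 < B by rewrite ltrDl.
have cN : (fun t => qp (b t) N) @ F --> qp b0 N by exact: cvg_qp_param.
have n1 := near_cmod_lt (FF := FF) bb0 hB.
have n2 := near_cmod_gt (FF := FF) cN hc0.
move: n1 n2; apply: filterS2 => t /ltW tB tc n.
(* For n <= N the symbol of length n is the one of length N divided by the missing factors, whose
   product is at most L in modulus. *)
have [nN|Nn] := leqP n N.
  apply: (@le_trans _ _ (c0 / L)); first by rewrite ge_min lexx.
  rewrite ler_pdivrMr //; apply: le_trans (ltW tc) _.
  rewrite -(subnKC nN) qpD cmodM ler_wpM2l ?cmod_ge0 // qp_le //.
  by apply: le_trans tB; rewrite cmodM ler_piMr ?cmod_ge0 ?cmod_qX.
apply: (@le_trans _ _ (c0 / 2)); first by rewrite ge_min lexx orbT.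
rewrite -(subnKC (ltnW Nn)) qpD cmodM; apply: ler_pM.
- exact: ltW.
- by rewrite invr_ge0.
- exact: ltW.
- exact: tail.
Qed.

Lemma dom_cvg_qpV b (b0 : K) : b @ F --> b0 ->
  (forall n, 1 - b0 * q ^+ n != 0) ->
  dom_cvg F (fun t k => (qp (b t) k)^-1) (fun k => (qp b0 k)^-1) 1.
Proof.
move=> bb0 hb; split=> [k|].
  by apply: cvgV; [exact: qp_neq0 | exact: cvg_qp_param].
have [c c0 h] := qp_lower_bound bb0 hb.
exists c^-1; first by rewrite invr_ge0 ltW.
apply: filterS h => t h k; rewrite cmodV expr1n mulr1 lef_pV2 ?posrE //.
by apply: lt_le_trans c0 _.
Qed.

End Filtered.

Lemma qpoch_inf_neq0 x : (forall n, 1 - x * q ^+ n != 0) -> P x != 0.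
Proof.
move=> hx; have [c c0 h] := qp_lower_bound (@cvg_cst _ x nat \oo _) hx.
rewrite -cmod_gt0; apply: lt_le_trans c0 _.
have hc : (fun n => cmod (qp x n)) @ \oo --> cmod (P x).
  by apply: cvg_cmod; exact: cvg_qp.
rewrite -(cvg_lim _ hc) //; apply: limr_ge; first exact: cvgP hc.
by apply: nearW => n; case: h => N _ /(_ N (leqnn N)).
Qed.

Lemma cvg_shift_index (u : nat -> K) (l : K) (s : nat -> nat) : u @ \oo --> l ->
  (forall m, \forall N \near \oo, (m <= s N)%N) -> (fun N => u (s N)) @ \oo --> l.
Proof.
move=> ul hs; apply: cvg_comp ul => A [m _ hm].
by apply: filterS (hs m) => N; exact: hm.
Qed.

Lemma dom_cvg_qp_index y (s : nat -> nat -> nat) :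
  (forall k m, \forall N \near \oo, (m <= s N k)%N) ->
  dom_cvg \oo (fun N k => qp y (s N k)) (fun=> P y) 1.
Proof.
move=> hs; split=> [k|].
  by apply: (cvg_shift_index (s := s^~ k)); [exact: cvg_qp | exact: hs].
exists (expR (cmod y / (1 - rho))); first exact: expR_ge0.
by apply: nearW => N k; rewrite expr1n mulr1 qp_le.
Qed.

Lemma dom_cvg_qpV_index y (s : nat -> nat -> nat) : P y != 0 ->
  (forall k m, \forall N \near \oo, (m <= s N k)%N) ->
  dom_cvg \oo (fun N k => (qp y (s N k))^-1) (fun=> (P y)^-1) 1.
Proof.
move=> Py hs; split=> [k|].
  apply: cvgV => //.
  by apply: (cvg_shift_index (s := s^~ k)); [exact: cvg_qp | exact: hs].
have hy n : 1 - y * q ^+ n != 0 by exact: qpoch_inf_factor_neq0.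
have [c c0 [N0 _ h]] := qp_lower_bound (@cvg_cst _ y nat \oo _) hy.
exists c^-1; first by rewrite invr_ge0 ltW.
apply: nearW => N k; rewrite cmodV expr1n mulr1.
have hc := h N0 (leqnn N0) (s N k).
by rewrite lef_pV2 ?posrE //; exact: lt_le_trans c0 _.
Qed.

Lemma qq1 k : 1 - q * q ^+ k != 0.
Proof.
rewrite -exprS subr_eq0; apply/eqP => h.
have : cmod (q ^+ k.+1) < 1 by rewrite cmodX exprn_ilt1 ?cmod_ge0.
by rewrite -h cmod1 ltxx.
Qed.

Lemma cvg_qX : (fun n => q ^+ n) @ \oo --> (0 : K).
Proof.
apply/cvg_cmodP; rewrite (_ : (fun n => _) = fun n => cmod q ^+ n).
  by apply: cvg_expr; rewrite ger0_norm ?cmod_ge0.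
by apply/funext => n; rewrite subr0 cmodX.
Qed.

Lemma dom_cvg_qX : dom_cvg \oo (fun _ k => q ^+ k) (fun k => q ^+ k) (cmod q).
Proof. by apply: (dom_cvg_const (M := 1)) => // k; rewrite cmodX mul1r. Qed.

Lemma dom_cvg_qp_cst {T} {F : set_system T} {FF : ProperFilter F} x : dom_cvg F (fun _ k => qp x k) (qp x) 1.
Proof. by apply: dom_cvg_qp; exact: cvg_cst. Qed.

Lemma dom_cvg_qpV_cst {T} {F : set_system T} {FF : ProperFilter F} x : P x != 0 ->
  dom_cvg F (fun _ k => (qp x k)^-1) (fun k => (qp x k)^-1) 1.
Proof.
move=> h; apply: dom_cvg_qpV; first exact: cvg_cst.
by move=> n; exact: qpoch_inf_factor_neq0 h.
Qed.

Lemma qpoch_inf_mulq_neq0 x : P x != 0 -> P (q * x) != 0.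
Proof. by rewrite qpoch_inf1 // mulf_eq0 negb_or => /andP[]. Qed.

Lemma qpoch_inf_q_neq0 : P q != 0.
Proof. by apply: qpoch_inf_neq0 => // n; exact: qq1. Qed.

Lemma qpoch_inf_neq1 x : P x != 0 -> 1 - x != 0.
Proof. by rewrite qpoch_inf1 // mulf_eq0 negb_or => /andP[]. Qed.

Lemma geo_bounded_cvg0 (u : nat -> K) : geo_bounded u -> u @ \oo --> (0 : K).
Proof. by move/is_cvg_geo_bounded; exact: cvg_series_cvg_0. Qed.

Lemma qp_mulq x k : 1 - x != 0 -> qp (q * x) k = qp x k * (1 - x * q ^+ k) / (1 - x).
Proof. by move=> h; rewrite -qpS qpSl (mulrC q) mulrAC mulfV ?mul1r. Qed.

Lemma qpoch_inf_le B x : cmod x <= B -> cmod (P x) <= expR (B / (1 - cmod q)).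
Proof.
move=> xB; have h : (fun n => cmod (qp x n)) @ \oo --> cmod (P x).
  by apply: cvg_cmod; exact: cvg_qp.
rewrite -(cvg_lim _ h) //; apply: limr_le; first exact: cvgP h.
by apply: nearW => n; exact: qp_le.
Qed.

Lemma dom_cvg_qpoch_inf {T} {F : set_system T} {FF : ProperFilter F} (a : T -> K) (a0 : K) :
  a @ F --> a0 ->
  dom_cvg F (fun t k => P (a t * q ^+ k)) (fun k => P (a0 * q ^+ k)) 1.
Proof.
move=> aa0; split=> [k|].
  by apply: cvg_qpoch_inf; apply: cvgM; [exact: aa0 | exact: cvg_cst].
exists (expR ((cmod a0 + 1) / (1 - cmod q))); first exact: expR_ge0.
have h : cmod a0 < cmod a0 + 1 by rewrite ltrDl.
apply: filterS (near_cmod_lt aa0 h) => t /ltW h' k.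
rewrite expr1n mulr1 qpoch_inf_le // cmodM (le_trans _ h') //.
by rewrite ler_piMr ?cmod_ge0 ?cmod_qX.
Qed.

(** A bound for 1 / P (a q^k) that does not depend on k: in (a; q)_(k+n) = (a; q)_k (a q^k; q)_n the
    left side is bounded below by [qp_lower_bound] and the first factor on the right is bounded
    above by L. *)
Lemma dom_cvg_qpoch_infV {T} {F : set_system T} {FF : ProperFilter F} (a : T -> K) (a0 : K) :
  a @ F --> a0 -> P a0 != 0 ->
  dom_cvg F (fun t k => (P (a t * q ^+ k))^-1) (fun k => (P (a0 * q ^+ k))^-1) 1.
Proof.
move=> aa0 Pa0; split=> [k|].
  apply: cvgV; last first.
    by apply: cvg_qpoch_inf; apply: cvgM; [exact: aa0 | exact: cvg_cst].
  by move: Pa0; rewrite (qpoch_inf_qp a0 k) mulf_eq0 negb_or => /andP[].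
have hy n : 1 - a0 * q ^+ n != 0 by exact: qpoch_inf_factor_neq0.
have [c c0 hc] := qp_lower_bound aa0 hy.
pose B := cmod a0 + 1; pose L := expR (B / (1 - cmod q)).
have L0 : 0 < L by exact: expR_gt0.
have hB : cmod a0 < B by rewrite ltrDl.
exists (L / c); first by rewrite divr_ge0 ?expR_ge0 ?ltW.
have n1 := near_cmod_lt (FF := FF) aa0 hB.
move: n1 hc; apply: filterS2 => t /ltW tB hc k.
rewrite expr1n mulr1 cmodV -[L / c]invrK invf_div lef_pV2 ?posrE; first 1 last.
- rewrite cmod_gt0; apply: qpoch_inf_neq0 => n; rewrite -mulrA -exprD.
  apply/eqP => e; have := hc (k + n).+1.
  by rewrite qpS e mulr0 cmod0 leNgt c0.
- by rewrite divr_gt0.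
have h : (fun n => cmod (qp (a t * q ^+ k) n)) @ \oo --> cmod (P (a t * q ^+ k)).
  by apply: cvg_cmod; exact: cvg_qp.
rewrite -(cvg_lim _ h) //; apply: limr_ge; first exact: cvgP h.
apply: nearW => n; rewrite ler_pdivrMr //.
apply: le_trans (hc (k + n)%N) _; rewrite qpD cmodM mulrC.
by rewrite ler_wpM2l ?cmod_ge0 // qp_le.
Qed.

End QPochhammer.

(* Splits [dom_cvg] of a product, or of the inverse of a product, into its
   factors; [cv] proves the convergence of the parameters of the q-Pochhammer
   symbols, [nz] the nonvanishing of those in denominators. *)
Ltac dom_cvg_prod cv nz :=
  cbv beta; lazymatch goal with
  | |- dom_cvg _ (fun _ _ => (_ * _)^-1) _ _ => apply: dom_cvgVM; dom_cvg_prod cv nz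
  | |- dom_cvg _ (fun _ _ => _ * _) _ _ => apply: dom_cvgMr; dom_cvg_prod cv nz
  | |- dom_cvg _ (fun _ k => (qpoch_inf _ (_ * _ ^+ k))^-1) _ _ =>
      apply: dom_cvg_qpoch_infV; [cv | nz]
  | |- dom_cvg _ (fun _ k => qpoch_inf _ (_ * _ ^+ k)) _ _ => apply: dom_cvg_qpoch_inf; cv
  | |- dom_cvg _ (fun _ k => (qpoch_fin _ ?x k)^-1) _ _ => apply: dom_cvg_qpV_cst; nz
  | |- dom_cvg _ (fun _ k => qpoch_fin _ ?x k) _ _ => exact: dom_cvg_qp_cst
  | |- dom_cvg _ (fun _ k => (qpoch_fin _ _ k)^-1) _ _ => apply: dom_cvg_qpV; [cv | nz]
  | |- dom_cvg _ (fun _ k => qpoch_fin _ _ k) _ _ => apply: dom_cvg_qp; cv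
  end.

(** * The 6-phi-5 sum *)

Lemma div1_neq0 (K : fieldType) (x y : K) : y != 0 -> (1 - x / y != 0) = (y - x != 0).
Proof. by move=> y0; rewrite -[in LHS](divff y0) -mulrBl mulf_eq0 invr_eq0 (negPf y0) orbF. Qed.

(** The rational identity behind [telescope], with X for q^k, Z for the k-th power of q a / (b c),
    [Pt] for the product of the t - q^i, and the other capitals for symbols of length k. The factors
    after the common term on the right are the certificate of creative telescoping. *)
Lemma vwp65_certificate (K : fieldType) (q a b c t X Z Pt A B Cc Qq D1 D2 D3 : K) :
  b != 0 -> c != 0 -> 1 - a != 0 -> 1 - q * a != 0 ->
  1 - q * a / b != 0 -> 1 - q * a / c != 0 -> 1 - q * a / b * X != 0 ->
  1 - q * a / c * X != 0 ->
  1 - q * a * t * X != 0 -> 1 - q * a * t != 0 -> 1 - q * a * t / (b * c) != 0 ->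
  1 - q * X != 0 -> Qq != 0 -> D1 != 0 -> D2 != 0 -> D3 != 0 ->
 (1 - a * (X * X)) / (1 - a) * (A * B * Cc / (Qq * D1 * D2 * D3)) * (Pt * Z) -
  (1 - q * a) * (1 - q * a / (b * c)) * (1 - q * a * t / b) *
  (1 - q * a * t / c) /
  ((1 - q * a / b) * (1 - q * a / c) * (1 - q * a * t) *
   (1 - q * a * t / (b * c))) *
  ((1 - q * a * (X * X)) / (1 - q * a) *
   (A * (1 - a * X) / (1 - a) * B * Cc /
    (Qq * (D1 * (1 - q * a / b * X) / (1 - q * a / b)) *
     (D2 * (1 - q * a / c * X) / (1 - q * a / c)) *
     (D3 * (1 - q * a * t * X) / (1 - q * a * t)))) *
   (Pt * (X * Z))) =
 (1 - a)^-1 *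
 (A * (1 - a * X) * (B * (1 - b * X)) * (Cc * (1 - c * X)) /
  (Qq * (1 - q * X) * (D1 * (1 - q * a / b * X)) * (D2 * (1 - q * a / c * X)) *
   (D3 * (1 - q * a * t * X)))) *
 (Pt * (t - X) * (q * a / (b * c) * Z)) *
 ((1 - q * X) * (a * (q * a * t / (b * c)) * (q * X) - 1) /
  (1 - q * a * t / (b * c))) -
 (1 - a)^-1 * (A * B * Cc / (Qq * D1 * D2 * D3)) * (Pt * Z) *
 ((1 - X) * (a * (q * a * t / (b * c)) * X - 1) / (1 - q * a * t / (b * c))).
Proof.
move=> b0 c0; rewrite ![q * a / _ * X]mulrAC !div1_neq0 ?mulf_neq0 // => *; field.
by do !(apply/andP; split => //).
Qed.

Lemma telescoped_ratio (K : fieldType) (n1 n2 n3 n4 d1 d2 d3 d4 A B D E A' B' D' E' F F' : K) :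
  d1 != 0 -> d2 != 0 -> d3 != 0 -> d4 != 0 ->
  F * (A * B * D * E) = A' * B' * D' * E' * F' ->
  n1 * n2 * n3 * n4 / (d1 * d2 * d3 * d4) * F * (d1 * A * (d2 * B) * (d3 * D) * (d4 * E)) =
  n1 * A' * (n2 * B') * (n3 * D') * (n4 * E') * F'.
Proof.
move=> d10 d20 d30 d40 h.
transitivity (n1 * n2 * n3 * n4 * (F * (A * B * D * E))).
  by field; rewrite d10 d20 d30 d40.
by rewrite h; ring.
Qed.

Section VeryWellPoised65.
Context {R : realType} {K : numFieldType} {KR : modulus R K}.
Local Notation cmod := (@cmod R K KR).
Context {q : K} {hq : nome q}.
Local Notation P := (qpoch_inf q).
Local Notation qp := (qpoch_fin q).

(** The term of the very-well-poised 6-phi-5 whose third free parameter is 1/t: the product of the t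
    - q^i is t^k (1/t; q)_k. In this form t = 0 is harmless, and the sum visibly terminates when t
    is a nonnegative power of q. *)
Definition vwp65 (a b c t : K) k : K :=
  (1 - a * q ^+ (2 * k)) / (1 - a) *
  (qp a k * qp b k * qp c k /
   (qp q k * qp (q * a / b) k * qp (q * a / c) k * qp (q * a * t) k)) *
  (\prod_(0 <= i < k) (t - q ^+ i) * (q * a / (b * c)) ^+ k).

Section Summation.
Variables b c t : K.
Hypotheses (b0 : b != 0) (c0 : c != 0).

Let ok a := [/\ P a != 0, P (q * a / b) != 0, P (q * a / c) != 0, P (q * a * t) != 0 &
  P (q * a * t / (b * c)) != 0].
(** Left abstract because two different situations feed it: for general t the inequality |q a t / (b
    c)| < 1 provides the decay, while at t = q^n the sum is finite and no inequality is required. *)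
Let bnd a := exists M r : R, [/\ 0 <= M, 0 <= r < 1 &
  forall k, cmod (\prod_(0 <= i < k) (t - q ^+ i) * (q * a / (b * c)) ^+ k) <= M * r ^+ k].

(** The antidifference. Its factor [1 - q ^+ k] vanishes at k = 0 and [G a] tends to 0, so that the
    telescoped sum is 0 and the 6-phi-5 satisfies a first-order recurrence in a -> q a. *)
Let G a k : K := (1 - a)^-1 *
  (qp a k * qp b k * qp c k /
   (qp q k * qp (q * a / b) k * qp (q * a / c) k * qp (q * a * t) k)) *
  (\prod_(0 <= i < k) (t - q ^+ i) * (q * a / (b * c)) ^+ k) *
  ((1 - q ^+ k) * (a * (q * a * t / (b * c)) * q ^+ k - 1) / (1 - q * a * t / (b * c))).

Let rho a : K := (1 - q * a) * (1 - q * a / (b * c)) * (1 - q * a * t / b) * (1 - q * a * t / c) /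
  ((1 - q * a / b) * (1 - q * a / c) * (1 - q * a * t) * (1 - q * a * t / (b * c))).

Let okS a : ok a -> ok (q * a).
Proof. by case=> *; split; rewrite -?mulrA; apply: qpoch_inf_mulq_neq0; rewrite ?mulrA. Qed.

Let bndS a : bnd a -> bnd (q * a).
Proof.
case=> M [r [M0 r01 h]]; exists M, r; split=> // k; apply: le_trans (h k).
have -> : q * (q * a) / (b * c) = q * (q * a / (b * c)) by rewrite !mulrA.
rewrite exprMn mulrCA; set z := \prod_(_ <= _ < _) _ * _.
by rewrite cmodM ler_piMl ?cmod_ge0 ?cmod_qX.
Qed.

Let telescope a k : ok a ->
  vwp65 a b c t k - rho a * vwp65 (q * a) b c t k = G a k.+1 - G a k.
Proof.
case=> a1 ab1 ac1 at1 u1.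
rewrite /vwp65 /G /rho !qpS big_nat_recr //= !exprS.
have a10 := qpoch_inf_neq1 (hq := hq) a1; have ab10 := qpoch_inf_neq1 (hq := hq) ab1.
have a11 := qpoch_inf_neq1 (hq := hq) (qpoch_inf_mulq_neq0 (hq := hq) a1).
have ac10 := qpoch_inf_neq1 (hq := hq) ac1; have at10 := qpoch_inf_neq1 (hq := hq) at1.
have u10 := qpoch_inf_neq1 (hq := hq) u1.
have e1 : q * (q * a) / b = q * (q * a / b) by rewrite !mulrA.
have e2 : q * (q * a) / c = q * (q * a / c) by rewrite !mulrA.
have e3 : q * (q * a) * t = q * (q * a * t) by rewrite !mulrA.
rewrite e1 e2 e3 !qp_mulq // {e1 e2 e3}.
have e4 : q * (q * a) / (b * c) = q * (q * a / (b * c)) by rewrite !mulrA.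
rewrite e4 (exprMn _ q) mulnC exprM expr2 {e4}.
have nq := qpoch_inf_qp_neq0 (hq := hq) k (qpoch_inf_q_neq0 (hq := hq)).
have nab := qpoch_inf_qp_neq0 (hq := hq) k ab1; have nac := qpoch_inf_qp_neq0 (hq := hq) k ac1.
have nat_ := qpoch_inf_qp_neq0 (hq := hq) k at1.
apply: vwp65_certificate => //; last exact: qq1.
all: exact: qpoch_inf_factor_neq0.
Qed.

Lemma geo_vwp65 a : ok a -> bnd a -> geo_bounded (vwp65 a b c t).
Proof.
case=> a1 ab1 ac1 at1 u1 [M [r [M0 r01 h]]].
apply: (@dom_cvg_geo_bounded _ _ _ _ \oo _ (fun _ => vwp65 a b c t) _ r r01).
apply: dom_cvgMl; last exact: dom_cvg_const h.
apply: dom_cvgMr.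
  apply: dom_cvgMr; last exact: dom_cvg_cst.
  apply: (dom_cvg_const (M := 1 + cmod a)) => [|k].
    by rewrite addr_ge0 // cmod_ge0.
  rewrite expr1n mulr1; apply: le_trans (ler_cmodB _ _) _.
  by rewrite cmod1 lerD2l cmodM ler_piMr ?cmod_ge0 ?cmod_qX.
by dom_cvg_prod idtac ltac:(first [assumption | exact: qpoch_inf_q_neq0]).
Qed.

Let geo_G a : ok a -> bnd a -> geo_bounded (G a).
Proof.
case=> a1 ab1 ac1 at1 u1 [M [r [M0 r01 h]]].
apply: (@dom_cvg_geo_bounded _ _ _ _ \oo _ (fun _ => G a) _ r r01).
have affine x y : dom_cvg \oo (fun (_ : nat) k => x + y * q ^+ k) (fun k => x + y * q ^+ k) 1.
  apply: (dom_cvg_const (M := cmod x + cmod y)) => [|k].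
    by rewrite addr_ge0 // cmod_ge0.
  rewrite expr1n mulr1; apply: le_trans (ler_cmodD _ _) _.
  by rewrite lerD2l cmodM ler_piMr ?cmod_ge0 ?cmod_qX.
apply: dom_cvgMr; last first.
  apply: dom_cvgMr; last exact: dom_cvg_cst.
  apply: dom_cvgMr; last first.
    by apply: eq_dom_cvg (affine (-1) (a * (q * a * t / (b * c)))) => // [_ k|k]; rewrite addrC.
  by apply: eq_dom_cvg (affine 1 (-1)) => // [_ k|k]; rewrite mulN1r.
apply: dom_cvgMl; last exact: dom_cvg_const h.
apply: dom_cvgMr; first exact: dom_cvg_cst.
by dom_cvg_prod idtac ltac:(first [assumption | exact: qpoch_inf_q_neq0]).
Qed.

Let recurrence a : ok a -> bnd a ->
  nsum (vwp65 a b c t) = rho a * nsum (vwp65 (q * a) b c t).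
Proof.
move=> oka ba; apply/eqP; rewrite -subr_eq0; apply/eqP.
have g1 := geo_vwp65 oka ba; have g2 := geo_vwp65 (okS oka) (bndS ba).
rewrite -nsumZ // -nsumB //; last exact: geo_boundedZ.
rewrite (eq_nsum (v := fun k => -1 * (G a k - G a k.+1))); last first.
  by move=> k; rewrite mulN1r opprB telescope.
have cG := geo_bounded_cvg0 (geo_G oka ba).
rewrite nsumZ; last first.
  have gS := geo_boundedS (geo_G oka ba).
  apply: (eq_geo_bounded (u := fun k => G a k + (-1) * G a k.+1)).
    by move=> k; rewrite mulN1r.
  apply: geo_boundedD; first exact: geo_G.
  exact: geo_boundedZ gS.
rewrite (nsum_telescope cG) subr0 /G expr0 subrr !mul0r.
by rewrite !mulr0.
Qed.

Let iterate n a : ok a -> bnd a -> nsum (vwp65 a b c t) *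
   (qp (q * a / b) n * qp (q * a / c) n * qp (q * a * t) n * qp (q * a * t / (b * c)) n) =
   qp (q * a) n * qp (q * a / (b * c)) n * qp (q * a * t / b) n * qp (q * a * t / c) n *
   nsum (vwp65 (q ^+ n * a) b c t).
Proof.
elim: n a => [|n IH] a oka ba; first by rewrite !qp0 expr0 !mul1r !mulr1.
rewrite recurrence //.
have [_ /(qpoch_inf_neq1 (hq := hq)) h1 /(qpoch_inf_neq1 (hq := hq)) h2 /(qpoch_inf_neq1 (hq := hq)) h3 /(qpoch_inf_neq1 (hq := hq)) h4] := oka.
have := IH (q * a) (okS oka) (bndS ba).
rewrite !qpSl (_ : q ^+ n.+1 * a = q ^+ n * (q * a)); last by rewrite exprSr mulrA.
rewrite (_ : q * (q * a) = q * a * q); last by ring.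
rewrite (_ : q * a * q / b = q * a / b * q); last by ring.
rewrite (_ : q * a * q / c = q * a / c * q); last by ring.
rewrite (_ : q * a * q * t = q * a * t * q); last by ring.
rewrite (_ : q * a * t * q / b = q * a * t / b * q); last by ring.
rewrite (_ : q * a * t * q / c = q * a * t / c * q); last by ring.
rewrite (_ : q * a * q / (b * c) = q * a / (b * c) * q); last by ring.
rewrite (_ : q * a * t * q / (b * c) = q * a * t / (b * c) * q); last by ring.
exact: telescoped_ratio.
Qed.

Theorem sum_vwp65 a : ok a -> bnd a ->
  nsum (vwp65 a b c t) = P (q * a) * P (q * a / (b * c)) * P (q * a * t / b) * P (q * a * t / c) /
    (P (q * a / b) * P (q * a / c) * P (q * a * t) * P (q * a * t / (b * c))).
Proof.
move=> oka ba; have [a1 ab1 ac1 at1 u1] := oka.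
have [M [r [M0 r01 h]]] := ba.
have cq x : (fun n => q ^+ n * x) @ \oo --> (0 : K).
  rewrite -(mul0r x); apply: cvgM; [exact: cvg_qX | exact: cvg_cst].
have lim1 : (fun n => nsum (vwp65 (q ^+ n * a) b c t)) @ \oo --> (1 : K).
  (* The factor [0 ^+ k] is the limit of (q^n)^k, which comes from the argument; since 0^0 = 1 it
     keeps exactly the term k = 0. *)
  pose v k : K := (1 - 0 * q ^+ (2 * k)) / (1 - 0) * (qp 0 k * qp b k * qp c k /
      (qp q k * qp 0 k * qp 0 k * qp 0 k)) *
     (\prod_(0 <= i < k) (t - q ^+ i) * (q * a / (b * c)) ^+ k * 0 ^+ k).
  have vE : nsum v = 1.
    rewrite (@nsum_fin _ v 1) => [|n n0]; last by rewrite /v expr0n gtn_eqF // !mulr0.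
    by rewrite big_nat1 /v !qp0 big_geq // !expr0 !(mul0r, subr0, mulr1, divr1).
  rewrite -vE; apply: (dom_cvg_nsum r01).
  apply: (eq_dom_cvg (U := fun n k => (1 - q ^+ n * a * q ^+ (2 * k)) / (1 - q ^+ n * a) *
    (qp (q ^+ n * a) k * qp b k * qp c k / (qp q k * qp (q ^+ n * (q * a / b)) k *
     qp (q ^+ n * (q * a / c)) k * qp (q ^+ n * (q * a * t)) k)) *
    (\prod_(0 <= i < k) (t - q ^+ i) * (q * a / (b * c)) ^+ k * (q ^+ n) ^+ k)) (v := v) (r := r)) => //.
    move=> n k; rewrite /vwp65 -[_ * _ * _ ^+ k]mulrA -exprMn.
    by congr (_ * (_ / (_ * qp _ k * qp _ k * qp _ k)) * (_ * _ ^+ k)); ring.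
  apply: dom_cvgMl; last first.
    apply: dom_cvgMr; first exact: dom_cvg_const h.
    split=> [k|]; first by apply: cvg_exprn; exact: cvg_qX.
    exists 1 => //; apply: nearW => n k; rewrite expr1n mulr1 -exprM.
    exact: cmod_qX.
  apply: dom_cvgMr.
    apply: dom_cvgMr.
      apply: dom_cvgD; first exact: dom_cvg_cst.
      apply: (eq_dom_cvg (U := fun n k => (- (q ^+ n * a)) * q ^+ (2 * k))
        (v := fun k => - 0 * q ^+ (2 * k)) (r := 1)) => // [n k|k|].
      - by rewrite mulNr.
      - by rewrite mulNr.
      apply: dom_cvgMr.
        by apply: dom_cvg_scalar; apply: cvgN; exact: cq.
      by apply: (dom_cvg_const (M := 1)) => // k; rewrite expr1n mulr1 cmod_qX.
    apply: dom_cvg_scalar; apply: cvgV; first by rewrite subr0 oner_neq0.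
    by apply: cvgB; [exact: cvg_cst | exact: cq].
  have z n : 1 - (0 : K) * q ^+ n != 0 by rewrite mul0r subr0 oner_neq0.
  by dom_cvg_prod ltac:(exact: cq) ltac:(first [assumption | exact: qpoch_inf_q_neq0]).
have e1 : (fun n => nsum (vwp65 a b c t) *
   (qp (q * a / b) n * qp (q * a / c) n * qp (q * a * t) n * qp (q * a * t / (b * c)) n)) @ \oo -->
   nsum (vwp65 a b c t) * (P (q * a / b) * P (q * a / c) * P (q * a * t) * P (q * a * t / (b * c))).
  by apply: cvg_cstM; do 3![apply: cvgM; last exact: cvg_qp]; exact: cvg_qp.
have e2 : (fun n => nsum (vwp65 a b c t) *
   (qp (q * a / b) n * qp (q * a / c) n * qp (q * a * t) n * qp (q * a * t / (b * c)) n)) @ \oo -->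
   P (q * a) * P (q * a / (b * c)) * P (q * a * t / b) * P (q * a * t / c) * 1.
  under eq_fun do rewrite iterate //.
  by apply: cvgM lim1; do 3![apply: cvgM; last exact: cvg_qp]; exact: cvg_qp.
apply: (canRL (mulfK _)); first by rewrite !mulf_neq0.
rewrite -(mulr1 (P (q * a) * _ * _ * _)) -(cvg_lim _ e2) // (cvg_lim _ e1) //.
Qed.

End Summation.
End VeryWellPoised65.

(** * The nonterminating q-Saalschuetz sum and theta functions *)

Lemma q_saalschutz_certificate (K : fieldType) (A B d e f t pA pB pc pd pe pf : K) :
  A != 0 -> B != 0 -> 1 - d * t != 0 -> 1 - e * t != 0 -> 1 - f * t != 0 ->
  pd != 0 -> pe != 0 -> pf != 0 ->
  let c := A * B * d * e * f in
  (1 - A * d) * (1 - B * d) * (t *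
    (pA * pB * ((1 - c * t) * pc) / (((1 - d * t) * pd) * ((1 - e * t) * pe) * ((1 - f * t) * pf)))) -
  (1 - A * B * d * f) * (1 - A * B * d * e) * (t *
    (pA * pB * pc / (pd * ((1 - e * t) * pe) * ((1 - f * t) * pf)))) =
  d * A * B * ((1 - t / A) * pA * ((1 - t / B) * pB) * ((1 - c * t) * pc) /
    (((1 - d * t) * pd) * ((1 - e * t) * pe) * ((1 - f * t) * pf)) -
   pA * pB * pc / (pd * pe * pf)).
Proof. by move=> ? ? ? ? ? ? ? ? c; rewrite /c; field; do !(apply/andP; split => //). Qed.

Section QSaalschutz.
Context {R : realType} {K : numFieldType} {KR : modulus R K}.
Local Notation cmod := (@cmod R K KR).
Context {q : K} {hq : nome q}.
Local Notation P := (qpoch_inf q).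
Local Notation qp := (qpoch_fin q).

Let q0 : q != 0 := nome_neq0.
Let q1 : cmod q < 1 := nome_lt1.

(* The q-integral of P (q t / A) P (q t / B) P (c t) / (P (d t) P (e t) P (f t))
   from 0 to x, with the factor x (1 - q) dropped. *)
Definition qint_term (y1 y2 y3 z1 z2 z3 : K) (n : nat) : K :=
  q ^+ n * (P (y1 * q ^+ n) * P (y2 * q ^+ n) * P (y3 * q ^+ n) /
    (P (z1 * q ^+ n) * P (z2 * q ^+ n) * P (z3 * q ^+ n))).

Definition qint y1 y2 y3 z1 z2 z3 : K := nsum (qint_term y1 y2 y3 z1 z2 z3).

Lemma dom_cvg_qint {T} {F : set_system T} {FF : ProperFilter F}
    (y1 y2 y3 z1 z2 z3 : T -> K) (y10 y20 y30 z10 z20 z30 : K) :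
  y1 @ F --> y10 -> y2 @ F --> y20 -> y3 @ F --> y30 ->
  z1 @ F --> z10 -> z2 @ F --> z20 -> z3 @ F --> z30 ->
  P z10 != 0 -> P z20 != 0 -> P z30 != 0 ->
  dom_cvg F (fun t => qint_term (y1 t) (y2 t) (y3 t) (z1 t) (z2 t) (z3 t))
    (qint_term y10 y20 y30 z10 z20 z30) (cmod q).
Proof.
move=> h1 h2 h3 h4 h5 h6 n1 n2 n3; apply: dom_cvgMr.
  by apply: (dom_cvg_const (M := 1)) => // k; rewrite cmodX mul1r.
by dom_cvg_prod ltac:(assumption) ltac:(assumption).
Qed.

Lemma geo_bounded_qint y1 y2 y3 z1 z2 z3 : P z1 != 0 -> P z2 != 0 -> P z3 != 0 ->
  geo_bounded (qint_term y1 y2 y3 z1 z2 z3).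
Proof.
move=> n1 n2 n3.
have c (x : K) : (fun _ : nat => x) @ \oo --> x by exact: cvg_cst.
apply: (dom_cvg_geo_bounded (F := \oo) (U := fun _ : nat => qint_term y1 y2 y3 z1 z2 z3) (r := cmod q)).
  by rewrite cmod_ge0 q1.
exact: (dom_cvg_qint (c y1) (c y2) (c y3) (c z1) (c z2) (c z3)).
Qed.

(** The q-integral from A to B divided by 1 - q. The choice c = A B d e f makes both half-line sums
    balanced 3-phi-2 series, up to constants. *)
Definition qsaal A B d e f : K :=
  B * qint (q * (B / A)) q (A * B * d * e * f * B) (d * B) (e * B) (f * B) -
  A * qint q (q * (A / B)) (A * B * d * e * f * A) (d * A) (e * A) (f * A).

Lemma qsaal_sym12 A B d e f : qsaal A B d e f = qsaal A B e d f.
Proof.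
rewrite /qsaal (_ : A * B * d * e * f = A * B * e * d * f); last by ring.
by congr (_ * _ - _ * _); apply: eq_nsum => n; rewrite /qint_term;
   congr (_ * (_ / (_ * _))); rewrite mulrC.
Qed.

Lemma qsaal_sym23 A B d e f : qsaal A B d e f = qsaal A B d f e.
Proof.
rewrite /qsaal (_ : A * B * d * e * f = A * B * d * f * e); last by ring.
by congr (_ * _ - _ * _); apply: eq_nsum => n; rewrite /qint_term;
   congr (_ * (_ / _)); rewrite mulrAC.
Qed.

Section Step.
Variables A B d e f : K.
Hypotheses (A0 : A != 0) (B0 : B != 0).

Let c := A * B * d * e * f.
Let V t : K := d * A * B * (P (t / A) * P (t / B) * P (c * t) / (P (d * t) * P (e * t) * P (f * t))).

(** V is a q-primitive: its differences along x q^n are the combination of the integrands for d and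
    q d. It vanishes at x = A and x = B because P 1 = 0, and its value at the origin is d A B from
    either side, so that the difference of the two endpoints in [qsaal] is homogeneous. *)
Let qint_step x : P (d * x) != 0 -> P (e * x) != 0 -> P (f * x) != 0 -> V x = 0 ->
  (1 - A * d) * (1 - B * d) *
    (x * qint (q * (x / A)) (q * (x / B)) (c * x) (d * x) (e * x) (f * x)) -
  (1 - A * B * d * f) * (1 - A * B * d * e) *
    (x * qint (q * (x / A)) (q * (x / B)) (q * c * x) (q * d * x) (e * x) (f * x)) =
  - (d * A * B).
Proof.
move=> dx ex fx Vx0.
have dx' : P (q * d * x) != 0 by rewrite -mulrA qpoch_inf_mulq_neq0.
rewrite /qint -!nsumZ; do ?[exact: geo_bounded_qint | apply: geo_boundedZ].
rewrite -nsumB; do ?[exact: geo_bounded_qint | apply: geo_boundedZ].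
have VE n : V (x * q ^+ n) - V (x * q ^+ n.+1) = 
  (1 - A * d) * (1 - B * d) *
    (x * qint_term (q * (x / A)) (q * (x / B)) (c * x) (d * x) (e * x) (f * x) n) -
  (1 - A * B * d * f) * (1 - A * B * d * e) *
    (x * qint_term (q * (x / A)) (q * (x / B)) (q * c * x) (q * d * x) (e * x) (f * x) n).
  have nz y : P (y * x) != 0 -> 1 - y * (x * q ^+ n) != 0.
    by move=> /(qpoch_inf_factor_neq0 (hq := hq) n); rewrite mulrA.
  have nzP y : P (y * x) != 0 -> P (q * (y * (x * q ^+ n))) != 0.
    move=> h; apply: qpoch_inf_mulq_neq0; move: h.
    by rewrite mulrA (qpoch_inf_qp _ n) mulf_eq0 negb_or => /andP[].
  set t := x * q ^+ n.
  have eV : V t = d * A * B * ((1 - t / A) * P (q * (t / A)) * ((1 - t / B) * P (q * (t / B))) *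
      ((1 - c * t) * P (q * (c * t))) / (((1 - d * t) * P (q * (d * t))) *
      ((1 - e * t) * P (q * (e * t))) * ((1 - f * t) * P (q * (f * t))))).
    by rewrite /V -!qpoch_inf1.
  have eVq : V (x * q ^+ n.+1) = d * A * B * (P (q * (t / A)) * P (q * (t / B)) *
      P (q * (c * t)) / (P (q * (d * t)) * P (q * (e * t)) * P (q * (f * t)))).
    rewrite (_ : x * q ^+ n.+1 = t * q) /V; last by rewrite exprSr mulrA.
    by congr (_ * (P _ * P _ * P _ / (P _ * P _ * P _))); ring.
  have eQ y1 y2 y3 z1 z2 z3 w1 w2 w3 o1 o2 o3 : y1 * q ^+ n = w1 -> y2 * q ^+ n = w2 ->
     y3 * q ^+ n = w3 -> z1 * q ^+ n = o1 -> z2 * q ^+ n = o2 -> z3 * q ^+ n = o3 ->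
     x * qint_term y1 y2 y3 z1 z2 z3 n = t * (P w1 * P w2 * P w3 / (P o1 * P o2 * P o3)).
    by move=> <- <- <- <- <- <-; rewrite /qint_term mulrA.
  rewrite eV eVq.
  rewrite (eQ _ _ _ _ _ _ (q * (t / A)) (q * (t / B)) (c * t) (d * t) (e * t) (f * t));
    do ?[by rewrite /t; ring].
  rewrite (eQ _ _ _ _ _ _ (q * (t / A)) (q * (t / B)) (q * (c * t)) (q * (d * t)) (e * t) (f * t));
    do ?[by rewrite /t; ring].
  rewrite -mulrBr (qpoch_inf1 (c * t)) (qpoch_inf1 (d * t)) (qpoch_inf1 (e * t)) (qpoch_inf1 (f * t)).
  by symmetry; apply: q_saalschutz_certificate => //; do ?[exact: nz | exact: nzP].
rewrite -(eq_nsum VE) (nsum_telescope (l := d * A * B)) ?expr0 ?mulr1 ?Vx0 ?sub0r //.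
have cP y : (fun n => P (y * (x * q ^+ n))) @ \oo --> P (0 : K).
  apply: cvg_qpoch_inf; rewrite -(mulr0 y); apply: cvg_cstM; rewrite -(mulr0 x).
  by apply: cvg_cstM; exact: cvg_qX.
have cPV y : (fun n => P (x * q ^+ n / y)) @ \oo --> P (0 : K).
  by under eq_fun do rewrite mulrC; exact: (cP y^-1).
rewrite -[X in _ --> X]mulr1; apply: cvg_cstM.
rewrite -[X in _ --> X](divr1 (1 : K)) -{1}(mulr1 (1 : K)) -{1}(mulr1 (1 : K)) -[X in _ / X](mulr1 (1 : K)) -[X in _ / (X * _)](mulr1 (1 : K)) -(qpoch_inf_at0 (hq := hq)).
apply: cvgM; first by apply: cvgM; [apply: cvgM; [exact: cPV | exact: cPV] | exact: cP].
apply: cvgV; first by rewrite qpoch_inf_at0 !mulr1 oner_neq0.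
by apply: cvgM; [apply: cvgM; [exact: cP | exact: cP] | exact: cP].
Qed.

Lemma qsaal_step : P (d * A) != 0 -> P (e * A) != 0 -> P (f * A) != 0 ->
  P (d * B) != 0 -> P (e * B) != 0 -> P (f * B) != 0 ->
  (1 - A * d) * (1 - B * d) * qsaal A B d e f =
  (1 - A * B * d * f) * (1 - A * B * d * e) * qsaal A B (q * d) e f.
Proof.
move=> dA eA fA dB eB fB.
have hA := qint_step dA eA fA; have hB := qint_step dB eB fB.
rewrite /V !divff // qpoch_inf_at1 mulr1 in hA hB.
rewrite !(mul0r, mulr0) in hA hB.
have {}hA := hA erefl; have {}hB := hB erefl.
rewrite /qsaal (_ : A * B * (q * d) * e * f = q * c); last by rewrite /c; ring.
rewrite -/c; apply/eqP; rewrite -subr_eq0; apply/eqP.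
transitivity (- (d * A * B) - - (d * A * B)); last by rewrite subrr.
by rewrite -{1}hB -hA; ring.
Qed.

End Step.

Let cvg_qXM (x : K) : (fun n => q ^+ n * x) @ \oo --> (0 : K).
Proof.
by under eq_fun do rewrite mulrC; rewrite -(mulr0 x); apply: cvg_cstM; exact: cvg_qX.
Qed.

Lemma qsaal_iter A B d e f n : A != 0 -> B != 0 ->
  P (d * A) != 0 -> P (e * A) != 0 -> P (f * A) != 0 ->
  P (d * B) != 0 -> P (e * B) != 0 -> P (f * B) != 0 ->
  qsaal A B d e f * (qp (A * d) n * qp (B * d) n) =
  qp (A * B * d * f) n * qp (A * B * d * e) n * qsaal A B (q ^+ n * d) e f.
Proof.
move=> A0 B0; elim: n d => [|n IH] d dA eA fA dB eB fB; first by rewrite !qp0 expr0 !mul1r mulr1.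
have := IH (q * d); rewrite -![q * d * _]mulrA => /(_ (qpoch_inf_mulq_neq0 dA) eA fA
  (qpoch_inf_mulq_neq0 dB) eB fB) h.
rewrite !qpSl (_ : qsaal A B d e f * _ =
  (1 - A * d) * (1 - B * d) * qsaal A B d e f * (qp (A * d * q) n * qp (B * d * q) n)); last by ring.
rewrite qsaal_step // exprSr -(mulrA (q ^+ n)).
rewrite (_ : A * d * q = A * (q * d)); last by ring.
rewrite (_ : B * d * q = B * (q * d)); last by ring.
rewrite -[LHS]mulrA h.
rewrite (_ : A * B * d * f * q = A * B * (q * d) * f); last by ring.
rewrite (_ : A * B * d * e * q = A * B * (q * d) * e); last by ring.
by ring.
Qed.

Lemma qsaal_lim A B d e f : A != 0 -> B != 0 ->
  P (d * A) != 0 -> P (e * A) != 0 -> P (f * A) != 0 ->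
  P (d * B) != 0 -> P (e * B) != 0 -> P (f * B) != 0 ->
  qsaal A B d e f * (P (A * d) * P (B * d)) =
  P (A * B * d * f) * P (A * B * d * e) * qsaal A B 0 e f.
Proof.
move=> A0 B0 dA eA fA dB eB fB.
have cint u v x : P (e * x) != 0 -> P (f * x) != 0 ->
  (fun n => qint u v (A * B * (q ^+ n * d) * e * f * x) (q ^+ n * d * x) (e * x) (f * x)) @ \oo -->
   qint u v (A * B * 0 * e * f * x) (0 * x) (e * x) (f * x).
  move=> ex fx; have q01 : 0 <= cmod q < 1 by rewrite cmod_ge0 q1.
  have c3 : (fun n => A * B * (q ^+ n * d) * e * f * x) @ \oo --> A * B * 0 * e * f * x.
    rewrite (_ : (fun n => _) = fun n => q ^+ n * (A * B * d * e * f * x)); last first.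
      by apply/funext => n; ring.
    by rewrite mulr0 !mul0r; exact: cvg_qXM.
  have c4 : (fun n => q ^+ n * d * x) @ \oo --> 0 * x.
    by under eq_fun do rewrite -mulrA; rewrite mul0r; exact: cvg_qXM.
  have n4 : P (0 * x) != 0 by rewrite mul0r qpoch_inf_at0 oner_neq0.
  have cc (y : K) : (fun _ : nat => y) @ \oo --> y by exact: cvg_cst.
  apply: (dom_cvg_nsum q01).
  exact: (dom_cvg_qint (cc u) (cc v) c3 c4 (cc (e * x)) (cc (f * x)) n4 ex fx).
have c1 : (fun n => qsaal A B (q ^+ n * d) e f) @ \oo --> qsaal A B 0 e f.
  by apply: cvgB; apply: cvg_cstM; apply: cint.
have c2 : (fun n => qsaal A B d e f * (qp (A * d) n * qp (B * d) n)) @ \oo -->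
   qsaal A B d e f * (P (A * d) * P (B * d)).
  by apply: cvg_cstM; apply: cvgM; exact: cvg_qp.
have c3 : (fun n => qsaal A B d e f * (qp (A * d) n * qp (B * d) n)) @ \oo -->
   P (A * B * d * f) * P (A * B * d * e) * qsaal A B 0 e f.
  under eq_fun do rewrite qsaal_iter //.
  by apply: cvgM c1; apply: cvgM; exact: cvg_qp.
by rewrite -(cvg_lim _ c2) // (cvg_lim _ c3).
Qed.

Let P0x x : P (0 * x) != 0. Proof. by rewrite mul0r qpoch_inf_at0 oner_neq0. Qed.

(** [qsaal] is symmetric in d, e, f, so that each of them can be sent to 0 in turn; what remains
    depends on A and B alone. *)
Lemma qsaal_reduce A B d e f : A != 0 -> B != 0 ->
  P (d * A) != 0 -> P (e * A) != 0 -> P (f * A) != 0 ->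
  P (d * B) != 0 -> P (e * B) != 0 -> P (f * B) != 0 ->
  qsaal A B d e f * (P (A * d) * P (B * d) * (P (A * e) * P (B * e)) * (P (A * f) * P (B * f))) =
  P (A * B * d * f) * P (A * B * d * e) * P (A * B * e * f) * qsaal A B 0 0 0.
Proof.
move=> A0 B0 dA eA fA dB eB fB.
have h1 := qsaal_lim A0 B0 dA eA fA dB eB fB.
have h2 := qsaal_lim A0 B0 eA (P0x A) fA eB (P0x B) fB.
have h3 := qsaal_lim A0 B0 fA (P0x A) (P0x A) fB (P0x B) (P0x B).
have e1 : qsaal A B 0 e f = qsaal A B e 0 f by exact: qsaal_sym12.
have e2 : qsaal A B 0 0 f = qsaal A B f 0 0 by rewrite qsaal_sym23 qsaal_sym12.
rewrite !mulr0 qpoch_inf_at0 !mulr1 in h2 h3; rewrite mul1r in h3.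
transitivity (qsaal A B d e f * (P (A * d) * P (B * d)) *
  (P (A * e) * P (B * e)) * (P (A * f) * P (B * f))); first by ring.
rewrite h1 e1 -2!mulrA [qsaal A B e 0 f * _]mulrA h2 e2 -[_ * qsaal _ _ _ _ _ * _]mulrA h3.
by ring.
Qed.

Lemma nsum_geom : nsum (fun n => q ^+ n) * (1 - q) = 1.
Proof.
have g : geo_bounded (fun n => q ^+ n).
  by exists 1, (cmod q); split; rewrite ?ler01 ?cmod_ge0 ?q1 // => n; rewrite cmodX mul1r.
have h := nsum_recl g.
have e : nsum (fun n => q ^+ n.+1) = q * nsum (fun n => q ^+ n).
  by rewrite -nsumZ //; apply: eq_nsum => n; rewrite exprS.
by rewrite mulrBr mulr1 {1}h expr0 e mulrC addrK.
Qed.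

Let qpoch_infX_neq0 x n : P x != 0 -> P (x * q ^+ n) != 0.
Proof. by rewrite (qpoch_inf_qp x n) mulf_eq0 negb_or => /andP[]. Qed.

Theorem q_saalschutz A B d e f : A != 0 -> B != 0 ->
  P (q * (A / B)) != 0 -> P (q * (B / A)) != 0 ->
  P (d * A) != 0 -> P (e * A) != 0 -> P (f * A) != 0 ->
  P (d * B) != 0 -> P (e * B) != 0 -> P (f * B) != 0 ->
  qsaal A B d e f * (P (A * d) * P (B * d) * (P (A * e) * P (B * e)) * (P (A * f) * P (B * f))) =
  P (A * B * d * f) * P (A * B * d * e) * P (A * B * e * f) *
   (B * P q * P (q * (B / A)) * P (A / B)).
Proof.
move=> A0 B0 AB BA dA eA fA dB eB fB; rewrite qsaal_reduce //; congr (_ * _).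
have Pq := qpoch_inf_q_neq0 (hq := hq).
(* The constant is read off where the integrand is identically 1: for d = q/B, e = q/A, f = 0
   numerator and denominator coincide, and the integral is a geometric series with value (B - A) /
   (1 - q). *)
have h := qsaal_reduce (d := q / B) (e := q / A) (f := 0) A0 B0.
rewrite !divfK // !(mul0r, mulr0) !qpoch_inf_at0 !mulr1 in h.
rewrite -!(mulrA q) ![_^-1 * _]mulrC !(mulrA _ q) ![_ * q]mulrC -!(mulrA q) divff // divff // mulr1 in h.
have {}h := h AB Pq (oner_neq0 _) Pq BA (oner_neq0 _).
have hI : qsaal A B (q / B) (q / A) 0 * (1 - q) = B - A.
  rewrite /qsaal !mulr0 !mul0r !divfK // [q / B * A]mulrAC [q / A * B]mulrAC -!(mulrA q).
  have e3 : qint (q * (B / A)) q 0 q (q * (B / A)) 0 = nsum (fun n => q ^+ n).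
    apply: eq_nsum => n; rewrite /qint_term mul0r qpoch_inf_at0 !mulr1 [P (q * q ^+ n) * _]mulrC.
    by rewrite divff ?mulr1 // mulf_neq0 // qpoch_infX_neq0.
  have e4 : qint q (q * (A / B)) 0 (q * (A / B)) q 0 = nsum (fun n => q ^+ n).
    apply: eq_nsum => n; rewrite /qint_term mul0r qpoch_inf_at0 !mulr1 [P (q * q ^+ n) * _]mulrC.
    by rewrite divff ?mulr1 // mulf_neq0 // qpoch_infX_neq0.
  by rewrite e3 e4 -mulrBl -mulrA nsum_geom mulr1.
move: h; rewrite mul1r (_ : A * B / B / A = 1) ?mulr1; last by rewrite mulfK // divff.
move: Pq; rewrite (qpoch_inf1 q) (qpoch_inf1 (A / B)) mulf_eq0 negb_or => /andP[n1 n2] h.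
apply: (mulfI n2); rewrite -h.
transitivity (qsaal A B (q / B) (q / A) 0 * (1 - q) * ((P (q * (A / B)) * P (q * q) *
   ((1 - q) * P (q * q) * P (q * (B / A)))))); first by ring.
rewrite hI (_ : B - A = B * (1 - A / B)); first by ring.
by rewrite mulrBr mulr1 mulrCA divff ?mulr1.
Qed.

(** * Theta functions and Weierstrass' three-term relation *)

Definition qtheta x : K := P x * P (q / x).
Local Notation th := qtheta.

Lemma qint_rot y1 y2 y3 z1 z2 z3 : qint y1 y2 y3 z1 z2 z3 = qint y2 y3 y1 z1 z2 z3.
Proof. by apply: eq_nsum => n; rewrite /qint_term; congr (_ * (_ / _)); ring. Qed.

(* The integrals of the same integrand from A to B, from B to D and from D to A
   add up to zero. *)
Theorem theta_three_term A B D d e f : A * B * D * d * e * f = q ->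
  P (q * (A / B)) != 0 -> P (q * (B / A)) != 0 -> P (q * (A / D)) != 0 ->
  P (q * (D / A)) != 0 -> P (q * (B / D)) != 0 -> P (q * (D / B)) != 0 ->
  P (d * A) != 0 -> P (e * A) != 0 -> P (f * A) != 0 ->
  P (d * B) != 0 -> P (e * B) != 0 -> P (f * B) != 0 ->
  P (d * D) != 0 -> P (e * D) != 0 -> P (f * D) != 0 ->
  B * th (A / B) * th (D * d) * th (D * e) * th (D * f) +
  D * th (B / D) * th (A * d) * th (A * e) * th (A * f) +
  A * th (D / A) * th (B * d) * th (B * e) * th (B * f) = 0.
Proof.
move=> pq AB BA AD DA BD DB dA eA fA dB eB fB dD eD fD.
have : A * B * D * d * e * f != 0 by rewrite pq.
rewrite !mulf_eq0 !negb_or => /andP[/andP[/andP[/andP[/andP[A0 B0] D0] d0] e0] f0].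
have h1 := q_saalschutz A0 B0 AB BA dA eA fA dB eB fB.
have h2 := q_saalschutz B0 D0 BD DB dB eB fB dD eD fD.
have h3 := q_saalschutz D0 A0 DA AD dD eD fD dA eA fA.
have p2 : B * D * A * d * e * f = q by rewrite -[RHS]pq; ring.
have p3 : D * A * B * d * e * f = q by rewrite -[RHS]pq; ring.
have hsum : qsaal A B d e f + qsaal B D d e f + qsaal D A d e f = 0.
  rewrite /qsaal.
  (* Under A B D d e f = q the balancing parameter c of two endpoints is q divided by the third, so
     that the integrand has numerator P (q t / A) P (q t / B) P (q t / D), the same for all three
     pairs of endpoints. *)
  have cE x y z : x * y * z * d * e * f = q -> x != 0 -> y != 0 -> z != 0 ->
      forall w, x * y * d * e * f * w = q * (w / z).
    move=> pq' x0 y0 z0 w; rewrite -{}pq'.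
    by field.
  rewrite !(cE A B D pq) // !(cE B D A p2) // !(cE D A B p3) // (qint_rot (q * (B / A)) q) (qint_rot (q * (D / B)) q) (qint_rot (q * (A / D)) q).
  by ring.
have Pq := qpoch_inf_q_neq0 (hq := hq); apply: (mulfI Pq); rewrite mulr0.
(* By the same hypothesis q / (z d) = x y e f and similarly for e and f: the infinite products of
   the Saalschuetz sums pair off into thetas. *)
have tq x y z : x * y * z * d * e * f = q -> x != 0 -> y != 0 -> z != 0 ->
    [/\ th (z * d) = P (z * d) * P (x * y * e * f), th (z * e) = P (z * e) * P (x * y * d * f),
     th (z * f) = P (z * f) * P (x * y * d * e) & th (x / y) = P (x / y) * P (q * (y / x))].
  move=> xyz x0 y0 z0; rewrite /th invf_div; split => //; congr (_ * P _); rewrite -xyz; field.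
  - by rewrite z0 d0.
  - by rewrite z0 e0.
  - by rewrite z0 f0.
have [-> -> -> ->] := tq A B D pq A0 B0 D0.
have [-> -> -> ->] := tq B D A p2 B0 D0 A0.
have [-> -> -> ->] := tq D A B p3 D0 A0 B0.
have := congr1 (fun z => z * (P (A * d) * P (A * e) * P (A * f) * (P (B * d) * P (B * e) * P (B * f)) *
  (P (D * d) * P (D * e) * P (D * f)))) hsum; rewrite mul0r => <-.
transitivity (P (A * B * d * f) * P (A * B * d * e) * P (A * B * e * f) *
   (B * P q * P (q * (B / A)) * P (A / B)) * (P (D * d) * P (D * e) * P (D * f)) +
   P (B * D * d * f) * P (B * D * d * e) * P (B * D * e * f) *
    (D * P q * P (q * (D / B)) * P (B / D)) * (P (A * d) * P (A * e) * P (A * f)) +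
   P (D * A * d * f) * P (D * A * d * e) * P (D * A * e * f) *
    (A * P q * P (q * (A / D)) * P (D / A)) * (P (B * d) * P (B * e) * P (B * f))); first by ring.
by rewrite -h1 -h2 -h3; ring.
Qed.

End QSaalschutz.

(** * Watson's nonterminating transformation *)

Section Watson.
Context {R : realType} {K : numFieldType} {KR : modulus R K}.
Local Notation cmod := (@cmod R K KR).
Context {q : K} {hq : nome q}.
Local Notation P := (qpoch_inf q).
Local Notation qp := (qpoch_fin q).
Local Notation th := (qtheta (q := q)).

Let q0 : q != 0 := nome_neq0.
Let q1 : cmod q < 1 := nome_lt1.

Local Notation rt t k := (\prod_(0 <= i < k) (t - q ^+ i)).

(** Each t - q^i = - q^i (1 - t / q^i) prolongs the product P (q t) downwards by one factor. For t =
    q^n with n < k the right side vanishes through P, which encodes the termination of the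
    6-phi-5. *)
Lemma rt_shift t k : rt t k * P (q * t) = (-1) ^+ k * q ^+ 'C(k, 2) * P (q * (t / q ^+ k)).
Proof.
elim: k => [|k IH]; first by rewrite big_geq // !expr0 !mul1r divr1.
have qk : q ^+ k != 0 by rewrite expf_neq0.
rewrite big_nat_recr //= mulrAC IH binS bin1 exprD exprSr.
have -> : q * (t / q ^+ k.+1) = t / q ^+ k by rewrite exprS; field; rewrite qk q0.
rewrite (qpoch_inf1 (t / _)).
have e : t - q ^+ k = - q ^+ k * (1 - t / q ^+ k) by field.
by rewrite e; ring.
Qed.

Lemma rt_inv z k : z != 0 -> rt z^-1 k = z ^- k * qp z k.
Proof.
move=> z0; elim: k => [|k IH]; first by rewrite big_geq // qp0 expr0 invr1 mulr1.
rewrite big_nat_recr //= IH qpS exprS invfM.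
have -> : z^-1 - q ^+ k = z^-1 * (1 - z * q ^+ k) by rewrite mulrBr mulr1 mulKf.
by ring.
Qed.

Lemma th_shift z k : z != 0 -> th (q ^+ k * z) = (-1) ^+ k * z ^- k * q ^- 'C(k, 2) * th z.
Proof.
move=> z0; rewrite /th; have h := rt_shift z^-1 k.
have qk n : q ^+ n != 0 by rewrite expf_neq0.
have e1 : q * (z^-1 / q ^+ k) = q / (q ^+ k * z) by field; rewrite z0 qk.
rewrite e1 in h.
have e2 := rt_inv k z0.
apply: (mulfI (x := (-1) ^+ k * q ^+ 'C(k, 2))); first by rewrite mulf_neq0 // signr_eq0.
rewrite (mulrC (P _)) mulrA -h e2 (qpoch_inf_qp z k) [z * _]mulrC.
rewrite (_ : (-1) ^+ k * q ^+ 'C(k, 2) * ((-1) ^+ k * z ^- k * q ^- 'C(k, 2) *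
   (qp z k * P (q ^+ k * z) * P (q / z))) = ((-1) ^+ k * (-1) ^+ k) * (q ^+ 'C(k, 2) / q ^+ 'C(k, 2)) *
   (z ^- k * qp z k * P (q / z) * P (q ^+ k * z))); last by ring.
by rewrite divff // mulr1 -expr2 sqrr_sign mul1r.
Qed.

Lemma superexp_bound (w : R) : 0 <= w ->
  exists2 M : R, 0 <= M & forall k, cmod q ^+ 'C(k, 2) * w ^+ k <= M.
Proof.
move=> w0; pose u k := cmod q ^+ 'C(k, 2) * w ^+ k.
have u0 k : 0 <= u k by rewrite mulr_ge0 ?exprn_ge0 ?cmod_ge0.
have uS k : u k.+1 = u k * (cmod q ^+ k * w).
  by rewrite /u binS bin1 exprD exprS; ring.
have [N hN] : exists N, forall k, (N <= k)%N -> cmod q ^+ k * w <= 1.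
  have h : (fun k => w * cmod q ^+ k) @ \oo --> (0 : R).
    by apply: cvg_geometric; rewrite ger0_norm ?cmod_ge0.
  move/cvgr0Pnorm_lt: h => /(_ 1 ltr01) [N _ hN]; exists N => k /hN h.
  by rewrite mulrC; apply/ltW; apply: le_lt_trans h; exact: ler_norm.
exists (\sum_(0 <= i < N.+1) u i); first by apply: sumr_ge0.
have hs i : (i <= N)%N -> u i <= \sum_(0 <= i < N.+1) u i.
  move=> iN; rewrite big_mkord (bigD1 (Ordinal (iN : (i < N.+1)%N))) //= lerDl.
  by apply: sumr_ge0.
elim=> [|k IH]; first exact: hs.
have [kN|Nk] := ltnP k N; first exact: hs.
by rewrite -/(u _) uS; apply: le_trans IH; rewrite ler_piMr ?hN.
Qed.

Lemma rt_bound_scale (B : K) : B != 0 -> exists2 M : R, 0 <= M &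
  forall k n, cmod (rt (B * q ^+ n) k) <= M * cmod B ^+ k.
Proof.
move=> B0; exists (expR ((cmod B)^-1 / (1 - cmod q))); first exact: expR_ge0.
move=> k n; rewrite cmod_prod.
apply: (@le_trans _ _ (\prod_(0 <= i < k) (cmod B * expR ((cmod B)^-1 * cmod q ^+ i)))).
  apply: ler_prod => i _; rewrite cmod_ge0 /=.
  apply: le_trans (ler_cmodB _ _) _.
  apply: (@le_trans _ _ (cmod B * (1 + (cmod B)^-1 * cmod q ^+ i))); last first.
    by rewrite ler_wpM2l ?cmod_ge0 // expR_ge1Dx.
  rewrite mulrDr mulr1 mulrA divff ?cmod_eq0 // mul1r cmodM !cmodX.
  by rewrite lerD2r ler_piMr ?cmod_ge0 // -cmodX cmod_qX.
rewrite big_split /= prodr_const_nat subn0 mulrC ler_wpM2r ?exprn_ge0 ?cmod_ge0 //.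
rewrite -expR_sum ler_expR -mulr_sumr ler_wpM2l ?invr_ge0 ?cmod_ge0 //.
have q01 : 0 <= cmod q < 1 by rewrite cmod_ge0 q1.
by apply: le_trans (sum_geometric_le _ _ q01) _; rewrite expr0 mul1r.
Qed.

(** For n < k a factor is 0, and for n >= k each one is |q|^i up to factors whose product is
    bounded. The resulting decay in k beats every geometric growth, so that at the endpoint t = 1 no
    condition on q a / (b c) arises. *)
Lemma rt_bound_qX : exists2 M : R, 0 <= M &
  forall k n, cmod (rt (q ^+ n) k) <= M * cmod q ^+ 'C(k, 2).
Proof.
exists (expR (1 / (1 - cmod q))); first exact: expR_ge0.
move=> k n; have [kn|nk] := leqP k n; last first.
  rewrite (big_cat_nat (n := n)) //=; last exact: ltnW.
  rewrite (big_ltn nk) subrr mul0r mulr0 cmod0.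
  by rewrite mulr_ge0 ?expR_ge0 ?exprn_ge0 ?cmod_ge0.
rewrite cmod_prod.
apply: (@le_trans _ _ (\prod_(0 <= i < k) (cmod q ^+ i * expR (cmod q ^+ (k - i.+1))))).
  rewrite big_nat [leRHS]big_nat; apply: ler_prod => i /andP[_ ik]; rewrite cmod_ge0 /=.
  apply: le_trans (ler_cmodB _ _) _.
  apply: (@le_trans _ _ (cmod q ^+ i * (1 + cmod q ^+ (k - i.+1)))); last first.
    by rewrite ler_wpM2l ?exprn_ge0 ?cmod_ge0 // expR_ge1Dx.
  rewrite mulrDr mulr1 -exprD !cmodX addrC lerD2l.
  by apply: ler_wiXn2l; rewrite ?cmod_ge0 ?(ltW q1) //; lia.
rewrite big_split /= mulrC; apply: ler_pM.
- by apply: prodr_ge0 => i _; exact: expR_ge0.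
- by apply: prodr_ge0 => i _; rewrite exprn_ge0 ?cmod_ge0.
- rewrite -expR_sum ler_expR.
  have q01 : 0 <= cmod q < 1 by rewrite cmod_ge0 q1.
  apply: le_trans (_ : \sum_(0 <= i < k) cmod q ^+ i <= _).
    by rewrite [leRHS]big_nat_rev.
  by apply: le_trans (sum_geometric_le _ _ q01) _; rewrite expr0.
- elim: k {kn} => [|k IH]; first by rewrite big_geq.
  by rewrite big_nat_recr //= binS bin1 exprD mulrC [leRHS]mulrC ler_wpM2l ?exprn_ge0 ?cmod_ge0.
Qed.

Lemma qpoch_infX_neq0 x n : P x != 0 -> P (x * q ^+ n) != 0.
Proof. by rewrite (qpoch_inf_qp x n) mulf_eq0 negb_or => /andP[]. Qed.

Lemma nsum_shift (u : nat -> K) k : geo_bounded u -> (forall n, (n < k)%N -> u n = 0) ->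
  nsum u = nsum (fun n => u (n + k)%N).
Proof.
elim: k u => [|k IH] u gu hu; first by apply: eq_nsum => n; rewrite addn0.
rewrite nsum_recl // hu // add0r IH; first by apply: eq_nsum => n; rewrite addnS.
  exact: geo_boundedS.
by move=> n nk; rewrite hu.
Qed.

Definition u4_term (y1 y2 y3 y4 z1 z2 z3 z4 : K) n : K :=
  q ^+ n * (P (y1 * q ^+ n) * P (y2 * q ^+ n) * P (y3 * q ^+ n) * P (y4 * q ^+ n) /
    (P (z1 * q ^+ n) * P (z2 * q ^+ n) * P (z3 * q ^+ n) * P (z4 * q ^+ n))).

Definition u4 y1 y2 y3 y4 z1 z2 z3 z4 : K := nsum (u4_term y1 y2 y3 y4 z1 z2 z3 z4).

Lemma geo_bounded_u4 y1 y2 y3 y4 z1 z2 z3 z4 :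
  P z1 != 0 -> P z2 != 0 -> P z3 != 0 -> P z4 != 0 ->
  geo_bounded (u4_term y1 y2 y3 y4 z1 z2 z3 z4).
Proof.
move=> n1 n2 n3 n4.
apply: (dom_cvg_geo_bounded (F := \oo) (U := fun _ : nat => u4_term y1 y2 y3 y4 z1 z2 z3 z4)
  (r := cmod q)); first by rewrite cmod_ge0 q1.
apply: dom_cvgMr; first exact: dom_cvg_qX.
by dom_cvg_prod ltac:(exact: cvg_cst) ltac:(assumption).
Qed.

Section Lattice.
Variables a b c d e f B t0 : K.
Hypotheses (b0 : b != 0) (c0 : c != 0) (B0 : B != 0).
Hypotheses (Pa : P a != 0) (Pab : P (q * a / b) != 0) (Pac : P (q * a / c) != 0).
Hypotheses (Pat : P (q * a * t0) != 0) (Pabct : P (q * a * t0 / (b * c)) != 0).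
Hypotheses (Pd : P (d * t0) != 0) (Pe : P (e * t0) != 0) (Pf : P (f * t0) != 0).
Variables (M r : R).
Hypotheses (M0 : 0 <= M) (r01 : 0 <= r < 1).
Hypothesis bnd : forall k n, cmod (rt (t0 * q ^+ n) k * (q * a / (b * c)) ^+ k) <= M * r ^+ k.

Let X t := P (q * t) * P (q * (t / B)) * P (q * a * t) / (P (d * t) * P (e * t) * P (f * t)).

(** The double series behind Watson's transformation: k is the index of a 6-phi-5, n that of the
    points t0 q^n of a q-integral. The factor P (q a t) of the weight X plays two parts: it cancels
    against the sum over k, and it absorbs (q a t; q)_k for the sum over n. *)
Definition lattice_term k n := q ^+ n * (vwp65 (q := q) a b c (t0 * q ^+ n) k * X (t0 * q ^+ n)).

Let gk k : K := (1 - a * q ^+ (2 * k)) / (1 - a) *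
  (qp a k * qp b k * qp c k / (qp q k * qp (q * a / b) k * qp (q * a / c) k)).

(** The form suited to the sum over n: [rt_shift] merges the k-dependent polynomial with P (q t),
    and P (q a t) / (q a t; q)_k is P (q a q^k t), so that the integrand of [qint] appears. *)
Lemma lattice_termE k n : lattice_term k n = gk k * (q * a / (b * c)) ^+ k * ((-1) ^+ k * q ^+ 'C(k, 2)) *
  (q ^+ n * (P (q * (t0 * q ^+ n / q ^+ k)) * P (q * (t0 / B) * q ^+ n) * P (q * a * q ^+ k * t0 * q ^+ n) /
    (P (d * t0 * q ^+ n) * P (e * t0 * q ^+ n) * P (f * t0 * q ^+ n)))).
Proof.
rewrite /lattice_term /X /vwp65 /gk; set t := t0 * q ^+ n.
have h := rt_shift t k.
have nqat : qp (q * a * t) k != 0.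
  by apply: qpoch_inf_qp_neq0; rewrite mulrA qpoch_infX_neq0.
rewrite (qpoch_inf_qp (q * a * t) k) -!(mulrA _ t0) -/t.
rewrite (_ : q * (t0 / B) * q ^+ n = q * (t / B)); last by rewrite /t; ring.
rewrite (_ : q * a * q ^+ k * t = q * a * t * q ^+ k); last by ring.
transitivity ((1 - a * q ^+ (2 * k)) / (1 - a) *
  (qp a k * qp b k * qp c k / (qp q k * qp (q * a / b) k * qp (q * a / c) k)) *
  (q * a / (b * c)) ^+ k * (rt t k * P (q * t)) * (q ^+ n * (P (q * (t / B)) *
  P (q * a * t * q ^+ k) / (P (d * t) * P (e * t) * P (f * t)))) * (qp (q * a * t) k / qp (q * a * t) k)).
  by rewrite !invfM; ring.
by rewrite h divff //; ring.
Qed.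

Lemma lattice_term_bound : exists2 L : R, 0 <= L &
  forall k n, cmod (lattice_term k n) <= L * r ^+ k * cmod q ^+ n.
Proof.
have Pq := qpoch_inf_q_neq0 (hq := hq).
have [M1 M10 h1] : exists2 M1, 0 <= M1 & forall k, cmod (gk k) <= M1 * 1 ^+ k.
  apply: (dom_cvg_bound (F := \oo) (U := fun _ : nat => gk)).
  apply: dom_cvgMr; last by dom_cvg_prod idtac ltac:(assumption).
  apply: dom_cvgMr; last exact: dom_cvg_cst.
  apply: (dom_cvg_const (M := 1 + cmod a)) => [|k].
    by rewrite addr_ge0 // cmod_ge0.
  rewrite expr1n mulr1; apply: le_trans (ler_cmodB _ _) _.
  by rewrite cmod1 lerD2l cmodM ler_piMr ?cmod_ge0 ?cmod_qX.
pose Y n := P (q * t0 * q ^+ n) * P (q * (t0 / B) * q ^+ n) /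
  (P (d * t0 * q ^+ n) * P (e * t0 * q ^+ n) * P (f * t0 * q ^+ n)).
have [M2 M20 h2] : exists2 M2, 0 <= M2 & forall n, cmod (Y n) <= M2 * 1 ^+ n.
  apply: (dom_cvg_bound (F := \oo) (U := fun _ : nat => Y)).
  rewrite /Y; by dom_cvg_prod ltac:(exact: cvg_cst) ltac:(assumption).
pose M3 := expR (cmod (q * a * t0) / (1 - cmod q)).
have h3 k n : cmod (P (q * a * t0 * q ^+ n * q ^+ k)) <= M3.
  by apply: qpoch_inf_le; rewrite -mulrA -exprD cmodM ler_piMr ?cmod_ge0 ?cmod_qX.
exists (M1 * M * M2 * M3); first by rewrite !mulr_ge0 ?expR_ge0.
move=> k n.
have -> : lattice_term k n = gk k * (rt (t0 * q ^+ n) k * (q * a / (b * c)) ^+ k) * Y n *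
    P (q * a * t0 * q ^+ n * q ^+ k) * q ^+ n.
  rewrite lattice_termE.
  transitivity (gk k * (q * a / (b * c)) ^+ k * ((-1) ^+ k * q ^+ 'C(k, 2) * P (q * (t0 * q ^+ n / q ^+ k))) *
    (q ^+ n * (P (q * (t0 / B) * q ^+ n) * P (q * a * q ^+ k * t0 * q ^+ n) /
    (P (d * t0 * q ^+ n) * P (e * t0 * q ^+ n) * P (f * t0 * q ^+ n))))); first by ring.
  rewrite -rt_shift /Y (mulrA q t0) (_ : q * a * q ^+ k * t0 * q ^+ n = q * a * t0 * q ^+ n * q ^+ k); last by ring.
  by ring.
rewrite 4!cmodM [cmod (q ^+ n)]cmodX ler_wpM2r ?exprn_ge0 ?cmod_ge0 //.
have {}h1 := h1 k; have {}h2 := h2 n; rewrite !expr1n !mulr1 in h1 h2.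
rewrite (_ : M1 * M * M2 * M3 * r ^+ k = M1 * (M * r ^+ k) * M2 * M3); last by ring.
by do 3![apply: ler_pM; rewrite ?mulr_ge0 ?cmod_ge0 //]; exact: bnd.
Qed.

Lemma sum_lattice : nsum (fun k => nsum (lattice_term k)) =
  P (q * a) * P (q * a / (b * c)) / (P (q * a / b) * P (q * a / c)) *
  u4 (q * t0) (q * (t0 / B)) (q * a * t0 / b) (q * a * t0 / c)
     (d * t0) (e * t0) (f * t0) (q * a * t0 / (b * c)).
Proof.
have [L L0 hL] := lattice_term_bound.
have q01 : 0 <= cmod q < 1 by rewrite cmod_ge0 q1.
rewrite (exchange_nsum L0 r01 q01 hL) /u4 -nsumZ; last exact: geo_bounded_u4.
apply: eq_nsum => n; rewrite /lattice_term.
set t := t0 * q ^+ n.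
have Patn : P (q * a * t) != 0 by rewrite mulrA qpoch_infX_neq0.
have Pabctn : P (q * a * t / (b * c)) != 0.
  by rewrite /t mulrA mulrAC qpoch_infX_neq0.
have bn : exists M r : R, [/\ 0 <= M, 0 <= r < 1 &
  forall k, cmod (rt t k * (q * a / (b * c)) ^+ k) <= M * r ^+ k].
  by exists M, r; split=> // k; exact: bnd.
have gv : geo_bounded (vwp65 (q := q) a b c t) by exact: geo_vwp65.
rewrite (eq_nsum (v := fun k => q ^+ n * X t * vwp65 (q := q) a b c t k)); last by move=> k; ring.
rewrite nsumZ // sum_vwp65 // /u4_term /X.
rewrite -![q * t0 * q ^+ n]mulrA -![d * t0 * _]mulrA -![e * t0 * _]mulrA -![f * t0 * _]mulrA -/t.
rewrite (_ : q * (t0 / B) * q ^+ n = q * (t / B)); last by rewrite /t; ring.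
rewrite (_ : q * a * t0 / b * q ^+ n = q * a * t / b); last by rewrite /t; ring.
rewrite (_ : q * a * t0 / c * q ^+ n = q * a * t / c); last by rewrite /t; ring.
rewrite (_ : q * a * t0 / (b * c) * q ^+ n = q * a * t / (b * c)); last by rewrite /t; ring.
rewrite !invfM; transitivity (q ^+ n * (P (q * t) * P (q * (t / B)) * ((P (d * t))^-1 * (P (e * t))^-1 * (P (f * t))^-1)) *
  (P (q * a) * P (q * a / (b * c)) * P (q * a * t / b) * P (q * a * t / c) * ((P (q * a / b))^-1 * (P (q * a / c))^-1 *
   (P (q * a * t / (b * c)))^-1)) * (P (q * a * t) / P (q * a * t))); first by rewrite -!(invfM b c); ring.
by rewrite divff //; rewrite -!(invfM b c); ring.
Qed.

End Lattice.
End Watson.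

Lemma watson_certificate (K : fieldType) (x y z1 z2 z3 z4 z5 z6 w1 w2 w3 w4 w5 w6 u Bk s w L B p t : K) :
  y != 0 -> w1 != 0 -> w2 != 0 -> w3 != 0 -> w4 != 0 -> w5 != 0 -> w6 != 0 -> w != 0 -> s * s = 1 ->
  x / y * (z1 * z2 * z3 / (w1 * w2 * w3)) * u * (s * w) *
    (z4 * z5 * z6 * L * (B * p * (s * Bk * w^-1 * t))) =
  B * p * t * L * (x / y * (z1 * z2 * z3 * z4 * z5 * z6 / (w1 * w2 * w3 * w4 * w5 * w6)) * (u * Bk)) *
  (w4 * w5 * w6).
Proof.
move=> ? ? ? ? ? ? ? ? ss.
transitivity ((s * s) * (x / y * (z1 * z2 * z3 / (w1 * w2 * w3)) * u *
  (z4 * z5 * z6 * L * (B * p * (Bk * t))))); first by field; do !(apply/andP; split => //).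
by rewrite ss; field; do !(apply/andP; split => //).
Qed.

Section NonterminatingWatson.
Context {R : realType} {K : numFieldType} {KR : modulus R K}.
Local Notation cmod := (@cmod R K KR).
Context {q : K} {hq : nome q}.
Local Notation P := (qpoch_inf q).
Local Notation qp := (qpoch_fin q).
Local Notation th := (qtheta (q := q)).

Let q0 : q != 0 := nome_neq0.
Let q1 : cmod q < 1 := nome_lt1.

Lemma th_neq0 x : th x != 0 -> P x != 0 /\ P (q / x) != 0.
Proof. by rewrite mulf_eq0 negb_or => /andP[]. Qed.

Lemma thV x : x != 0 -> th x^-1 = - x^-1 * th x.
Proof.
move=> x0; rewrite /qtheta (qpoch_inf1 x^-1) (qpoch_inf1 x) invrK.
have -> : 1 - x^-1 = - x^-1 * (1 - x) by field.
by ring.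
Qed.

Lemma th_sym x : x != 0 -> th (q / x) = th x.
Proof. by move=> x0; rewrite /qtheta (_ : q / (q / x) = x) 1?mulrC //; field; rewrite x0 q0. Qed.

Lemma geo_boundedB (u v : nat -> K) : geo_bounded u -> geo_bounded v ->
  geo_bounded (fun n => u n - v n).
Proof.
move=> gu gv; apply: (eq_geo_bounded (u := fun n => u n + (-1) * v n)) => [n|].
  by rewrite mulN1r.
by apply: geo_boundedD => //; exact: geo_boundedZ.
Qed.

Lemma geo_bounded_nsum (f : nat -> nat -> K) M r s :
  0 <= M -> 0 <= r < 1 -> 0 <= s < 1 ->
  (forall k n, cmod (f k n) <= M * r ^+ k * s ^+ n) -> geo_bounded (fun k => nsum (f k)).
Proof.
move=> M0 r01 s01 h; have /andP[r0 r1] := r01; have /andP[s0 s1] := s01.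
exists (M / (1 - s)), r; split=> // [|k]; first by rewrite divr_ge0 // subr_ge0 ltW.
have := @series_tail_le _ _ _ _ _ _ 0 (geometric_ge0 k M0 r0) s01 (h k).
by rewrite /series /= big_geq // subr0 expr0 mulr1 mulrAC.
Qed.

Lemma th_shift_neq0 x k : x != 0 -> th x != 0 -> th (q ^+ k * x) != 0.
Proof.
move=> x0 tx; rewrite th_shift // !(mulf_eq0, invr_eq0, expf_eq0) oppr_eq0 oner_eq0.
by rewrite -/(q / x) -mulf_eq0 (negPf x0) (negPf q0) (negPf tx) !andbF.
Qed.

Definition vw8 (a b c d e f z : K) k : K :=
  (1 - a * q ^+ (2 * k)) / (1 - a) *
  (qp a k * qp b k * qp c k * qp d k * qp e k * qp f k /
   (qp q k * qp (q * a / b) k * qp (q * a / c) k * qp (q * a / d) k *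
    qp (q * a / e) k * qp (q * a / f) k)) * z ^+ k.

Lemma geo_bounded_vw8 a b c d e f z : cmod z < 1 -> 
  P (q * a / b) != 0 -> P (q * a / c) != 0 -> P (q * a / d) != 0 ->
  P (q * a / e) != 0 -> P (q * a / f) != 0 -> geo_bounded (vw8 a b c d e f z).
Proof.
move=> z1 *; have Pq := qpoch_inf_q_neq0 (hq := hq).
apply: (dom_cvg_geo_bounded (F := \oo) (U := fun _ : nat => vw8 a b c d e f z) (r := cmod z)).
  by rewrite cmod_ge0 z1.
apply: dom_cvgMl; last first.
  by apply: (dom_cvg_const (M := 1)) => [|k]; rewrite ?ler01 // cmodX mul1r.
apply: dom_cvgMr; last by dom_cvg_prod idtac ltac:(assumption).
apply: dom_cvgMr; last exact: dom_cvg_cst.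
apply: (dom_cvg_const (M := 1 + cmod a)) => [|k].
  by rewrite addr_ge0 // cmod_ge0.
rewrite expr1n mulr1; apply: le_trans (ler_cmodB _ _) _.
by rewrite cmod1 lerD2l cmodM ler_piMr ?cmod_ge0 ?cmod_qX.
Qed.

Section Watson.
Variables a b c d e f : K.
Hypotheses (a0 : a != 0) (b0 : b != 0) (c0 : c != 0) (d0 : d != 0) (e0 : e != 0) (f0 : f != 0).
(** Forced by balance: between the endpoints q^k and B the Saalschuetz sum requires the numerator
    parameter q^k B d e f, whereas the lattice sum supplies q a q^k. *)
Let B := q * a / (d * e * f).
Hypotheses (Pa : P a != 0) (Pab : P (q * a / b) != 0) (Pac : P (q * a / c) != 0).
Hypotheses (Pabc : P (q * a / (b * c)) != 0) (PaB : P (q * a * B) != 0).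
Hypothesis PaBbc : P (q * a * B / (b * c)) != 0.
Hypotheses (Pd : P d != 0) (Pe : P e != 0) (Pf : P f != 0).
Hypotheses (PdB : P (d * B) != 0) (PeB : P (e * B) != 0) (PfB : P (f * B) != 0).
Hypotheses (Pad : P (q * a / d) != 0) (Pae : P (q * a / e) != 0) (Paf : P (q * a / f) != 0).
Hypothesis thB : th B != 0.
Hypothesis z1 : cmod (q * a * B / (b * c)) < 1.

Let B0 : B != 0. Proof. by rewrite !(mulf_neq0, invr_eq0). Qed.

(** The two ends of the q-integral, t0 = B and t0 = 1; their difference, the first one weighted by
    B, is what the Saalschuetz sum evaluates. *)
Let f1 := lattice_term (q := q) a b c d e f B B.
Let f2 := lattice_term (q := q) a b c d e f B 1.

Let gk k : K := (1 - a * q ^+ (2 * k)) / (1 - a) *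
  (qp a k * qp b k * qp c k / (qp q k * qp (q * a / b) k * qp (q * a / c) k)).

Let Bdef : B * d * e * f = q * a. 
Proof. by rewrite /B; field; rewrite d0 e0 f0. Qed.

Let w1 : cmod (q * a / (b * c)) * cmod B < 1.
Proof. by rewrite -cmodM mulrAC. Qed.

Let bound1 : exists2 M : R, 0 <= M & forall k n, cmod (\prod_(0 <= i < k) (B * q ^+ n - q ^+ i) *
  (q * a / (b * c)) ^+ k) <= M * (cmod (q * a / (b * c)) * cmod B) ^+ k.
Proof.
have [M M0 h] := rt_bound_scale B0; exists M => // k n.
by rewrite cmodM cmodX exprMn mulrC mulrCA ler_wpM2l ?exprn_ge0 ?cmod_ge0.
Qed.

Let bound2 : exists2 M : R, 0 <= M & forall k n, cmod (\prod_(0 <= i < k) (1 * q ^+ n - q ^+ i) *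
  (q * a / (b * c)) ^+ k) <= M * cmod q ^+ k.
Proof.
have [M M0 h] := rt_bound_qX.
have r0 : 0 < cmod q by rewrite cmod_gt0.
pose w := cmod (q * a / (b * c)) / cmod q.
have [N N0 hN] := superexp_bound (w := w) (divr_ge0 (cmod_ge0 _) (ltW r0)).
exists (M * N) => [|k n]; first by rewrite mulr_ge0.
rewrite mul1r cmodM cmodX; have -> : cmod (q * a / (b * c)) = w * cmod q by rewrite divfK ?gt_eqF.
rewrite exprMn mulrA ler_wpM2r ?exprn_ge0 ?cmod_ge0 //.
apply: le_trans (_ : M * (cmod q ^+ 'C(k, 2) * w ^+ k) <= _); last by rewrite ler_wpM2l.
by rewrite mulrA ler_wpM2r // exprn_ge0 // divr_ge0 ?cmod_ge0 // ltW.
Qed.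

Let r1 : 0 <= cmod (q * a / (b * c)) * cmod B < 1.
Proof. by rewrite mulr_ge0 ?cmod_ge0. Qed.

Let r2 : 0 <= cmod q < 1.
Proof. by rewrite cmod_ge0 q1. Qed.

Let geo1 k : geo_bounded (f1 k).
Proof.
have [M M0 h] := bound1.
have [L L0 hL] := lattice_term_bound B Pab Pac PaB PdB PeB PfB M0 h.
by exists (L * (cmod (q * a / (b * c)) * cmod B) ^+ k), (cmod q); split=> //; rewrite mulr_ge0 ?exprn_ge0 //; case/andP: r1.
Qed.

Let Pa1 : P (q * a * 1) != 0.
Proof. by rewrite mulr1 qpoch_inf_mulq_neq0. Qed.

Let x1 x : P x != 0 -> P (x * 1) != 0. Proof. by rewrite mulr1. Qed.

Let geo2 k : geo_bounded (f2 k).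
Proof.
have [M M0 h] := bound2.
have [L L0 hL] := lattice_term_bound B Pab Pac Pa1 (x1 Pd) (x1 Pe) (x1 Pf) M0 h.
by exists (L * cmod q ^+ k), (cmod q); split=> //; rewrite mulr_ge0 ?exprn_ge0 ?cmod_ge0.
Qed.

Let f1E k : nsum (f1 k) = gk k * (q * a / (b * c)) ^+ k * ((-1) ^+ k * q ^+ 'C(k, 2)) *
  qint (q := q) (q * (B / q ^+ k)) q (q ^+ k * B * d * e * f * B) (d * B) (e * B) (f * B).
Proof.
rewrite /qint -nsumZ; last exact: geo_bounded_qint.
apply: eq_nsum => n; rewrite /f1 (lattice_termE _ _ _ _ _ _ PaB) -/(gk k) /qint_term; congr (_ * (_ * (P _ * P _ * P _ / _))).
- by ring.
- by rewrite divff // mulr1.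
- by ring: Bdef.
Qed.

Let f2E k : nsum (f2 k) = gk k * (q * a / (b * c)) ^+ k * ((-1) ^+ k * q ^+ 'C(k, 2)) *
  (q ^+ k * qint (q := q) q (q * (q ^+ k / B)) (q ^+ k * B * d * e * f * q ^+ k)
     (d * q ^+ k) (e * q ^+ k) (f * q ^+ k)).
Proof.
have h x : P x != 0 -> P (x * q ^+ k) != 0 by exact: qpoch_infX_neq0.
have g := geo_bounded_qint (hq := hq) q (q * (q ^+ k / B)) (q ^+ k * B * d * e * f * q ^+ k)
  (h _ Pd) (h _ Pe) (h _ Pf).
have qk : q ^+ k != 0 by rewrite expf_neq0.
pose C := gk k * (q * a / (b * c)) ^+ k * ((-1) ^+ k * q ^+ 'C(k, 2)).
pose u n := C * (q ^+ k * qint_term (q := q) q (q * (q ^+ k / B)) (q ^+ k * B * d * e * f * q ^+ k)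
  (d * q ^+ k) (e * q ^+ k) (f * q ^+ k) n).
have uE n : f2 k (n + k) = u n.
  rewrite /f2 (lattice_termE _ _ _ _ _ _ Pa1) -/(gk k) -/C /u /qint_term; congr (_ * _).
  rewrite !mulr1 !mul1r !exprD mulfK //.
  rewrite (_ : q ^+ k * B * d * e * f * q ^+ k * q ^+ n = q * a * q ^+ k * (q ^+ n * q ^+ k)); last by ring: Bdef.
  rewrite (_ : q / B * (q ^+ n * q ^+ k) = q * (q ^+ k / B) * q ^+ n); last by ring.
  by rewrite -!(mulrA d) -!(mulrA e) -!(mulrA f) (mulrC (q ^+ k) (q ^+ n)); ring.
(* For n < k the argument q q^n / q^k is q^-(k-n-1), a zero of P. Dropping these terms moves the
   endpoint from 1 to q^k, which also explains the weight q^k. *)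
rewrite (nsum_shift (geo2 k) (k := k)); last first.
  move=> n nk; rewrite /f2 (lattice_termE _ _ _ _ _ _ Pa1).
  have -> : q * (1 * q ^+ n / q ^+ k) = (q ^+ (k - n.+1))^-1.
    rewrite mul1r -{1}(subnK nk) exprD exprS.
    by field; rewrite q0 !expf_neq0.
  rewrite (qpoch_inf_qp (hq := hq) (q ^+ (k - n.+1))^-1 (k - n.+1)) mulVf ?expf_neq0 //.
  by rewrite qpoch_inf_at1 mulr0 !mul0r !mulr0.
rewrite (eq_nsum uE) /u !nsumZ //; exact: geo_boundedZ.
Qed.

(** The Saalschuetz sum between q^k and B. Quasi-periodicity of theta at q^k / B extracts the
    dependence on k: three quotients of symbols, the power B^k, and a sign with a power of q that
    cancels the one in [f1E] and [f2E]. *)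
Let gtail k : qsaal (q := q) (q ^+ k) B d e f * (P d * P e * P f * (P (d * B) * P (e * B) * P (f * B))) *
  (qp (q * a / d) k * qp (q * a / e) k * qp (q * a / f) k) =
  qp d k * qp e k * qp f k * (P (q * a / d) * P (q * a / e) * P (q * a / f)) *
  (B * P q * ((-1) ^+ k * B ^+ k * q ^- 'C(k, 2) * th B^-1)).
Proof.
have qk : q ^+ k != 0 by rewrite expf_neq0.
have qX x : P x != 0 -> P (x * q ^+ k) != 0 by exact: qpoch_infX_neq0.
have tk : th (q ^+ k / B) != 0.
  by rewrite th_shift_neq0 ?invr_eq0 // thV // mulf_neq0 // oppr_eq0 invr_eq0.
have [t1 t2] := th_neq0 tk.
have := q_saalschutz (hq := hq) (A := q ^+ k) (B := B) (d := d) (e := e) (f := f) qk B0.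
move=> /(_ (qpoch_inf_mulq_neq0 (hq := hq) t1)).
have -> : q * (B / q ^+ k) = q / (q ^+ k / B) by field; rewrite qk B0.
move=> /(_ t2 (qX _ Pd) (qX _ Pe) (qX _ Pf) PdB PeB PfB) h.
have h2 := th_shift (hq := hq) k (invr_neq0 B0).
rewrite /qtheta exprVn invrK -/(qtheta B^-1) in h2.
have e1 : q ^+ k * B * d * f = q * a / e * q ^+ k by rewrite -Bdef; field.
have e2 : q ^+ k * B * d * e = q * a / f * q ^+ k by rewrite -Bdef; field.
have e3 : q ^+ k * B * e * f = q * a / d * q ^+ k by rewrite -Bdef; field.
rewrite e1 e2 e3 in h.
rewrite (qpoch_inf_qp (hq := hq) d k) (qpoch_inf_qp (hq := hq) e k) (qpoch_inf_qp (hq := hq) f k).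
rewrite (qpoch_inf_qp (hq := hq) (q * a / d) k) (qpoch_inf_qp (hq := hq) (q * a / e) k)
  (qpoch_inf_qp (hq := hq) (q * a / f) k).
rewrite -h2 !(mulrC B) !(mulrC (q ^+ k)) in h *.
transitivity (qp d k * qp e k * qp f k *
  (qp (q * a / d) k * qp (q * a / e) k * qp (q * a / f) k) *
  (qsaal (q := q) (q ^+ k) B d e f *
    (P (d * q ^+ k) * P (d * B) * (P (e * q ^+ k) * P (e * B)) *
    (P (f * q ^+ k) * P (f * B))))); first by ring.
by rewrite h; ring.
Qed.

Let Pq := qpoch_inf_q_neq0 (hq := hq).
Let D := P d * P e * P f * (P (d * B) * P (e * B) * P (f * B)).
Let C := B * P q * th B^-1 * (P (q * a / d) * P (q * a / e) * P (q * a / f)).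

Let terms k : (B * nsum (f1 k) - nsum (f2 k)) * D = C * vw8 a b c d e f (q * a * B / (b * c)) k.
Proof.
have qk n : q ^+ n != 0 by rewrite expf_neq0.
rewrite f1E f2E.
pose g := gk k * (q * a / (b * c)) ^+ k * ((-1) ^+ k * q ^+ 'C(k, 2)).
transitivity (g * (qsaal (q := q) (q ^+ k) B d e f * D)); first by rewrite /g /qsaal; ring.
have nz x : P x != 0 -> qp x k != 0 by exact: qpoch_inf_qp_neq0.
have nd := nz _ Pad; have ne := nz _ Pae; have nf := nz _ Paf.
have nn : qp (q * a / d) k * qp (q * a / e) k * qp (q * a / f) k != 0 by rewrite !mulf_neq0.
have h := gtail k; rewrite -/D in h; apply: (mulIf nn); rewrite -(mulrA g) h.
rewrite /g /gk /vw8 /C (_ : q * a * B / (b * c) = q * a / (b * c) * B); last by ring.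
rewrite (exprMn k (q * a / (b * c)) B); apply: watson_certificate => //; rewrite ?nz //; last by rewrite -expr2 sqrr_sign.
exact: (qpoch_inf_neq1 (hq := hq)).
Qed.

(** The double series summed in both orders: over n first, [terms] gives the 8-phi-7; over k first,
    [sum_lattice] gives one balanced 4-phi-3 for each endpoint. *)
Theorem nonterminating_watson :
  C * nsum (vw8 a b c d e f (q * a * B / (b * c))) * (P (q * a / b) * P (q * a / c)) =
  P (q * a) * P (q * a / (b * c)) * D *
  (B * u4 (q := q) (q * B) q (q * a * B / b) (q * a * B / c) (d * B) (e * B) (f * B) (q * a * B / (b * c)) -
   u4 (q := q) q (q / B) (q * a / b) (q * a / c) d e f (q * a / (b * c))).
Proof.
have [M1 M10 h1] := bound1; have [M2 M20 h2] := bound2.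
have [L1 L10 b1] := lattice_term_bound B Pab Pac PaB PdB PeB PfB M10 h1.
have [L2 L20 b2] := lattice_term_bound B Pab Pac Pa1 (x1 Pd) (x1 Pe) (x1 Pf) M20 h2.
have s1 := sum_lattice B b0 c0 Pa Pab Pac PaB PaBbc PdB PeB PfB M10 r1 h1.
have Pabc1 : P (q * a * 1 / (b * c)) != 0 by rewrite mulr1.
have s2 := sum_lattice B b0 c0 Pa Pab Pac Pa1 Pabc1 (x1 Pd) (x1 Pe) (x1 Pf) M20 r2 h2.
have g1 : geo_bounded (fun k => nsum (f1 k)) := geo_bounded_nsum L10 r1 r2 b1.
have g2 : geo_bounded (fun k => nsum (f2 k)) := geo_bounded_nsum L20 r2 r2 b2.
have gv : geo_bounded (vw8 a b c d e f (q * a * B / (b * c))) by exact: geo_bounded_vw8.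
rewrite -(nsumZ _ gv) -(eq_nsum terms).
rewrite (eq_nsum (v := fun k => D * (B * nsum (f1 k) - nsum (f2 k)))); last by move=> k; rewrite mulrC.
rewrite nsumZ; last by apply: geo_boundedB; first exact: geo_boundedZ.
rewrite nsumB //; last exact: geo_boundedZ.
rewrite nsumZ // s1 s2 !mulr1 divff // mulr1 mul1r.
have n12 : P (q * a / b) * P (q * a / c) != 0 by rewrite mulf_neq0.
move: (u4 _ _ _ _ _ _ _ _) => u1; move: (u4 _ _ _ _ _ _ _ _) => u2.
pose X := P (q * a) * P (q * a / (b * c)) / (P (q * a / b) * P (q * a / c)).
transitivity (X * (P (q * a / b) * P (q * a / c)) * D * (B * u1 - u2)); first by rewrite /X; ring.
by rewrite /X divfK.
Qed.

End Watson.
End NonterminatingWatson.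

(** * Partial fractions over geometric progressions *)

Section Lagrange.
Variable K : fieldType.

(** The sum is the coefficient of degree #|T| - 1 in the Lagrange interpolation polynomial, which is
    p itself and has smaller degree. *)
Lemma lagrange_sum (T : finType) (x : T -> K) (p : {poly K}) :
  injective x -> (size p < #|T|)%N ->
  \sum_i p.[x i] / \prod_(k | k != i) (x i - x k) = 0.
Proof.
move=> xI sp; have n0 : (0 < #|T|)%N by exact: leq_ltn_trans sp.
pose l i : {poly K} := \prod_(k | k != i) ('X - (x k)%:P).
have sl i : size (l i) = #|T|.
  rewrite /l -big_filter size_prod_XsubC size_filter -sum1_count sum1_card.
  by rewrite -[RHS]prednK // -(cardC1 i).
have ml i : l i \is monic by exact: monic_prod_XsubC.
pose D i := \prod_(k | k != i) (x i - x k).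
have lD i : (l i).[x i] = D i by rewrite /l horner_prod; apply: eq_bigr => k _; rewrite !hornerE.
have l0 i j : j != i -> (l i).[x j] = 0.
  move=> ji; rewrite /l horner_prod (bigD1 j) //= !hornerE subrr mul0r //.
have D0 i : D i != 0.
  by rewrite /D prodf_seq_neq0; apply/allP => k _; apply/implyP => ki; rewrite subr_eq0 (inj_eq xI) eq_sym.
pose L := \sum_i (p.[x i] / D i) *: l i.
have Lx j : L.[x j] = p.[x j].
  rewrite /L horner_sum (bigD1 j) //= hornerZ lD divfK // big1 ?addr0 // => i ij.
  by rewrite hornerZ l0 ?mulr0 // eq_sym.
have Lp : L = p.
  apply/eqP; rewrite -subr_eq0; apply/negPn/negP => nz.
  have sz : (size (L - p)%R <= #|T|)%N.
    apply: (leq_trans (size_polyD _ _)); rewrite geq_max size_polyN (ltnW sp) andbT.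
    apply: (leq_trans (size_sum _ _ _)); apply/bigmax_leqP => i _.
    by apply: (leq_trans (size_scale_leq _ _)); rewrite sl.
  have := max_poly_roots nz (rs := [seq x i | i <- enum T]).
  rewrite size_map -cardE ltnNge sz map_inj_uniq // enum_uniq => h.
  suff : false by []; apply: h => //; apply/allP => _ /mapP[i _ ->].
  by rewrite rootE !hornerE Lx subrr.
have := congr1 (fun r : {poly K} => r`_(#|T|.-1)) Lp.
rewrite [RHS]nth_default; last by rewrite -ltnS prednK.
rewrite /L coef_sum => e; rewrite -[RHS]e; apply: eq_bigr => i _.
rewrite coefZ; have /monicP := ml i; rewrite /lead_coef sl => ->.
by rewrite mulr1.
Qed.

Lemma two_sided_partial_fractions (I J : finType) (y : I -> K) (c : J -> K) (W V : seq K)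
    (al be ga : K) (h := fun x => al / x + be + ga * x) :
  injective y -> injective c -> (forall i, y i != 0) -> (forall j, c j != 0) ->
  (forall i j, 1 - c j * y i != 0) -> (size W + 2 <= #|I|)%N -> (size V + 2 <= #|J|)%N ->
  \sum_i h (y i) * (\prod_(w <- W) (1 - w / y i) * \prod_(v <- V) (1 - v * y i) /
     (\prod_(k | k != i) (1 - y k / y i) * \prod_j (1 - c j * y i))) =
  \sum_j h (c j)^-1 * (\prod_(v <- V) (1 - v / c j) * \prod_(w <- W) (1 - w * c j) /
     (\prod_(k | k != j) (1 - c k / c j) * \prod_i (1 - y i * c j))).
Proof.
move=> yI cI y0 c0 cy sW sV.
pose x (t : I + J) : K := match t with inl i => y i | inr j => (c j)^-1 end.
have xI : injective x.
  move=> [i|j] [i'|j'] /= e.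
  - by congr inl; exact: yI.
  - by have := cy i j'; rewrite e divff // subrr eqxx.
  - by have := cy i' j; rewrite -e divff // subrr eqxx.
  - by congr inr; apply: cI; exact: invr_inj.
(* Multiplying the summand by x^(#|I| - 1) clears the negative powers of x coming from the w / x,
   from the differences 1 - y k / x and from al / x. The degree of p is then at most #|I| + #|J| -
   2, which is just what interpolation at the y i and the inverses of the c j allows. *)
pose n := (#|I| - 2 - size W)%N.
pose p : {poly K} := 'X ^+ n * (al%:P + be *: 'X + ga *: 'X ^+ 2) *
  \prod_(w <- W) ('X - w%:P) * \prod_(v <- V) (1 - v *: 'X).
have sp : (size p < #|{: I + J}|)%N.
  have sprod (L : seq K) (F : K -> {poly K}) : (forall w, size (F w) <= 2)%N ->
    (size (\prod_(w <- L) F w)%R <= (size L).+1)%N.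
    move=> hF; elim: L => [|w L IH]; first by rewrite big_nil size_poly1.
    rewrite big_cons; apply: leq_trans (size_polyMleq _ _) _ => /=.
    by move: (leq_add (hF w) IH); case: (size (F w) + _)%N => // m; rewrite addSn add1n.
  rewrite card_sum /p.
  have sM (r1 r2 : {poly K}) m1 m2 : (size r1 <= m1)%N -> (size r2 <= m2.+1)%N ->
    (size (r1 * r2)%R <= m1 + m2)%N.
    move=> h1 h2; apply: leq_trans (size_polyMleq _ _) _.
    by have := leq_add h1 h2; rewrite addnS; case: (size r1 + _)%N.
  have s1 : (size ('X ^+ n * (al%:P + be *: 'X + ga *: 'X ^+ 2) : {poly K})%R <= n + 3)%N.
    apply: (leq_trans (sM _ _ n.+1 2 _ _)); rewrite ?size_polyXn ?addSnnS //.
    apply: leq_trans (size_polyD _ _) _; rewrite geq_max; apply/andP; split; last first.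
      by apply: leq_trans (size_scale_leq _ _) _; rewrite size_polyXn.
    apply: leq_trans (size_polyD _ _) _; rewrite geq_max; apply/andP; split.
      by apply: leq_trans (size_polyC_leq1 _) _.
    by apply: leq_trans (size_scale_leq _ _) _; rewrite size_polyX.
  have s2 : (size (\prod_(w <- W) ('X - w%:P))%R <= (size W).+1)%N.
    by apply: sprod => w; rewrite size_XsubC.
  have s3 : (size (\prod_(v <- V) (1 - v *: 'X : {poly K}))%R <= (size V).+1)%N.
    apply: sprod => v; apply: leq_trans (size_polyD _ _) _; rewrite geq_max size_poly1 size_polyN /=.
    by apply: leq_trans (size_scale_leq _ _) _; rewrite size_polyX.
  by have := sM _ _ _ _ (sM _ _ _ _ s1 s2) s3; rewrite /n => s; apply: leq_ltn_trans s _; lia.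
have px t : t != 0 -> p.[t] = t ^+ (#|I|).-1 * h t * (\prod_(w <- W) (1 - w / t) * \prod_(v <- V) (1 - v * t)).
  move=> t0; rewrite /p !hornerM !horner_prod !hornerD hornerC !hornerZ !hornerXn hornerX.
  have -> : \prod_(w <- W) ('X - w%:P).[t] = t ^+ size W * \prod_(w <- W) (1 - w / t).
    rewrite (eq_bigr (fun w => t * (1 - w / t))); first by rewrite big_split /= big_const_seq count_predT iter_mulr_1.
    by move=> w _; rewrite hornerXsubC; field.
  have -> : \prod_(v <- V) (1 - v *: 'X).[t] = \prod_(v <- V) (1 - v * t).
    by apply: eq_bigr => v _; rewrite hornerD hornerN hornerZ hornerX -polyC1 hornerC.
  have -> : (#|I|.-1 = n + size W + 1)%N by rewrite /n; lia.
  by rewrite !exprD expr1 /h; field.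
have e := lagrange_sum xI sp.
rewrite big_sumType /= in e.
pose ka := \prod_j (- (c j)^-1).
have ka0 : ka != 0.
  by rewrite /ka prodf_seq_neq0; apply/allP => j _; rewrite oppr_eq0 invr_eq0 c0.
set L := LHS; set R := RHS; apply/eqP; rewrite -subr_eq0; apply/eqP.
apply: (mulIf (invr_neq0 ka0)); rewrite mul0r mulrBl -{}e; congr (_ + _).
  rewrite /L mulr_suml; apply: eq_bigr => i _.
  rewrite big_sumType /=.
  rewrite px //.
  have -> : \prod_(i0 | inl i0 != inl i :> I + J) (y i - y i0) = y i ^+ (#|I|).-1 * \prod_(k | k != i) (1 - y k / y i).
    rewrite -(cardC1 i) -prodr_const -big_split /=.
    apply: eq_big => [k|k _]; first by [].
    by field.
  have -> : \prod_(j | inr j != inl i :> I + J) (y i - (c j)^-1) = ka * \prod_j (1 - c j * y i).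
    rewrite /ka -big_split /=; apply: eq_bigr => j _; by field.
  have yn : y i ^+ (#|I|).-1 != 0 by rewrite expf_neq0.
  rewrite !invfM; set t1 := (\prod_(k | k != i) _)^-1; set t2 := (\prod_j _)^-1.
  transitivity (h (y i) * (\prod_(w <- W) (1 - w / y i) * \prod_(v <- V) (1 - v * y i) * (t1 * t2)) / ka * (y i ^+ (#|I|).-1 / y i ^+ (#|I|).-1)); last by ring.
  by rewrite divff // mulr1.
rewrite /R mulr_suml -sumrN; apply: eq_bigr => j _.
have Cnc : \prod_(k | inr k != inr j :> I + J) ((c j)^-1 - (c k)^-1) = - (ka * c j * \prod_(k | k != j) (1 - c k / c j)).
  have -> : ka = - (c j)^-1 * \prod_(k | k != j) (- (c k)^-1) by rewrite /ka (bigD1 j).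
  rewrite !mulNr opprK (mulrAC (c j)^-1) mulVf // mul1r -big_split /=.
  apply: eq_big => [k|k _]; first by [].
  by field; rewrite !c0.
have Cy : \prod_(i | inl i != inr j :> I + J) ((c j)^-1 - y i) = (c j)^-1 ^+ #|I| * \prod_i (1 - y i * c j).
  rewrite -prodr_const -big_split /=; apply: eq_bigr => i _; by field.
rewrite big_sumType /= px ?invr_eq0 // Cnc Cy !invrK.
have n1 : (#|I| = (#|I|).-1.+1)%N by rewrite prednK //; lia.
rewrite {2}n1 exprS; set z := _ ^+ _.-1.
have z0 : z != 0 by rewrite expf_neq0 // invr_eq0.
rewrite !invfM invrN !invfM !invrK; set t1 := (\prod_(k | k != j) _)^-1; set t2 := (\prod_i _)^-1.
transitivity (- (h (c j)^-1 * (\prod_(v <- V) (1 - v / c j) * \prod_(w <- W) (1 - w * c j) * (t1 * t2)) / ka * (z / z) * (c j / c j))); last by ring.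
by rewrite !divff // !mulr1.
Qed.
End Lagrange.

(** * Residue sums as limits of interpolation sums *)

Section Residues.
Context {R : realType} {K : numFieldType} {KR : modulus R K}.
Local Notation cmod := (@cmod R K KR).
Context {q : K} {hq : nome q}.
Local Notation P := (qpoch_inf q).
Local Notation qp := (qpoch_fin q).
Local Notation th := (qtheta (q := q)).

Let q0 : q != 0 := nome_neq0.
Let q1 : cmod q < 1 := nome_lt1.
Let qX0 n : q ^+ n != 0. Proof. by rewrite expf_neq0. Qed.

Lemma dom_cvg_bigprod {T} {F : set_system T} {FF : ProperFilter F} (I : Type) (s : seq I)
    (U : I -> T -> nat -> K) (v : I -> nat -> K) (r : I -> R) :
  (forall i, dom_cvg F (U i) (v i) (r i)) ->
  dom_cvg F (fun t k => \prod_(i <- s) U i t k) (fun k => \prod_(i <- s) v i k)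
    (\prod_(i <- s) r i).
Proof.
move=> h; elim: s => [|i s IH].
  apply: (eq_dom_cvg (U := fun _ _ => 1) (v := fun=> 1) (r := 1)); rewrite ?big_nil //.
  - by move=> t k; rewrite big_nil.
  - by move=> k; rewrite big_nil.
  exact: dom_cvg_cst.
apply: (eq_dom_cvg _ _ _ (dom_cvgM (h i) IH)); rewrite ?big_cons //.
- by move=> t k; rewrite big_cons.
- by move=> k; rewrite big_cons.
Qed.

Lemma cvg_bigsum {T} {F : set_system T} {FF : ProperFilter F} (I : Type) (s : seq I)
    (f : I -> T -> K) (l : I -> K) : (forall i, f i @ F --> l i) ->
  (fun t => \sum_(i <- s) f i t) @ F --> \sum_(i <- s) l i.
Proof.
move=> h; elim: s => [|i s IH].
  by rewrite big_nil; under eq_fun do rewrite big_nil; exact: cvg_cst.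
by rewrite big_cons; under eq_fun do rewrite big_cons; exact: cvgD.
Qed.

Let sg m : K := (-1) ^+ m * q ^- 'C(m.+1, 2).

Let sg0 m : sg m != 0.
Proof. by rewrite mulf_neq0 ?invr_eq0 // expf_neq0 // oppr_eq0 oner_eq0. Qed.

Lemma qp_shift_down y m : y != 0 ->
  qp (y / q ^+ m) m = (-1) ^+ m * q ^- 'C(m.+1, 2) * y ^+ m * qp (q / y) m.
Proof.
move=> y0; elim: m => [|m IH]; first by rewrite !qp0 !expr0 invr1 !mulr1.
rewrite qpSl (_ : y / q ^+ m.+1 * q = y / q ^+ m); last by rewrite exprS; field; rewrite q0 qX0.
rewrite IH qpS [in RHS]binS bin1 exprD invfM !exprS.
by field; rewrite !qX0 y0 q0.
Qed.

Lemma qp_shift_downD y m n : y != 0 -> (m <= n)%N ->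
  qp (y / q ^+ m) n = (-1) ^+ m * q ^- 'C(m.+1, 2) * y ^+ m * qp (q / y) m * qp y (n - m).
Proof.
move=> y0 mn; rewrite -{1}(subnKC mn) qpD qp_shift_down // divfK //.
Qed.

Lemma dom_cvg_qp_scaled y (s : nat -> nat) : (forall m, \forall N \near \oo, (m <= s N)%N) ->
  dom_cvg \oo (fun N m => qp (y * q ^+ m) (s N)) (fun m => P (y * q ^+ m)) 1.
Proof.
move=> hs; split=> [k|]; first by apply: cvg_shift_index => //; exact: cvg_qp.
exists (expR (cmod y / (1 - cmod q))); first exact: expR_ge0.
apply: nearW => N k; rewrite expr1n mulr1; apply: qp_le.
by rewrite cmodM ler_piMr ?cmod_ge0 ?cmod_qX.
Qed.

Lemma dom_cvg_qp_scaledV y (s : nat -> nat) : P y != 0 ->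
  (forall m, \forall N \near \oo, (m <= s N)%N) ->
  dom_cvg \oo (fun N m => (qp (y * q ^+ m) (s N))^-1) (fun m => (P (y * q ^+ m))^-1) 1.
Proof.
move=> Py hs.
have e m n : (qp (y * q ^+ m) n)^-1 = qp y m * (qp y (m + n))^-1.
  have h := qpoch_inf_qp_neq0 (hq := hq) m Py.
  by rewrite qpD invfM mulrA divff // mul1r.
have e' m : (P (y * q ^+ m))^-1 = qp y m * (P y)^-1.
  have h := qpoch_inf_qp_neq0 (hq := hq) m Py.
  by rewrite (qpoch_inf_qp y m) invfM mulrA divff // mul1r.
apply: (eq_dom_cvg (U := fun N m => qp y m * (qp y (m + s N))^-1) (v := fun m => qp y m * (P y)^-1)
  (r := 1)) => //.
apply: dom_cvgMr; first exact: dom_cvg_qp_cst.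
apply: dom_cvg_qpV_index => // k m; apply: filterS (hs m) => N h.
exact: leq_trans h (leq_addl _ _).
Qed.

Section Lists.
Variable r : nat.
Implicit Types A B : 'I_r -> K.

Definition res_coef A B i j : K := P (B j / A i) / (if j == i then P q else P (A j / A i)).

(** The residue at x = A_i q^m, with respect to dx / x, of h(x) times the product over j of P (B_j /
    x) P (B'_j x) / (P (A_j / x) P (A'_j x)). The poles with index in A' lie at the inverses of the
    A'_j q^m. *)
Definition res_term (h : K -> K) A B A' B' i m : K := h (A i * q ^+ m) *
  \prod_(j < r) ((B j / A j) ^+ m * (qp (q * A i / B j) m / qp (q * A i / A j) m) *
    res_coef A B i j * (P (B' j * A i * q ^+ m) / P (A' j * A i * q ^+ m))).

Let fin_coef A B i j n : K :=
  qp (B j / A i) n * (if j == i then qp q n else qp (A j / A i) n.+1)^-1.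

Let fin_term (h : K -> K) A B A' B' M i m : K := h (A i * q ^+ m) *
  \prod_(j < r) ((B j / A j) ^+ m * (qp (q * A i / B j) m / qp (q * A i / A j) m) *
    fin_coef A B i j (M - m) * (qp (B' j * A i * q ^+ m) M / qp (A' j * A i * q ^+ m) M.+1)).

Let zeros B M : seq K := [seq B j * q ^+ n | j <- enum 'I_r, n <- iota 0 M].

Let size_zeros B M : size (zeros B M) = (r * M)%N.
Proof. by rewrite size_allpairs size_enum_ord size_iota. Qed.

Let prod_zeros B M (F : K -> K) : \prod_(w <- zeros B M) F w =
  \prod_(j < r) \prod_(0 <= n < M) F (B j * q ^+ n).
Proof. by rewrite big_allpairs_dep /= big_enum; apply: eq_bigr => j _; rewrite /index_iota subn0. Qed.

Let node A M (p : 'I_r * 'I_M.+1) : K := A p.1 * q ^+ p.2.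

Let others A M i (m : 'I_M.+1) : (forall j, A j != 0) ->
  \prod_(p | p != (i, m)) (1 - node A p / node A (i, m)) =
  \prod_(j < r) (sg m * (A j / A i) ^+ m * qp (q * A i / A j) m *
     (if j == i then qp q (M - m) else qp (A j / A i) (M - m).+1)).
Proof.
move=> A0.
transitivity (\prod_(j < r) \prod_(n < M.+1 | (j, n) != (i, m)) (1 - node A (j, n) / node A (i, m))).
  rewrite pair_big_dep /=; apply: eq_big => [[j n]|[j n] _] //=.
apply: eq_bigr => j _; have nE k (n : 'I_M.+1) : node A (k, n) / node A (i, m) = A k / A i / q ^+ m * q ^+ n.
  by rewrite /node /=; field; rewrite A0 qX0.
have mM : (m <= M)%N by rewrite -ltnS.
case: eqP => [->|/eqP ji].
  rewrite divff // expr1n mulr1 mulfK //.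
  (* On the progression of the node itself, the points before m give (q^-m; q)_m and those after it
     give (q; q)_(M-m). *)
  transitivity (\prod_(0 <= n < M.+1 | n != m) (1 - q ^+ n / q ^+ m)).
    rewrite big_mkord; apply: eq_big => [n|n _]; first by rewrite xpair_eqE eqxx.
    by rewrite nE divff // mul1r mulrC.
  rewrite (big_cat_nat (n := m)) //=; last exact: leqW.
  rewrite [X in _ * X]big_ltn_cond // eqxx /=; congr (_ * _).
    have := qp_shift_down m (oner_neq0 K); rewrite expr1n mulr1 divr1 => <-.
    rewrite big_nat_cond [RHS]big_nat; apply: eq_big => [n|n _].
      by rewrite /=; case: ltngtP.
    by rewrite mul1r mulrC.
  rewrite -{1}(add0n m.+1) big_addn subSS big_nat_cond [RHS]big_nat; apply: eq_big => [n|n _].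
    by rewrite gtn_eqF ?andbT // addnS ltnS leq_addl.
  by rewrite addnS exprS exprD; congr (1 - _); field.
transitivity (qp (A j / A i / q ^+ m) M.+1).
  rewrite /qpoch_fin big_mkord; apply: eq_big => [n|n _]; first by rewrite xpair_eqE (negPf ji).
  by rewrite nE.
rewrite qp_shift_downD ?mulf_neq0 ?invr_eq0 //; last exact: leqW.
rewrite subSn // /sg (_ : q / (A j / A i) = q * A i / A j) //.
by field; rewrite !A0.
Qed.
Let fin_termE h A B A' B' M i (m : 'I_M.+1) :
  (forall j, A j != 0) -> (forall j, B j != 0) ->
  h (node A (i, m)) * (\prod_(w <- zeros B M) (1 - w / node A (i, m)) *
    \prod_(v <- zeros B' M) (1 - v * node A (i, m)) /
    (\prod_(p | p != (i, m)) (1 - node A p / node A (i, m)) *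
     \prod_(p : 'I_r * 'I_M.+1) (1 - node A' p * node A (i, m)))) = fin_term h A B A' B' M i m.
Proof.
move=> A0 B0; have mM : (m <= M)%N by rewrite -ltnS.
rewrite /fin_term; congr (_ * _); rewrite (others _ _ A0) !prod_zeros.
have -> : \prod_(p : 'I_r * 'I_M.+1) (1 - node A' p * node A (i, m)) =
    \prod_(j < r) qp (A' j * A i * q ^+ m) M.+1.
  rewrite /qpoch_fin; under [RHS]eq_bigr => j _ do rewrite big_mkord.
  rewrite pair_big /=; apply: eq_bigr => [[j n] _]; rewrite /node /=; congr (1 - _); ring.
rewrite -!big_split /= -prodfV -big_split /=; apply: eq_bigr => j _.
have -> : \prod_(0 <= n < M) (1 - B j * q ^+ n / node A (i, m)) = qp (B j / A i / q ^+ m) M.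
  by apply: eq_bigr => n _; rewrite /node /=; congr (1 - _); field; rewrite A0 qX0.
have -> : \prod_(0 <= n < M) (1 - B' j * q ^+ n * node A (i, m)) = qp (B' j * A i * q ^+ m) M.
  by apply: eq_bigr => n _; rewrite /node /=; congr (1 - _); ring.
rewrite qp_shift_downD ?mulf_neq0 ?invr_eq0 // -/(sg m).
rewrite (_ : q / (B j / A i) = q * A i / B j); last by field; rewrite A0 B0.
rewrite /fin_coef; set X := if _ then _ else _.
move: (sg m) (sg0 m) => s s0.
rewrite !exprMn !exprVn !invfM invrK.
have a0 : A i ^+ m != 0 by rewrite expf_neq0.
transitivity (B j ^+ m * (A j ^+ m)^-1 * (qp (q * A i / B j) m * (qp (q * A i / A j) m)^-1) *
 (qp (B j / A i) (M - m) * X^-1) * (qp (B' j * A i * q ^+ m) M * (qp (A' j * A i * q ^+ m) M.+1)^-1) *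
 (s / s) * (A i ^+ m / A i ^+ m)); first by ring.
by rewrite !divff // !mulr1.
Qed.

(** Taken for both orders of i and j, this says that no quotient A_i / A_j is an integral power of
    q, that is, the geometric progressions are disjoint. *)
Definition distinct_nodes A := forall i j, i != j -> P (A i / A j) != 0.

Let node_inj A M : (forall j, A j != 0) -> distinct_nodes A -> injective (@node A M).
Proof.
move=> A0 dA; have key i j (m n : nat) : (m <= n)%N -> A i * q ^+ m = A j * q ^+ n -> i = j /\ m = n.
  move=> mn e.
  have e1 : A i / A j = q ^+ (n - m).
    have := congr1 (fun x => x / A j / q ^+ m) e; rewrite -{1}(subnKC mn) exprD => e'.
    transitivity (A i * q ^+ m / A j / q ^+ m); first by field; rewrite A0 qX0.
    by rewrite e'; field; rewrite A0 qX0.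
  have ij : i = j.
    apply/eqP/negPn/negP => ij; have := dA j i; rewrite eq_sym => /(_ ij).
    have -> : A j / A i = q ^- (n - m) by rewrite -e1 invf_div.
    rewrite (qpoch_inf_qp (hq := hq) (q ^- (n - m)) (n - m)) mulVf // qpoch_inf_at1.
    by rewrite mulr0 eqxx.
  split=> //; move: e1; rewrite ij divff // => e1.
  apply/eqP; rewrite eqn_leq mn /= -subn_eq0; apply/eqP.
  case: (n - m)%N e1 => // k e1.
  have := qq1 (hq := hq) k; rewrite -exprS -e1 subrr eqxx //.
move=> [i m] [j n]; rewrite /node /= => e.
have [mn|nm] := leqP m n.
  by have [-> /val_inj ->] := key _ _ _ _ mn e.
by have [-> /val_inj ->] := key _ _ _ _ (ltnW nm) (esym e).
Qed.

Let fin_identity A B A' B' M al be ga : (1 < r)%N ->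
  (forall j, A j != 0) -> (forall j, B j != 0) -> (forall j, A' j != 0) -> (forall j, B' j != 0) ->
  distinct_nodes A -> distinct_nodes A' -> (forall i j, P (A' j * A i) != 0) ->
  \sum_(i < r) \sum_(0 <= m < M.+1) fin_term (fun x => al / x + be + ga * x) A B A' B' M i m =
  \sum_(i < r) \sum_(0 <= m < M.+1) fin_term (fun x => ga / x + be + al * x) A' B' A B M i m.
Proof.
move=> r1 A0 B0 A'0 B'0 dA dA' nAA'.
have n0 C : (forall j, C j != 0) -> forall p, @node C M p != 0.
  by move=> C0 p; rewrite mulf_neq0.
have yc (p p' : 'I_r * 'I_M.+1) : 1 - node A' p' * node A p != 0.
  rewrite /node (_ : A' p'.1 * _ * _ = A' p'.1 * A p.1 * q ^+ (p'.2 + p.2)).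
    exact: qpoch_inf_factor_neq0.
  by rewrite exprD; ring.
(* Each progression carries M + 1 nodes against M zeros. The surplus of r >= 2 points pays for the
   two extra degrees of h. *)
have sz C : (size (zeros C M) + 2 <= #|{: 'I_r * 'I_M.+1}|)%N.
  by rewrite size_zeros card_prod !card_ord mulnS addnC leq_add2r.
have := two_sided_partial_fractions al be ga (node_inj A0 dA) (node_inj A'0 dA')
  (n0 _ A0) (n0 _ A'0) yc (sz B) (sz B').
pose h x := al / x + be + ga * x; pose h' x := ga / x + be + al * x.
have t1 (p : 'I_r * 'I_M.+1) := fin_termE h A' B' p.1 p.2 A0 B0.
have t2 (p : 'I_r * 'I_M.+1) := fin_termE h' A B p.1 p.2 A'0 B'0.
move=> e; transitivity (\sum_(p : 'I_r * 'I_M.+1) fin_term h A B A' B' M p.1 p.2).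
  rewrite -(pair_big xpredT xpredT (fun i (m : 'I_M.+1) => fin_term h A B A' B' M i m)) /=.
  by apply: eq_bigr => i _; rewrite big_mkord.
transitivity (\sum_(p : 'I_r * 'I_M.+1) fin_term h' A' B' A B M p.1 p.2); last first.
  rewrite -(pair_big xpredT xpredT (fun i (m : 'I_M.+1) => fin_term h' A' B' A B M i m)) /=.
  by apply: eq_bigr => i _; rewrite big_mkord.
refine (etrans (esym (eq_bigr _ (fun p _ => t1 p))) (etrans _ (eq_bigr _ (fun p _ => t2 p)))).
refine (etrans (etrans _ e) _); first by apply: eq_bigr => -[i m] _.
apply: eq_bigr => -[i m] _; rewrite /h' invrK; congr (_ * _).
by ring.
Qed.

Definition res_sum (h : K -> K) A B A' B' : K :=
  \sum_(i < r) nsum (res_term h A B A' B' i).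

(* Geometric decay of the residues: [h] grows like [1 / x] along the nodes only if [al != 0]. *)
Definition residue_decay (al : K) A B := exists2 w : R, 1 <= w /\ (al = 0 \/ 1 <= w * cmod q) &
  w * \prod_(j < r) cmod (B j / A j) < 1.

Let near_leq (m : nat) : \forall N \near \oo, (m <= N)%N.
Proof. by exists m. Qed.

(** The indicator of m <= M extends the finite sums to all m, so that the truncation M becomes the
    parameter of a dominated convergence. The number w of [residue_decay] absorbs the growth of h
    along the nodes. *)
Let dom_cvg_fin_term A B A' B' al be ga i :
  (forall j, A j != 0) -> distinct_nodes A -> (forall j, P (A' j * A i) != 0) ->
  residue_decay al A B -> exists2 s : R, 0 <= s < 1 &
  dom_cvg \oo (fun M m => ((m < M.+1)%N)%:R * fin_term (fun x => al / x + be + ga * x) A B A' B' M i m)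
    (res_term (fun x => al / x + be + ga * x) A B A' B' i) s.
Proof.
move=> A0 dA nAA' [w [w1 hw] wr]; have Pq := qpoch_inf_q_neq0 (hq := hq).
have w0 : 0 <= w := le_trans ler01 w1.
have p0 : 0 <= \prod_(j < r) cmod (B j / A j) by apply: prodr_ge0 => j _; exact: cmod_ge0.
pose rj j : R := cmod (B j / A j) * (1 * 1) * (1 * 1) * (1 * 1).
exists (1 * (w * \prod_(j < r) rj j)).
  by under eq_bigr => j _ do rewrite /rj !mulr1; rewrite mul1r wr mulr_ge0.
pose v m := 1 * ((al / (A i * q ^+ m) + be + ga * (A i * q ^+ m)) *
  \prod_(j < r) ((B j / A j) ^+ m * (qp (q * A i / B j) m * (qp (q * A i / A j) m)^-1) *
    (P (B j / A i) * (if j == i then P q else P (A j / A i))^-1) *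
    (P (B' j * A i * q ^+ m) * (P (A' j * A i * q ^+ m))^-1))).
apply: (eq_dom_cvg (v := v) (fun _ _ => erefl) _ erefl) => [k|].
  by rewrite /v mul1r.
rewrite /fin_term /fin_coef.
apply: dom_cvgM.
  split=> [k|]; first by apply: cvg_near_cst; exists k => // n /= kn; rewrite ltnS kn.
  exists 1 => //; apply: nearW => t k; rewrite expr1n mulr1.
  by case: ltnP => _ /=; rewrite ?cmod1 // cmod0.
apply: dom_cvgM.
  apply: (dom_cvg_const (M := cmod (al / A i) + cmod be + cmod (ga * A i))) => [|k].
    by rewrite !addr_ge0 // cmod_ge0.
  have wk : 1 <= w ^+ k by exact: exprn_ege1.
  rewrite !mulrDl; apply: le_trans (ler_cmodD _ _) _; apply: lerD; first
    (apply: le_trans (ler_cmodD _ _) _; apply: lerD).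
  - case: hw => [->|hw]; first by rewrite !mul0r cmod0 mul0r.
    rewrite invfM mulrA cmodM ler_wpM2l ?cmod_ge0 // cmodV cmodX.
    have c0 : 0 < cmod q ^+ k by rewrite exprn_gt0 // cmod_gt0.
    by rewrite -[leLHS]mul1r ler_pdivrMr // -exprMn exprn_ege1.
  - by rewrite ler_peMr ?cmod_ge0.
  - rewrite mulrA cmodM ler_wpM2l ?cmod_ge0 //; apply: le_trans wk; exact: cmod_qX.
apply: dom_cvg_bigprod => j; have PA : P (q * A i / A j) != 0.
  have [->|ij] := eqVneq i j; first by rewrite mulfK.
  by rewrite -mulrA qpoch_inf_mulq_neq0 // dA.
have sN k m : \forall N \near \oo, (m <= N - k)%N.
  by exists (m + k)%N => // N /= h; rewrite leq_subRL 1?addnC //; apply: leq_trans h; exact: leq_addl.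
apply: dom_cvgM; last first.
  apply: dom_cvgM; first exact: dom_cvg_qp_scaled.
  apply: (dom_cvg_qp_scaledV (s := S)) => // m; apply: filterS (near_leq m) => N h; exact: leqW.
apply: dom_cvgM; first apply: dom_cvgM.
- by apply: (dom_cvg_const (M := 1)) => [|k]; rewrite ?ler01 // cmodX mul1r.
- by apply: dom_cvgM; [exact: dom_cvg_qp_cst | exact: dom_cvg_qpV_cst].
- apply: dom_cvgM; first exact: (dom_cvg_qp_index _ sN).
  case: eqP => [_|/eqP ji]; first exact: (dom_cvg_qpV_index Pq sN).
  apply: (dom_cvg_qpV_index (s := fun N k => (N - k).+1)) => [|k m]; first exact: dA.
  by apply: filterS (sN k m) => N h; exact: leqW.
Qed.

Let cvg_side A B A' B' al be ga :
  (forall j, A j != 0) -> distinct_nodes A -> (forall i j, P (A' j * A i) != 0) ->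
  residue_decay al A B ->
  (fun M => \sum_(i < r) \sum_(0 <= m < M.+1) fin_term (fun x => al / x + be + ga * x) A B A' B' M i m)
  @ \oo --> res_sum (fun x => al / x + be + ga * x) A B A' B'.
Proof.
move=> A0 dA nAA' rd; apply: cvg_bigsum => i.
have [s s01 h] := dom_cvg_fin_term B' be ga A0 dA (nAA' i) rd.
have c := dom_cvg_nsum s01 h.
have e : (fun M => nsum (fun m => ((m < M.+1)%N)%:R * fin_term (fun x => al / x + be + ga * x) A B A' B' M i m)) =
  (fun M => \sum_(0 <= m < M.+1) fin_term (fun x => al / x + be + ga * x) A B A' B' M i m).
  by apply/funext => M; rewrite nsum_ltn.
by rewrite e in c; exact: c.
Qed.

Theorem sum_residues A B A' B' al be ga : (1 < r)%N ->
  (forall j, A j != 0) -> (forall j, B j != 0) -> (forall j, A' j != 0) -> (forall j, B' j != 0) ->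
  distinct_nodes A -> distinct_nodes A' -> (forall i j, P (A' j * A i) != 0) ->
  residue_decay al A B -> residue_decay ga A' B' ->
  res_sum (fun x => al / x + be + ga * x) A B A' B' =
  res_sum (fun x => ga / x + be + al * x) A' B' A B.
Proof.
move=> r1 A0 B0 A'0 B'0 dA dA' nAA' rd rd'.
have h1 := @cvg_side A B A' B' al be ga A0 dA nAA' rd.
have nA'A i j : P (A j * A' i) != 0 by rewrite mulrC.
have h2 := @cvg_side A' B' A B ga be al A'0 dA' nA'A rd'.
have e : (fun M => \sum_(i < r) \sum_(0 <= m < M.+1) fin_term (fun x => al / x + be + ga * x) A B A' B' M i m) =
  (fun M => \sum_(i < r) \sum_(0 <= m < M.+1) fin_term (fun x => ga / x + be + al * x) A' B' A B M i m).
  by apply/funext => M; exact: fin_identity.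
by rewrite e in h1; rewrite -(cvg_lim _ h1) // -(cvg_lim _ h2).
Qed.
End Lists.
End Residues.

(** * The five-term relation for 4-psi-4 *)

Ltac nz := rewrite ?oppr_eq0 ?expf_neq0; repeat (apply/andP; split); try assumption; try done.
Ltac fz := field; nz.

(** Passage from the residue identity to the form of [five_term]. The balancing q = mu b1 b2 / (a1
    a2) turns the weight of the node q into the factor of the second half-line in [bilateral4]. *)
Lemma five_term_certificate (K : fieldType) (q mu a1 a2 b1 b2 b3 b4 p ta1 ta2 ta3 ta4 tb1 tb2 tb3 tb4
    t11 t21 t12 t22 t33 t34 t43 t44 t1m t2m t3m t4m a12 a21 b34 b43 tm
    X1 X2 X3 Y1 Y2 Y3 : K) :
  q != 0 -> mu != 0 -> a1 != 0 -> a2 != 0 -> b1 != 0 -> b2 != 0 -> b3 != 0 -> b4 != 0 -> p != 0 ->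
  ta1 != 0 -> ta2 != 0 -> ta3 != 0 -> ta4 != 0 -> tb3 != 0 -> tb4 != 0 -> a12 != 0 -> a21 != 0 -> b34 != 0 -> b43 != 0 ->
  q = mu * (b1 * b2) / (a1 * a2) ->
  t11 / p ^+ 2 * (t21 / a21) * (t1m / ta1) * X1 + t12 / a12 * (t22 / p ^+ 2) * (t2m / ta2) * X2 +
    - (b1 / q) * tb1 / (- (a1 / q) * ta1) * (- (b2 / q) * tb2 / (- (a2 / q) * ta2)) *
      (tm / p ^+ 2) * X3 =
  t33 / p ^+ 2 * (t34 / b34) * (- (b3 / mu / q) * t3m / (- (b3 / q) * tb3)) * Y1 +
    t43 / b43 * (t44 / p ^+ 2) * (- (b4 / mu / q) * t4m / (- (b4 / q) * tb4)) * Y2 +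
    ta3 / tb3 * (ta4 / tb4) * (- mu^-1 * tm / p ^+ 2) * Y3 ->
  ta3 * ta4 * tm / (mu * (tb3 * tb4) * p ^+ 2) *
    (Y3 + q * (tb1 * tb2 * tb3 * tb4 / (ta1 * ta2 * ta3 * ta4)) * X3) +
    t11 * t21 * t1m / (p ^+ 2 * a21 * ta1) * X1 + t12 * t22 * t2m / (p ^+ 2 * a12 * ta2) * X2 =
  t33 * t34 * t3m / (p ^+ 2 * mu * b34 * tb3) * Y1 + t43 * t44 * t4m / (p ^+ 2 * mu * b43 * tb4) * Y2.
Proof.
move=> q0 mu0 a10 a20 b10 b20 b30 b40 p0 ta10 ta20 ta30 ta40 tb30 tb40 a120 a210 b340 b430 eq_q.
rewrite (_ : t11 / p ^+ 2 * (t21 / a21) * (t1m / ta1) = t11 * t21 * t1m / (p ^+ 2 * a21 * ta1)); last by fz.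
rewrite (_ : t12 / a12 * (t22 / p ^+ 2) * (t2m / ta2) = t12 * t22 * t2m / (p ^+ 2 * a12 * ta2)); last by fz.
rewrite (_ : t33 / p ^+ 2 * (t34 / b34) * (- (b3 / mu / q) * t3m / (- (b3 / q) * tb3)) =
  t33 * t34 * t3m / (p ^+ 2 * mu * b34 * tb3)); last by fz.
rewrite (_ : t43 / b43 * (t44 / p ^+ 2) * (- (b4 / mu / q) * t4m / (- (b4 / q) * tb4)) =
  t43 * t44 * t4m / (p ^+ 2 * mu * b43 * tb4)); last by fz.
set c := ta3 * ta4 * tm / (mu * (tb3 * tb4) * p ^+ 2).
set k := q * (tb1 * tb2 * tb3 * tb4 / (ta1 * ta2 * ta3 * ta4)).
rewrite (_ : ta3 / tb3 * (ta4 / tb4) * (- mu^-1 * tm / p ^+ 2) = - c); last by rewrite /c; fz.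
rewrite (_ : - (b1 / q) * tb1 / (- (a1 / q) * ta1) * (- (b2 / q) * tb2 / (- (a2 / q) * ta2)) *
      (tm / p ^+ 2) = c * k); last first.
  transitivity (b1 * b2 / (a1 * a2) * (tb1 * tb2 / (ta1 * ta2)) * (tm / p ^+ 2)); first by fz.
  have -> : b1 * b2 / (a1 * a2) = q / mu by rewrite eq_q; fz.
  by rewrite /c /k; fz.
move: (_ / _) (_ / _) (_ / _) (_ / _) => c2 c1 d2 d1 E.
apply: (addrI (- c * Y3)).
transitivity (d1 * X1 + d2 * X2 + c * k * X3); first by ring.
by rewrite E; ring.
Qed.

Section ThreeTerm.
Context {R : realType} {K : numFieldType} {KR : modulus R K}.
Local Notation cmod := (@cmod R K KR).
Context {q : K} {hq : nome q}.
Local Notation P := (qpoch_inf q).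
Local Notation qp := (qpoch_fin q).
Local Notation th := (qtheta (q := q)).

Let q0 : q != 0 := nome_neq0.
Let q1 : cmod q < 1 := nome_lt1.
Let qX0 n : q ^+ n != 0. Proof. by rewrite expf_neq0. Qed.
Let Pq : P q != 0 := qpoch_inf_q_neq0 (hq := hq).

Definition res_weight r (A B : 'I_r -> K) i j : K :=
  th (B j / A i) / (if j == i then P q ^+ 2 else th (A j / A i)).

(** Trading the finite symbols for quotients of infinite products completes the constants P (B_j /
    A_i) and P (A_j / A_i) to thetas, gathered in [res_weight], and leaves a summand made of factors
    P (y q^m). *)
Lemma res_termE r (h : K -> K) (A B A' B' : 'I_r -> K) i m :
  (forall j, A j != 0) -> (forall j, B j != 0) ->
  (forall j, P (q * A i / A j) != 0) -> (forall j, P (q * A i / B j) != 0) ->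
  res_term (q := q) h A B A' B' i m = \prod_(j < r) res_weight A B i j *
    (h (A i * q ^+ m) * (\prod_(j < r) (B j / A j)) ^+ m *
     \prod_(j < r) (P (B' j * A i * q ^+ m) * P (q * A i / A j * q ^+ m) /
        (P (A' j * A i * q ^+ m) * P (q * A i / B j * q ^+ m)))).
Proof.
move=> A0 B0 nA nB; rewrite /res_term mulrCA; rewrite -!(mulrA (h _)); congr (_ * _).
rewrite mulrA -prodrXl -!big_split /=; apply: eq_bigr => j _.
have hA := qpoch_infX_neq0 (hq := hq) m (nA j); have hB := qpoch_infX_neq0 (hq := hq) m (nB j).
have -> : qp (q * A i / B j) m / qp (q * A i / A j) m = P (q * A i / B j) / P (q * A i / A j) *
    (P (q * A i / A j * q ^+ m) / P (q * A i / B j * q ^+ m)).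
  have := nA j; rewrite (qpoch_inf_qp (q * A i / A j) m) (qpoch_inf_qp (q * A i / B j) m).
  rewrite mulf_eq0 negb_or => /andP[hA' _].
  by field; rewrite hA hB hA'.
rewrite /res_coef /res_weight /qtheta.
have -> : q / (B j / A i) = q * A i / B j by field; rewrite A0 B0.
case: eqP => [->|/eqP ji]; last first.
  have -> : q / (A j / A i) = q * A i / A j by field; rewrite !A0.
  by rewrite !invfM; ring.
by rewrite mulfK // !invfM; ring.
Qed.

Definition vec3 (x y z : K) (i : 'I_3) : K := nth 0 [:: x; y; z] i.

Lemma prod3 (F : 'I_3 -> K) : \prod_(j < 3) F j = F (inord 0) * F (inord 1) * F (inord 2).
Proof.
rewrite !big_ord_recl big_ord0 mulr1 mulrA; congr (F _ * F _ * F _); apply: val_inj;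
  by rewrite /= inordK.
Qed.

Lemma vec3E x y z : (vec3 x y z (inord 0) = x) * (vec3 x y z (inord 1) = y) * (vec3 x y z (inord 2) = z).
Proof. by rewrite /vec3 !inordK. Qed.

(** The third pairs are tied by A3' = q / A3 and B3' = q / B3, so that they only enter through a
    quotient of thetas. Such a quotient is quasi-periodic: its factors cancel in the summand, and
    only the constant [res_weight] and the argument keep a trace of it. *)
Lemma nsum_residue3 A1 A2 A3 B1 B2 B3 A1' A2' A3' B1' B2' B3' (i : 'I_3) :
  let A := vec3 A1 A2 A3 in let B := vec3 B1 B2 B3 in
  let A' := vec3 A1' A2' A3' in let B' := vec3 B1' B2' B3' in
  (forall j, A j != 0) -> (forall j, B j != 0) ->
  (forall j, P (q * A i / A j) != 0) -> (forall j, P (q * A i / B j) != 0) ->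
  (forall j, P (A' j * A i) != 0) ->
  A3' = q / A3 -> B3' = q / B3 -> B1 / A1 * (B2 / A2) * (B3 / A3) = q ->
  nsum (res_term (q := q) (fun x => 0 / x + 1 + 0 * x) A B A' B' i) =
  \prod_(j < 3) res_weight A B i j *
  u4 (q := q) (B1' * A i) (B2' * A i) (q * A i / A1) (q * A i / A2)
    (A1' * A i) (A2' * A i) (q * A i / B1) (q * A i / B2).
Proof.
move=> A B A' B' A0 B0 nA nB nA' eA eB e.
have nA1 := nA' (inord 0); have nA2 := nA' (inord 1); have nA3 := nA' (inord 2).
have nB1 := nB (inord 0); have nB2 := nB (inord 1); have nB3 := nB (inord 2).
rewrite /B /A' !vec3E in nA1 nA2 nA3 nB1 nB2 nB3.
rewrite /u4 -nsumZ; last exact: geo_bounded_u4.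
apply: eq_nsum => m; rewrite res_termE // mul0r mul0r add0r addr0 mul1r; congr (_ * _).
rewrite !prod3 /A /B /A' /B' !vec3E e /u4_term -/A; congr (_ * _).
have hA3 := qpoch_infX_neq0 (hq := hq) m nA3; have hB3 := qpoch_infX_neq0 (hq := hq) m nB3.
have e1 : q * A i / A3 = A3' * A i by rewrite eA; ring.
have e2 : q * A i / B3 = B3' * A i by rewrite eB; ring.
rewrite e1 e2 in hB3 *.
rewrite !invfM; set X := P (A3' * A i * _) in hA3 *; set Y := P (B3' * A i * _) in hB3 *.
rewrite (_ : Y * X * (X^-1 * Y^-1) = 1); last by field; rewrite hA3 hB3.
by rewrite mulr1; ring.
Qed.

Section FiveTerm.
Variables a1 a2 a3 a4 b1 b2 b3 b4 mu : K.
Hypotheses (a10 : a1 != 0) (a20 : a2 != 0) (a30 : a3 != 0) (a40 : a4 != 0).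
Hypotheses (b10 : b1 != 0) (b20 : b2 != 0) (b30 : b3 != 0) (b40 : b4 != 0) (mu0 : mu != 0).
Hypothesis mua : mu * (b1 * b2) = q * (a1 * a2).
Hypothesis mub : b3 * b4 = mu * (q * (a3 * a4)).

(* [x] is generic when it is not an integral power of [q]. *)
Definition qgeneric x := (x != 0) && (th x != 0).
Local Notation generic := qgeneric.

Lemma generic_neq0 x : generic x -> x != 0. Proof. by case/andP. Qed.
Lemma generic_th x : generic x -> th x != 0. Proof. by case/andP. Qed.

Lemma genericV x : generic x -> generic x^-1.
Proof. by case/andP=> x0 tx; rewrite /generic invr_eq0 x0 thV // mulf_neq0 // oppr_eq0 invr_eq0. Qed.

Lemma generic_qM x : generic x -> generic (q * x).
Proof.
case/andP=> x0 tx; rewrite /generic mulf_neq0 //=.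
by have := th_shift_neq0 (hq := hq) 1 x0 tx; rewrite expr1.
Qed.

Lemma generic_Vq x : generic x -> generic (x / q).
Proof. by move=> /genericV/generic_qM/genericV; rewrite invfM invrK mulrC. Qed.

Lemma generic_P x : generic x -> P x != 0.
Proof. by case/andP=> _ /th_neq0[]. Qed.

Lemma generic_qV x : generic x -> generic (q / x).
Proof. by move=> /genericV/generic_qM. Qed.

Hypotheses (ga1 : generic a1) (ga2 : generic a2) (ga3 : generic a3) (ga4 : generic a4).
Hypotheses (gb1 : generic b1) (gb2 : generic b2) (gb3 : generic b3) (gb4 : generic b4).
Hypotheses (ga12 : generic (a1 / a2)) (gb34 : generic (b3 / b4)) (gmu : generic mu).
Hypotheses (g11 : generic (a1 / b1)) (g12 : generic (a1 / b2)) (g13 : generic (a1 / b3)) (g14 : generic (a1 / b4)).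
Hypotheses (g21 : generic (a2 / b1)) (g22 : generic (a2 / b2)) (g23 : generic (a2 / b3)) (g24 : generic (a2 / b4)).
Hypotheses (g33 : generic (a3 / b3)) (g34 : generic (a3 / b4)) (g43 : generic (a4 / b3)) (g44 : generic (a4 / b4)).
Hypotheses (gm1 : generic (a1 / mu)) (gm2 : generic (a2 / mu)) (gm3 : generic (mu / b3)) (gm4 : generic (mu / b4)).

(** The poles q^(m+1), from the node q of A, and q^-m, from the node 1 of A', exhaust the integral
    powers of q: together they produce the bilateral series. The third pairs contribute the factor
    theta (x / mu) / theta (x), where mu is fixed by the requirement that both products of ratios
    B_j / A_j and B'_j / A'_j equal q. *)
Let A := vec3 a1 a2 q.
Let B := vec3 b1 b2 (q * mu).
Let A' := vec3 (q / b3) (q / b4) 1.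
Let B' := vec3 (q / a3) (q / a4) mu^-1.

Let forall3 (Q : 'I_3 -> Prop) : Q (inord 0) -> Q (inord 1) -> Q (inord 2) -> forall i, Q i.
Proof.
move=> h0 h1 h2 [[|[|[|i]]] h] //; [move: h0|move: h1|move: h2];
  by congr (Q _); apply: val_inj; rewrite /= inordK.
Qed.

Let A0 j : A j != 0. Proof. by elim/forall3: j; rewrite /A !vec3E. Qed.
Let B0 j : B j != 0. Proof. by elim/forall3: j; rewrite /B !vec3E // mulf_neq0. Qed.
Let A'0 j : A' j != 0. Proof. by elim/forall3: j; rewrite /A' !vec3E ?oner_neq0 // mulf_neq0 ?invr_eq0. Qed.
Let B'0 j : B' j != 0. Proof. by elim/forall3: j; rewrite /B' !vec3E ?invr_eq0 // mulf_neq0 ?invr_eq0. Qed.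

Let gen1 x y : generic x -> y = x -> P y != 0. Proof. by move=> h ->; exact: generic_P. Qed.
Let gen2 x y : generic x -> y = q * x -> P y != 0. Proof. by move=> h ->; exact/generic_P/generic_qM. Qed.
Let gen3 x y : generic x -> y = x^-1 -> P y != 0. Proof. by move=> h ->; exact/generic_P/genericV. Qed.
Let gen4 x y : generic x -> y = q / x -> P y != 0. Proof. by move=> h ->; exact/generic_P/generic_qV. Qed.
Let gen5 x y : generic x -> y = x / q -> P y != 0. Proof. by move=> h ->; exact/generic_P/generic_Vq. Qed.
Let gen6 x y : generic x -> y = q * (q / x) -> P y != 0. Proof. by move=> h ->; exact/generic_P/generic_qM/generic_qV. Qed.

Let gen7 x y : generic x -> y = q * (q * x) -> P y != 0. Proof. by move=> h ->; exact/generic_P/generic_qM/generic_qM. Qed.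

Let nAA' i j : P (A' j * A i) != 0.
Proof.
elim/forall3: i; elim/forall3: j; rewrite /A /A' !vec3E ?mul1r.
- by apply: (gen2 g13); fz.
- by apply: (gen2 g14); fz.
- exact: generic_P.
- by apply: (gen2 g23); fz.
- by apply: (gen2 g24); fz.
- exact: generic_P.
- by apply: (gen6 gb3); fz.
- by apply: (gen6 gb4); fz.
- exact: Pq.
Qed.

Let dA : distinct_nodes (q := q) A.
Proof.
move=> i j; elim/forall3: i; elim/forall3: j; rewrite /A !vec3E ?eqxx // => _.
- by apply: (gen1 ga12); fz.
- by apply: (gen5 ga1); fz.
- by apply: (gen3 ga12); fz.
- by apply: (gen5 ga2); fz.
- by apply: (gen4 ga1); fz.
- by apply: (gen4 ga2); fz.
Qed.

Let dA' : distinct_nodes (q := q) A'.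
Proof.
move=> i j; elim/forall3: i; elim/forall3: j; rewrite /A' !vec3E ?eqxx // => _.
- by apply: (gen3 gb34); fz.
- by apply: (gen4 gb3); fz.
- by apply: (gen1 gb34); fz.
- by apply: (gen4 gb4); fz.
- by apply: (gen5 gb3); fz.
- by apply: (gen5 gb4); fz.
Qed.

Let nqA i j : P (q * A i / A j) != 0.
Proof.
have [->|ij] := eqVneq i j; first by rewrite mulfK.
by rewrite -mulrA qpoch_inf_mulq_neq0 // dA.
Qed.

Let nqA' i j : P (q * A' i / A' j) != 0.
Proof.
have [->|ij] := eqVneq i j; first by rewrite mulfK.
by rewrite -mulrA qpoch_inf_mulq_neq0 // dA'.
Qed.

Let nqB i j : P (q * A i / B j) != 0.
Proof.
elim/forall3: i; elim/forall3: j; rewrite /A /B !vec3E.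
- by apply: (gen2 g11); fz.
- by apply: (gen2 g12); fz.
- by apply: (gen1 gm1); fz.
- by apply: (gen2 g21); fz.
- by apply: (gen2 g22); fz.
- by apply: (gen1 gm2); fz.
- by apply: (gen6 gb1); fz.
- by apply: (gen6 gb2); fz.
- by apply: (gen4 gmu); fz.
Qed.

Let nqB' i j : P (q * A' i / B' j) != 0.
Proof.
elim/forall3: i; elim/forall3: j; rewrite /A' /B' !vec3E.
- by apply: (gen2 g33); fz.
- by apply: (gen2 g43); fz.
- by apply: (gen7 gm3); fz.
- by apply: (gen2 g34); fz.
- by apply: (gen2 g44); fz.
- by apply: (gen7 gm4); fz.
- by apply: (gen1 ga3); fz.
- by apply: (gen1 ga4); fz.
- by apply: (gen2 gmu); fz.
Qed.

Let cmodq : cmod q = 1 * \prod_(j < 3) cmod (B j / A j).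
Proof.
rewrite mul1r -cmod_prod; congr cmod; rewrite prod3 /A /B !vec3E.
have -> : q = mu * (b1 * b2) / (a1 * a2) by rewrite mua; fz.
by fz.
Qed.

Let cmodq' : cmod q = 1 * \prod_(j < 3) cmod (B' j / A' j).
Proof.
rewrite mul1r -cmod_prod; congr cmod; rewrite prod3 /A' /B' !vec3E.
have e : b3 * b4 / (mu * (a3 * a4)) = q by rewrite mub; fz.
by rewrite -[LHS]e; fz.
Qed.

Let residues0 : res_sum (q := q) (fun x => 0 / x + 1 + 0 * x) A B A' B' =
  res_sum (q := q) (fun x => 0 / x + 1 + 0 * x) A' B' A B.
Proof.
apply: sum_residues => //.
- by exists 1; [split=> //; left | rewrite -cmodq].
- by exists 1; [split=> //; left | rewrite -cmodq'].
Qed.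

(** The 4-psi-4 at argument q up to a quotient of infinite products, as [psi_bilateral4] shows. The
    second sum is the half k < 0, re-indexed from k = -1; this shift accounts for the factor q and
    for the parameters q^2 / x. *)
Definition bilateral4 x1 x2 x3 x4 y1 y2 y3 y4 :=
  u4 (q := q) y1 y2 y3 y4 x1 x2 x3 x4 +
  q * (th y1 * th y2 * th y3 * th y4 / (th x1 * th x2 * th x3 * th x4)) *
  u4 (q := q) (q * (q / x1)) (q * (q / x2)) (q * (q / x3)) (q * (q / x4))
    (q * (q / y1)) (q * (q / y2)) (q * (q / y3)) (q * (q / y4)).

Let thq x : x != 0 -> th (x / q) = - (x / q) * th x.
Proof.
move=> x0; have y0 : x / q != 0 by rewrite mulf_neq0 ?invr_eq0.
have := th_shift (hq := hq) 1 y0; rewrite expr1 mulrC divfK // => ->.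
by rewrite !expr1 (_ : 'C(1, 2) = 0%N) // expr0 invr1 mulr1; fz.
Qed.

Theorem five_term :
  th a3 * th a4 * th mu / (mu * (th b3 * th b4) * P q ^+ 2) * bilateral4 a1 a2 a3 a4 b1 b2 b3 b4 +
  th (b1 / a1) * th (b2 / a1) * th (a1 / mu) / (P q ^+ 2 * th (a2 / a1) * th a1) *
    u4 (q := q) (q * a1 / a3) (q * a1 / a4) q (q * a1 / a2) (q * a1 / b3) (q * a1 / b4) (q * a1 / b1) (q * a1 / b2) +
  th (b1 / a2) * th (b2 / a2) * th (a2 / mu) / (P q ^+ 2 * th (a1 / a2) * th a2) *
    u4 (q := q) (q * a2 / a3) (q * a2 / a4) (q * a2 / a1) q (q * a2 / b3) (q * a2 / b4) (q * a2 / b1) (q * a2 / b2) =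
  th (b3 / a3) * th (b3 / a4) * th (b3 / mu) / (P q ^+ 2 * mu * th (b3 / b4) * th b3) *
    u4 (q := q) (q * b1 / b3) (q * b2 / b3) q (q * b4 / b3) (q * a1 / b3) (q * a2 / b3) (q * a3 / b3) (q * a4 / b3) +
  th (b4 / a3) * th (b4 / a4) * th (b4 / mu) / (P q ^+ 2 * mu * th (b4 / b3) * th b4) *
    u4 (q := q) (q * b1 / b4) (q * b2 / b4) (q * b3 / b4) q (q * a1 / b4) (q * a2 / b4) (q * a3 / b4) (q * a4 / b4).
Proof.
have E := residues0; rewrite /res_sum in E.
have sum3 (F : 'I_3 -> K) : \sum_(j < 3) F j = F (inord 0) + F (inord 1) + F (inord 2).
  rewrite !big_ord_recl big_ord0 addr0 addrA; congr (F _ + F _ + F _); apply: val_inj;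
    by rewrite /= inordK.
have pA : b1 / a1 * (b2 / a2) * (q * mu / q) = q.
  have -> : b1 / a1 * (b2 / a2) * (q * mu / q) = mu * (b1 * b2) / (a1 * a2) by fz.
  by rewrite mua; fz.
have pA' : q / a3 / (q / b3) * (q / a4 / (q / b4)) * (mu^-1 / 1) = q.
  have -> : q / a3 / (q / b3) * (q / a4 / (q / b4)) * (mu^-1 / 1) = b3 * b4 / (mu * (a3 * a4)) by fz.
  by rewrite mub; fz.
have eA i : nsum (res_term (q := q) (fun x => 0 / x + 1 + 0 * x) A B A' B' i) =
    \prod_(j < 3) res_weight A B i j * u4 (q := q) (q / a3 * A i) (q / a4 * A i) (q * A i / a1)
    (q * A i / a2) (q / b3 * A i) (q / b4 * A i) (q * A i / b1) (q * A i / b2).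
  by apply: nsum_residue3 => //; fz.
have eA' i : nsum (res_term (q := q) (fun x => 0 / x + 1 + 0 * x) A' B' A B i) =
    \prod_(j < 3) res_weight A' B' i j * u4 (q := q) (b1 * A' i) (b2 * A' i) (q * A' i / (q / b3))
    (q * A' i / (q / b4)) (a1 * A' i) (a2 * A' i) (q * A' i / (q / a3)) (q * A' i / (q / a4)).
  apply: nsum_residue3 => //; last by fz.
  - by move=> j; rewrite mulrC.
  - by fz.
rewrite !sum3 !eA !eA' !prod3 in E.
have ne (k l : nat) : (k < 3)%N -> (l < 3)%N -> (inord k == inord l :> 'I_3) = (k == l).
  by move=> kl ll; rewrite -val_eqE /= !inordK.
rewrite /res_weight !ne // /A /B /A' /B' !vec3E /= in E.
have sy (x y : K) : x != 0 -> y = q / x -> th y = th x by move=> x0 ->; exact: th_sym.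
have dv (x y : K) : x != 0 -> y != 0 -> x / y != 0 by move=> *; rewrite mulf_neq0 ?invr_eq0.
have s1 := sy (a1 / mu) (q * mu / a1) (dv _ _ a10 mu0); have s2 := sy (a2 / mu) (q * mu / a2) (dv _ _ a20 mu0).
have s3 : th (mu^-1 / (q / b3)) = - (b3 / mu / q) * th (b3 / mu).
  by rewrite -thq ?dv //; congr th; fz.
have s4 : th (mu^-1 / (q / b4)) = - (b4 / mu / q) * th (b4 / mu).
  by rewrite -thq ?dv //; congr th; fz.
have s5 : th (1 / (q / b3)) = - (b3 / q) * th b3 by rewrite -thq //; congr th; fz.
have s6 : th (1 / (q / b4)) = - (b4 / q) * th b4 by rewrite -thq //; congr th; fz.
have dd (x y : K) : x != 0 -> y != 0 -> q / x / (q / y) = y / x by move=> *; fz.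
have uE x1 x2 x3 x4 y1 y2 y3 y4 x1' x2' x3' x4' y1' y2' y3' y4' :
  x1 = x1' -> x2 = x2' -> x3 = x3' -> x4 = x4' -> y1 = y1' -> y2 = y2' -> y3 = y3' -> y4 = y4' ->
  u4 (q := q) x1 x2 x3 x4 y1 y2 y3 y4 = u4 (q := q) x1' x2' x3' x4' y1' y2' y3' y4'.
  by move=> -> -> -> -> -> -> -> ->.
have U1 : u4 (q := q) (q / a3 * a1) (q / a4 * a1) (q * a1 / a1) (q * a1 / a2) 
    (q / b3 * a1) (q / b4 * a1) (q * a1 / b1) (q * a1 / b2) =
  u4 (q := q) (q * a1 / a3) (q * a1 / a4) q (q * a1 / a2) (q * a1 / b3) (q * a1 / b4) (q * a1 / b1) (q * a1 / b2).
  by apply: uE; fz.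
have U2 : u4 (q := q) (q / a3 * a2) (q / a4 * a2) (q * a2 / a1) (q * a2 / a2) 
    (q / b3 * a2) (q / b4 * a2) (q * a2 / b1) (q * a2 / b2) =
  u4 (q := q) (q * a2 / a3) (q * a2 / a4) (q * a2 / a1) q (q * a2 / b3) (q * a2 / b4) (q * a2 / b1) (q * a2 / b2).
  by apply: uE; fz.
have U3 : u4 (q := q) (q / a3 * q) (q / a4 * q) (q * q / a1) (q * q / a2) 
    (q / b3 * q) (q / b4 * q) (q * q / b1) (q * q / b2) =
  u4 (q := q) (q * (q / a1)) (q * (q / a2)) (q * (q / a3)) (q * (q / a4))
    (q * (q / b1)) (q * (q / b2)) (q * (q / b3)) (q * (q / b4)).
  transitivity (u4 (q := q) (q * q / a1) (q * q / a2) (q / a3 * q) (q / a4 * q)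
    (q * q / b1) (q * q / b2) (q / b3 * q) (q / b4 * q)); last by apply: uE; fz.
  by apply: eq_nsum => n; rewrite /u4_term; congr (_ * (_ / _)); ring.
have V1 : u4 (q := q) (b1 * (q / b3)) (b2 * (q / b3)) (q * (q / b3) / (q / b3))
    (q * (q / b3) / (q / b4)) (a1 * (q / b3)) (a2 * (q / b3))
    (q * (q / b3) / (q / a3)) (q * (q / b3) / (q / a4)) =
  u4 (q := q) (q * b1 / b3) (q * b2 / b3) q (q * b4 / b3) (q * a1 / b3) (q * a2 / b3) (q * a3 / b3) (q * a4 / b3).
  by apply: uE; fz.
have V2 : u4 (q := q) (b1 * (q / b4)) (b2 * (q / b4)) (q * (q / b4) / (q / b3))
    (q * (q / b4) / (q / b4)) (a1 * (q / b4)) (a2 * (q / b4))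
    (q * (q / b4) / (q / a3)) (q * (q / b4) / (q / a4)) =
  u4 (q := q) (q * b1 / b4) (q * b2 / b4) (q * b3 / b4) q (q * a1 / b4) (q * a2 / b4) (q * a3 / b4) (q * a4 / b4).
  by apply: uE; fz.
have V3 : u4 (q := q) (b1 * 1) (b2 * 1) (q * 1 / (q / b3)) (q * 1 / (q / b4)) 
    (a1 * 1) (a2 * 1) (q * 1 / (q / a3)) (q * 1 / (q / a4)) = u4 (q := q) b1 b2 b3 b4 a1 a2 a3 a4.
  by apply: uE; fz.
have qmu : q * mu / q = mu by fz.
rewrite U1 U2 U3 V1 V2 V3 qmu s1 ?s2 ?s3 ?s4 ?s5 ?s6 ?(th_sym, thq) ?dd // in E; try by fz.
rewrite !divr1 thV // !th_sym // in E.
apply: five_term_certificate E; try assumption; try exact: generic_th.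
- by rewrite -invf_div; exact/generic_th/genericV.
- by rewrite -invf_div; exact/generic_th/genericV.
- by rewrite mua; fz.
Qed.
End FiveTerm.
End ThreeTerm.

(** * The three-term relation for 8-Psi-8 *)

Lemma three_term_certificate (K : fieldType) (q a b c d e f g z p ta tb tc td te tf tg tba tea tab tae tac
    tad taf tag teb tbe bc bd bf bg ec ed ef eg Wa Wb We Wq : K) :
  q != 0 -> a != 0 -> b != 0 -> c != 0 -> d != 0 -> e != 0 -> f != 0 -> g != 0 -> p != 0 ->
  ta != 0 -> tb != 0 -> tc != 0 -> td != 0 -> te != 0 -> tf != 0 -> tg != 0 ->
  tab != 0 -> tae != 0 -> teb != 0 -> tbe != 0 ->
  tba = - (b / a) * tab -> tea = - (e / a) * tae -> z * (b * c * d * e * f * g) = q ^+ 2 * a ^+ 3 ->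
  bc / p ^+ 2 * (bd / teb) * (bf / tab) * (bg / tb) / b * Wb +
  ec / tbe * (ed / p ^+ 2) * (ef / tae) * (eg / te) / e * We +
  tc / tba * (td / tea) * (tf / p ^+ 2) * (tg / ta) / a * Wa +
  tac / (- (b / q) * tb) * (tad / (- (e / q) * te)) * (taf / (- (a / q) * ta)) * (tag / p ^+ 2) / q * Wq = 0 ->
  tc * td * tf * tg / (tba * tea * ta) / a * (Wa - a * z * (- (b / a) * tab / tb * (- (c / a) * tac / tc) *
   (- (d / a) * tad / td) * (- (e / a) * tae / te) * (- (f / a) * taf / tf) * (- (g / a) * tag / tg)) * Wq) +
  bc * bd * bf * bg / (teb * tab * tb) / b * Wb + ec * ed * ef * eg / (tbe * tae * te) / e * We = 0.
Proof.
move=> q0 a0 b0 c0 d0 e0 f0 g0 p0 ta0 tb0 tc0 td0 te0 tf0 tg0 tab0 tae0 teb0 tbe0 tbaE teaE zE.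
have tba0 : tba != 0 by rewrite tbaE mulf_neq0 // oppr_eq0 mulf_neq0 ?invr_eq0.
have tea0 : tea != 0 by rewrite teaE mulf_neq0 // oppr_eq0 mulf_neq0 ?invr_eq0.
set Cb := bc * bd * bf * bg / _ / b; set Ce := ec * ed * ef * eg / _ / e.
set Ca := tc * td * tf * tg / _ / a.
rewrite (_ : bc / p ^+ 2 * (bd / teb) * (bf / tab) * (bg / tb) / b = p ^- 2 * Cb); last by rewrite /Cb; fz.
rewrite (_ : ec / tbe * (ed / p ^+ 2) * (ef / tae) * (eg / te) / e = p ^- 2 * Ce); last by rewrite /Ce; fz.
rewrite (_ : tc / tba * (td / tea) * (tf / p ^+ 2) * (tg / ta) / a = p ^- 2 * Ca); last by rewrite /Ca; fz.
set k := a * z * _.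
rewrite (_ : tac / (- (b / q) * tb) * (tad / (- (e / q) * te)) * (taf / (- (a / q) * ta)) *
  (tag / p ^+ 2) / q = p ^- 2 * (- (Ca * k))).
  by move=> E; rewrite -[RHS](mulr0 (p ^+ 2)) -E; field.
have -> : k = q ^+ 2 / (a ^+ 2) * (tab * tac * tad * tae * taf * tag / (tb * tc * td * te * tf * tg)).
  rewrite /k; have -> : z = q ^+ 2 * a ^+ 3 / (b * c * d * e * f * g) by rewrite -zE mulfK // !mulf_neq0.
  by fz.
have -> : Ca = tc * td * tf * tg / (b * e * tab * tae * ta) * a by rewrite /Ca tbaE teaE; fz.
by fz.
Qed.
Section Jackson.
Context {R : realType} {K : numFieldType} {KR : modulus R K}.
Local Notation cmod := (@cmod R K KR).
Context {q : K} {hq : nome q}.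
Local Notation P := (qpoch_inf q).
Local Notation th := (qtheta (q := q)).
Local Notation generic := (qgeneric (q := q)).

Let q0 : q != 0 := nome_neq0.
Let q1 : cmod q < 1 := nome_lt1.
Let qX0 n : q ^+ n != 0. Proof. by rewrite expf_neq0. Qed.
Let Pq : P q != 0 := qpoch_inf_q_neq0 (hq := hq).

Lemma th_qM x : x != 0 -> th (q * x) = - x^-1 * th x.
Proof.
move=> x0; have := th_shift (hq := hq) 1 x0.
by rewrite !expr1 (_ : 'C(1, 2) = 0%N) // expr0 invr1 mulr1 mulN1r.
Qed.

Lemma th_divq x : x != 0 -> th (x / q) = - (x / q) * th x.
Proof.
move=> x0; have y0 : x / q != 0 by rewrite mulf_neq0 ?invr_eq0.
by have := th_qM y0; rewrite mulrC divfK // => ->; fz.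
Qed.

(* The half-line sum over [x q^k] of the well-poised integrand with parameters [a; b, ..., g]. *)
Definition wp_term (a b c d e f g z x : K) k : K := (1 - x * x / a * q ^+ (2 * k)) * z ^+ k *
  (P (q * x / b * q ^+ k) * P (q * x / c * q ^+ k) * P (q * x / d * q ^+ k) *
   P (q * x / e * q ^+ k) * P (q * x / f * q ^+ k) * P (q * x / g * q ^+ k) /
   (P (b * x / a * q ^+ k) * P (c * x / a * q ^+ k) * P (d * x / a * q ^+ k) *
    P (e * x / a * q ^+ k) * P (f * x / a * q ^+ k) * P (g * x / a * q ^+ k))).

Definition wp a b c d e f g z x : K := nsum (wp_term a b c d e f g z x).

Lemma geo_bounded_wp a b c d e f g z x : cmod z < 1 ->
  P (b * x / a) != 0 -> P (c * x / a) != 0 -> P (d * x / a) != 0 ->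
  P (e * x / a) != 0 -> P (f * x / a) != 0 -> P (g * x / a) != 0 ->
  geo_bounded (wp_term a b c d e f g z x).
Proof.
move=> z1 *.
apply: (dom_cvg_geo_bounded (F := \oo) (U := fun _ : nat => wp_term a b c d e f g z x) (r := cmod z)).
  by rewrite cmod_ge0 z1.
apply: dom_cvgMr; last by dom_cvg_prod ltac:(exact: cvg_cst) ltac:(assumption).
apply: dom_cvgMl; last first.
  by apply: (dom_cvg_const (M := 1)) => [|k]; rewrite ?ler01 // cmodX mul1r.
apply: (dom_cvg_const (M := 1 + cmod (x * x / a))) => [|k].
  by rewrite addr_ge0 // cmod_ge0.
rewrite expr1n mulr1; apply: le_trans (ler_cmodB _ _) _.
by rewrite cmod1 lerD2l [leLHS]cmodM ler_piMr ?cmod_ge0 ?cmod_qX.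
Qed.

Section Relation.
Variables a b c d e f g z : K.
Hypotheses (ga : generic a) (gb : generic b) (gc : generic c) (gd : generic d) (ge : generic e)
  (gf : generic f) (gg : generic g).
Hypotheses (gba : generic (b / a)) (gea : generic (e / a)) (gbe : generic (b / e)).
Hypotheses (gca : generic (c / a)) (gda : generic (d / a)) (gfa : generic (f / a)) (gga : generic (g / a)).
Hypotheses (gbb : generic (b * b / a)) (gbc : generic (b * c / a)) (gbd : generic (b * d / a))
  (gbea : generic (b * e / a)) (gbf : generic (b * f / a)) (gbg : generic (b * g / a)).
Hypotheses (gee : generic (e * e / a)) (gec : generic (e * c / a)) (ged : generic (e * d / a))
  (gef : generic (e * f / a)) (geg : generic (e * g / a)).
Hypothesis zE : z * (b * c * d * e * f * g) = q ^+ 2 * a ^+ 3.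
Hypothesis z1 : cmod z < 1.

Let a0 := generic_neq0 ga. Let b0 := generic_neq0 gb. Let c0 := generic_neq0 gc.
Let d0 := generic_neq0 gd. Let e0 := generic_neq0 ge. Let f0 := generic_neq0 gf.
Let g0 := generic_neq0 gg.

Definition vec4 (x y z t : K) (i : 'I_4) : K := nth 0 [:: x; y; z; t] i.

Lemma prod4 (F : 'I_4 -> K) :
  \prod_(j < 4) F j = F (inord 0) * F (inord 1) * F (inord 2) * F (inord 3).
Proof.
rewrite !big_ord_recl big_ord0 mulr1 !mulrA; congr (F _ * F _ * F _ * F _); apply: val_inj;
  by rewrite /= inordK.
Qed.

Lemma vec4E x y u t : (vec4 x y u t (inord 0) = x) * (vec4 x y u t (inord 1) = y) *
  (vec4 x y u t (inord 2) = u) * (vec4 x y u t (inord 3) = t).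
Proof. by rewrite /vec4 !inordK. Qed.

Let forall4 (Q : 'I_4 -> Prop) :
  Q (inord 0) -> Q (inord 1) -> Q (inord 2) -> Q (inord 3) -> forall i, Q i.
Proof.
move=> h0 h1 h2 h3 [[|[|[|[|i]]]] h] //; [move: h0|move: h1|move: h2|move: h3];
  by congr (Q _); apply: val_inj; rewrite /= inordK.
Qed.

(** Since A' = A / a and B' = B / a, the reflection x -> a / x exchanges the two families of poles,
    and it changes the sign of h, the very-well-poised factor. The node a carries the half k >= 0 of
    the 8-Psi-8 and the node q its half k < 0; b and e carry the two 8-phi-7. *)
Let A := vec4 b e a q.
Let B := vec4 (q * a / c) (q * a / d) (q * a / f) (q * a / g).
Let A' i := A i / a.
Let B' i := B i / a.
Let h x := 1 / x + 0 + (- a^-1) * x.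

Let A0 j : A j != 0. Proof. by elim/forall4: j; rewrite /A !vec4E. Qed.
Let B0 j : B j != 0. Proof. by elim/forall4: j; rewrite /B !vec4E !mulf_neq0 ?invr_eq0. Qed.
Let A'0 j : A' j != 0. Proof. by rewrite mulf_neq0 ?invr_eq0. Qed.
Let B'0 j : B' j != 0. Proof. by rewrite mulf_neq0 ?invr_eq0. Qed.

Let gen1 x y : generic x -> y = x -> P y != 0. Proof. by move=> t ->; exact: generic_P. Qed.
Let gen2 x y : generic x -> y = q * x -> P y != 0. Proof. by move=> t ->; exact/generic_P/generic_qM. Qed.
Let gen3 x y : generic x -> y = x^-1 -> P y != 0. Proof. by move=> t ->; exact/generic_P/genericV. Qed.
Let gen4 x y : generic x -> y = q / x -> P y != 0. Proof. by move=> t ->; exact/generic_P/generic_qV. Qed.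
Let gen5 x y : generic x -> y = x / q -> P y != 0. Proof. by move=> t ->; exact/generic_P/generic_Vq. Qed.
Let gen6 x y : generic x -> y = q * (q / x) -> P y != 0.
Proof. by move=> t ->; exact/generic_P/generic_qM/generic_qV. Qed.

Let dA : distinct_nodes (q := q) A.
Proof.
move=> i j; elim/forall4: i; elim/forall4: j; rewrite /A !vec4E ?eqxx // => _.
- by apply: (gen1 gbe); fz.
- by apply: (gen1 gba); fz.
- by apply: (gen5 gb); fz.
- by apply: (gen3 gbe); fz.
- by apply: (gen1 gea); fz.
- by apply: (gen5 ge); fz.
- by apply: (gen3 gba); fz.
- by apply: (gen3 gea); fz.
- by apply: (gen5 ga); fz.
- by apply: (gen4 gb); fz.
- by apply: (gen4 ge); fz.
- by apply: (gen4 ga); fz.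
Qed.

Let dA' : distinct_nodes (q := q) A'.
Proof. by move=> i j ij; rewrite /A' invf_div mulrA divfK //; exact: dA. Qed.

Let nAA i j : P (A' j * A i) != 0.
Proof.
elim/forall4: i; elim/forall4: j; rewrite /A' /A !vec4E ?divfK //.
- by apply: (gen1 gbb); fz.
- by apply: (gen1 gbea); fz.
- by rewrite divff // mul1r; apply: generic_P.
- by apply: (gen2 gba); fz.
- by apply: (gen1 gbea); fz.
- by apply: (gen1 gee); fz.
- by rewrite divff // mul1r; apply: generic_P.
- by apply: (gen2 gea); fz.
- exact: generic_P.
- exact: generic_P.
- exact: generic_P.
- by apply: (gen2 gba); fz.
- by apply: (gen2 gea); fz.
- by rewrite divff // mul1r.
- by apply: (gen6 ga); fz.
Qed.

Let nqA i j : P (q * A i / A j) != 0.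
Proof.
have [->|ij] := eqVneq i j; first by rewrite mulfK.
by rewrite -mulrA qpoch_inf_mulq_neq0 // dA.
Qed.

Let nqB i j : P (q * A i / B j) != 0.
Proof.
elim/forall4: i; elim/forall4: j; rewrite /A /B !vec4E.
- by apply: (gen1 gbc); fz.
- by apply: (gen1 gbd); fz.
- by apply: (gen1 gbf); fz.
- by apply: (gen1 gbg); fz.
- by apply: (gen1 gec); fz.
- by apply: (gen1 ged); fz.
- by apply: (gen1 gef); fz.
- by apply: (gen1 geg); fz.
- by apply: (gen1 gc); fz.
- by apply: (gen1 gd); fz.
- by apply: (gen1 gf); fz.
- by apply: (gen1 gg); fz.
- by apply: (gen2 gca); fz.
- by apply: (gen2 gda); fz.
- by apply: (gen2 gfa); fz.
- by apply: (gen2 gga); fz.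
Qed.

Let prodBA : \prod_(j < 4) (B j / A j) = q * z.
Proof.
rewrite prod4 /A /B !vec4E.
have -> : z = q ^+ 2 * a ^+ 3 / (b * c * d * e * f * g).
  by rewrite -zE mulfK // !mulf_neq0.
by fz.
Qed.

Let AE : (A (inord 0) = b) * (A (inord 1) = e) * (A (inord 2) = a) * (A (inord 3) = q).
Proof. by rewrite /A !vec4E. Qed.

Let nP i : [/\ P (b * A i / a) != 0, P (c * A i / a) != 0, P (d * A i / a) != 0 &
  [/\ P (e * A i / a) != 0, P (f * A i / a) != 0 & P (g * A i / a) != 0]].
Proof.
have x0 := A0 i.
have := nAA i (inord 0); have := nAA i (inord 1); have := nqB i (inord 0); have := nqB i (inord 1).
have := nqB i (inord 2); have := nqB i (inord 3); rewrite /A' !AE /B !vec4E.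
have fl y : y != 0 -> q * A i / (q * a / y) = y * A i / a by move=> *; fz.
by rewrite !fl // ![_ / a * A i]mulrAC => *; split => //; split.
Qed.

Let termE i m : res_term (q := q) h A B A' B' i m =
  (\prod_(j < 4) res_weight (q := q) A B i j) / A i * wp_term a b c d e f g z (A i) m.
Proof.
have x0 := A0 i; rewrite res_termE //; rewrite -[RHS]mulrA; congr (_ * _).
rewrite prodBA prod4 /A' /B' /B !vec4E /wp_term /h.
have nx1 := qpoch_infX_neq0 (hq := hq) m (nAA i (inord 2)).
have nx2 := qpoch_infX_neq0 (hq := hq) m (nAA i (inord 3)).
rewrite /A' in nx1 nx2; rewrite !AE in nx1 nx2 *.
have fl y : y != 0 -> q * A i / (q * a / y) = y * A i / a by move=> *; fz.
have fk y : y != 0 -> q * a / y / a * A i = q * A i / y by move=> *; fz.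
rewrite !fl // !fk // divff // mul1r in nx1 nx2 *.
have qAq : q * A i / q = A i by fz.
rewrite mul1r qAq ![_ / a * A i]mulrAC in nx1 nx2 *.
have -> : ((A i * q ^+ m)^-1 + 0 + - a^-1 * (A i * q ^+ m)) * (q * z) ^+ m =
    (A i)^-1 * ((1 - A i * A i / a * q ^+ (2 * m)) * z ^+ m).
  by rewrite exprMn mul2n -addnn exprD; field; rewrite x0 qX0 a0.
rewrite !invfM; set X := P (A i * q ^+ m) in nx1 *; set Y := P (q * A i / a * q ^+ m) in nx2 *.
have XY : X * Y / (Y * X) = 1 by fz.
rewrite -[RHS]mul1r -XY !invfM; ring.
Qed.

Let geo_res i : geo_bounded (res_term (q := q) h A B A' B' i).
Proof.
have [? ? ? [? ? ?]] := nP i.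
apply: eq_geo_bounded (fun m => esym (termE i m)) _; apply: geo_boundedZ.
exact: geo_bounded_wp.
Qed.

Let residues0 : res_sum (q := q) h A B A' B' = 0.
Proof.
have prodBA' : \prod_(j < 4) (B' j / A' j) = q * z.
  by rewrite -prodBA; apply: eq_bigr => j _; rewrite /B' /A' invf_div mulrA divfK.
have r0 : 0 < cmod q by rewrite cmod_gt0.
(* Here h grows like 1/x along the nodes, which costs 1/|q| per step; against the ratio q z this
   leaves exactly the condition |z| < 1. *)
have w1 : 1 <= (cmod q)^-1 by rewrite invf_ge1 // ltW.
have E := @sum_residues _ _ _ _ hq 4 A B A' B' 1 0 (- a^-1) isT A0 B0 A'0 B'0 dA dA' nAA.
have rd (C D : 'I_4 -> K) al : \prod_(j < 4) (C j / D j) = q * z -> residue_decay (q := q) al D C.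
  move=> pr; exists (cmod q)^-1; first by split=> //; right; rewrite mulVf ?gt_eqF.
  by rewrite -cmod_prod pr cmodM mulKf ?gt_eqF.
have {}E := E (rd _ _ _ prodBA) (rd _ _ _ prodBA').
rewrite -/h in E.
(* By the antisymmetry of h the two sides of [sum_residues] are opposite to each other, and a sum
   equal to its opposite is 0. *)
suff opp : res_sum (q := q) (fun x => - a^-1 / x + 0 + 1 * x) A' B' A B = - res_sum (q := q) h A B A' B'.
  by move: E; rewrite opp => /eqP; rewrite -subr_eq0 opprK -mulr2n mulrn_eq0 /= => /eqP.
rewrite /res_sum -sumrN; apply: eq_bigr => i _.
rewrite -[RHS]mulN1r -[RHS](nsumZ _ (geo_res i)); apply: eq_nsum => m.
have x0 := A0 i.
rewrite /res_term /h [RHS]mulrA; congr (_ * _); first by rewrite /A'; field; rewrite x0 qX0 a0.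
apply: eq_bigr => j _; rewrite /res_coef /A' /B'.
have e1 : B j / a / (A j / a) = B j / A j by have := A0 j => *; fz.
have e2 : q * (A i / a) / (B j / a) = q * A i / B j by have := B0 j => *; fz.
have e3 : q * (A i / a) / (A j / a) = q * A i / A j by have := A0 j => *; fz.
have e4 : B j / a / (A i / a) = B j / A i by fz.
have e5 : A j / a / (A i / a) = A j / A i by fz.
have e6 : B j * (A i / a) = B j / a * A i by ring.
have e7 : A j * (A i / a) = A j / a * A i by ring.
by rewrite e1 e2 e3 e4 e5 e6 e7.
Qed.

Definition wp_bilateral : K := wp a b c d e f g z a -
  a * z * (th (q * a / b) / th b * (th (q * a / c) / th c) * (th (q * a / d) / th d) *
    (th (q * a / e) / th e) * (th (q * a / f) / th f) * (th (q * a / g) / th g)) * wp a b c d e f g z q.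

Theorem three_term_wp :
  th c * th d * th f * th g / (th (b / a) * th (e / a) * th a) / a * wp_bilateral +
  th (b * c / a) * th (b * d / a) * th (b * f / a) * th (b * g / a) /
    (th (e / b) * th (a / b) * th b) / b * wp a b c d e f g z b +
  th (e * c / a) * th (e * d / a) * th (e * f / a) * th (e * g / a) /
    (th (b / e) * th (a / e) * th e) / e * wp a b c d e f g z e = 0.
Proof.
have E := residues0.
have sum4 (F : 'I_4 -> K) : \sum_(j < 4) F j = F (inord 0) + F (inord 1) + F (inord 2) + F (inord 3).
  rewrite !big_ord_recl big_ord0 addr0 !addrA; congr (F _ + F _ + F _ + F _); apply: val_inj;
    by rewrite /= inordK.
have nsE i : nsum (res_term (q := q) h A B A' B' i) =
    (\prod_(j < 4) res_weight (q := q) A B i j) / A i * wp a b c d e f g z (A i).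
  have [? ? ? [? ? ?]] := nP i.
  by rewrite (eq_nsum (termE i)) nsumZ //; exact: geo_bounded_wp.
have ne (k l : nat) : (k < 4)%N -> (l < 4)%N -> (inord k == inord l :> 'I_4) = (k == l).
  by move=> kl ll; rewrite -val_eqE /= !inordK.
rewrite /res_sum sum4 !nsE !prod4 /res_weight !ne // !AE /B !vec4E /= in E.
have dv (x y : K) : x != 0 -> y != 0 -> x / y != 0 by move=> *; rewrite mulf_neq0 ?invr_eq0.
have sy (x y : K) : x != 0 -> y = q / x -> th y = th x by move=> x0 ->; exact: th_sym.
have s1 x y : x != 0 -> y != 0 -> th (q * a / x / y) = th (y * x / a).
  by move=> x0 y0; apply: sy; [rewrite !mulf_neq0 ?invr_eq0 | fz].
have s2 x : x != 0 -> th (q * a / x / a) = th x by move=> x0; apply: sy => //; fz.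
have s3 x : x != 0 -> th (q * a / x / q) = th (a / x) by move=> x0; congr th; fz.
have s4 x : x != 0 -> th (q * a / x) = - (x / a) * th (a / x).
  by move=> x0; rewrite -mulrA th_qM ?dv // invf_div.
have s5 x : x != 0 -> th (x / a) = - (x / a) * th (a / x) by move=> x0; rewrite -invf_div thV ?dv // invf_div.
rewrite !s2 // !s3 // !s1 // !th_sym // !th_divq // in E.
rewrite /wp_bilateral !s4 //.
move: (generic_th ga) (generic_th gb) (generic_th gc) (generic_th gd) (generic_th ge)
  (generic_th gf) (generic_th gg) (generic_th gba) (generic_th gea) => ta tb tc td te tf tg tba tea.
have tV x : generic x -> th x^-1 != 0 by move=> /genericV/generic_th.
apply: three_term_certificate E => //; rewrite ?s5 //.
- by rewrite -invf_div tV.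
- by rewrite -invf_div tV.
- by rewrite -invf_div tV.
- exact: generic_th.
Qed.
End Relation.
End Jackson.

(** * Watson's transformation for series in infinite products *)

Lemma watson_P_certificate (K : fieldType) (B p q1 q2 q3 q4 q5 pa pb pc pd pe pf pq thB V X n1 n2 n3 n4 u1 uB a1 : K) :
  pd != 0 -> pe != 0 -> pf != 0 -> B != 0 -> q1 != 0 -> q2 != 0 -> q3 != 0 -> q4 != 0 -> q5 != 0 ->
  pq != 0 -> a1 != 0 -> p != 0 ->
  (B * pq * (- B^-1 * thB) * (q3 * q4 * q5)) *
    (V * (a1 * p * pb * pc * pd * pe * pf / (a1 * pq * q1 * q2 * q3 * q4 * q5))) * (q1 * q2) =
  p * n1 * (pd * pe * pf * (n2 * n3 * n4)) * (B * uB - u1) ->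
  thB * pb * pc * V = n1 * (n2 * n3 * n4) * (u1 - B * uB).
Proof.
move=> d0 e0 f0 B0 q10 q20 q30 q40 q50 pq0 a10 p0 E.
apply: (mulfI (x := p * (pd * pe * pf))); first by rewrite !mulf_neq0.
transitivity (- (p * n1 * (pd * pe * pf * (n2 * n3 * n4)) * (B * uB - u1))); last by ring.
by rewrite -E; fz.
Qed.

Section WatsonP.
Context {R : realType} {K : numFieldType} {KR : modulus R K}.
Local Notation cmod := (@cmod R K KR).
Context {q : K} {hq : nome q}.
Local Notation P := (qpoch_inf q).
Local Notation qp := (qpoch_fin q).
Local Notation th := (qtheta (q := q)).
Local Notation generic := (qgeneric (q := q)).

Let q0 : q != 0 := nome_neq0.
Let q1 : cmod q < 1 := nome_lt1.
Let qX0 n : q ^+ n != 0. Proof. by rewrite expf_neq0. Qed.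
Let Pq : P q != 0 := qpoch_inf_q_neq0 (hq := hq).

(** The term of the 8-phi-7 without its constant factor, each (y; q)_k being traded for 1 / P (y
    q^k). The half-line sums [wp] at x = b and x = e have literally this shape, with base x^2 /
    a. *)
Definition vwP_term (a b c d e f z : K) k : K := (1 - a * q ^+ (2 * k)) * z ^+ k *
  (P (q * q ^+ k) * P (q * a / b * q ^+ k) * P (q * a / c * q ^+ k) * P (q * a / d * q ^+ k) *
   P (q * a / e * q ^+ k) * P (q * a / f * q ^+ k) /
   (P (a * q ^+ k) * P (b * q ^+ k) * P (c * q ^+ k) * P (d * q ^+ k) * P (e * q ^+ k) * P (f * q ^+ k))).

Definition vwP a b c d e f z : K := nsum (vwP_term a b c d e f z).

Lemma vw8_vwP a b c d e f z : cmod z < 1 -> P a != 0 -> P b != 0 -> P c != 0 -> P d != 0 -> P e != 0 ->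
  P f != 0 -> P (q * a / b) != 0 -> P (q * a / c) != 0 -> P (q * a / d) != 0 -> P (q * a / e) != 0 ->
  P (q * a / f) != 0 ->
  nsum (vw8 (q := q) a b c d e f z) = vwP a b c d e f z * (P a * P b * P c * P d * P e * P f /
   ((1 - a) * P q * P (q * a / b) * P (q * a / c) * P (q * a / d) * P (q * a / e) * P (q * a / f))).
Proof.
move=> z1 na nb nc nd ne nf nqb nqc nqd nqe nqf.
have g : geo_bounded (vw8 (q := q) a b c d e f z) by exact: geo_bounded_vw8.
have a1 : 1 - a != 0 by exact: (qpoch_inf_neq1 (hq := hq)).
set C := _ / _.
have C0 : C != 0 by rewrite /C !(mulf_neq0, invr_eq0).
have E k : vw8 (q := q) a b c d e f z k = C * vwP_term a b c d e f z k.
  rewrite /vwP_term /vw8 /C.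
  have X x : P x != 0 -> qp x k = P x / P (x * q ^+ k).
    by move=> h; rewrite (qpoch_inf_qp x k) mulfK //; exact: qpoch_infX_neq0.
  by rewrite !X // !invfM !invrK; ring.
have gV : geo_bounded (vwP_term a b c d e f z).
  apply: (eq_geo_bounded (u := fun k => C^-1 * vw8 (q := q) a b c d e f z k)).
    by move=> k; rewrite E mulKf.
  exact: geo_boundedZ.
by rewrite (eq_nsum E) nsumZ // mulrC.
Qed.

Theorem watson_P a b c d e f B z : a != 0 -> b != 0 -> c != 0 -> d != 0 -> e != 0 -> f != 0 ->
  B * (d * e * f) = q * a -> z * (b * c) = q * a * B -> cmod z < 1 ->
  P a != 0 -> P b != 0 -> P c != 0 -> P d != 0 -> P e != 0 -> P f != 0 ->
  P (q * a / b) != 0 -> P (q * a / c) != 0 -> P (q * a / d) != 0 -> P (q * a / e) != 0 ->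
  P (q * a / f) != 0 -> P (q * a / (b * c)) != 0 -> P (q * a * B) != 0 -> P z != 0 ->
  P (d * B) != 0 -> P (e * B) != 0 -> P (f * B) != 0 -> th B != 0 ->
  th B * P b * P c * vwP a b c d e f z = P (q * a / (b * c)) * (P (d * B) * P (e * B) * P (f * B)) *
  (u4 (q := q) q (q / B) (q * a / b) (q * a / c) d e f (q * a / (b * c)) -
   B * u4 (q := q) (q * B) q (q * a * B / b) (q * a * B / c) (d * B) (e * B) (f * B) z).
Proof.
move=> a0 b0 c0 d0 e0 f0 BE zE z1 na nb nc nd ne nf nqb nqc nqd nqe nqf nbc naB nz' ndB neB nfB tB.
have B0 : B != 0 by apply: contra_neq (mulf_neq0 q0 a0) => B0; rewrite -BE B0 mul0r.
have eB : B = q * a / (d * e * f) by rewrite -BE mulfK // !mulf_neq0.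
have ez : z = q * a * B / (b * c) by rewrite -zE mulfK // mulf_neq0.
have h := nonterminating_watson (hq := hq) a0 b0 c0 d0 e0 f0 na nqb nqc nbc.
rewrite -eB -ez in h.
have {}h := h naB nz' nd ne nf ndB neB nfB nqd nqe nqf tB z1.
rewrite vw8_vwP // (qpoch_inf1 a) thV // in h.
apply: watson_P_certificate h => //.
- exact: (qpoch_inf_neq1 (hq := hq)).
- by move: na; rewrite (qpoch_inf1 a) mulf_eq0 negb_or => /andP[].
Qed.
End WatsonP.

(** * Theta relations between the coefficients *)

Lemma residue_weight_certificate (K : fieldType) (a1 a2 mu x1 x2 x12 y12 y22 y2m y11 y21 y1m z1 z2 zm : K) :
  a1 != 0 -> a2 != 0 -> mu != 0 ->
  - (a2 / a1) * x12 / a2 * z1 * z2 * zm + - a2^-1 * x2 * (y11) * (y21) * (- (mu / a1) * y1m) -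
    - a1^-1 * x1 * y12 * y22 * (- (mu / a2) * y2m) = 0 ->
  x12 != 0 -> x2 != 0 -> x1 != 0 ->
  y12 * y22 * y2m / (x12 * x2) + a2 / a1 * (y11 * y21 * y1m / (- (a2 / a1) * x12 * x1)) =
  - (a2 / mu) * (z1 * z2 * zm / (x1 * x2)).
Proof.
move=> a10 a20 mu0 E x120 x20 x10.
apply/eqP; rewrite -subr_eq0; apply/eqP.
rewrite -[RHS](mulr0 (- (a1 * a2 / (mu * x12 * x1 * x2)))) -E; fz.
Qed.

Section ThetaRelations.
Context {R : realType} {K : numFieldType} {KR : modulus R K}.
Local Notation cmod := (@cmod R K KR).
Context {q : K} {hq : nome q}.
Local Notation P := (qpoch_inf q).
Local Notation th := (qtheta (q := q)).
Local Notation generic := (qgeneric (q := q)).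

Let q0 : q != 0 := nome_neq0.
Let Pq : P q != 0 := qpoch_inf_q_neq0 (hq := hq).

Lemma theta_three_term_generic A B D d e f : A != 0 -> B != 0 -> D != 0 ->
  A * B * D * d * e * f = q ->
  generic (A / B) -> generic (A / D) -> generic (B / D) ->
  generic (d * A) -> generic (e * A) -> generic (f * A) ->
  generic (d * B) -> generic (e * B) -> generic (f * B) ->
  generic (d * D) -> generic (e * D) -> generic (f * D) ->
  B * th (A / B) * th (D * d) * th (D * e) * th (D * f) +
  D * th (B / D) * th (A * d) * th (A * e) * th (A * f) -
  D * th (A / D) * th (B * d) * th (B * e) * th (B * f) = 0.
Proof.
move=> A0 B0 D0 Eq gAB gAD gBD *.
have qM x : generic x -> P (q * x) != 0 by move=> *; exact/generic_P/generic_qM.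
have qV x y : generic (x / y) -> P (q * (y / x)) != 0.
  by move=> g; apply: qM; rewrite -invf_div; exact: genericV.
have E := theta_three_term (hq := hq) (A := A) (B := B) (D := D) (d := d) (e := e) (f := f) Eq
  (qM _ gAB) (qV _ _ gAB) (qM _ gAD) (qV _ _ gAD) (qM _ gBD) (qV _ _ gBD).
rewrite -[RHS]E; try exact: generic_P.
rewrite -(invf_div A D) thV; last by rewrite mulf_neq0 ?invr_eq0.
rewrite invf_div; set t := th (A / D).
have -> : - (D / A) * t = - (D * t) / A by field; rewrite A0.
by field; rewrite A0.
Qed.

(** Weierstrass' relation at the points 1/a1, 1/a2, 1 with cofactors b1, b2, mu; the balancing
    hypothesis is exactly the condition that the six numbers multiply to q. It adds the weights of
    the two nodes a1 and a2 of the five-term relation into a single product. *)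
Lemma residue_weight_sum a1 a2 b1 b2 mu : b1 != 0 -> b2 != 0 ->
  mu * (b1 * b2) = q * (a1 * a2) -> generic a1 -> generic a2 -> generic b1 -> generic b2 -> generic mu ->
  generic (a1 / a2) -> generic (a1 / b1) -> generic (a1 / b2) -> generic (a2 / b1) -> generic (a2 / b2) ->
  generic (a1 / mu) -> generic (a2 / mu) ->
  th (b1 / a2) * th (b2 / a2) * th (a2 / mu) / (th (a1 / a2) * th a2) +
    a2 / a1 * (th (b1 / a1) * th (b2 / a1) * th (a1 / mu) / (th (a2 / a1) * th a1)) =
  - (a2 / mu) * (th b1 * th b2 * th mu / (th a1 * th a2)).
Proof.
move=> b10 b20 Emu g1 g2 gb1 gb2 gmu g12 h11 h12 h21 h22 h1m h2m.
have a10 := generic_neq0 g1; have a20 := generic_neq0 g2; have mu0 := generic_neq0 gmu.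
have i1 := invr_neq0 a10; have i2 := invr_neq0 a20.
have gI x y : generic (x / y) -> generic (y * x^-1) by move=> /genericV; rewrite invf_div.
have gM x : generic x -> generic (x * 1) by rewrite mulr1.
have dv (x y : K) : x != 0 -> y != 0 -> x / y != 0 by move=> *; rewrite mulf_neq0 ?invr_eq0.
have E := theta_three_term_generic (A := a1^-1) (B := a2^-1) (D := 1) (d := b1) (e := b2) (f := mu)
  i1 i2 (oner_neq0 K).
have e0 : a1^-1 * a2^-1 * 1 * b1 * b2 * mu = q.
  transitivity (mu * (b1 * b2) / (a1 * a2)); first by fz.
  by rewrite Emu; fz.
have gi12 : generic (a1^-1 / a2^-1) by rewrite invrK mulrC; exact: gI.
have gi1 : generic (a1^-1 / 1) by rewrite divr1; exact: genericV.
have gi2 : generic (a2^-1 / 1) by rewrite divr1; exact: genericV.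
have {}E := E e0 gi12 gi1 gi2 (gI _ _ h11) (gI _ _ h12) (gI _ _ h1m) (gI _ _ h21) (gI _ _ h22)
  (gI _ _ h2m) (gM _ gb1) (gM _ gb2) (gM _ gmu).
rewrite !divr1 !mul1r invrK !(thV a10) !(thV a20) in E.
have tdiv (x y : K) : x != 0 -> y != 0 -> th (x^-1 * y) = - (y / x) * th (x / y).
  by move=> x0 y0; rewrite [x^-1 * y]mulrC -[in LHS](invf_div x y) thV ?dv // invf_div.
have t12 := tdiv _ _ a10 a20; have tm1 := tdiv _ _ a10 mu0; have tm2 := tdiv _ _ a20 mu0.
have t21 : th (a2 / a1) = - (a2 / a1) * th (a1 / a2) by rewrite -t12 mulrC.
rewrite t12 tm1 tm2 ![a1^-1 * _]mulrC ![a2^-1 * _]mulrC in E; rewrite t21.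
have := generic_th g1; have := generic_th g2; have := generic_th g12.
move: E; move: (th a1) (th a2) (th (a1 / a2)) (th (b1 / a2)) (th (b2 / a2)) (th (a2 / mu)) (th (b1 / a1))
  (th (b2 / a1)) (th (a1 / mu)) (th b1) (th b2) (th mu) => x1 x2 x12 y12 y22 y2m y11 y21 y1m z1 z2 zm.
exact: residue_weight_certificate.
Qed.

(** The substitution of q/b for a, q/a for b and 1/mu for mu carries the previous relation to the
    nodes on the other side of the five-term relation. *)
Lemma residue_weight_sum_lower a3 a4 b3 b4 mu :
  b3 * b4 = mu * (q * (a3 * a4)) -> generic a3 -> generic a4 -> generic b3 -> generic b4 -> generic mu ->
  generic (b3 / b4) -> generic (a3 / b3) -> generic (a4 / b3) -> generic (a3 / b4) -> generic (a4 / b4) ->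
  generic (b3 / mu) -> generic (b4 / mu) ->
  th (b4 / a3) * th (b4 / a4) * th (b4 / mu) / (th (b4 / b3) * th b4) +
    b3 / b4 * (th (b3 / a3) * th (b3 / a4) * th (b3 / mu) / (th (b3 / b4) * th b3)) =
  q / b4 * (th a3 * th a4 * th mu / (th b3 * th b4)).
Proof.
move=> Emu g3 g4 h3 h4 gmu g34 g33 g43 g3' g4' gm3 gm4.
have a30 := generic_neq0 g3; have a40 := generic_neq0 g4; have mu0 := generic_neq0 gmu.
have b30 := generic_neq0 h3; have b40 := generic_neq0 h4.
have dd (x y : K) : x != 0 -> y != 0 -> q / x / (q / y) = y / x by move=> *; fz.
have nz (x : K) : x != 0 -> q / x != 0 by move=> x0; rewrite mulf_neq0 ?invr_eq0.
have dm (x : K) : x != 0 -> q / x / mu^-1 = q / (x / mu) by move=> *; fz.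
have gq x : generic x -> generic (q / x) by exact: generic_qV.
have dv (x y : K) : x != 0 -> y != 0 -> x / y != 0 by move=> *; rewrite mulf_neq0 ?invr_eq0.
have gI x y : generic (x / y) -> generic (y / x) by move=> /genericV; rewrite invf_div.
have E := residue_weight_sum (a1 := q / b3) (a2 := q / b4) (b1 := q / a3) (b2 := q / a4) (mu := mu^-1)
  (nz _ a30) (nz _ a40).
rewrite !dd // !dm // !th_sym ?dv // thV // in E.
have e : mu^-1 * (q / a3 * (q / a4)) = q * (q / b3 * (q / b4)).
  have -> : q * (q / b3 * (q / b4)) = q ^+ 3 / (b3 * b4) by fz.
  by rewrite Emu; fz.
rewrite (E e (gq _ h3) (gq _ h4) (gq _ g3) (gq _ g4) (genericV gmu) (gI _ _ g34) g33 g43 g3' g4'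
  (gq _ gm3) (gq _ gm4)).
have t3 : th b3 != 0 by exact: generic_th.
have t4 : th b4 != 0 by exact: generic_th.
by fz.
Qed.

End ThetaRelations.

(** * Generic monomials *)

(* Laurent monomials in seven parameters (indices 0 to 6) and in q (index 7): deciding by computation
   that a monomial is, up to inversion and powers of q, a member of a given list. *)
Inductive mexp := MVar of nat | MOne | MMul of mexp & mexp | MInv of mexp | MPow of mexp & nat.

(** Exponents in numerator ([true]) and denominator ([false]) are counted separately to remain in
    [nat]; inversion swaps the two. *)
Fixpoint mdeg (s : bool) (m : mexp) (i : nat) : nat :=
  match m with
  | MVar j => s && (i == j)
  | MOne => 0
  | MMul m1 m2 => mdeg s m1 i + mdeg s m2 i
  | MInv m1 => mdeg (~~ s) m1 i
  | MPow m1 n => n * mdeg s m1 i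
  end.

Fixpoint mden (K : fieldType) (x : nat -> K) (m : mexp) : K :=
  match m with
  | MVar i => x i
  | MOne => 1
  | MMul m1 m2 => mden x m1 * mden x m2
  | MInv m1 => (mden x m1)^-1
  | MPow m1 n => mden x m1 ^+ n
  end.

(** Equality of net exponents by cross addition. Index 7, which is q, is left out: monomials are
    compared modulo powers of q, under which genericity is invariant. *)
Definition same_mon (m1 m2 : mexp) : bool :=
  all (fun i => mdeg true m1 i + mdeg false m2 i == mdeg true m2 i + mdeg false m1 i)%N (iota 0 7).

Definition listed (L : seq mexp) (m : mexp) : bool :=
  has (fun m' => same_mon m m' || same_mon (MInv m) m') L.

Fixpoint mwf (m : mexp) : bool :=
  match m with
  | MVar i => (i < 8)%N
  | MOne => true
  | MMul m1 m2 => mwf m1 && mwf m2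
  | MInv m1 => mwf m1
  | MPow m1 n => mwf m1
  end.

Section MonomialDenotation.
Variables (K : fieldType) (x : nat -> K).
Hypothesis x0 : forall i, (i < 8)%N -> x i != 0.

Let N (f : nat -> nat) : K := \prod_(0 <= i < 8) x i ^+ f i.

Let ND f g : N (fun i => f i + g i)%N = N f * N g.
Proof. by rewrite /N -big_split; apply: eq_bigr => i _; rewrite exprD. Qed.

Let N0 f : N f != 0.
Proof.
rewrite /N big_nat; elim/big_ind: _ => [|u v|i /andP[_ i8]]; [exact: oner_neq0 | exact: mulf_neq0 |].
by rewrite expf_neq0 // x0.
Qed.

Lemma mden_neq0 m : mwf m -> mden x m != 0.
Proof.
elim: m => /= [i|_|m1 h1 m2 h2 /andP[/h1 ? /h2 ?]|m h w|m h n w].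
- exact: x0.
- exact: oner_neq0.
- exact: mulf_neq0.
- by rewrite invr_eq0 h.
- by rewrite expf_neq0 // h.
Qed.

Lemma mdenE m : mwf m -> mden x m * N (mdeg false m) = N (mdeg true m).
Proof.
elim: m => //= [i i8|_|m1 h1 m2 h2 /andP[w1 w2]|m h w|m h n w].
- rewrite /N /= big1 ?mulr1 => [|j _]; last by rewrite expr0.
  rewrite big_mkord (bigD1 (Ordinal i8)) //= eqxx expr1 big1 ?mulr1 // => j /negP ji.
  by case: eqP => [e|_]; rewrite ?expr0 //; case: ji; apply/eqP/val_inj.
- by rewrite mul1r.
- by rewrite !ND -(h1 w1) -(h2 w2); ring.
- by rewrite -(h w) mulKf // mden_neq0.
- have e s : N (fun i => n * mdeg s m i)%N = N (mdeg s m) ^+ n.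
    by rewrite /N -prodrXl; apply: eq_bigr => i _; rewrite mulnC exprM.
  by rewrite !e -(h w) exprMn.
Qed.

Lemma same_mon_eq m1 m2 : mwf m1 -> mwf m2 -> same_mon m1 m2 ->
  exists k l, mden x m1 = x 7 ^+ k / x 7 ^+ l * mden x m2.
Proof.
move=> w1 w2 /allP s.
pose N7 (f : nat -> nat) : K := \prod_(0 <= i < 7) x i ^+ f i.
have NE f : N f = N7 f * x 7 ^+ f 7 by rewrite /N big_nat_recr.
have e : N7 (fun i => mdeg true m1 i + mdeg false m2 i)%N = N7 (fun i => mdeg true m2 i + mdeg false m1 i)%N.
  rewrite /N7 !big_mkord; apply: eq_bigr => i _; congr (_ ^+ _); apply/eqP/s.
  by rewrite mem_iota /= add0n ltn_ord.
have n7 f : N7 f != 0 by have := N0 f; rewrite NE mulf_eq0 negb_or => /andP[].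
have N7D f g : N7 (fun i => f i + g i)%N = N7 f * N7 g.
  by rewrite /N7 -big_split; apply: eq_bigr => i _; rewrite exprD.
have y0 k : x 7 ^+ k != 0 by rewrite expf_neq0 // x0.
exists (mdeg true m1 7 + mdeg false m2 7)%N, (mdeg true m2 7 + mdeg false m1 7)%N.
have h1 := mdenE w1; have h2 := mdenE w2; rewrite !NE in h1 h2; rewrite !N7D in e.
have -> : mden x m1 = N7 (mdeg true m1) * x 7 ^+ mdeg true m1 7 / (N7 (mdeg false m1) * x 7 ^+ mdeg false m1 7).
  by rewrite -h1 mulfK // mulf_neq0.
have -> : mden x m2 = N7 (mdeg true m2) * x 7 ^+ mdeg true m2 7 / (N7 (mdeg false m2) * x 7 ^+ mdeg false m2 7).
  by rewrite -h2 mulfK // mulf_neq0.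
have -> : N7 (mdeg true m1) = N7 (mdeg true m2) * N7 (mdeg false m1) / N7 (mdeg false m2).
  by rewrite -e mulfK.
rewrite !exprD.
move: (y0 (mdeg true m1 7)) (y0 (mdeg false m1 7)) (y0 (mdeg true m2 7)) (y0 (mdeg false m2 7)).
move: (n7 (mdeg true m1)) (n7 (mdeg false m1)) (n7 (mdeg true m2)) (n7 (mdeg false m2)).
move: (N7 _) (N7 _) (N7 _) (N7 _) => u1 u2 u3 u4.
move: (x 7 ^+ _) (x 7 ^+ _) (x 7 ^+ _) (x 7 ^+ _) => v1 v2 v3 v4 *.
by fz.
Qed.
End MonomialDenotation.

Section GenericMonomials.
Context {R : realType} {K : numFieldType} {KR : modulus R K}.
Context {q : K} {hq : nome q}.
Local Notation generic := (qgeneric (q := q)).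

Definition params (a b c d e f g : K) (i : nat) : K := nth 0 [:: a; b; c; d; e; f; g; q] i.

Lemma generic_shift k l x : generic x -> generic (q ^+ k / q ^+ l * x).
Proof.
move=> gx; elim: l => [|l IH].
  rewrite expr0 divr1; elim: k => [|k IH]; first by rewrite expr0 mul1r.
  by rewrite exprS -mulrA; exact: generic_qM.
have -> : q ^+ k / q ^+ l.+1 * x = q ^+ k / q ^+ l * x / q by rewrite exprS invfM; ring.
exact: generic_Vq.
Qed.

Lemma generic_mon (x : nat -> K) (L : seq mexp) m : x 7 = q -> (forall i, (i < 8)%N -> x i != 0) ->
  all mwf L -> all (fun m => generic (mden x m)) L -> mwf m -> listed L m -> generic (mden x m).
Proof.
move=> xq x0 + + wm; elim: L => //= m' L IH /andP[wm' wL] /andP[gm' gL] /orP[/orP[] s|]; last exact: IH.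
  by have [k [l ->]] := same_mon_eq x0 wm wm' s; rewrite xq; exact: generic_shift.
have [k [l e]] := same_mon_eq x0 (wm : mwf (MInv m)) wm' s.
rewrite -[mden x m]invrK; apply: genericV; rewrite -/(mden x (MInv m)) e xq.
exact: generic_shift.
Qed.
End GenericMonomials.

Ltac reify_mon q a b c d e f g t :=
  let rec go t :=
    match t with
    | q => constr:(MVar 7) | a => constr:(MVar 0) | b => constr:(MVar 1) | c => constr:(MVar 2)
    | d => constr:(MVar 3) | e => constr:(MVar 4) | f => constr:(MVar 5) | g => constr:(MVar 6)
    | GRing.one => constr:(MOne)
    | GRing.mul ?x ?y => let x' := go x in let y' := go y in constr:(MMul x' y')
    | GRing.inv ?x => let x' := go x in constr:(MInv x')
    | GRing.exp ?x ?n => let x' := go x in constr:(MPow x' n)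
    end in go t.

(** * The expansion for generic parameters *)

Definition mon (num den : seq nat) : mexp :=
  MMul (foldr (fun i m => MMul (MVar i) m) MOne num) (MInv (foldr (fun i m => MMul (MVar i) m) MOne den)).

(* The monomials that must avoid the powers of q for the residue computations; the indices 0 to 6 stand
   for a to g, as in [params]. *)
Definition omega : seq mexp := [::
  mon [:: 0] [:: ]; mon [:: 1] [:: ]; mon [:: 2] [:: ]; mon [:: 3] [:: ];
  mon [:: 4] [:: ]; mon [:: 5] [:: ]; mon [:: 6] [:: ]; mon [:: 1] [:: 0];
  mon [:: 2] [:: 0]; mon [:: 3] [:: 0]; mon [:: 4] [:: 0]; mon [:: 5] [:: 0];
  mon [:: 6] [:: 0]; mon [:: 1] [:: 2]; mon [:: 1] [:: 3]; mon [:: 1] [:: 4];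
  mon [:: 1] [:: 5]; mon [:: 1] [:: 6]; mon [:: 4] [:: 2]; mon [:: 4] [:: 3];
  mon [:: 4] [:: 5]; mon [:: 4] [:: 6]; mon [:: 1; 1] [:: 0]; mon [:: 4; 4] [:: 0];
  mon [:: 1; 2] [:: 0]; mon [:: 1; 3] [:: 0]; mon [:: 1; 4] [:: 0]; mon [:: 1; 5] [:: 0];
  mon [:: 1; 6] [:: 0]; mon [:: 2; 4] [:: 0]; mon [:: 3; 4] [:: 0]; mon [:: 4; 5] [:: 0];
  mon [:: 4; 6] [:: 0]; mon [:: 2; 3] [:: 0]; mon [:: 5; 6] [:: 0]; mon [:: 1; 2; 4] [:: 0];
  mon [:: 1; 3; 4] [:: 0]; mon [:: 2; 3; 4] [:: 0]; mon [:: 1; 2; 3] [:: 0]; mon [:: 2; 3; 4] [:: 0; 1];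
  mon [:: 4; 5; 6] [:: 0; 1]; mon [:: 1; 2; 3] [:: 0; 4]; mon [:: 1; 2; 3; 4] [:: 0; 0]; mon [:: 1; 2; 3; 4; 5] [:: 0; 0];
  mon [:: 1; 2; 3; 4; 6] [:: 0; 0]; mon [:: 1; 2; 3; 4; 4] [:: 0; 0]; mon [:: 1; 1; 2; 3; 4] [:: 0; 0]; mon [:: 1; 4; 5; 6] [:: 0; 0];
  mon [:: 2; 4; 5; 6] [:: 0; 0]; mon [:: 3; 4; 5; 6] [:: 0; 0]; mon [:: 2; 3; 4; 5] [:: 0; 0]; mon [:: 2; 3; 4; 6] [:: 0; 0];
  mon [:: 1; 2; 3; 4; 5; 6] [:: 0; 0; 0]; mon [:: 1; 2; 3; 4; 4; 5; 6] [:: 0; 0; 0]; mon [:: 1; 1; 2; 3; 4; 5; 6] [:: 0; 0; 0]; mon [:: 2; 3; 4; 4; 5; 6] [:: 0; 0; 0]].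

(** This and the next three lemmas isolate the algebra of [R1] to [R4], with every infinite product
    and theta replaced by a variable, so that [field] faces rational identities only. *)
Lemma relation_lower_certificate (K : fieldType) (qb4 K1 w mu p Bb x y tb4 u tBb tb3 : K) :
  mu != 0 -> p != 0 -> tb3 != 0 -> tb4 != 0 -> y != 0 -> tBb != 0 ->
  x / (y * tb4) + Bb * (u / (tBb * tb3)) = qb4 * (w / (tb3 * tb4)) ->
  - (qb4 * K1) * (w / (mu * (tb3 * tb4) * p ^+ 2)) =
  - (K1 * (x / (p ^+ 2 * mu * y * tb4) + Bb * (u / (p ^+ 2 * mu * tBb * tb3)))).
Proof.
move=> mu0 p0 tb30 tb40 y0 tBb0 E.
transitivity (- (K1 / (mu * p ^+ 2) * (qb4 * (w / (tb3 * tb4))))); first by fz.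
by rewrite -E; fz.
Qed.

Lemma relation_upper_certificate (K : fieldType) (K1 mu p Be a2 x1 x2 tBe tBi te ta2 ta3 ta4 tb1 tb2 tb3 tb4 tm : K) :
  mu != 0 -> p != 0 -> Be != 0 -> te != 0 -> ta2 != 0 -> ta3 != 0 -> ta4 != 0 -> tb3 != 0 -> tb4 != 0 ->
  tBe != 0 -> tBi != 0 ->
  x2 / (tBe * ta2) + Be^-1 * (x1 / (tBi * te)) = - (a2 / mu) * (tb1 * tb2 * tm / (te * ta2)) ->
  Be * - (a2 * K1 * (tb1 * tb2 * tb3 * tb4 / (te * ta2 * ta3 * ta4))) *
    (ta3 * ta4 * tm / (mu * (tb3 * tb4) * p ^+ 2)) =
  K1 * (Be * (x2 / (p ^+ 2 * tBe * ta2)) + x1 / (p ^+ 2 * tBi * te)).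
Proof.
move=> mu0 p0 Be0 te0 ta20 ta30 ta40 tb30 tb40 tBe0 tBi0 E.
transitivity (Be * K1 / p ^+ 2 * (- (a2 / mu) * (tb1 * tb2 * tm / (te * ta2)))); first by fz.
by rewrite -E; fz.
Qed.

Lemma relation_product_certificate (K : fieldType) (a b e Be thce thde Pef' Pef Peg' Peg teb tae te Pfg Pbc' Pbc Pbd'
    Pbd Pcd tc td tf tg tba ta tBe ta3 ta4 tb tb3 tb4 p : K) :
  a != 0 -> b != 0 -> e != 0 -> Be != 0 -> teb != 0 -> tae != 0 -> te != 0 -> tc != 0 -> td != 0 -> tf != 0 ->
  tg != 0 -> tba != 0 -> ta != 0 -> tBe != 0 -> tb != 0 -> tb3 != 0 -> tb4 != 0 -> p != 0 ->
  Pbc' != 0 -> Pbd' != 0 ->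
  thce * thde * (Pef' * Pef) * (Peg' * Peg) / ((- (b / e) * teb) * tae * te) / e *
    (Pfg * (Pbc * Pbd * Pcd)) * Be * (ta3 * ta4 * teb / (e / b * (tb3 * tb4) * p ^+ 2)) =
  - (tc * td * tf * tg / (tba * (- (e / a) * tae) * ta) / a * (tBe * Pef' * Peg') *
     (ta * tba * thce * thde * (Pcd * Pef * Peg * Pfg) * ta3 * ta4 /
       (tb * tc * td * tf * tg * Pbc' * Pbd' * tb3 * tb4)) *
     ((Pbc' * Pbc) * (Pbd' * Pbd) * tb / (p ^+ 2 * (- Be^-1 * tBe) * te))).
Proof. move=> *; field; nz; exact: oner_neq0. Qed.

Lemma relation_theta_certificate (K : fieldType) (a b e tbc tbd tbf tbg teb tab tb tc td tf tg ta tce tde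
    Pcd Pef Peg Pfg Pce Pde Pbe Pz Pbc Pbd tBb tBe tea tbcd ta3 ta4 tb3 tb4 p : K) :
  a != 0 -> b != 0 -> e != 0 -> teb != 0 -> tab != 0 -> tb != 0 -> tc != 0 -> td != 0 -> tf != 0 ->
  tg != 0 -> ta != 0 -> Pbc != 0 -> Pbd != 0 -> tBb != 0 -> tea != 0 -> tb3 != 0 -> tb4 != 0 -> p != 0 ->
  Pbe != 0 -> Pz != 0 ->
  b * teb * tc * td * tBe + a * (- (b / a) * tab) * tce * tde * tbcd - a * tea * tbc * tbd * tb3 = 0 ->
  tc * td * tf * tg / (- (b / a) * tab * tea * ta) / a * (tBb * Pbc * Pbd) *
    (ta * (- (b / a) * tab) * tce * tde * (Pcd * Pef * Peg * Pfg) * ta3 * ta4 /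
       (tb * tc * td * tf * tg * Pbc * Pbd * tb3 * tb4) *
     (tbf * tbg * tbcd / (p ^+ 2 * (e / b) * tBb * tb3)) * (tBb * Pce * Pde) +
     - (ta * (- (b / a) * tab) * Pcd * Pce * Pde * Pfg * tbf * tbg * tBe /
       (tb * tf * tg * Pbc * Pbd * Pbe * Pz * tab * tb3)) * (Pbe * (Pef * Peg * Pz)) *
     (ta3 * ta4 * teb / (e / b * (tb3 * tb4) * p ^+ 2))) =
  - (tbc * tbd * tbf * tbg / (teb * tab * tb) / b * (Pcd * (Pef * Peg * Pfg)) *
     (ta3 * ta4 * teb / (e / b * (tb3 * tb4) * p ^+ 2)) * (tBb * Pce * Pde)).
Proof.
move=> a0 b0 e0 teb0 tab0 tb0 tc0 td0 tf0 tg0 ta0 Pbc0 Pbd0 tBb0 tea0 tb30 tb40 p0 Pbe0 Pz0 E.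
(* Weierstrass' relation is solved for one of its thetas; after substitution the claim is an
   identity of rational functions. *)
have tBeE : tBe = (a * tea * tbc * tbd * tb3 + b * tab * tce * tde * tbcd) / (b * teb * tc * td).
  apply: (mulfI (x := b * teb * tc * td)); first by rewrite !mulf_neq0.
  rewrite [RHS]mulrC divfK ?mulf_neq0 //; apply/eqP; rewrite -subr_eq0 -[X in _ == X]E; apply/eqP; fz.
rewrite tBeE; fz.
Qed.

(** L is the 8-Psi-8, T the 4-psi-4, V the 8W7, [Wb] and [We] the two 8-phi-7, and [Ub], [U0], [Pe],
    [P0] the four 4-phi-3. The four relations on coefficients say: the multiple of [Ub - Bb * U0]
    cancels, the multiple of [Pe - Be * P0] cancels, and what is left over of [U0] and [Pe] is K4
    and K3. *)
Lemma eliminate_series (K : fieldType) (L T V Pe U0 P0 Ub Wb We ca cb ce kb nb ke ne kl nl t c1 c2 d1 d2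
    Bb Be K1 K2 K3 K4 : K) :
  ca != 0 -> kb != 0 -> ke != 0 -> kl != 0 -> t != 0 -> Be != 0 ->
  ca * L + cb * Wb + ce * We = 0 ->
  kb * Wb = nb * (Ub - Bb * U0) -> ke * We = ne * (Pe - Be * P0) -> kl * V = nl * (Ub - Bb * U0) ->
  t * T + c1 * P0 + c2 * Pe = d1 * Ub + d2 * U0 ->
  K4 * t = - (K1 * (d2 + Bb * d1)) -> Be * K3 * t = K1 * (Be * c2 + c1) ->
  ca * kb * (K1 * d1 * kl + K2 * nl * t) = - (cb * nb * t * kl) ->
  ce * ne * Be * t = - (ca * ke * K1 * c1) ->
  L = K1 * T + K2 * V + K3 * Pe + K4 * U0.
Proof.
move=> ca0 kb0 ke0 kl0 t0 Be0 /eqP; rewrite -!addrA addr_eq0 => /eqP EJ EWb EWe EV F R1 R3 R2 R4.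
apply/eqP; rewrite -subr_eq0; apply/eqP.
have nn : ca * kb * kl * ke * t * Be != 0 by rewrite !mulf_neq0.
apply: (mulfI nn); rewrite mulr0.
transitivity (kb * kl * ke * t * Be * (ca * L) - ca * kb * kl * ke * Be * K1 * (t * T) -
  ca * kb * ke * t * Be * K2 * (kl * V) - ca * kb * kl * ke * Pe * (Be * K3 * t) -
  ca * kb * kl * ke * Be * U0 * (K4 * t)); first by ring.
have -> : t * T = d1 * Ub + d2 * U0 - c1 * P0 - c2 * Pe by rewrite -F; ring.
rewrite EJ EV R3 R1.
transitivity (- (kl * ke * t * Be * cb * (kb * Wb)) - kb * kl * t * Be * ce * (ke * We) -
  ca * kb * kl * ke * Be * K1 * (d1 * Ub + d2 * U0 - c1 * P0 - c2 * Pe) -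
  ca * kb * ke * t * Be * K2 * (nl * (Ub - Bb * U0)) -
  ca * kb * kl * ke * Pe * (K1 * (Be * c2 + c1)) -
  ca * kb * kl * ke * Be * U0 * (- (K1 * (d2 + Bb * d1)))); first by ring.
rewrite EWb EWe.
transitivity (- (Be * ke * (Ub - Bb * U0) * (cb * nb * t * kl + ca * kb * (K1 * d1 * kl + K2 * nl * t))) -
  kb * kl * (Pe - Be * P0) * (ce * ne * Be * t + ca * ke * K1 * c1)); first by ring.
by rewrite R2 R4 !(subrr, addNr) !mulr0 oppr0 addr0.
Qed.

Section Main.
Context {R : realType} {K : numFieldType} {KR : modulus R K}.
Local Notation cmod := (@cmod R K KR).
Context {q : K} {hq : nome q}.
Local Notation P := (qpoch_inf q).
Local Notation th := (qtheta (q := q)).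
Local Notation generic := (qgeneric (q := q)).
Local Notation u4 := (u4 (q := q)).

Let q0 : q != 0 := nome_neq0.
Let Pq : P q != 0 := qpoch_inf_q_neq0 (hq := hq).

Variables a b c d e f g z : K.
Hypotheses (a0 : a != 0) (b0 : b != 0) (c0 : c != 0) (d0 : d != 0) (e0 : e != 0) (f0 : f != 0) (g0 : g != 0).
Let X := params (q := q) a b c d e f g.
Hypothesis G : all (fun m => generic (mden X m)) omega.
Hypothesis zE : z * (b * c * d * e * f * g) = q ^+ 2 * a ^+ 3.
Hypothesis z1 : cmod z < 1.
Hypothesis w1 : cmod (q * a / (f * g)) < 1.

Let X0 i : (i < 8)%N -> X i != 0.
Proof. by case: i => [|[|[|[|[|[|[|[|i]]]]]]]]. Qed.

Let gen m : mwf m -> listed omega m -> generic (mden X m).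
Proof. by apply: generic_mon => //. Qed.

Ltac gm := lazymatch goal with |- is_true (qgeneric ?t) =>
  let m := reify_mon q a b c d e f g t in
  change (is_true (generic (mden X m))); apply: gen; vm_compute; reflexivity end.

Ltac Pn := first [ exact: Pq | apply: generic_P; gm | apply: generic_th; gm ].

Let jackson :
  th c * th d * th f * th g / (th (b / a) * th (e / a) * th a) / a * wp_bilateral (q := q) a b c d e f g z +
  th (b * c / a) * th (b * d / a) * th (b * f / a) * th (b * g / a) /
    (th (e / b) * th (a / b) * th b) / b * wp (q := q) a b c d e f g z b +
  th (e * c / a) * th (e * d / a) * th (e * f / a) * th (e * g / a) /
    (th (b / e) * th (a / e) * th e) / e * wp (q := q) a b c d e f g z e = 0.
Proof. by apply: three_term_wp => //; gm. Qed.

(** The parameter B of Watson's transformation for the 8-phi-7 with base b^2 / a, where b e / a, b f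
    / a, b g / a play the upper parameters, and [Be] likewise for base e^2 / a with b e / a, c e /
    a, d e / a. *)
Let Bb := q * a ^+ 2 / (b * e * f * g).
Let Be := q * a ^+ 2 / (b * c * d * e).

(** Of the four normalised 4-phi-3, [u4e] and [u4z] are those of the theorem, while [u4b] and [u4p]
    are to be eliminated. *)
Definition u4b := u4 q (b * e * f * g / a ^+ 2) (q * b / c) (q * b / d)
  (b * e / a) (b * f / a) (b * g / a) (q * a / (c * d)).
Definition u4e := u4 q (b * c * d * e / a ^+ 2) (q * e / f) (q * e / g)
  (b * e / a) (c * e / a) (d * e / a) (q * a / (f * g)).
Definition u4z := u4 q (q ^+ 2 * a ^+ 2 / (b * e * f * g)) (q ^+ 2 * a ^+ 2 / (c * e * f * g))
  (q ^+ 2 * a ^+ 2 / (d * e * f * g)) (q * a / (e * f)) (q * a / (e * g)) (q * a / (f * g)) z.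
Definition u4p := u4 q (q ^+ 2 * a ^+ 2 / (b * c * d * e)) (q ^+ 2 * a ^+ 2 / (b * c * d * f))
  (q ^+ 2 * a ^+ 2 / (b * c * d * g)) (q * a / (b * c)) (q * a / (b * d)) (q * a / (c * d)) z.

Let u4E y1 y2 y3 y4 x1 x2 x3 x4 y1' y2' y3' y4' x1' x2' x3' x4' :
  y1 = y1' -> y2 = y2' -> y3 = y3' -> y4 = y4' -> x1 = x1' -> x2 = x2' -> x3 = x3' -> x4 = x4' ->
  u4 y1 y2 y3 y4 x1 x2 x3 x4 = u4 y1' y2' y3' y4' x1' x2' x3' x4'.
Proof. by move=> -> -> -> -> -> -> -> ->. Qed.

Ltac u4perm := apply: eq_nsum => ?; rewrite /u4_term; congr (_ * (_ / _)); ring.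

Let zE' : z = q ^+ 2 * a ^+ 3 / (b * c * d * e * f * g).
Proof. by rewrite -zE mulfK // !mulf_neq0. Qed.

Let Pz : P z != 0. Proof. rewrite zE'; Pn. Qed.

Let wp_b : wp (q := q) a b c d e f g z b =
  vwP (q := q) (b * b / a) (b * c / a) (b * d / a) (b * e / a) (b * f / a) (b * g / a) z.
Proof.
apply: eq_nsum => k; rewrite /wp_term /vwP_term.
have e1 y : y != 0 -> q * (b * b / a) / (b * y / a) = q * b / y by move=> *; fz.
by rewrite mulfK // !e1 // (mulrC c b) (mulrC d b) (mulrC e b) (mulrC f b) (mulrC g b).
Qed.

Let wp_e : wp (q := q) a b c d e f g z e =
  vwP (q := q) (e * e / a) (e * f / a) (e * g / a) (b * e / a) (c * e / a) (d * e / a) z.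
Proof.
apply: eq_nsum => k; rewrite /wp_term /vwP_term.
have e1 y : y != 0 -> q * (e * e / a) / (e * y / a) = q * e / y by move=> *; fz.
have e2 y : y != 0 -> q * (e * e / a) / (y * e / a) = q * e / y by move=> *; fz.
rewrite mulfK // !e1 // !e2 // (mulrC e f) (mulrC e g); congr (_ * (_ / _)); ring.
Qed.

Let scaled_difference (k k' l u u' v v' : K) : k = k' -> u = u' -> v = v' -> k * (u - l * v) = k' * (u' - l * v').
Proof. by move=> -> -> ->. Qed.

Let watson_b : th Bb * P (b * c / a) * P (b * d / a) * wp (q := q) a b c d e f g z b =
  P (q * a / (c * d)) * (P (q * a / (e * f)) * P (q * a / (e * g)) * P (q * a / (f * g))) * (u4b - Bb * u4z).
Proof.
have e1 : q * (b * b / a) / (b * c / a * (b * d / a)) = q * a / (c * d) by fz.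
have e2 : b * e / a * Bb = q * a / (f * g) by rewrite /Bb; fz.
have e3 : b * f / a * Bb = q * a / (e * g) by rewrite /Bb; fz.
have e4 : b * g / a * Bb = q * a / (e * f) by rewrite /Bb; fz.
have e5 y : y != 0 -> q * (b * b / a) / (b * y / a) = q * b / y by move=> *; fz.
have h := @watson_P _ _ _ q hq (b * b / a) (b * c / a) (b * d / a) (b * e / a) (b * f / a) (b * g / a) Bb z.
rewrite !e5 // e1 e2 e3 e4 in h; rewrite wp_b h; last first.
all: lazymatch goal with |- is_true (_ < _) => exact: z1 | |- @eq _ _ _ => idtac
  | |- is_true (P _ != 0) => rewrite /Bb; first [exact: Pz | Pn] | |- is_true (qtheta _ != 0) => rewrite /Bb; Pn
  | |- is_true (_ != 0) => by rewrite !mulf_neq0 ?invr_eq0 end.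
- by rewrite zE' /Bb; fz.
- by rewrite /Bb; fz.
- apply: scaled_difference; first by ring.
    by rewrite /u4b; apply: u4E => //; rewrite /Bb; fz.
  rewrite /u4z.
  transitivity (u4 (q * Bb) q (q * (b * b / a) * Bb / (b * c / a)) (q * (b * b / a) * Bb / (b * d / a))
    (q * a / (e * f)) (q * a / (e * g)) (q * a / (f * g)) z); first by u4perm.
  transitivity (u4 (q ^+ 2 * a ^+ 2 / (b * e * f * g)) q (q ^+ 2 * a ^+ 2 / (c * e * f * g))
    (q ^+ 2 * a ^+ 2 / (d * e * f * g)) (q * a / (e * f)) (q * a / (e * g)) (q * a / (f * g)) z).
    by apply: u4E => //; rewrite /Bb; fz.
  by u4perm.
Qed.

Let watson_e : th Be * P (e * f / a) * P (e * g / a) * wp (q := q) a b c d e f g z e =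
  P (q * a / (f * g)) * (P (q * a / (b * c)) * P (q * a / (b * d)) * P (q * a / (c * d))) * (u4e - Be * u4p).
Proof.
have e1 : q * (e * e / a) / (e * f / a * (e * g / a)) = q * a / (f * g) by fz.
have e2 : b * e / a * Be = q * a / (c * d) by rewrite /Be; fz.
have e3 : c * e / a * Be = q * a / (b * d) by rewrite /Be; fz.
have e4 : d * e / a * Be = q * a / (b * c) by rewrite /Be; fz.
have e5 y : y != 0 -> q * (e * e / a) / (e * y / a) = q * e / y by move=> *; fz.
have e6 y : y != 0 -> q * (e * e / a) / (y * e / a) = q * e / y by move=> *; fz.
have h := @watson_P _ _ _ q hq (e * e / a) (e * f / a) (e * g / a) (b * e / a) (c * e / a) (d * e / a) Be z.
rewrite !e5 // !e6 // e1 e2 e3 e4 in h; rewrite wp_e h; last first.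
all: lazymatch goal with |- is_true (_ < _) => exact: z1 | |- @eq _ _ _ => idtac
  | |- is_true (P _ != 0) => rewrite /Be; first [exact: Pz | Pn] | |- is_true (qtheta _ != 0) => rewrite /Be; Pn
  | |- is_true (_ != 0) => by rewrite !mulf_neq0 ?invr_eq0 end.
- by rewrite zE' /Be; fz.
- by rewrite /Be; fz.
- apply: scaled_difference; first by ring.
    by rewrite /u4e; apply: u4E => //; rewrite /Be; fz.
  rewrite /u4p.
  transitivity (u4 (q * Be) q (q * (e * e / a) * Be / (e * f / a)) (q * (e * e / a) * Be / (e * g / a))
    (q * a / (b * c)) (q * a / (b * d)) (q * a / (c * d)) z); first by u4perm.
  transitivity (u4 (q ^+ 2 * a ^+ 2 / (b * c * d * e)) q (q ^+ 2 * a ^+ 2 / (b * c * d * f))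
    (q ^+ 2 * a ^+ 2 / (b * c * d * g)) (q * a / (b * c)) (q * a / (b * d)) (q * a / (c * d)) z).
    by apply: u4E => //; rewrite /Be; fz.
  by u4perm.
Qed.

(** The 8W7 of the theorem with its parameters ordered so that q a / (c e) and q a / (d e) form the
    distinguished pair of Watson's transformation. With this pairing B is again [Bb] and the two
    resulting 4-phi-3 are those of the 8-phi-7 at b, which makes the two very-well-poised series
    proportional. *)
Definition vw_l := vwP (q := q) (q * a * b / (c * d * e)) (q * a / (c * e)) (q * a / (d * e))
  (q * a / (c * d)) (b * f / a) (b * g / a) (q * a / (f * g)).

Let watson_l : th Bb * P (q * a / (c * e)) * P (q * a / (d * e)) * vw_l =
  P (b * e / a) * (P (q * a / (e * f)) * P (q * a / (e * g)) * P z) * (u4b - Bb * u4z).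
Proof.
set A := q * a * b / (c * d * e).
have e1 : q * A / (q * a / (c * e) * (q * a / (d * e))) = b * e / a by rewrite /A; fz.
have e2 : q * a / (c * d) * Bb = z by rewrite zE' /Bb; fz.
have e3 : b * f / a * Bb = q * a / (e * g) by rewrite /Bb; fz.
have e4 : b * g / a * Bb = q * a / (e * f) by rewrite /Bb; fz.
have e5 : q * A / (q * a / (c * e)) = q * b / d by rewrite /A; fz.
have e6 : q * A / (q * a / (d * e)) = q * b / c by rewrite /A; fz.
have e7 : q * A / (q * a / (c * d)) = q * b / e by rewrite /A; fz.
have e8 : q * A / (b * f / a) = q ^+ 2 * a ^+ 2 / (c * d * e * f) by rewrite /A; fz.
have e9 : q * A / (b * g / a) = q ^+ 2 * a ^+ 2 / (c * d * e * g) by rewrite /A; fz.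
have h := @watson_P _ _ _ q hq A (q * a / (c * e)) (q * a / (d * e)) (q * a / (c * d)) (b * f / a) (b * g / a)
  Bb (q * a / (f * g)).
rewrite e1 e2 e3 e4 e5 e6 e7 e8 e9 in h; rewrite /vw_l -/A h; last first.
all: lazymatch goal with |- is_true (_ < _) => exact: w1 | |- @eq _ _ _ => idtac
  | |- is_true (P _ != 0) => rewrite /A ?/Bb; first [exact: Pz | Pn] | |- is_true (qtheta _ != 0) => rewrite /Bb; Pn
  | |- is_true (_ != 0) => by rewrite /A !(mulf_neq0, invr_eq0) end.
- by rewrite /A /Bb; fz.
- by rewrite /A /Bb; fz.
- apply: scaled_difference; first by ring.
  + rewrite /u4b.
    transitivity (u4 q (q / Bb) (q * b / c) (q * b / d) (b * e / a) (b * f / a) (b * g / a) (q * a / (c * d))).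
      by u4perm.
    by apply: u4E => //; rewrite /Bb; fz.
  rewrite /u4z.
  transitivity (u4 (q * Bb) q (q * A * Bb / (q * a / (c * e))) (q * A * Bb / (q * a / (d * e)))
    (q * a / (e * f)) (q * a / (e * g)) (q * a / (f * g)) z); first by u4perm.
  transitivity (u4 (q ^+ 2 * a ^+ 2 / (b * e * f * g)) q (q ^+ 2 * a ^+ 2 / (d * e * f * g))
    (q ^+ 2 * a ^+ 2 / (c * e * f * g)) (q * a / (e * f)) (q * a / (e * g)) (q * a / (f * g)) z).
    by apply: u4E => //; rewrite /A /Bb; fz.
  by u4perm.
Qed.

Let a2 := b * c * d * e ^+ 2 / (q * a ^+ 2).
Let a3 := b * c * d * e * f / (q * a ^+ 2).
Let a4 := b * c * d * e * g / (q * a ^+ 2).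
Let b1 := b * c * e / a.
Let b2 := b * d * e / a.
Let b3 := c * d * e / a.
Let b4 := b * c * d * e ^+ 2 * f * g / (q * a ^+ 3).

Ltac gma := rewrite ?/a2 ?/a3 ?/a4 ?/b1 ?/b2 ?/b3 ?/b4 ?/Be ?/Bb; gm.

(** The 4-psi-4 of the theorem, with e in the place of a1. Balance forces mu = e / b, and the four
    companion series turn out to be precisely the 4-phi-3 produced by Watson's transformation. *)
Let five : th a3 * th a4 * th (e / b) / (e / b * (th b3 * th b4) * P q ^+ 2) *
    bilateral4 (q := q) e a2 a3 a4 b1 b2 b3 b4 +
  th (b * c / a) * th (b * d / a) * th b / (P q ^+ 2 * th Be^-1 * th e) * u4p +
  th (b1 / a2) * th (b2 / a2) * th (a2 / (e / b)) / (P q ^+ 2 * th Be * th a2) * u4e =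
  th (b * f / a) * th (b * g / a) * th (b * c * d / a) / (P q ^+ 2 * (e / b) * th Bb * th b3) * u4b +
  th (b4 / a3) * th (b4 / a4) * th (b4 / (e / b)) / (P q ^+ 2 * (e / b) * th (b4 / b3) * th b4) * u4z.
Proof.
have F := @five_term _ _ _ q hq e a2 a3 a4 b1 b2 b3 b4 (e / b).
have sy (x y : K) : x != 0 -> y = q / x -> th y = th x by move=> x0 ->; exact: th_sym.
have t1 : b1 / e = b * c / a by rewrite /b1; fz.
have t2 : b2 / e = b * d / a by rewrite /b2; fz.
have t3 : e / (e / b) = b by fz.
have t4 : a2 / e = Be^-1 by rewrite /a2 /Be; fz.
have t5 : e / a2 = Be by rewrite /a2 /Be; fz.
have t6 : th (b3 / a3) = th (b * f / a).
  by apply: sy; [rewrite !mulf_neq0 ?invr_eq0 | rewrite /b3 /a3; fz].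
have t7 : th (b3 / a4) = th (b * g / a).
  by apply: sy; [rewrite !mulf_neq0 ?invr_eq0 | rewrite /b3 /a4; fz].
have t8 : b3 / (e / b) = b * c * d / a by rewrite /b3; fz.
have t9 : b3 / b4 = Bb by rewrite /b3 /b4 /Bb; fz.
rewrite t1 t2 t3 t4 t5 t6 t7 t8 t9 in F.
have p1 : u4 (q * e / a3) (q * e / a4) q (q * e / a2) (q * e / b3) (q * e / b4) (q * e / b1) (q * e / b2) = u4p.
  transitivity (u4 (q ^+ 2 * a ^+ 2 / (b * c * d * f)) (q ^+ 2 * a ^+ 2 / (b * c * d * g)) q
    (q ^+ 2 * a ^+ 2 / (b * c * d * e)) (q * a / (c * d)) z (q * a / (b * c)) (q * a / (b * d))).
    by apply: u4E; rewrite ?zE' /a2 /a3 /a4 /b1 /b2 /b3 /b4; fz.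
  by rewrite /u4p; u4perm.
have p2 : u4 (q * a2 / a3) (q * a2 / a4) (q * a2 / e) q (q * a2 / b3) (q * a2 / b4) (q * a2 / b1) (q * a2 / b2) = u4e.
  transitivity (u4 (q * e / f) (q * e / g) (b * c * d * e / a ^+ 2) q
    (b * e / a) (q * a / (f * g)) (d * e / a) (c * e / a)).
    by apply: u4E; rewrite /a2 /a3 /a4 /b1 /b2 /b3 /b4; fz.
  by rewrite /u4e; u4perm.
have p3 : u4 (q * b1 / b3) (q * b2 / b3) q (q * b4 / b3) (q * e / b3) (q * a2 / b3) (q * a3 / b3) (q * a4 / b3) = u4b.
  transitivity (u4 (q * b / d) (q * b / c) q (b * e * f * g / a ^+ 2)
    (q * a / (c * d)) (b * e / a) (b * f / a) (b * g / a)).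
    by apply: u4E; rewrite /a2 /a3 /a4 /b1 /b2 /b3 /b4; fz.
  by rewrite /u4b; u4perm.
have p4 : u4 (q * b1 / b4) (q * b2 / b4) (q * b3 / b4) q (q * e / b4) (q * a2 / b4) (q * a3 / b4) (q * a4 / b4) = u4z.
  transitivity (u4 (q ^+ 2 * a ^+ 2 / (d * e * f * g)) (q ^+ 2 * a ^+ 2 / (c * e * f * g))
    (q ^+ 2 * a ^+ 2 / (b * e * f * g)) q z (q * a / (f * g)) (q * a / (e * g)) (q * a / (e * f))).
    by apply: u4E; rewrite ?zE' /a2 /a3 /a4 /b1 /b2 /b3 /b4; fz.
  by rewrite /u4z; u4perm.
rewrite -t4 p1 p2 p3 p4 in F; rewrite -t4; apply: F.
all: lazymatch goal with |- is_true (qgeneric _) => rewrite ?t4; gma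
  | |- @eq _ _ _ => rewrite /a2 /a3 /a4 /b1 /b2 /b3 /b4; fz
  | |- is_true (_ != 0) => apply: (generic_neq0 (q := q)); gma end.
Qed.

Let mu0 : e / b != 0. Proof. by rewrite mulf_neq0 ?invr_eq0. Qed.
Let Be0 : Be != 0. Proof. by rewrite /Be !mulf_neq0 ?invr_eq0 ?mulf_neq0 ?expf_neq0. Qed.
Let ths x : generic x -> th x != 0. Proof. exact: generic_th. Qed.
Let Pn0 x : generic x -> P x != 0. Proof. exact: generic_P. Qed.

Ltac ne := lazymatch goal with
  | |- is_true (qtheta _ != 0) => apply: ths; gma
  | |- is_true (P q != 0) => exact: Pq
  | |- is_true (P z != 0) => exact: Pz
  | |- is_true (P _ != 0) => apply: Pn0; gma
  | |- is_true (e / b != 0) => exact: mu0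
  | |- is_true (Be != 0) => exact: Be0
  | |- is_true (a != 0) => exact: a0
  | |- is_true (b != 0) => exact: b0
  | |- is_true (e != 0) => exact: e0
  | |- is_true (qgeneric _) => gma
  | |- is_true (_ * _ != 0) => apply: mulf_neq0; ne
  | |- is_true (_ ^+ _ != 0) => apply: expf_neq0; ne
  | |- is_true (_^-1 != 0) => rewrite invr_eq0; ne
  end.

(** K1 is the value that removes [u4p] ([R4]) and K2 the one that then removes [u4b] ([R2]). K3 and
    K4 are written as single products; that they equal the sums left by the elimination is the
    content of [R3] and [R1]. *)
Let K1 := th a * th (b / a) * th (c * e / a) * th (d * e / a) *
  (P (q * a / (c * d)) * P (q * a / (e * f)) * P (q * a / (e * g)) * P (q * a / (f * g))) * th a3 * th a4 /
  (th b * th c * th d * th f * th g * P (b * c / a) * P (b * d / a) * th b3 * th b4).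
Let K2 := - (th a * th (b / a) * P (q * a / (c * d)) * P (q * a / (c * e)) * P (q * a / (d * e)) *
  P (q * a / (f * g)) * th (b * f / a) * th (b * g / a) * th Be /
  (th b * th f * th g * P (b * c / a) * P (b * d / a) * P (b * e / a) * P z * th (a / b) * th b3)).
Let K3 := - (a2 * K1 * (th b1 * th b2 * th b3 * th b4 / (th e * th a2 * th a3 * th a4))).
Let K4 := - (q / b4 * K1).

Let t := th a3 * th a4 * th (e / b) / (e / b * (th b3 * th b4) * P q ^+ 2).
Let c1 := th (b * c / a) * th (b * d / a) * th b / (P q ^+ 2 * th Be^-1 * th e).
Let c2 := th (b1 / a2) * th (b2 / a2) * th (a2 / (e / b)) / (P q ^+ 2 * th Be * th a2).
Let d1 := th (b * f / a) * th (b * g / a) * th (b * c * d / a) / (P q ^+ 2 * (e / b) * th Bb * th b3).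
Let d2 := th (b4 / a3) * th (b4 / a4) * th (b4 / (e / b)) / (P q ^+ 2 * (e / b) * th (b4 / b3) * th b4).

Let t6 : b3 / b4 = Bb. Proof. by rewrite /b3 /b4 /Bb; fz. Qed.
Let t4 : a2 / e = Be^-1. Proof. by rewrite /a2 /Be; fz. Qed.
Let t5 : e / a2 = Be. Proof. by rewrite /a2 /Be; fz. Qed.
Let sy (x y : K) : x != 0 -> y = q / x -> th y = th x. Proof. by move=> x0 ->; exact: th_sym. Qed.

Let R1 : K4 * t = - (K1 * (d2 + Bb * d1)).
Proof.
have t7 : b3 / (e / b) = b * c * d / a by rewrite /b3; fz.
have t8 : th (b3 / a3) = th (b * f / a).
  by apply: sy; [rewrite !mulf_neq0 ?invr_eq0 | rewrite /b3 /a3; fz].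
have t9 : th (b3 / a4) = th (b * g / a).
  by apply: sy; [rewrite !mulf_neq0 ?invr_eq0 | rewrite /b3 /a4; fz].
have E : th (b4 / a3) * th (b4 / a4) * th (b4 / (e / b)) / (th (b4 / b3) * th b4) +
    b3 / b4 * (th (b3 / a3) * th (b3 / a4) * th (b3 / (e / b)) / (th (b3 / b4) * th b3)) =
  q / b4 * (th a3 * th a4 * th (e / b) / (th b3 * th b4)).
  apply: residue_weight_sum_lower; try gma.
  by rewrite /b3 /b4 /a3 /a4; fz.
rewrite t6 t7 t8 t9 in E.
apply: relation_lower_certificate E; ne.
Qed.

Let R3 : Be * K3 * t = K1 * (Be * c2 + c1).
Proof.
have t7 : e / (e / b) = b by fz.
have t8 : b1 / e = b * c / a by rewrite /b1; fz.
have t9 : b2 / e = b * d / a by rewrite /b2; fz.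
have E : th (b1 / a2) * th (b2 / a2) * th (a2 / (e / b)) / (th (e / a2) * th a2) +
    a2 / e * (th (b1 / e) * th (b2 / e) * th (e / (e / b)) / (th (a2 / e) * th e)) =
  - (a2 / (e / b)) * (th b1 * th b2 * th (e / b) / (th e * th a2)).
  apply: residue_weight_sum; try gma; last by rewrite /b1 /b2 /a2; fz.
  - by rewrite /b1 !mulf_neq0 ?invr_eq0.
  - by rewrite /b2 !mulf_neq0 ?invr_eq0.
rewrite t4 t5 t7 t8 t9 in E.
apply: relation_upper_certificate E; ne.
Qed.

Let cb := th (b * c / a) * th (b * d / a) * th (b * f / a) * th (b * g / a) / (th (e / b) * th (a / b) * th b) / b.
Let ca := th c * th d * th f * th g / (th (b / a) * th (e / a) * th a) / a.
Let ce := th (e * c / a) * th (e * d / a) * th (e * f / a) * th (e * g / a) / (th (b / e) * th (a / e) * th e) / e.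

Let thdiv (x y : K) : x != 0 -> y != 0 -> th (x / y) = - (x / y) * th (y / x).
Proof. by move=> x0 y0; rewrite -(invf_div y x) thV ?invf_div // mulf_neq0 ?invr_eq0. Qed.

Let R2 : ca * (th Bb * P (b * c / a) * P (b * d / a)) *
    (K1 * d1 * (th Bb * P (q * a / (c * e)) * P (q * a / (d * e))) +
     K2 * (P (b * e / a) * (P (q * a / (e * f)) * P (q * a / (e * g)) * P z)) * t) =
  - (cb * (P (q * a / (c * d)) * (P (q * a / (e * f)) * P (q * a / (e * g)) * P (q * a / (f * g)))) * t *
     (th Bb * P (q * a / (c * e)) * P (q * a / (d * e)))).
Proof.
have s1 : th (a * (q * a / (b * c * d * e))) = th Be by congr th; rewrite /Be; ring.
have s2 : th (e * (q * a / (b * c * d * e))) = th (b * c * d / a).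
  by apply: sy; [rewrite !mulf_neq0 ?invr_eq0 | fz].
have s3 : th (b * (q * a / (b * c * d * e))) = th b3.
  by rewrite /b3; apply: sy; [rewrite !mulf_neq0 ?invr_eq0 | fz].
have s4 x : a * (x / a) = x by fz.
(* Weierstrass' relation at the points e, b, a with cofactors c/a, d/a and q a / (b c d e), whose
   product is q. *)
have E : b * th (e / b) * th (a * (c / a)) * th (a * (d / a)) * th (a * (q * a / (b * c * d * e))) +
    a * th (b / a) * th (e * (c / a)) * th (e * (d / a)) * th (e * (q * a / (b * c * d * e))) -
    a * th (e / a) * th (b * (c / a)) * th (b * (d / a)) * th (b * (q * a / (b * c * d * e))) = 0.
  apply: theta_three_term_generic; first [exact: e0 | exact: b0 | exact: a0 | gma | fz].
have s5 x y : x * (y / a) = x * y / a by rewrite mulrA.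
rewrite s1 s2 s3 !s4 !s5 (mulrC e c) (mulrC e d) (thdiv b0 a0) in E.
rewrite /ca /cb /K1 /K2 /d1 /t (thdiv b0 a0).
apply: relation_theta_certificate E; ne.
Qed.

Let thE x y : x != 0 -> y = q / x -> th x = P x * P y.
Proof. by move=> x0 ->. Qed.

(** No addition of thetas is involved: once the thetas at b c / a, b d / a, e f / a and e g / a are
    split into two infinite products, both sides are the same monomial. *)
Let R4 : ce * (P (q * a / (f * g)) * (P (q * a / (b * c)) * P (q * a / (b * d)) * P (q * a / (c * d)))) * Be * t =
  - (ca * (th Be * P (e * f / a) * P (e * g / a)) * K1 * c1).
Proof.
have s1 : th (b * c / a) = P (b * c / a) * P (q * a / (b * c)).
  by apply: thE; [rewrite !mulf_neq0 ?invr_eq0 | fz].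
have s2 : th (b * d / a) = P (b * d / a) * P (q * a / (b * d)).
  by apply: thE; [rewrite !mulf_neq0 ?invr_eq0 | fz].
have s3 : th (e * f / a) = P (e * f / a) * P (q * a / (e * f)).
  by apply: thE; [rewrite !mulf_neq0 ?invr_eq0 | fz].
have s4 : th (e * g / a) = P (e * g / a) * P (q * a / (e * g)).
  by apply: thE; [rewrite !mulf_neq0 ?invr_eq0 | fz].
have s5 : th Be^-1 = - Be^-1 * th Be := thV Be0.
rewrite /ca /ce /K1 /c1 /t s1 s2 s3 s4 s5 (thdiv b0 e0) (thdiv e0 a0) (mulrC e c) (mulrC e d).
apply: relation_product_certificate; ne.
Qed.

Theorem bilateral_expansion : wp_bilateral (q := q) a b c d e f g z =
  K1 * bilateral4 (q := q) e a2 a3 a4 b1 b2 b3 b4 + K2 * vw_l + K3 * u4e + K4 * u4z.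
Proof.
apply: (eliminate_series _ _ _ _ _ Be0 jackson watson_b watson_e watson_l five R1 R3 R2 R4); ne.
Qed.
End Main.

(** * The series of the statement *)

Section Conversion.
Context {R : realType} {K : numFieldType} {KR : modulus R K}.
Local Notation cmod := (@cmod R K KR).
Context {q : K} {hq : nome q}.
Local Notation P := (qpoch_inf q).
Local Notation qp := (qpoch_fin q).
Local Notation th := (qtheta (q := q)).
Local Notation u4 := (u4 (q := q)).
Implicit Types (La Lb : seq K) (w : nat -> K).

Let q0 : q != 0 := nome_neq0.

Definition hyper La Lb w : K := nsum (fun n => \prod_(x <- La) qp x n / \prod_(y <- Lb) qp y n * w n).

Lemma hyperE La Lb w : all (fun x => P x != 0) La -> all (fun y => P y != 0) Lb ->
  geo_bounded (fun n => \prod_(y <- Lb) P (y * q ^+ n) / \prod_(x <- La) P (x * q ^+ n) * w n) ->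
  hyper La Lb w = \prod_(x <- La) P x / \prod_(y <- Lb) P y *
    nsum (fun n => \prod_(y <- Lb) P (y * q ^+ n) / \prod_(x <- La) P (x * q ^+ n) * w n).
Proof.
move=> ha hb g; rewrite -nsumZ //; apply: eq_nsum => n.
have E L : all (fun x => P x != 0) L -> \prod_(x <- L) qp x n = \prod_(x <- L) P x / \prod_(x <- L) P (x * q ^+ n).
  elim: L => [|x L IH] /=; first by rewrite !big_nil divr1.
  case/andP=> x0 /IH; rewrite !big_cons => ->.
  have h : P (x * q ^+ n) != 0 by exact: qpoch_infX_neq0.
  rewrite (qpoch_inf_qp x n) invfM -[LHS]mulr1 -(divff h); ring.
by rewrite !E // !invfM !invrK; ring.
Qed.

Lemma qpoch_negE x n : x != 0 ->
  qpoch q x (- n.+1%:Z) = ((- x) ^+ n.+1 / q ^+ 'C(n.+2, 2) * qp (q / x) n.+1)^-1.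
Proof.
move=> x0; rewrite /=; congr (_^-1).
transitivity (qp (x / q ^+ n.+1) n.+1).
  rewrite /qpoch_fin big_nat_rev /= big_add1 /= !big_mkord; apply: eq_bigr => i _.
  have ni : (i <= n)%N by rewrite -ltnS.
  rewrite add1n !subSS -mulrA; congr (1 - _ * _).
  have -> : q ^- n.+1 * q ^+ i = (q ^+ n.+1 / q ^+ i)^-1 by rewrite invf_div mulrC.
  by rewrite -expfB ?ltnS // -subSn.
by rewrite qp_shift_down // [(- x) ^+ _]exprNn; ring.
Qed.

Lemma qpoch_neg_ratio x y n : x != 0 -> y != 0 ->
  qpoch q x (- n.+1%:Z) / qpoch q y (- n.+1%:Z) =
  (y / x) ^+ n.+1 * ((1 - q / y) / (1 - q / x)) * (qp (q * q / y) n / qp (q * q / x) n).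
Proof.
move=> x0 y0; rewrite !qpoch_negE // invrK !qpSl (exprNn x) (exprNn y) expr_div_n.
have e u : q / u * q = q * q / u by ring.
rewrite !e !invfM !invrK -!exprVn.
have s : (-1) ^+ n.+1 * (-1)^-1 ^+ n.+1 = 1 :> K by rewrite -exprMn mulrV ?expr1n // unitrN1.
have h : q ^+ 'C(n.+2, 2) * q^-1 ^+ 'C(n.+2, 2) = 1 by rewrite -exprMn divff // expr1n.
transitivity (((-1) ^+ n.+1 * (-1)^-1 ^+ n.+1) * (q ^+ 'C(n.+2, 2) * q^-1 ^+ 'C(n.+2, 2)) *
  (y ^+ n.+1 * x^-1 ^+ n.+1 * ((1 - q / y) / (1 - q / x)) * (qp (q * q / y) n / qp (q * q / x) n))).
  by ring.
by rewrite s h !mul1r; ring.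
Qed.

Lemma phi_hyper r (aa : r.+1.-tuple K) (bb : r.-tuple K) z :
  phi aa bb q z = hyper aa (q :: bb) (fun n => z ^+ n).
Proof. by []. Qed.

Lemma W87_hyper a (aa : 5.-tuple K) z :
  W87 a aa q z = hyper (a :: aa) (q :: [seq q * a / x | x <- aa])
    (fun n => (1 - a * q ^+ (2 * n)) / (1 - a) * z ^+ n).
Proof.
apply: eq_nsum => n; rewrite !big_cons big_map prodf_div invfM /qpoch_fin /qpoch /=; ring.
Qed.

(** Reversing the symbols of negative index turns the half k < 0 into a one-sided series. The
    hypothesis on the products makes its argument q^2 / q, that is q again. *)
Lemma psi_hyper x1 x2 x3 x4 y1 y2 y3 y4 : x1 != 0 -> x2 != 0 -> x3 != 0 -> x4 != 0 ->
  y1 != 0 -> y2 != 0 -> y3 != 0 -> y4 != 0 -> y1 * y2 * y3 * y4 = q ^+ 2 * (x1 * x2 * x3 * x4) ->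
  psi [tuple x1; x2; x3; x4] [tuple y1; y2; y3; y4] q q =
  hyper [:: x1; x2; x3; x4] [:: y1; y2; y3; y4] (fun n => q ^+ n) +
  hyper [:: q * q / y1; q * q / y2; q * q / y3; q * q / y4] [:: q * q / x1; q * q / x2; q * q / x3; q * q / x4]
   (fun n => q * ((1 - q / y1) * (1 - q / y2) * (1 - q / y3) * (1 - q / y4) /
     ((1 - q / x1) * (1 - q / x2) * (1 - q / x3) * (1 - q / x4))) * q ^+ n).
Proof.
move=> x10 x20 x30 x40 y10 y20 y30 y40 E; rewrite /psi /bilateral_sum; congr (_ + _).
apply: eq_nsum => n; rewrite /qpochs !big_cons !big_nil !mulr1 -exprnN.
have r1 := qpoch_neg_ratio n x10 y10; have r2 := qpoch_neg_ratio n x20 y20.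
have r3 := qpoch_neg_ratio n x30 y30; have r4 := qpoch_neg_ratio n x40 y40.
transitivity (qpoch q x1 (- n.+1%:Z) / qpoch q y1 (- n.+1%:Z) * (qpoch q x2 (- n.+1%:Z) / qpoch q y2 (- n.+1%:Z)) *
  (qpoch q x3 (- n.+1%:Z) / qpoch q y3 (- n.+1%:Z)) * (qpoch q x4 (- n.+1%:Z) / qpoch q y4 (- n.+1%:Z)) * q ^- n.+1).
  by rewrite !invfM; ring.
rewrite r1 r2 r3 r4.
have e : (y1 / x1) ^+ n.+1 * (y2 / x2) ^+ n.+1 * (y3 / x3) ^+ n.+1 * (y4 / x4) ^+ n.+1 * q ^- n.+1 = q ^+ n.+1.
  rewrite -!exprMn (_ : y1 / x1 * (y2 / x2) * (y3 / x3) * (y4 / x4) = q ^+ 2); last first.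
    by apply: (mulIf (mulf_neq0 (mulf_neq0 (mulf_neq0 x10 x20) x30) x40)); rewrite -E; fz.
  by rewrite -exprM mulnC exprM expr2 mulfK // expf_neq0.
rewrite !invfM.
transitivity (((y1 / x1) ^+ n.+1 * (y2 / x2) ^+ n.+1 * (y3 / x3) ^+ n.+1 * (y4 / x4) ^+ n.+1 * q ^- n.+1) *
  (((1 - q / y1) / (1 - q / x1)) * (qp (q * q / y1) n / qp (q * q / x1) n) *
   (((1 - q / y2) / (1 - q / x2)) * (qp (q * q / y2) n / qp (q * q / x2) n)) *
   (((1 - q / y3) / (1 - q / x3)) * (qp (q * q / y3) n / qp (q * q / x3) n)) *
   (((1 - q / y4) / (1 - q / x4)) * (qp (q * q / y4) n / qp (q * q / x4) n)))); first by ring.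
by rewrite e exprS; ring.
Qed.

Lemma Psi88_hyper a b c d e f g z : a != 0 -> b != 0 -> c != 0 -> d != 0 -> e != 0 -> f != 0 -> g != 0 ->
  z * (b * c * d * e * f * g) = q ^+ 2 * a ^+ 3 ->
  Psi88 a [tuple b; c; d; e; f; g] q z =
  hyper [:: b; c; d; e; f; g] [:: q * a / b; q * a / c; q * a / d; q * a / e; q * a / f; q * a / g]
    (fun n => (1 - a * q ^+ (2 * n)) / (1 - a) * z ^+ n) +
  hyper [:: b * q / a; c * q / a; d * q / a; e * q / a; f * q / a; g * q / a]
    [:: q * q / b; q * q / c; q * q / d; q * q / e; q * q / f; q * q / g]
    (fun n => (- a * z / (1 - a) * ((1 - b / a) * (1 - c / a) * (1 - d / a) * (1 - e / a) * (1 - f / a) * (1 - g / a) /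
      ((1 - q / b) * (1 - q / c) * (1 - q / d) * (1 - q / e) * (1 - q / f) * (1 - q / g)))) *
      ((1 - q * q / a * q ^+ (2 * n)) * z ^+ n)).
Proof.
move=> a0 b0 c0 d0 e0 f0 g0 E; rewrite /Psi88 /bilateral_sum; congr (_ + _).
  apply: eq_nsum => n; rewrite !big_cons !big_nil !mulr1 !invfM /qpoch_fin /qpoch.
  have -> : q ^ (2 * n%:Z)%R = q ^+ (2 * n) by [].
  have -> : z ^ n%:Z = z ^+ n by [].
  ring.
have z0 : z != 0.
  by apply: contra_neq (mulf_neq0 (expf_neq0 2 q0) (expf_neq0 3 a0)) => z0; rewrite -E z0 mul0r.
apply: eq_nsum => n; rewrite !big_cons !big_nil !mulr1 -exprnN.
have r x : x != 0 -> qpoch q x (- n.+1%:Z) / qpoch q (q * a / x) (- n.+1%:Z) =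
  (q * a / x / x) ^+ n.+1 * ((1 - x / a) / (1 - q / x)) * (qp (x * q / a) n / qp (q * q / x) n).
  move=> x0; rewrite qpoch_neg_ratio ?mulf_neq0 ?invr_eq0 //.
  by congr (_ * ((1 - _) / _) * (qp _ _ / _)); fz.
rewrite !r //.
(* The six reversed quotients contribute (q a)^6 / (b c d e f g)^2 = q^2 z^2 per step, and dividing
   by z leaves q^2 z. *)
have e1 : (q * a / b / b) ^+ n.+1 * (q * a / c / c) ^+ n.+1 * (q * a / d / d) ^+ n.+1 *
  (q * a / e / e) ^+ n.+1 * (q * a / f / f) ^+ n.+1 * (q * a / g / g) ^+ n.+1 * z ^- n.+1 = (q ^+ 2 * z) ^+ n.+1.
  rewrite -!exprMn -exprVn -exprMn; congr (_ ^+ _).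
  apply: (mulIf (mulf_neq0 z0 (expf_neq0 2 (mulf_neq0 (mulf_neq0 (mulf_neq0 (mulf_neq0 (mulf_neq0 b0 c0) d0) e0) f0) g0)))).
  transitivity ((q * a) ^+ 6); first by fz.
  transitivity (q ^+ 2 * (z * (b * c * d * e * f * g)) ^+ 2); last by ring.
  by rewrite E; ring.
(* The factor q^(2(n+1)) is spent on clearing the very-well-poised factor of its negative power of
   q, so that the half k < 0 has argument z as well. *)
have e2 : (1 - a * q ^ (2 * - n.+1%:Z)) * (q ^+ 2 * z) ^+ n.+1 = - a * z * ((1 - q * q / a * q ^+ (2 * n)) * z ^+ n).
  have -> : (2 * - n.+1%:Z = - (2 * n.+1)%N%:Z)%R by lia.
  rewrite -exprnN exprMn -exprM.
  have h : q ^+ (2 * n.+1) != 0 by rewrite expf_neq0.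
  transitivity ((q ^+ (2 * n.+1) - a) * z ^+ n.+1); first by rewrite mulrA mulrBl mul1r -mulrA mulVf ?mulr1.
  rewrite mulnS exprD [z ^+ n.+1]exprS; fz.
rewrite -e1 in e2; rewrite !invfM.
transitivity (((1 - a * q ^ (2 * - n.+1%:Z)) *
   ((q * a / b / b) ^+ n.+1 * (q * a / c / c) ^+ n.+1 * (q * a / d / d) ^+ n.+1 *
    (q * a / e / e) ^+ n.+1 * (q * a / f / f) ^+ n.+1 * (q * a / g / g) ^+ n.+1 * z ^- n.+1)) / (1 - a) *
  (((1 - b / a) / (1 - q / b)) * (qp (b * q / a) n / qp (q * q / b) n) *
   (((1 - c / a) / (1 - q / c)) * (qp (c * q / a) n / qp (q * q / c) n)) *
   (((1 - d / a) / (1 - q / d)) * (qp (d * q / a) n / qp (q * q / d) n)) *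
   (((1 - e / a) / (1 - q / e)) * (qp (e * q / a) n / qp (q * q / e) n)) *
   (((1 - f / a) / (1 - q / f)) * (qp (f * q / a) n / qp (q * q / f) n)) *
   (((1 - g / a) / (1 - q / g)) * (qp (g * q / a) n / qp (q * q / g) n)))).
  by ring.
rewrite e2; ring.
Qed.
End Conversion.

(** * The series of the statement as sums of infinite products *)

Section SeriesNormalForms.
Context {R : realType} {K : numFieldType} {KR : modulus R K}.
Local Notation cmod := (@cmod R K KR).
Context {q : K} {hq : nome q}.
Local Notation P := (qpoch_inf q).
Local Notation th := (qtheta (q := q)).
Local Notation u4 := (u4 (q := q)).

Let q0 : q != 0 := nome_neq0.
Let Pq : P q != 0 := qpoch_inf_q_neq0 (hq := hq).

Lemma dom_cvg_prod_all {T} {F : set_system T} {FF : ProperFilter F} (I : Type) (s : seq I) (p : pred I)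
    (U : I -> T -> nat -> K) (v : I -> nat -> K) :
  (forall i, p i -> dom_cvg F (U i) (v i) 1) -> all p s ->
  dom_cvg F (fun t k => \prod_(i <- s) U i t k) (fun k => \prod_(i <- s) v i k) 1.
Proof.
move=> h; elim: s => [|i s IH] /= => [_|/andP[pi /IH{}IH]].
  by apply: eq_dom_cvg (dom_cvg_cst 1) => [t k|k|//]; rewrite big_nil.
by apply: eq_dom_cvg (dom_cvgMr (h i pi) IH) => [t k|k|//]; rewrite big_cons.
Qed.

Lemma geo_bounded_prod_qpoch_inf La Lb (w : nat -> K) : all (fun x => P x != 0) La -> geo_bounded w ->
  geo_bounded (fun n => \prod_(y <- Lb) P (y * q ^+ n) / \prod_(x <- La) P (x * q ^+ n) * w n).
Proof.
move=> ha [M [r [M0 r01 hw]]].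
have hb : dom_cvg \oo (fun _ n => \prod_(y <- Lb) P (y * q ^+ n)) (fun n => \prod_(y <- Lb) P (y * q ^+ n)) 1.
  apply: (dom_cvg_prod_all (p := xpredT) (U := fun y (_ : nat) n => P (y * q ^+ n))) (all_predT _) => y _.
  by apply: dom_cvg_qpoch_inf; exact: cvg_cst.
have hv : dom_cvg \oo (fun _ n => \prod_(x <- La) (P (x * q ^+ n))^-1) (fun n => \prod_(x <- La) (P (x * q ^+ n))^-1) 1.
  apply: (dom_cvg_prod_all (U := fun y (_ : nat) n => (P (y * q ^+ n))^-1)) ha => y y0.
  by apply: dom_cvg_qpoch_infV => //; exact: cvg_cst.
apply: (eq_geo_bounded (u := fun n => \prod_(y <- Lb) P (y * q ^+ n) * \prod_(x <- La) (P (x * q ^+ n))^-1 * w n)).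
  by move=> n; rewrite prodfV.
exact: dom_cvg_geo_bounded r01 (dom_cvgMl (dom_cvgMr hb hv) (dom_cvg_const M0 hw)).
Qed.

Lemma geo_bounded_qX : geo_bounded (fun n => q ^+ n).
Proof.
by exists 1, (cmod q); split=> // [|n]; [rewrite cmod_ge0 nome_lt1 | rewrite cmodX mul1r].
Qed.

Lemma geo_bounded_affine_exp a z : cmod z < 1 -> geo_bounded (fun n => (1 - a * q ^+ (2 * n)) * z ^+ n).
Proof.
move=> z1; exists (1 + cmod a), (cmod z); split=> [| |n]; first by rewrite addr_ge0 ?cmod_ge0.
  by rewrite cmod_ge0.
rewrite cmodM cmodX ler_wpM2r ?exprn_ge0 ?cmod_ge0 //.
by apply: le_trans (ler_cmodB _ _) _; rewrite cmod1 lerD2l [leLHS]cmodM ler_piMr ?cmod_ge0 ?cmod_qX.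
Qed.

Lemma phi_u4 x1 x2 x3 x4 y1 y2 y3 : P x1 != 0 -> P x2 != 0 -> P x3 != 0 -> P x4 != 0 ->
  P y1 != 0 -> P y2 != 0 -> P y3 != 0 ->
  phi [tuple x1; x2; x3; x4] [tuple y1; y2; y3] q q =
  P x1 * P x2 * P x3 * P x4 / (P q * P y1 * P y2 * P y3) * u4 q y1 y2 y3 x1 x2 x3 x4.
Proof.
move=> *; rewrite phi_hyper hyperE /=; first last.
- apply: geo_bounded_prod_qpoch_inf geo_bounded_qX; rewrite /=; do !(apply/andP; split=> //).
- by do !(apply/andP; split=> //).
- by do !(apply/andP; split=> //).
rewrite !big_cons !big_nil !mulr1 !mulrA; congr (_ * _); apply: eq_nsum => n.
by rewrite !big_cons !big_nil /u4_term !mulr1 mulrC !mulrA.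
Qed.

Lemma psi_bilateral4 x1 x2 x3 x4 y1 y2 y3 y4 : qgeneric (q := q) x1 -> qgeneric (q := q) x2 ->
  qgeneric (q := q) x3 -> qgeneric (q := q) x4 -> qgeneric (q := q) y1 -> qgeneric (q := q) y2 ->
  qgeneric (q := q) y3 -> qgeneric (q := q) y4 -> y1 * y2 * y3 * y4 = q ^+ 2 * (x1 * x2 * x3 * x4) ->
  psi [tuple x1; x2; x3; x4] [tuple y1; y2; y3; y4] q q =
  P x1 * P x2 * P x3 * P x4 / (P y1 * P y2 * P y3 * P y4) * bilateral4 (q := q) x1 x2 x3 x4 y1 y2 y3 y4.
Proof.
move=> gx1 gx2 gx3 gx4 gy1 gy2 gy3 gy4 E; rewrite psi_hyper ?(generic_neq0 (q := q)) //.
have nz x : qgeneric (q := q) x -> [/\ x != 0, P x != 0, P (q / x) != 0 & P (q * q / x) != 0].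
  move=> gx; split; [exact: generic_neq0 gx | exact: generic_P | |]; apply: generic_P; first exact: generic_qV.
  by rewrite -mulrA; apply: generic_qM; exact: generic_qV.
have [] := nz _ gx1; have [] := nz _ gx2; have [] := nz _ gx3; have [] := nz _ gx4.
have [] := nz _ gy1; have [] := nz _ gy2; have [] := nz _ gy3; have [] := nz _ gy4.
move=> *; rewrite !hyperE /=; first last.
1,4: apply: geo_bounded_prod_qpoch_inf; rewrite /= ?andbT; do ?[apply/andP; split=> //];
  first [exact: geo_bounded_qX | apply: geo_boundedZ; exact: geo_bounded_qX].
all: try by do !(apply/andP; split=> //).
rewrite !big_cons !big_nil !mulr1 /bilateral4 [RHS]mulrDr; congr (_ + _).
  rewrite !mulrA; congr (_ * _); apply: eq_nsum => n.
  by rewrite !big_cons !big_nil /u4_term !mulr1 mulrC !mulrA.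
set C := q * (_ / _).
rewrite (_ : nsum _ = C * u4 (q * (q / x1)) (q * (q / x2)) (q * (q / x3)) (q * (q / x4))
    (q * (q / y1)) (q * (q / y2)) (q * (q / y3)) (q * (q / y4))).
  rewrite /C /qtheta [LHS]mulrA [RHS]mulrA; congr (_ * _).
  have s x : P (q / x) = (1 - q / x) * P (q * q / x) by rewrite -[q * q / x]mulrA -qpoch_inf1.
  have h x : P (q / x) != 0 -> 1 - q / x != 0 by exact: (qpoch_inf_neq1 (hq := hq)).
  have hx1 : 1 - q / x1 != 0 by exact: h.
  have hx2 : 1 - q / x2 != 0 by exact: h.
  have hx3 : 1 - q / x3 != 0 by exact: h.
  have hx4 : 1 - q / x4 != 0 by exact: h.
  rewrite (s x1) (s x2) (s x3) (s x4) (s y1) (s y2) (s y3) (s y4).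
  move: hx1 hx2 hx3 hx4; move: (1 - q / x1) (1 - q / x2) (1 - q / x3) (1 - q / x4) (1 - q / y1) (1 - q / y2)
    (1 - q / y3) (1 - q / y4) => *.
  by fz.
rewrite -nsumZ; last by apply: geo_bounded_u4; rewrite mulrA.
have m x : q * (q / x) = q * q / x by rewrite mulrA.
by apply: eq_nsum => n; rewrite !big_cons !big_nil /u4_term !mulr1 !m !invfM; ring.
Qed.

Lemma W87_vwP a x1 x2 x3 x4 x5 z : cmod z < 1 -> P a != 0 -> P x1 != 0 -> P x2 != 0 -> P x3 != 0 ->
  P x4 != 0 -> P x5 != 0 -> P (q * a / x1) != 0 -> P (q * a / x2) != 0 -> P (q * a / x3) != 0 ->
  P (q * a / x4) != 0 -> P (q * a / x5) != 0 ->
  W87 a [tuple x1; x2; x3; x4; x5] q z =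
  P a * P x1 * P x2 * P x3 * P x4 * P x5 /
   ((1 - a) * (P q * P (q * a / x1) * P (q * a / x2) * P (q * a / x3) * P (q * a / x4) * P (q * a / x5))) *
  vwP (q := q) a x1 x2 x3 x4 x5 z.
Proof.
move=> z1 na *; have a1 : 1 - a != 0 by exact: (qpoch_inf_neq1 (hq := hq)).
have g : geo_bounded (fun n => (1 - a * q ^+ (2 * n)) / (1 - a) * z ^+ n).
  apply: eq_geo_bounded (geo_boundedZ (1 - a)^-1 (geo_bounded_affine_exp a z1)) => n; ring.
rewrite W87_hyper hyperE /=; first last.
- by apply: geo_bounded_prod_qpoch_inf g; rewrite /=; do !(apply/andP; split=> //).
- by do !(apply/andP; split=> //).
- by do !(apply/andP; split=> //).
rewrite (_ : nsum _ = (1 - a)^-1 * vwP (q := q) a x1 x2 x3 x4 x5 z); last first.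
  rewrite -nsumZ; last first.
    apply: (eq_geo_bounded (u := fun n => \prod_(y <- [:: q; q * a / x1; q * a / x2; q * a / x3; q * a / x4; q * a / x5])
      P (y * q ^+ n) / \prod_(x <- [:: a; x1; x2; x3; x4; x5]) P (x * q ^+ n) * ((1 - a * q ^+ (2 * n)) * z ^+ n))).
      by move=> n; rewrite !big_cons !big_nil !mulr1 /vwP_term !mulrA; ring.
    apply: geo_bounded_prod_qpoch_inf (geo_bounded_affine_exp a z1).
    by rewrite /=; do !(apply/andP; split=> //).
  apply: eq_nsum => n; rewrite !big_cons !big_nil !mulr1 /vwP_term !mulrA; ring.
by rewrite !big_cons !big_nil !mulr1 [((1 - a) * _)^-1]invfM !mulrA; ring.
Qed.

Lemma Psi88_wp_bilateral a b c d e f g z : cmod z < 1 -> z * (b * c * d * e * f * g) = q ^+ 2 * a ^+ 3 ->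
  qgeneric (q := q) a ->
  qgeneric (q := q) b -> qgeneric (q := q) c -> qgeneric (q := q) d -> qgeneric (q := q) e ->
  qgeneric (q := q) f -> qgeneric (q := q) g ->
  qgeneric (q := q) (b / a) -> qgeneric (q := q) (c / a) -> qgeneric (q := q) (d / a) -> qgeneric (q := q) (e / a) ->
  qgeneric (q := q) (f / a) -> qgeneric (q := q) (g / a) ->
  Psi88 a [tuple b; c; d; e; f; g] q z =
  P b * P c * P d * P e * P f * P g /
   ((1 - a) * (P (q * a / b) * P (q * a / c) * P (q * a / d) * P (q * a / e) * P (q * a / f) * P (q * a / g))) *
  wp_bilateral (q := q) a b c d e f g z.
Proof.
move=> z1 zE ga gb gc gd ge gf gg gba gca gda gea gfa gga.
rewrite Psi88_hyper ?(generic_neq0 (q := q)) //.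
have a1 : 1 - a != 0 by apply: (qpoch_inf_neq1 (hq := hq)); exact: generic_P.
have nz x : qgeneric (q := q) x -> qgeneric (q := q) (x / a) ->
    [/\ x != 0, P x != 0, P (q * a / x) != 0, P (x * q / a) != 0 & P (q * q / x) != 0] /\ P (q / x) != 0 /\ P (x / a) != 0.
  move=> gx gxa; split; last by split; apply: generic_P => //; exact: generic_qV.
  split; [exact: generic_neq0 gx | exact: generic_P | | |]; apply: generic_P.
  - by rewrite -mulrA -invf_div; exact: generic_qV.
  - by rewrite mulrAC mulrC; exact: generic_qM.
  - by rewrite -mulrA; apply: generic_qM; exact: generic_qV.
have [[b0 b1 b2 b3 b4] [b5 b6]] := nz _ gb gba; have [[c0 c1 c2 c3 c4] [c5 c6]] := nz _ gc gca.
have [[d0 d1 d2 d3 d4] [d5 d6]] := nz _ gd gda; have [[e0 e1 e2 e3 e4] [e5 e6]] := nz _ ge gea.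
have [[f0 f1 f2 f3 f4] [f5 f6]] := nz _ gf gfa; have [[g0 g1 g2 g3 g4] [g5 g6]] := nz _ gg gga.
have a0 := generic_neq0 ga.
have gw y := geo_bounded_affine_exp y z1.
rewrite !hyperE /=; first last.
all: lazymatch goal with
  | |- geo_bounded _ => apply: geo_bounded_prod_qpoch_inf; first by rewrite /=; do !(apply/andP; split=> //)
  | |- @eq _ _ _ => idtac
  | |- _ => by do !(apply/andP; split=> //) end.
- by apply: eq_geo_bounded (geo_boundedZ (1 - a)^-1 (gw a)) => n; ring.
- exact: geo_boundedZ.
rewrite /wp_bilateral [RHS]mulrBr.
congr (_ + _).
  rewrite (_ : nsum _ = (1 - a)^-1 * wp (q := q) a b c d e f g z a).
    by rewrite !big_cons !big_nil !mulr1 [((1 - a) * _)^-1]invfM !mulrA; ring.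
  rewrite -nsumZ; last by apply: geo_bounded_wp => //; rewrite mulfK.
  apply: eq_nsum => n; rewrite !big_cons !big_nil !mulr1 /wp_term !mulfK // !invfM; ring.
set C := - a * z / (1 - a) * (_ / _).
rewrite (_ : nsum _ = C * wp (q := q) a b c d e f g z q); last first.
  rewrite -nsumZ; last by apply: geo_bounded_wp.
  by apply: eq_nsum => n; rewrite !big_cons !big_nil !mulr1 /wp_term !invfM; ring.
have s x : P (q / x) = (1 - q / x) * P (q * q / x) by rewrite -[q * q / x]mulrA -qpoch_inf1.
have s' x : x != 0 -> P (q / (q * a / x)) = (1 - x / a) * P (x * q / a).
  by move=> x0; rewrite (_ : x * q / a = q * (x / a)); [rewrite -qpoch_inf1; congr (P _); fz | ring].
have h x : P (q / x) != 0 -> 1 - q / x != 0 by exact: (qpoch_inf_neq1 (hq := hq)).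
rewrite /qtheta !s' // (s b) (s c) (s d) (s e) (s f) (s g) !big_cons !big_nil !mulr1 /C.
move: (h _ b5) (h _ c5) (h _ d5) (h _ e5) (h _ f5) (h _ g5) a1.
move: (1 - q / b) (1 - q / c) (1 - q / d) (1 - q / e) (1 - q / f) (1 - q / g) (1 - a) => *.
move: (wp _ _ _ _ _ _ _ _ _) (1 - b / a) (1 - c / a) (1 - d / a) (1 - e / a) (1 - f / a) (1 - g / a) => *.
by fz.
Qed.
End SeriesNormalForms.

(** * The two sides of the identity as functions of the parameters *)

Section Sides.
Context {K : numFieldType}.
Variables q a b c d e f g : K.

Definition num_psi := qpochs_inf q [:: q * a; q / a; b / a; c * e / a; d * e / a;
    q * a / (c * d); q * a / (c * e); q * a / (d * e); q * a / (e * f); q * a / (e * g); q * a / (f * g);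
    b * c * e / a; b * d * e / a; q ^+ 2 * a ^+ 2 / (b * c * d * e * f); q ^+ 2 * a ^+ 2 / (b * c * d * e * g)].
Definition den_psi := qpochs_inf q [:: q / b; q / c; q / d; q / f; q / g; q * a / c; q * a / d;
    q * a / e; q * a / f; q * a / g; b * c / a; b * d / a; q * a / (c * d * e);
    b * c * d * e ^+ 2 / (q * a ^+ 2); q ^+ 2 * a ^+ 3 / (b * c * d * e ^+ 2 * f * g)].

Definition num_W87 := qpochs_inf q [:: q; c; d; e; q * a; q / a; b / a; q * b / c; q * b / d;
    q * b / e; q * a / (b * f); q * a / (b * g); q * a / (f * g);
    q ^+ 2 * a ^+ 2 / (c * d * e * f); q ^+ 2 * a ^+ 2 / (c * d * e * g)] * theta q (q * a ^+ 2 / (b * c * d * e)).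
Definition den_W87 := qpochs_inf q [:: q / b; q / f; q / g; q * a / c; q * a / d; q * a / e;
    q * a / f; q * a / g; b * c / a; b * d / a; b * e / a;
    q ^+ 2 * a * b / (c * d * e); q ^+ 2 * a ^+ 3 / (b * c * d * e * f * g)] * thetas q [:: a / b; c * d * e / a].

Definition num_upper := qpochs_inf q [:: q; q * a; q / a; b / a; q * e / f; q * e / g;
    q * a / (c * d); q * a / (c * e); q * a / (d * e); q * a / (e * f);
    q * a / (e * g); b * c * d * e / a ^+ 2; q ^+ 2 * a ^+ 3 / (b * c * d * e * f * g)] *
  thetas q [:: b * c * e / a; b * d * e / a].
Definition den_upper := qpochs_inf q [:: q / b; q / c; q / d; q / e; q / f; q / g; q * a / c;
    q * a / d; q * a / e; q * a / f; q * a / g; b * c / a; b * d / a;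
    b * e / a; q ^+ 2 * a ^+ 3 / (b * c * d * e * f * g)] * theta q (q * a ^+ 2 / (b * c * d * e ^+ 2)).

Definition num_lower := qpochs_inf q [:: q; e; q * a; q / a; b / a; c * e / a; d * e / a;
    q * a / (c * d); q * a / (c * e); q * a / (d * e);
    q ^+ 2 * a ^+ 2 / (b * e * f * g); q ^+ 2 * a ^+ 2 / (c * e * f * g); q ^+ 2 * a ^+ 2 / (d * e * f * g)] *
  thetas q [:: b * c * d * e * f / (q * a ^+ 2); b * c * d * e * g / (q * a ^+ 2)].
Definition den_lower := qpochs_inf q [:: q / b; q / c; q / d; q / f; q / g; q * a / c; q * a / d;
    q * a / e; q * a / f; q * a / g; b * c / a; b * d / a; q ^+ 2 * a ^+ 3 / (b * c * d * e * f * g)] *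
  thetas q [:: c * d * e / a; b * c * d * e ^+ 2 * f * g / (q ^+ 2 * a ^+ 3)].

Definition lhs := Psi88 a [tuple b; c; d; e; f; g] q (q ^+ 2 * a ^+ 3 / (b * c * d * e * f * g)).

Definition psi_series := psi [tuple e; b * c * d * e ^+ 2 / (q * a ^+ 2);
      b * c * d * e * f / (q * a ^+ 2); b * c * d * e * g / (q * a ^+ 2)]
    [tuple b * c * e / a; b * d * e / a; c * d * e / a; b * c * d * e ^+ 2 * f * g / (q * a ^+ 3)] q q.

Definition W87_series := W87 (q * a * b / (c * d * e)) [tuple q * a / (c * d); q * a / (c * e); q * a / (d * e);
    b * f / a; b * g / a] q (q * a / (f * g)).

Definition upper_series := phi [tuple b * e / a; c * e / a; d * e / a; q * a / (f * g)]
    [tuple q * e / f; q * e / g; b * c * d * e / a ^+ 2] q q.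

Definition lower_series := phi [tuple q * a / (e * f); q * a / (e * g); q * a / (f * g); q ^+ 2 * a ^+ 3 / (b * c * d * e * f * g)]
    [tuple q ^+ 2 * a ^+ 2 / (b * e * f * g); q ^+ 2 * a ^+ 2 / (c * e * f * g); q ^+ 2 * a ^+ 2 / (d * e * f * g)] q q.

Definition rhs := num_psi / den_psi * psi_series - num_W87 / den_W87 * W87_series +
  num_upper / den_upper * upper_series + num_lower / den_lower * lower_series.
End Sides.

(** * The identity for generic parameters *)

Section GenericParameters.
Context {R : realType} {K : numFieldType} {KR : modulus R K}.
Local Notation cmod := (@cmod R K KR).
Context {q : K} {hq : nome q}.
Local Notation P := (qpoch_inf q).
Local Notation th := (qtheta (q := q)).
Local Notation generic := (qgeneric (q := q)).

Let q0 : q != 0 := nome_neq0.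

Variables a b c d e f g : K.
Hypotheses (a0 : a != 0) (b0 : b != 0) (c0 : c != 0) (d0 : d != 0) (e0 : e != 0) (f0 : f != 0) (g0 : g != 0).
Let X := params (q := q) a b c d e f g.
Hypothesis G : all (fun m => generic (mden X m)) omega.
Hypothesis z1 : cmod (q ^+ 2 * a ^+ 3 / (b * c * d * e * f * g)) < 1.
Hypothesis w1 : cmod (q * a / (f * g)) < 1.

Let X0 i : (i < 8)%N -> X i != 0.
Proof. by case: i => [|[|[|[|[|[|[|[|i]]]]]]]]. Qed.

Let gen m : mwf m -> listed omega m -> generic (mden X m).
Proof. by apply: generic_mon => //. Qed.

Ltac gm := lazymatch goal with |- is_true (qgeneric ?t) =>
  let m := reify_mon q a b c d e f g t in
  change (is_true (generic (mden X m))); apply: gen; vm_compute; reflexivity end.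

Let a1 : 1 - a != 0.
Proof. by apply: (qpoch_inf_neq1 (hq := hq)); apply: generic_P; gm. Qed.
Let W1 : 1 - q * a * b / (c * d * e) != 0.
Proof. by apply: (qpoch_inf_neq1 (hq := hq)); apply: generic_P; gm. Qed.

Let thetaE x : theta q x = th x.
Proof. by rewrite /theta /qpochs_inf !big_cons big_nil mulr1. Qed.

Let thE x y : x != 0 -> y = q / x -> th x = P x * P y.
Proof. by move=> x0 ->. Qed.

Let mon0 m : mwf m -> mden X m != 0.
Proof. exact: mden_neq0. Qed.

Ltac m0 := lazymatch goal with |- is_true (?t != 0) =>
  let m := reify_mon q a b c d e f g t in
  change (is_true (mden X m != 0)); apply: mon0; reflexivity end.

Let tha : th a = (1 - a) * P (q * a) * P (q / a).
Proof. by rewrite -qpoch_inf1. Qed.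
Let thb : th b = P b * P (q / b). Proof. by []. Qed.
Let thc : th c = P c * P (q / c). Proof. by []. Qed.
Let thd : th d = P d * P (q / d). Proof. by []. Qed.
Let the : th e = P e * P (q / e). Proof. by []. Qed.
Let thf : th f = P f * P (q / f). Proof. by []. Qed.
Let thg : th g = P g * P (q / g). Proof. by []. Qed.
Let thba : th (b / a) = P (b / a) * P (q * a / b). Proof. by apply: thE; [m0 | fz]. Qed.
Let thce : th (c * e / a) = P (c * e / a) * P (q * a / (c * e)). Proof. by apply: thE; [m0 | fz]. Qed.
Let thde : th (d * e / a) = P (d * e / a) * P (q * a / (d * e)). Proof. by apply: thE; [m0 | fz]. Qed.
Let thbf : th (b * f / a) = P (b * f / a) * P (q * a / (b * f)). Proof. by apply: thE; [m0 | fz]. Qed.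
Let thbg : th (b * g / a) = P (b * g / a) * P (q * a / (b * g)). Proof. by apply: thE; [m0 | fz]. Qed.
Let tha3 : th (b * c * d * e * f / (q * a ^+ 2)) =
  P (b * c * d * e * f / (q * a ^+ 2)) * P (q ^+ 2 * a ^+ 2 / (b * c * d * e * f)).
Proof. by apply: thE; [m0 | fz]. Qed.
Let tha4 : th (b * c * d * e * g / (q * a ^+ 2)) =
  P (b * c * d * e * g / (q * a ^+ 2)) * P (q ^+ 2 * a ^+ 2 / (b * c * d * e * g)).
Proof. by apply: thE; [m0 | fz]. Qed.
Let thb3 : th (c * d * e / a) = P (c * d * e / a) * P (q * a / (c * d * e)).
Proof. by apply: thE; [m0 | fz]. Qed.
Let thb4 : th (b * c * d * e ^+ 2 * f * g / (q * a ^+ 3)) =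
  P (b * c * d * e ^+ 2 * f * g / (q * a ^+ 3)) * P (q ^+ 2 * a ^+ 3 / (b * c * d * e ^+ 2 * f * g)).
Proof. by apply: thE; [m0 | fz]. Qed.
Let tha2 : th (q * a ^+ 2 / (b * c * d * e ^+ 2)) =
  - (b * c * d * e ^+ 2 / (q * a ^+ 2))^-1 * th (b * c * d * e ^+ 2 / (q * a ^+ 2)).
Proof. by rewrite -thV; [rewrite invf_div | m0]. Qed.
Let thb4q : th (b * c * d * e ^+ 2 * f * g / (q ^+ 2 * a ^+ 3)) =
  - (b * c * d * e ^+ 2 * f * g / (q * a ^+ 3) / q) * th (b * c * d * e ^+ 2 * f * g / (q * a ^+ 3)).
Proof. by rewrite -th_divq; [congr th; fz | m0]. Qed.
Let PW : P (q * a * b / (c * d * e)) = (1 - q * a * b / (c * d * e)) * P (q ^+ 2 * a * b / (c * d * e)).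
Proof. by rewrite qpoch_inf1; congr (_ * P _); ring. Qed.

Let z := q ^+ 2 * a ^+ 3 / (b * c * d * e * f * g).

Let K1 := th a * th (b / a) * th (c * e / a) * th (d * e / a) *
  (P (q * a / (c * d)) * P (q * a / (e * f)) * P (q * a / (e * g)) * P (q * a / (f * g))) *
  th (b * c * d * e * f / (q * a ^+ 2)) * th (b * c * d * e * g / (q * a ^+ 2)) /
  (th b * th c * th d * th f * th g * P (b * c / a) * P (b * d / a) * th (c * d * e / a) *
   th (b * c * d * e ^+ 2 * f * g / (q * a ^+ 3))).
Let K2 := - (th a * th (b / a) * P (q * a / (c * d)) * P (q * a / (c * e)) * P (q * a / (d * e)) *
  P (q * a / (f * g)) * th (b * f / a) * th (b * g / a) * th (q * a ^+ 2 / (b * c * d * e)) /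
  (th b * th f * th g * P (b * c / a) * P (b * d / a) * P (b * e / a) * P z * th (a / b) * th (c * d * e / a))).
Let K3 := - (b * c * d * e ^+ 2 / (q * a ^+ 2) * K1 *
  (th (b * c * e / a) * th (b * d * e / a) * th (c * d * e / a) * th (b * c * d * e ^+ 2 * f * g / (q * a ^+ 3)) /
   (th e * th (b * c * d * e ^+ 2 / (q * a ^+ 2)) * th (b * c * d * e * f / (q * a ^+ 2)) *
    th (b * c * d * e * g / (q * a ^+ 2))))).
Let K4 := - (q / (b * c * d * e ^+ 2 * f * g / (q * a ^+ 3)) * K1).

Let N0 := P b * P c * P d * P e * P f * P g /
   ((1 - a) * (P (q * a / b) * P (q * a / c) * P (q * a / d) * P (q * a / e) * P (q * a / f) * P (q * a / g))).

Let gP x : generic x -> P x != 0. Proof. exact: generic_P. Qed.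
Let gth x : generic x -> th x != 0. Proof. exact: generic_th. Qed.
Let Pq : P q != 0 := qpoch_inf_q_neq0 (hq := hq).

(* The products are atoms for [field], so [P] and [th] are first replaced by variables. *)
Ltac coefficient := move: a1 W1 gP gth Pq; move: (1 - a) (1 - q * a * b / (c * d * e)) (qtheta (q := q)) (qpoch_inf q);
  let u := fresh "u" in let w := fresh "w" in let t := fresh "t" in let p := fresh "p" in
  let un := fresh "un" in let wn := fresh "wn" in
  let tn := fresh "tn" in let pn := fresh "pn" in let pq := fresh "pq" in
  intros u w t p un wn pn tn pq; field; repeat (apply/andP; split);
  first [exact: un | exact: wn | exact: pq | apply: pn; gm | apply: tn; gm | assumption | m0].

(** This and the next three lemmas compare the stated coefficients with those of
    [bilateral_expansion]. [N0] converts [wp_bilateral] into the 8-Psi-8, and the second factor on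
    the left converts the series on the right into its normal form. *)
Lemma coefficient_psi : num_psi q a b c d e f g / den_psi q a b c d e f g *
  (P e * P (b * c * d * e ^+ 2 / (q * a ^+ 2)) * P (b * c * d * e * f / (q * a ^+ 2)) *
   P (b * c * d * e * g / (q * a ^+ 2)) / (P (b * c * e / a) * P (b * d * e / a) * P (c * d * e / a) *
   P (b * c * d * e ^+ 2 * f * g / (q * a ^+ 3)))) = N0 * K1.
Proof.
rewrite /num_psi /den_psi /K1 /N0 tha thba thce thde tha3 tha4 thb thc thd thf thg thb3 thb4 /qpochs_inf !big_cons big_nil mulr1.
coefficient.
Qed.

(** The sign appears because the theorem subtracts this series while the minus sign is part of
    K2. *)
Lemma coefficient_W87 : num_W87 q a b c d e f g / den_W87 q a b c d e f g *
  (P (q * a * b / (c * d * e)) * P (q * a / (c * d)) * P (q * a / (c * e)) * P (q * a / (d * e)) *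
   P (b * f / a) * P (b * g / a) / ((1 - q * a * b / (c * d * e)) * (P q * P (q * b / e) * P (q * b / d) *
   P (q * b / c) * P (q ^+ 2 * a ^+ 2 / (c * d * e * f)) * P (q ^+ 2 * a ^+ 2 / (c * d * e * g))))) = - (N0 * K2).
Proof.
rewrite /num_W87 /den_W87 /K2 /N0 tha thba thbf thbg thb thf thg PW /qpochs_inf /thetas !big_cons !big_nil !mulr1 !thetaE /z.
coefficient.
Qed.

Lemma coefficient_phi_upper : num_upper q a b c d e f g / den_upper q a b c d e f g *
  (P (b * e / a) * P (c * e / a) * P (d * e / a) * P (q * a / (f * g)) /
   (P q * P (q * e / f) * P (q * e / g) * P (b * c * d * e / a ^+ 2))) = N0 * K3.
Proof.
rewrite /num_upper /den_upper /K3 /K1 /N0 tha thba thce thde thb thc thd the thf thg /qpochs_inf /thetas !big_cons !big_nil !mulr1 !thetaE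
  tha2 /z.
coefficient.
Qed.

Lemma coefficient_phi_lower : num_lower q a b c d e f g / den_lower q a b c d e f g *
  (P (q * a / (e * f)) * P (q * a / (e * g)) * P (q * a / (f * g)) * P z /
   (P q * P (q ^+ 2 * a ^+ 2 / (b * e * f * g)) * P (q ^+ 2 * a ^+ 2 / (c * e * f * g)) *
    P (q ^+ 2 * a ^+ 2 / (d * e * f * g)))) = N0 * K4.
Proof.
rewrite /num_lower /den_lower /K4 /K1 /N0 tha thba thce thde thb thc thd thf thg /qpochs_inf /thetas !big_cons !big_nil !mulr1 !thetaE
  thb4q /z.
coefficient.
Qed.

Lemma generic_Psi88 : lhs q a b c d e f g = rhs q a b c d e f g.
Proof.
have zE : z * (b * c * d * e * f * g) = q ^+ 2 * a ^+ 3 by rewrite /z mulfVK // !mulf_neq0.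
rewrite /lhs /rhs /psi_series /W87_series /upper_series /lower_series -/z.
have L : Psi88 a [tuple b; c; d; e; f; g] q z = N0 * wp_bilateral (q := q) a b c d e f g z.
  by apply: (Psi88_wp_bilateral z1 zE); gm.
have e1 : q * (q * a * b / (c * d * e)) / (q * a / (c * d)) = q * b / e by fz.
have e2 : q * (q * a * b / (c * d * e)) / (q * a / (c * e)) = q * b / d by fz.
have e3 : q * (q * a * b / (c * d * e)) / (q * a / (d * e)) = q * b / c by fz.
have e4 : q * (q * a * b / (c * d * e)) / (b * f / a) = q ^+ 2 * a ^+ 2 / (c * d * e * f) by fz.
have e5 : q * (q * a * b / (c * d * e)) / (b * g / a) = q ^+ 2 * a ^+ 2 / (c * d * e * g) by fz.
have EW := @W87_vwP _ _ _ q hq (q * a * b / (c * d * e)) (q * a / (c * d)) (q * a / (c * e)) (q * a / (d * e))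
  (b * f / a) (b * g / a) (q * a / (f * g)) w1.
rewrite e1 e2 e3 e4 e5 in EW.
have EV : vwP (q := q) (q * a * b / (c * d * e)) (q * a / (c * d)) (q * a / (c * e)) (q * a / (d * e))
  (b * f / a) (b * g / a) (q * a / (f * g)) = vw_l (q := q) a b c d e f g.
  by apply: eq_nsum => k; rewrite /vwP_term; congr (_ * (_ / _)); ring.
rewrite L (bilateral_expansion a0 b0 c0 d0 e0 f0 g0 G zE z1 w1) -/K1 -/K2 -/K3 -/K4.
rewrite psi_bilateral4; last 1 first.
  by fz.
all: try gm.
rewrite [W87 _ _ _ _]EW; try by apply: gP; gm.
rewrite !phi_u4; try by apply: gP; rewrite ?/z; gm.
have EU : u4 (q := q) q (q * e / f) (q * e / g) (b * c * d * e / a ^+ 2) (b * e / a) (c * e / a) (d * e / a)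
  (q * a / (f * g)) = u4e (q := q) a b c d e f g.
  by apply: eq_nsum => k; rewrite /u4_term; congr (_ * (_ / _)); ring.
rewrite EV EU.
have combine (m k1 k2 k3 k4 x1 x2 x3 x4 n1 n2 n3 n4 s1 s2 s3 s4 : K) : x1 * n1 = m * k1 -> x2 * n2 = - (m * k2) ->
    x3 * n3 = m * k3 -> x4 * n4 = m * k4 -> m * (k1 * s1 + k2 * s2 + k3 * s3 + k4 * s4) =
    x1 * (n1 * s1) - x2 * (n2 * s2) + x3 * (n3 * s3) + x4 * (n4 * s4).
  by move=> h1 h2 h3 h4; rewrite !(mulrA _ _ s1) !(mulrA _ _ s2) !(mulrA _ _ s3) !(mulrA _ _ s4) h1 h2 h3 h4; ring.
exact: combine coefficient_psi coefficient_W87 coefficient_phi_upper coefficient_phi_lower.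
Qed.
End GenericParameters.

(** * Removing genericity *)

(* Chosen so that every monomial of [omega] has positive total weight. *)
Definition weight (i : nat) : nat := nth 0 [:: 1; 4; 2; 2; 3; 2; 2] i.

Fixpoint wdeg (s : bool) (m : mexp) : nat :=
  match m with
  | MVar j => if s then weight j else 0
  | MOne => 0
  | MMul m1 m2 => wdeg s m1 + wdeg s m2
  | MInv m1 => wdeg (~~ s) m1
  | MPow m1 n => wdeg s m1 * n
  end.

Lemma mden_scale (K : fieldType) (x : nat -> K) u m : u != 0 ->
  mden (fun i => x i * u ^+ weight i) m * u ^+ wdeg false m = mden x m * u ^+ wdeg true m.
Proof.
move=> u0; elim: m => /= [i||m1 h1 m2 h2|m h|m h n].
- by rewrite mulr1.
- by [].
- by rewrite !exprD mulrACA h1 h2 mulrACA.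
- apply: (mulIf (x := u ^+ wdeg false m)); first by rewrite expf_neq0.
  move: (mden _ m) h => y h.
  have [y0|y0] := eqVneq y 0.
    have /eqP : mden x m * u ^+ wdeg true m = 0 by rewrite -h y0 mul0r.
    by rewrite mulf_eq0 expf_eq0 (negPf u0) andbF orbF y0 => /eqP->; rewrite invr0 !mul0r.
  have x0 : mden x m != 0.
    by apply: contra_neq (mulf_neq0 y0 (expf_neq0 (wdeg false m) u0)) => x0; rewrite h x0 mul0r.
  have u1 : u ^+ wdeg false m != 0 by rewrite expf_neq0.
  have u2 : u ^+ wdeg true m != 0 by rewrite expf_neq0.
  have -> : y = mden x m * u ^+ wdeg true m / u ^+ wdeg false m by rewrite -h mulfK.
  by move: (u ^+ wdeg false m) (u ^+ wdeg true m) u1 u2 => *; fz.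
- by rewrite !exprM -!exprMn h.
Qed.

Section Perturbation.
Context {R : realType} {K : numFieldType} {KR : modulus R K}.
Local Notation cmod := (@cmod R K KR).
Context {q : K} {hq : nome q}.
Local Notation P := (qpoch_inf q).
Local Notation generic := (qgeneric (q := q)).

Let q0 : q != 0 := nome_neq0.

(** The moduli of the powers of q form a geometric progression, and |u|, strictly between 1 and
    1/|q|, falls into one of its gaps. *)
Lemma cmod_mulqX_neq (u : K) i j : 1 < cmod u -> cmod u * cmod q < 1 -> u * q ^+ i != q ^+ j.
Proof.
move=> u1 uq; apply/eqP => /(congr1 cmod); rewrite cmodM !cmodX => E.
have r0 : 0 < cmod q by rewrite cmod_gt0.
have r1 : cmod q < 1 by exact: nome_lt1.
have [ij|ji] := leqP i j.
  have : cmod u = cmod q ^+ (j - i).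
    by apply: (mulIf (x := cmod q ^+ i)); [rewrite expf_neq0 // gt_eqF | rewrite E -exprD subnK].
  by move=> Eu; move: u1; rewrite Eu ltNge exprn_ile1 ?cmod_ge0 // ltW.
have : cmod u * cmod q * cmod q ^+ (i - j.+1) = 1.
  apply: (mulIf (x := cmod q ^+ j)); first by rewrite expf_neq0 // gt_eqF.
  by rewrite -mulrA -exprS -mulrA -exprD mul1r -E -subSn // subSS subnK // ltnW.
move=> Eu; have : cmod u * cmod q * cmod q ^+ (i - j.+1) < 1.
  apply: le_lt_trans uq; rewrite ler_piMr ?mulr_ge0 ?cmod_ge0 // exprn_ile1 ?cmod_ge0 //; exact: ltW.
by rewrite Eu ltxx.
Qed.

Lemma near_qpoch_inf_neq0 (v : nat -> K) (x : K) : v @ \oo --> x -> P x != 0 ->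
  \forall n \near \oo, P (v n) != 0.
Proof.
move=> vx; rewrite -cmod_gt0 => Px.
have h : (fun n => P (v n)) @ \oo --> P x by exact: cvg_qpoch_inf.
by apply: filterS (near_cmod_gt h Px) => n; rewrite cmod_gt0.
Qed.

Lemma qpoch_inf_eq0 x : P x = 0 -> exists n, x * q ^+ n = 1.
Proof.
move=> Px; apply: contrapT => h; have : P x != 0; last by rewrite Px eqxx.
apply: qpoch_inf_neq0 => n; rewrite subr_eq0 eq_sym; apply/eqP => E; apply: h; by exists n.
Qed.

Variable u : nat -> K.
Hypotheses (u1 : forall n, 1 < cmod (u n)) (ucv : u @ \oo --> (1 : K)).

Let u0 n : u n != 0. Proof. by rewrite -cmod_gt0 (lt_trans ltr01). Qed.

Let uq : \forall n \near \oo, cmod (u n) * cmod q < 1.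
Proof.
have h : (fun n => u n * q) @ \oo --> 1 * q by apply: cvgM; [exact: ucv | exact: cvg_cst].
have h1 : cmod (1 * q) < 1 by rewrite mul1r nome_lt1.
by apply: filterS (near_cmod_lt h h1) => n; rewrite cmodM.
Qed.

(* Multiplying by a number of modulus slightly above 1 leaves the spiral of the powers of [q]. *)
Lemma near_generic x : x != 0 -> \forall n \near \oo, generic (x * u n).
Proof.
move=> x0.
have hu : \forall n \near \oo, P (x * u n) != 0.
  (* Where P does not vanish continuity suffices. Otherwise x is q^-N for some N, and a zero at x u
     would make u a quotient of powers of q, which the gap between their moduli excludes. *)
  have [Px|Px] := eqVneq (P x) 0; last first.
    apply: near_qpoch_inf_neq0 Px; rewrite -[X in _ --> X]mulr1.
    by apply: cvgM; [exact: cvg_cst | exact: ucv].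
  have [N xN] := qpoch_inf_eq0 Px.
  apply: filterS uq => n hn; apply: qpoch_inf_neq0 => j; rewrite subr_eq0.
  apply: contra_neq (cmod_mulqX_neq j N (u1 n) hn) => E.
  by apply: (mulfI x0); rewrite xN mulrA -E.
have hv : \forall n \near \oo, P (q / x / u n) != 0.
  have [Px|Px] := eqVneq (P (q / x)) 0; last first.
    apply: near_qpoch_inf_neq0 Px; rewrite -[X in _ --> X]divr1.
    by apply: cvgM; [exact: cvg_cst | apply: cvgV; [exact: oner_neq0 | exact: ucv]].
  have [N xN] := qpoch_inf_eq0 Px.
  apply: filterS uq => n hn; apply: qpoch_inf_neq0 => j; rewrite subr_eq0.
  apply: contra_neq (cmod_mulqX_neq N j (u1 n) hn) => E.
  apply: (mulfI (mulf_neq0 q0 (invr_neq0 x0))).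
  have un : u n = q / x * q ^+ j.
    by rewrite -[LHS]mulr1 E; move: (u0 n); move: (u n) => y y0; fz.
  by rewrite mulrCA xN mulr1.
apply: filterS2 hu hv => n h1 h2; rewrite /qgeneric mulf_neq0 //= /qtheta mulf_neq0 //.
by rewrite invfM mulrA.
Qed.
End Perturbation.

Section PerturbedParameters.
Context {R : realType} {K : numFieldType} {KR : modulus R K}.
Local Notation cmod := (@cmod R K KR).
Context {q : K} {hq : nome q}.
Local Notation generic := (qgeneric (q := q)).

(** Scaling multiplies a monomial by u^w, where w is its total weight. As w is positive for every
    member of [omega], u^w again has modulus above 1 and tends to 1. *)
Lemma near_generic_omega (u : nat -> K) (x : nat -> K) : (forall n, 1 < cmod (u n)) -> u @ \oo --> (1 : K) ->
  (forall i, (i < 8)%N -> x i != 0) ->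
  \forall n \near \oo, all (fun m => generic (mden (fun i => x i * u n ^+ weight i) m)) omega.
Proof.
move=> u1 ucv x0.
have w : all (fun m => mwf m && (wdeg false m < wdeg true m)%N) omega by vm_compute.
elim: omega w => [_|m L IH /= /andP[/andP[wm dm] /IH{}IH]]; first exact: nearW.
have v1 n : 1 < cmod (u n ^+ (wdeg true m - wdeg false m)).
  by rewrite cmodX exprn_egt1 // -lt0n subn_gt0.
have vcv : (fun n => u n ^+ (wdeg true m - wdeg false m)) @ \oo --> (1 : K).
  by rewrite -[X in _ --> X](expr1n _ (wdeg true m - wdeg false m)); exact: cvg_exprn.
apply: filterS2 (near_generic (hq := hq) v1 vcv (mden_neq0 x0 wm)) IH => n gm ->; rewrite andbT.
have u0 : u n != 0 by rewrite -cmod_gt0 (lt_trans ltr01).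
suff -> : mden (fun i => x i * u n ^+ weight i) m = mden x m * u n ^+ (wdeg true m - wdeg false m) by [].
apply: (mulIf (x := u n ^+ wdeg false m)); first by rewrite expf_neq0.
by rewrite mden_scale // -mulrA -exprD subnK // ltnW.
Qed.
End PerturbedParameters.

(** * Continuity of both sides in the parameters *)

Section Continuity.
Context {R : realType} {K : numFieldType} {KR : modulus R K}.
Local Notation cmod := (@cmod R K KR).
Context {q : K} {hq : nome q}.
Local Notation P := (qpoch_inf q).
Context {T : Type} {F : set_system T} {FF : ProperFilter F}.

Let q0 : q != 0 := nome_neq0.

Section MonomialLimits.
Variables (x : T -> nat -> K) (x0 : nat -> K).
Hypothesis xcv : forall i, (i < 8)%N -> (fun t => x t i) @ F --> x0 i.
Hypothesis x00 : forall i, (i < 8)%N -> x0 i != 0.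

Lemma cvg_mden m : mwf m -> (fun t => mden (x t) m) @ F --> mden x0 m.
Proof.
elim: m => /= [i||m1 h1 m2 h2 /andP[w1 w2]|m h w|m h n w].
- exact: xcv.
- by move=> _; exact: cvg_cst.
- by apply: cvgM; [exact: h1 | exact: h2].
- by apply: cvgV; [exact: mden_neq0 | exact: h].
- by apply: cvg_exprn; exact: h.
Qed.

Lemma cvg_hyper (La Lb : seq mexp) (w : T -> nat -> K) (w0 : nat -> K) r : 0 <= r < 1 -> dom_cvg F w w0 r ->
  all mwf La -> all mwf Lb -> all (fun y => P y != 0) (map (mden x0) Lb) ->
  (fun t => hyper (q := q) (map (mden (x t)) La) (map (mden (x t)) Lb) (w t)) @ F -->
  hyper (q := q) (map (mden x0) La) (map (mden x0) Lb) w0.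
Proof.
move=> r01 hw wa wb nb; apply: dom_cvg_nsum r01 _.
have ha : dom_cvg F (fun t n => \prod_(m <- La) qpoch_fin q (mden (x t) m) n) (fun n => \prod_(m <- La) qpoch_fin q (mden x0 m) n) 1.
  apply: (dom_cvg_prod_all (U := fun m t n => qpoch_fin q (mden (x t) m) n)) wa => m wm.
  by apply: dom_cvg_qp; exact: cvg_mden.
have {}nb : all (fun m => mwf m && (P (mden x0 m) != 0)) Lb.
  by move: nb; rewrite all_map => nb; rewrite all_predI wb.
have hb : dom_cvg F (fun t n => \prod_(m <- Lb) (qpoch_fin q (mden (x t) m) n)^-1)
    (fun n => \prod_(m <- Lb) (qpoch_fin q (mden x0 m) n)^-1) 1.
  apply: (dom_cvg_prod_all (U := fun m t n => (qpoch_fin q (mden (x t) m) n)^-1)) nb => m /andP[wm nm].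
  by apply: dom_cvg_qpV; [exact: cvg_mden | move=> n; exact: qpoch_inf_factor_neq0].
apply: eq_dom_cvg (dom_cvgMl (dom_cvgMr ha hb) hw) => [t k|k|//].
  by rewrite !big_map prodfV.
by rewrite !big_map prodfV.
Qed.
End MonomialLimits.

Lemma cvg_qpochs_inf_nil : (fun _ : T => qpochs_inf q [::]) @ F --> qpochs_inf q [::].
Proof. exact: cvg_cst. Qed.

Lemma cvg_qpochs_inf_cons (x : T -> K) (x0 : K) (L : T -> seq K) L0 : x @ F --> x0 ->
  (fun t => qpochs_inf q (L t)) @ F --> qpochs_inf q L0 ->
  (fun t => qpochs_inf q (x t :: L t)) @ F --> qpochs_inf q (x0 :: L0).
Proof.
move=> xx0 LL0; rewrite /qpochs_inf (_ : (fun t => _) = fun t => P (x t) * qpochs_inf q (L t)).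
  by rewrite big_cons; apply: cvgM; [exact: cvg_qpoch_inf | exact: LL0].
by apply/funext => t; rewrite big_cons.
Qed.

Lemma cvg_theta (x : T -> K) (x0 : K) : x0 != 0 -> x @ F --> x0 -> (fun t => theta q (x t)) @ F --> theta q x0.
Proof.
move=> x00 xx0; apply: cvg_qpochs_inf_cons => //; apply: cvg_qpochs_inf_cons; last exact: cvg_qpochs_inf_nil.
by apply: cvgM; [exact: cvg_cst | exact: cvgV].
Qed.

Lemma cvg_thetas2 (x y : T -> K) (x0 y0 : K) : x0 != 0 -> y0 != 0 -> x @ F --> x0 -> y @ F --> y0 ->
  (fun t => thetas q [:: x t; y t]) @ F --> thetas q [:: x0; y0].
Proof.
move=> *; rewrite /thetas (_ : (fun t => _) = fun t => theta q (x t) * theta q (y t)).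
  by rewrite !big_cons big_nil mulr1; apply: cvgM; exact: cvg_theta.
by apply/funext => t; rewrite !big_cons big_nil mulr1.
Qed.

Lemma dom_cvg_affine_exp (A A0 z : T -> K) (a0 A00 z0 : K) r : cmod z0 < r -> A @ F --> A00 -> A0 @ F --> a0 ->
  z @ F --> z0 -> dom_cvg F (fun t n => A0 t * ((1 - A t * q ^+ (2 * n)) * z t ^+ n))
    (fun n => a0 * ((1 - A00 * q ^+ (2 * n)) * z0 ^+ n)) r.
Proof.
move=> zr hA hA0 hz; apply: dom_cvgMl; first exact: dom_cvg_scalar.
apply: dom_cvgMl; last exact: dom_cvg_pow.
have hs : dom_cvg F (fun t (_ : nat) => - A t) (fun=> - A00) 1.
  by apply: dom_cvg_scalar; apply: cvgN.
have hX : dom_cvg F (fun (_ : T) n => q ^+ (2 * n)) (fun n => q ^+ (2 * n)) 1.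
  by apply: (dom_cvg_const (M := 1)) => // k; rewrite expr1n mulr1 cmod_qX.
apply: eq_dom_cvg (dom_cvgD (dom_cvg_cst 1) (dom_cvgMr hs hX)) => [t k|k|//]; by rewrite mulNr.
Qed.

Lemma lower_okP L : lower_ok q L -> all (fun x => P x != 0) L.
Proof.
move=> h; apply/allP => x xL; apply: qpoch_inf_neq0 => n.
have := h n.+1; apply: contra_neq => E; rewrite /qpochs (big_rem _ xL) /=.
by rewrite big_nat_recr //= E mulr0 mul0r.
Qed.

(** 1 - x q^-(n+1) is a nonzero multiple of 1 - (q / x) q^n, so that the condition on the half k < 0
    becomes one on the lower parameters of the reversed series. *)
Lemma upper_okP L : upper_ok q L -> all (fun x => (x != 0) ==> (P (q / x) != 0)) L.
Proof.
move=> h; apply/allP => x xL; apply/implyP => x0; apply: qpoch_inf_neq0 => n.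
have := h n.+1 isT; apply: contra_neq => E; rewrite (big_rem _ xL) /=.
have -> : 1 - x * q ^- n.+1 = - (x * q ^- n.+1) * (1 - q / x * q ^+ n).
  have h0 : q ^+ n != 0 by rewrite expf_neq0.
  by rewrite exprS; move: (q ^+ n) h0 => y y0; fz.
by rewrite E mulr0 mul0r.
Qed.
End Continuity.

Section LimitOfSides.
Context {R : realType} {K : numFieldType} {KR : modulus R K}.
Local Notation cmod := (@cmod R K KR).
Context {q : K} {hq : nome q}.
Local Notation P := (qpoch_inf q).
Context {T : Type} {F : set_system T} {FF : ProperFilter F}.

Let q0 : q != 0 := nome_neq0.

Variables (a_ b_ c_ d_ e_ f_ g_ : T -> K) (a b c d e f g : K).
Hypotheses (acv : a_ @ F --> a) (bcv : b_ @ F --> b) (ccv : c_ @ F --> c) (dcv : d_ @ F --> d)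
  (ecv : e_ @ F --> e) (fcv : f_ @ F --> f) (gcv : g_ @ F --> g).
Hypotheses (a_0 : forall t, a_ t != 0) (b_0 : forall t, b_ t != 0) (c_0 : forall t, c_ t != 0)
  (d_0 : forall t, d_ t != 0) (e_0 : forall t, e_ t != 0) (f_0 : forall t, f_ t != 0) (g_0 : forall t, g_ t != 0).
Hypotheses (a0 : a != 0) (b0 : b != 0) (c0 : c != 0) (d0 : d != 0) (e0 : e != 0) (f0 : f != 0) (g0 : g != 0).

Let X t := params (q := q) (a_ t) (b_ t) (c_ t) (d_ t) (e_ t) (f_ t) (g_ t).
Let X0 := params (q := q) a b c d e f g.

Let Xcv i : (i < 8)%N -> (fun t => X t i) @ F --> X0 i.
Proof.
case: i => [|[|[|[|[|[|[|[|i]]]]]]]] // _; exact: cvg_cst.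
Qed.

Let X00 i : (i < 8)%N -> X0 i != 0.
Proof. by case: i => [|[|[|[|[|[|[|[|i]]]]]]]]. Qed.

Let mon_cv m : mwf m -> (fun t => mden (X t) m) @ F --> mden X0 m.
Proof. exact: cvg_mden. Qed.

Let mon_neq0 m : mwf m -> mden X0 m != 0.
Proof. exact: mden_neq0. Qed.

Ltac m0 := lazymatch goal with |- is_true (?t != 0) =>
  let m := reify_mon q a b c d e f g t in
  change (is_true (mden X0 m != 0)); apply: mon_neq0; reflexivity end.

Ltac mcv := lazymatch goal with |- _ --> ?l =>
  let m := reify_mon q a b c d e f g l in exact: (@mon_cv m isT) end.

Ltac qcv := repeat (apply: cvg_qpochs_inf_cons; first mcv); exact: cvg_qpochs_inf_nil.

Ltac reify_seq l := let l := eval hnf in l in lazymatch l with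
  | [::] => constr:(@nil mexp)
  | ?x :: ?s => let m := reify_mon q a b c d e f g x in let ms := reify_seq s in constr:(m :: ms) end.

Let q01 : 0 <= cmod q < 1. Proof. by rewrite cmod_ge0 nome_lt1. Qed.

Let qX_dom : dom_cvg F (fun (_ : T) n => q ^+ n) (fun n => q ^+ n) (cmod q).
Proof. by apply: (dom_cvg_const (M := 1)) => // k; rewrite cmodX mul1r. Qed.

Ltac hypercv r := lazymatch goal with |- _ --> @hyper _ _ ?la ?lb ?w =>
  let ma := reify_seq la in let mb := reify_seq lb in
  apply: (@cvg_hyper _ _ _ q _ _ _ _ X X0 Xcv X00 ma mb _ w r) end.

Let one_minus_cv m : mwf m -> (fun t => 1 - mden (X t) m) @ F --> 1 - mden X0 m.
Proof. by move=> wm; apply: cvgB; [exact: cvg_cst | exact: mon_cv]. Qed.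

Ltac omcv := lazymatch goal with |- _ --> 1 - ?l =>
  let m := reify_mon q a b c d e f g l in exact: (@one_minus_cv m isT) end.

Let W1_neq0 x : P x != 0 -> 1 - x != 0. Proof. exact: qpoch_inf_neq1. Qed.

Let Pqq x : P (q / x) != 0 -> P (q * q / x) != 0.
Proof. by move=> h; rewrite -mulrA; exact: (qpoch_inf_mulq_neq0 (hq := hq)). Qed.

Lemma cvg_upper_series : phi_ok [tuple q * e / f; q * e / g; b * c * d * e / a ^+ 2] q ->
  (fun t => upper_series q (a_ t) (b_ t) (c_ t) (d_ t) (e_ t) (f_ t) (g_ t)) @ F --> upper_series q a b c d e f g.
Proof.
move=> /lower_okP ok; rewrite /upper_series phi_hyper.
by hypercv (cmod q); [exact: q01 | exact: qX_dom | exact: isT | exact: isT | exact: ok].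
Qed.

Lemma cvg_lower_series : phi_ok [tuple q ^+ 2 * a ^+ 2 / (b * e * f * g); q ^+ 2 * a ^+ 2 / (c * e * f * g);
    q ^+ 2 * a ^+ 2 / (d * e * f * g)] q ->
  (fun t => lower_series q (a_ t) (b_ t) (c_ t) (d_ t) (e_ t) (f_ t) (g_ t)) @ F --> lower_series q a b c d e f g.
Proof.
move=> /lower_okP ok; rewrite /lower_series phi_hyper.
by hypercv (cmod q); [exact: q01 | exact: qX_dom | exact: isT | exact: isT | exact: ok].
Qed.

Lemma cvg_W87_series : cmod (q * a / (f * g)) < 1 ->
  W87_ok (q * a * b / (c * d * e)) [tuple q * a / (c * d); q * a / (c * e); q * a / (d * e); b * f / a; b * g / a] q ->
  (fun t => W87_series q (a_ t) (b_ t) (c_ t) (d_ t) (e_ t) (f_ t) (g_ t)) @ F --> W87_series q a b c d e f g.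
Proof.
move=> w1 [W1 /lower_okP ok]; rewrite /W87_series W87_hyper.
have E t := W87_hyper (q := q) (q * a_ t * b_ t / (c_ t * d_ t * e_ t)) [tuple q * a_ t / (c_ t * d_ t);
  q * a_ t / (c_ t * e_ t); q * a_ t / (d_ t * e_ t); b_ t * f_ t / a_ t; b_ t * g_ t / a_ t] (q * a_ t / (f_ t * g_ t)).
rewrite (funext E).
(* A ratio strictly between the modulus of the limiting argument and 1, so that the perturbed
   arguments eventually stay below it. *)
set r := (cmod (q * a / (f * g)) + 1) / 2.
have r1 : cmod (q * a / (f * g)) < r by rewrite /r; move: (cmod _) w1 => *; lra.
have r01 : 0 <= r < 1.
  by rewrite (le_trans (cmod_ge0 _) (ltW r1)) /r; move: (cmod _) w1 => *; lra.
hypercv r; [exact: r01 | | exact: isT | exact: isT | exact: ok].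
apply: eq_dom_cvg (dom_cvg_affine_exp (hq := hq) (A := fun t => q * a_ t * b_ t / (c_ t * d_ t * e_ t))
    (A0 := fun t => (1 - q * a_ t * b_ t / (c_ t * d_ t * e_ t))^-1) r1 _ _ _) => [t k|k||||].
- by rewrite mulrCA mulrA.
- by rewrite mulrCA mulrA.
- by [].
- mcv.
- by apply: cvgV => //; omcv.
- mcv.
Qed.

Let psi_bal (a' b' c' d' e' f' g' : K) : a' != 0 -> b' != 0 -> c' != 0 -> d' != 0 -> e' != 0 -> f' != 0 -> g' != 0 ->
  b' * c' * e' / a' * (b' * d' * e' / a') * (c' * d' * e' / a') * (b' * c' * d' * e' ^+ 2 * f' * g' / (q * a' ^+ 3)) =
  q ^+ 2 * (e' * (b' * c' * d' * e' ^+ 2 / (q * a' ^+ 2)) * (b' * c' * d' * e' * f' / (q * a' ^+ 2)) *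
    (b' * c' * d' * e' * g' / (q * a' ^+ 2))).
Proof. by move=> *; fz. Qed.

Lemma cvg_psi_series : psi_ok [tuple e; b * c * d * e ^+ 2 / (q * a ^+ 2); b * c * d * e * f / (q * a ^+ 2);
    b * c * d * e * g / (q * a ^+ 2)] [tuple b * c * e / a; b * d * e / a; c * d * e / a;
    b * c * d * e ^+ 2 * f * g / (q * a ^+ 3)] q ->
  (fun t => psi_series q (a_ t) (b_ t) (c_ t) (d_ t) (e_ t) (f_ t) (g_ t)) @ F --> psi_series q a b c d e f g.
Proof.
move=> [up /lower_okP lo]; have := upper_okP (hq := hq) up.
have x2 : b * c * d * e ^+ 2 / (q * a ^+ 2) != 0 by m0.
have x3 : b * c * d * e * f / (q * a ^+ 2) != 0 by m0.
have x4 : b * c * d * e * g / (q * a ^+ 2) != 0 by m0.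
rewrite /= e0 x2 x3 x4 andbT => /and4P[n1 n2 n3 n4].
have pa2 t : b_ t * c_ t * d_ t * e_ t ^+ 2 / (q * a_ t ^+ 2) != 0 by rewrite !(mulf_neq0, invr_eq0, expf_neq0).
have pa3 t : b_ t * c_ t * d_ t * e_ t * f_ t / (q * a_ t ^+ 2) != 0 by rewrite !(mulf_neq0, invr_eq0, expf_neq0).
have pa4 t : b_ t * c_ t * d_ t * e_ t * g_ t / (q * a_ t ^+ 2) != 0 by rewrite !(mulf_neq0, invr_eq0, expf_neq0).
have pb1 t : b_ t * c_ t * e_ t / a_ t != 0 by rewrite !(mulf_neq0, invr_eq0).
have pb2 t : b_ t * d_ t * e_ t / a_ t != 0 by rewrite !(mulf_neq0, invr_eq0).
have pb3 t : c_ t * d_ t * e_ t / a_ t != 0 by rewrite !(mulf_neq0, invr_eq0).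
have pb4 t : b_ t * c_ t * d_ t * e_ t ^+ 2 * f_ t * g_ t / (q * a_ t ^+ 3) != 0.
  by rewrite !(mulf_neq0, invr_eq0, expf_neq0).
have E t := psi_hyper (hq := hq) (e_0 t) (pa2 t) (pa3 t) (pa4 t) (pb1 t) (pb2 t) (pb3 t) (pb4 t)
  (psi_bal (a_0 t) (b_0 t) (c_0 t) (d_0 t) (e_0 t) (f_0 t) (g_0 t)).
rewrite /psi_series (funext E) psi_hyper; try (by m0); last by apply: psi_bal.
apply: cvgD.
  by hypercv (cmod q); [exact: q01 | exact: qX_dom | exact: isT | exact: isT | exact: lo].
hypercv (cmod q); [exact: q01 | | exact: isT | exact: isT | apply/and5P; split;
  [exact: (Pqq n1) | exact: (Pqq n2) | exact: (Pqq n3) | exact: (Pqq n4) | exact: isT]].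
apply: dom_cvgMl qX_dom; apply: dom_cvg_scalar.
apply: cvgM; first exact: cvg_cst.
apply: cvgM; first by do 3?[apply: cvgM]; omcv.
apply: cvgV; first by rewrite !mulf_neq0 // W1_neq0.
by do 3?[apply: cvgM]; omcv.
Qed.

Let Psi_bal (a' b' c' d' e' f' g' : K) : a' != 0 -> b' != 0 -> c' != 0 -> d' != 0 -> e' != 0 -> f' != 0 -> g' != 0 ->
  q ^+ 2 * a' ^+ 3 / (b' * c' * d' * e' * f' * g') * (b' * c' * d' * e' * f' * g') = q ^+ 2 * a' ^+ 3.
Proof. by move=> *; rewrite mulfVK // !mulf_neq0. Qed.

Lemma cvg_lhs : cmod (q ^+ 2 * a ^+ 3 / (b * c * d * e * f * g)) < 1 -> Psi88_ok a [tuple b; c; d; e; f; g] q ->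
  (fun t => lhs q (a_ t) (b_ t) (c_ t) (d_ t) (e_ t) (f_ t) (g_ t)) @ F --> lhs q a b c d e f g.
Proof.
move=> z1 [a1 up /lower_okP lo]; have := upper_okP (hq := hq) up; rewrite /= b0 c0 d0 e0 f0 g0 andbT.
move=> /and5P[n1 n2 n3 n4 /andP[n5 n6]].
have E t := Psi88_hyper (hq := hq) (a_0 t) (b_0 t) (c_0 t) (d_0 t) (e_0 t) (f_0 t) (g_0 t)
  (Psi_bal (a_0 t) (b_0 t) (c_0 t) (d_0 t) (e_0 t) (f_0 t) (g_0 t)).
rewrite /lhs (funext E) (Psi88_hyper (hq := hq) a0 b0 c0 d0 e0 f0 g0 (Psi_bal a0 b0 c0 d0 e0 f0 g0)).
set z := q ^+ 2 * a ^+ 3 / _.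
set r := (cmod z + 1) / 2.
have r1 : cmod z < r by rewrite /r; move: (cmod z) z1 => *; lra.
have r01 : 0 <= r < 1.
  by rewrite (le_trans (cmod_ge0 _) (ltW r1)) /r; move: (cmod z) z1 => *; lra.
have zcv : (fun t => q ^+ 2 * a_ t ^+ 3 / (b_ t * c_ t * d_ t * e_ t * f_ t * g_ t)) @ F --> z.
  by rewrite /z; mcv.
have iacv : (fun t => (1 - a_ t)^-1) @ F --> (1 - a)^-1 by apply: cvgV => //; omcv.
apply: cvgD.
  hypercv r; [exact: r01 | | exact: isT | exact: isT | exact: lo].
  apply: eq_dom_cvg (dom_cvg_affine_exp (hq := hq) r1 acv iacv zcv) => [t k|k|//].
  + by rewrite mulrCA mulrA.
  + by rewrite mulrCA mulrA.
hypercv r; [exact: r01 | | exact: isT | exact: isT | apply/and5P; split;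
  [exact: (Pqq n1) | exact: (Pqq n2) | exact: (Pqq n3) | exact: (Pqq n4) | apply/and3P; split;
  [exact: (Pqq n5) | exact: (Pqq n6) | exact: isT]]].
apply: dom_cvg_affine_exp; [exact: r1 | mcv | | exact: zcv].
apply: cvgM.
  apply: cvgM; last exact: iacv.
  by apply: cvgM; [apply: cvgN; exact: acv | exact: zcv].
apply: cvgM; first by do 5?[apply: cvgM]; omcv.
apply: cvgV; first by rewrite !mulf_neq0 // W1_neq0.
by do 5?[apply: cvgM]; omcv.
Qed.

Ltac thetacv := first [apply: cvg_theta; [m0 | mcv] | apply: cvg_thetas2; [m0 | m0 | mcv | mcv]].
Ltac coefcv := first [by qcv | by apply: cvgM; [qcv | thetacv]].

Let cvg_coefficient (u v s : T -> K) (u' v' s' : K) : u @ F --> u' -> v @ F --> v' -> s @ F --> s' -> v' != 0 ->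
  (fun t => u t / v t * s t) @ F --> u' / v' * s'.
Proof. by move=> *; apply: cvgM => //; apply: cvgM => //; apply: cvgV. Qed.

Lemma cvg_rhs : cmod (q * a / (f * g)) < 1 ->
  den_psi q a b c d e f g != 0 -> den_W87 q a b c d e f g != 0 -> den_upper q a b c d e f g != 0 ->
  den_lower q a b c d e f g != 0 ->
  psi_ok [tuple e; b * c * d * e ^+ 2 / (q * a ^+ 2); b * c * d * e * f / (q * a ^+ 2);
    b * c * d * e * g / (q * a ^+ 2)] [tuple b * c * e / a; b * d * e / a; c * d * e / a;
    b * c * d * e ^+ 2 * f * g / (q * a ^+ 3)] q ->
  W87_ok (q * a * b / (c * d * e)) [tuple q * a / (c * d); q * a / (c * e); q * a / (d * e); b * f / a; b * g / a] q ->
  phi_ok [tuple q * e / f; q * e / g; b * c * d * e / a ^+ 2] q ->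
  phi_ok [tuple q ^+ 2 * a ^+ 2 / (b * e * f * g); q ^+ 2 * a ^+ 2 / (c * e * f * g);
    q ^+ 2 * a ^+ 2 / (d * e * f * g)] q ->
  (fun t => rhs q (a_ t) (b_ t) (c_ t) (d_ t) (e_ t) (f_ t) (g_ t)) @ F --> rhs q a b c d e f g.
Proof.
move=> w1 D1 D2 D3 D4 psi_ W_ upper_ lower_.
apply: cvgD; last first.
  apply: cvg_coefficient D4; [rewrite /num_lower | rewrite /den_lower | exact: cvg_lower_series]; coefcv.
apply: cvgD; last first.
  apply: cvg_coefficient D3; [rewrite /num_upper | rewrite /den_upper | exact: cvg_upper_series]; coefcv.
apply: cvgB.
  apply: cvg_coefficient D1; [rewrite /num_psi | rewrite /den_psi | exact: cvg_psi_series]; coefcv.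
apply: cvg_coefficient D2; [rewrite /num_W87 | rewrite /den_W87 | exact: cvg_W87_series]; coefcv.
Qed.

End LimitOfSides.

(** * A sequence of modulus above 1 tending to 1 *)

Section ComplexPerturbation.
Context {R : realType}.
Local Notation C := (complex_complex__canonical__Num_NumField R).

Definition near_one (n : nat) : C := ((1 + harmonic n)%:C)%C.

Lemma near_one_gt1 n : 1 < Cmod (near_one n).
Proof.
rewrite -(@Cmod1 R) -Cmod_normr_lt normr1 /near_one.
have h : 0 < harmonic n :> R by exact: harmonic_gt0.
have h1 : 1 < 1 + harmonic n :> R by rewrite ltrDl.
by rewrite normc_def /= expr0n addr0 sqrtr_sqr gtr0_norm ?(lt_trans ltr01) // ltcR.
Qed.

Lemma cvg_near_one : near_one @ \oo --> (1 : C).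
Proof.
apply: (@cvg_ReIm R _ _ _ _ 1 0) => /=; last exact: cvg_cst.
by rewrite -[X in _ --> X]addr0; apply: cvgD; [exact: cvg_cst | exact: cvg_harmonic].
Qed.
End ComplexPerturbation.

Theorem corollary3p21 (R : realType) (q a b c d e f g : R[i]) :
  (* denominators of the coefficients of the four series on the right *)
  let D1 :=
    qpochs_inf q [:: q / b; q / c; q / d; q / f; q / g; q * a / c; q * a / d;
      q * a / e; q * a / f; q * a / g; b * c / a; b * d / a;
      q * a / (c * d * e); b * c * d * e ^+ 2 / (q * a ^+ 2);
      q ^+ 2 * a ^+ 3 / (b * c * d * e ^+ 2 * f * g)] in
  let D2 :=
    qpochs_inf q [:: q / b; q / f; q / g; q * a / c; q * a / d; q * a / e;
      q * a / f; q * a / g; b * c / a; b * d / a; b * e / a;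
      q ^+ 2 * a * b / (c * d * e);
      q ^+ 2 * a ^+ 3 / (b * c * d * e * f * g)] *
    thetas q [:: a / b; c * d * e / a] in
  let D3 :=
    qpochs_inf q [:: q / b; q / c; q / d; q / e; q / f; q / g; q * a / c;
      q * a / d; q * a / e; q * a / f; q * a / g; b * c / a; b * d / a;
      b * e / a; q ^+ 2 * a ^+ 3 / (b * c * d * e * f * g)] *
    theta q (q * a ^+ 2 / (b * c * d * e ^+ 2)) in
  let D4 :=
    qpochs_inf q [:: q / b; q / c; q / d; q / f; q / g; q * a / c; q * a / d;
      q * a / e; q * a / f; q * a / g; b * c / a; b * d / a;
      q ^+ 2 * a ^+ 3 / (b * c * d * e * f * g)] *
    thetas q [:: c * d * e / a;
      b * c * d * e ^+ 2 * f * g / (q ^+ 2 * a ^+ 3)] in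
  (* parameters of the five series *)
  let Psi_up := [tuple b; c; d; e; f; g] in
  let psi_up := [tuple e; b * c * d * e ^+ 2 / (q * a ^+ 2);
    b * c * d * e * f / (q * a ^+ 2); b * c * d * e * g / (q * a ^+ 2)] in
  let psi_lo := [tuple b * c * e / a; b * d * e / a; c * d * e / a;
    b * c * d * e ^+ 2 * f * g / (q * a ^+ 3)] in
  let W_a := q * a * b / (c * d * e) in
  let W_up := [tuple q * a / (c * d); q * a / (c * e); q * a / (d * e);
    b * f / a; b * g / a] in
  let phi1_up := [tuple b * e / a; c * e / a; d * e / a; q * a / (f * g)] in
  let phi1_lo := [tuple q * e / f; q * e / g; b * c * d * e / a ^+ 2] in
  let phi2_up := [tuple q * a / (e * f); q * a / (e * g); q * a / (f * g);
    q ^+ 2 * a ^+ 3 / (b * c * d * e * f * g)] in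
  let phi2_lo := [tuple q ^+ 2 * a ^+ 2 / (b * e * f * g);
    q ^+ 2 * a ^+ 2 / (c * e * f * g); q ^+ 2 * a ^+ 2 / (d * e * f * g)] in
  0 < `|q| < 1 ->
  a != 0 -> b != 0 -> c != 0 -> d != 0 -> e != 0 -> f != 0 -> g != 0 ->
  `|q ^+ 2 * a ^+ 3| < `|b * c * d * e * f * g| ->
  `|q * a| < `|f * g| ->
  (* none of the denominator factors vanish *)
  D1 != 0 -> D2 != 0 -> D3 != 0 -> D4 != 0 ->
  Psi88_ok a Psi_up q ->
  psi_ok psi_up psi_lo q ->
  W87_ok W_a W_up q ->
  phi_ok phi1_lo q ->
  phi_ok phi2_lo q ->
  Psi88 a Psi_up q (q ^+ 2 * a ^+ 3 / (b * c * d * e * f * g)) =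
    qpochs_inf q [:: q * a; q / a; b / a; c * e / a; d * e / a;
      q * a / (c * d); q * a / (c * e); q * a / (d * e); q * a / (e * f);
      q * a / (e * g); q * a / (f * g); b * c * e / a; b * d * e / a;
      q ^+ 2 * a ^+ 2 / (b * c * d * e * f);
      q ^+ 2 * a ^+ 2 / (b * c * d * e * g)]
      / D1 * psi psi_up psi_lo q q
    - qpochs_inf q [:: q; c; d; e; q * a; q / a; b / a; q * b / c; q * b / d;
      q * b / e; q * a / (b * f); q * a / (b * g); q * a / (f * g);
      q ^+ 2 * a ^+ 2 / (c * d * e * f); q ^+ 2 * a ^+ 2 / (c * d * e * g)]
      * theta q (q * a ^+ 2 / (b * c * d * e))
      / D2 * W87 W_a W_up q (q * a / (f * g))
    + qpochs_inf q [:: q; q * a; q / a; b / a; q * e / f; q * e / g;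
      q * a / (c * d); q * a / (c * e); q * a / (d * e); q * a / (e * f);
      q * a / (e * g); b * c * d * e / a ^+ 2;
      q ^+ 2 * a ^+ 3 / (b * c * d * e * f * g)]
      * thetas q [:: b * c * e / a; b * d * e / a]
      / D3 * phi phi1_up phi1_lo q q
    + qpochs_inf q [:: q; e; q * a; q / a; b / a; c * e / a; d * e / a;
      q * a / (c * d); q * a / (c * e); q * a / (d * e);
      q ^+ 2 * a ^+ 2 / (b * e * f * g); q ^+ 2 * a ^+ 2 / (c * e * f * g);
      q ^+ 2 * a ^+ 2 / (d * e * f * g)]
      * thetas q [:: b * c * d * e * f / (q * a ^+ 2);
                     b * c * d * e * g / (q * a ^+ 2)]
      / D4 * phi phi2_up phi2_lo q q.

Proof.
move=> D1 D2 D3 D4 Psi_up psi_up psi_lo W_a W_up phi1_up phi1_lo phi2_up phi2_lo.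
case/andP=> q0 q1 a0 b0 c0 d0 e0 f0 g0 z1 w1 D1n D2n D3n D4n Psi_ psi_ W_ upper_ lower_.
pose C := complex_complex__canonical__Num_NumField R.
have hq : nome (q : C) by rewrite /nome /= -[0](@Cmod0 R) -[1 in X in _ && X](@Cmod1 R) -!Cmod_normr_lt normr0 normr1 q0.
have cdiv (x y : C) : y != 0 -> `|x| < `|y| -> Cmod (x / y) < 1.
  move=> y0; rewrite Cmod_normr_lt => xy; rewrite CmodM CmodV ltr_pdivrMr ?mul1r //.
  by rewrite Cmod_gt0.
have {}z1 := cdiv _ _ (mulf_neq0 (mulf_neq0 (mulf_neq0 (mulf_neq0 (mulf_neq0 b0 c0) d0) e0) f0) g0) z1.
have {}w1 := cdiv _ _ (mulf_neq0 f0 g0) w1.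
pose u := @near_one R.
have u1 n : 1 < @cmod R C (@complex_modulus R) (u n) := near_one_gt1 n.
have u0 n : u n != 0 by rewrite -Cmod_gt0 (lt_trans ltr01) ?near_one_gt1.
have ucv : u @ \oo --> (1 : C) := cvg_near_one.
have scv (x : C) k : (fun n => x * u n ^+ k) @ \oo --> x.
  rewrite -[X in _ --> X]mulr1 -(expr1n C k).
  by apply: cvgM; [exact: cvg_cst | exact: cvg_exprn].
have s0 (x : C) k n : x != 0 -> x * u n ^+ k != 0 by move=> x0; rewrite mulf_neq0 ?expf_neq0.
have X0 i : (i < 8)%N -> params (q := q) a b c d e f g i != 0.
  by case: i => [|[|[|[|[|[|[|[|i]]]]]]]] //= _; exact: (nome_neq0 (hq := hq)).
pose s (x : C) k n := x * u n ^+ k.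
(* The exponents 1, 4, 2, 2, 3, 2, 2 are the values of [weight] at a to g. *)
have L := cvg_lhs (hq := hq) (FF := eventually_filter) (scv a 1%N) (scv b 4%N) (scv c 2%N) (scv d 2%N) (scv e 3%N) (scv f 2%N) (scv g 2%N)
  (fun n => s0 a 1%N n a0) (fun n => s0 b 4%N n b0) (fun n => s0 c 2%N n c0) (fun n => s0 d 2%N n d0)
  (fun n => s0 e 3%N n e0) (fun n => s0 f 2%N n f0) (fun n => s0 g 2%N n g0) a0 b0 c0 d0 e0 f0 g0 z1 Psi_.
have r := cvg_rhs (hq := hq) (FF := eventually_filter) (scv a 1%N) (scv b 4%N) (scv c 2%N) (scv d 2%N) (scv e 3%N) (scv f 2%N) (scv g 2%N)
  (fun n => s0 a 1%N n a0) (fun n => s0 b 4%N n b0) (fun n => s0 c 2%N n c0) (fun n => s0 d 2%N n d0)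
  (fun n => s0 e 3%N n e0) (fun n => s0 f 2%N n f0) (fun n => s0 g 2%N n g0) a0 b0 c0 d0 e0 f0 g0 w1
  D1n D2n D3n D4n psi_ W_ upper_ lower_.
change (lhs q a b c d e f g = rhs q a b c d e f g).
(* Both sides converge along the scaled parameters. If they agree for all large n, uniqueness of
   limits gives the theorem; they agree since the scaled parameters are eventually generic and the
   two strict inequalities on the arguments persist. *)
have E : \forall n \near \oo, lhs q (s a 1%N n) (s b 4%N n) (s c 2%N n) (s d 2%N n) (s e 3%N n) (s f 2%N n) (s g 2%N n) =
    rhs q (s a 1%N n) (s b 4%N n) (s c 2%N n) (s d 2%N n) (s e 3%N n) (s f 2%N n) (s g 2%N n); last first.
  have hC : hausdorff_space C by exact: norm_hausdorff.
  rewrite -[LHS](cvg_lim hC L) -[RHS](cvg_lim hC r).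
  apply/esym/(cvg_lim hC); rewrite (cvg_lim hC L); apply: cvg_trans L; apply: near_eq_cvg.
  exact: E.
have zs : (fun n => q ^+ 2 * s a 1%N n ^+ 3 / (s b 4%N n * s c 2%N n * s d 2%N n * s e 3%N n * s f 2%N n * s g 2%N n))
    @ \oo --> (q ^+ 2 * a ^+ 3 / (b * c * d * e * f * g) : C).
  apply: cvgM; first by apply: cvgM; [exact: cvg_cst | apply: cvg_exprn; exact: scv].
  by apply: cvgV; [rewrite !mulf_neq0 | do 5![apply: cvgM; last exact: scv]; exact: scv].
have ws : (fun n => q * s a 1%N n / (s f 2%N n * s g 2%N n)) @ \oo --> (q * a / (f * g) : C).
  apply: cvgM; first by apply: cvgM; [exact: cvg_cst | exact: scv].
  by apply: cvgV; [rewrite !mulf_neq0 | apply: cvgM; exact: scv].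
apply: filterS3 (near_generic_omega (hq := hq) u1 ucv X0) (near_cmod_lt zs z1) (near_cmod_lt ws w1) => n gn zn wn.
have G : all (fun m => qgeneric (q := q) (mden (params (q := q) (s a 1%N n) (s b 4%N n) (s c 2%N n) (s d 2%N n)
    (s e 3%N n) (s f 2%N n) (s g 2%N n)) m)) omega.
  rewrite (_ : params _ _ _ _ _ _ _ = fun i => params (q := q) a b c d e f g i * u n ^+ weight i) //.
  (* At index 7 [weight] takes its default value 0, so that q is not scaled; beyond it both sides
     are the default value 0 of [params]. *)
  apply/funext; case=> [|[|[|[|[|[|[|[|i]]]]]]]] //; last by rewrite /params !nth_default // mul0r.
  by rewrite expr0 mulr1.
by apply: (generic_Psi88 _ _ _ _ _ _ _ G zn wn); exact: s0.
Qed.
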